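(* Let $\varphi\in\mathcal{S}$ with $F(\varphi)=\{\zeta_1,\dots,\zeta_r\}$, and let $n_j=2m_j$ be the order of contact of $\varphi$ with $\partial\mathbb{D}$ at $\zeta_j$. Then there exist, for $j=1,\dots,r$, basic functions $\varphi_j$ of degree $m_j+1$ with contact at $\zeta_j$, each having order of contact $n_j$ with $\partial\mathbb{D}$ at $\zeta_j$ and satisfying $D_{n_j}(\varphi_j,\zeta_j)=D_{n_j}(\varphi,\zeta_j)$, such that $C_\varphi-(C_{\varphi_1}+\dots+C_{\varphi_r})$ is compact on $H^2$.
   Context: $C_\varphi f=f\circ\varphi$ on the Hardy space $H^2$. Class $\mathcal{S}$: analytic self-maps $\varphi$ of $\mathbb{D}$ with (1) $|\varphi|<1$ a.e. on $\partial\mathbb{D}$; (2) $E(\varphi)$ finite, where $E(\varphi)$ is the closure of the union of the supports of the singular parts of the Clark measures $\mu_\alpha$ ($|\alpha|=1$; $\mathrm{Re}\frac{\alpha+\varphi(z)}{\alpha-\varphi(z)}=\int P_z\,d\mu_\alpha$), in which case $E(\varphi)=F(\varphi)$, the set of boundary points where $\varphi$ has a finite angular derivative; (3) at each $\zeta\in F(\varphi)$, $\varphi$ has an even order of contact $n$ with $\partial\mathbb{D}$ ($\varphi(\zeta)\in\partial\mathbb{D}$ and $\frac{1-|\varphi(e^{i\theta})|^2}{|\varphi(\zeta)-\varphi(e^{i\theta})|^n}$ essentially bounded above and away from $0$ as $e^{i\theta}\to\zeta$) and $\varphi(z)=\sum_{k=0}^na_k(z-\zeta)^k+o(|z-\zeta|^n)$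 as $z\to\zeta$ unrestrictedly in $\mathbb{D}$; set $\varphi^{(k)}(\zeta):=k!a_k$ and $D_n(\varphi,\zeta)=(\varphi(\zeta),\varphi'(\zeta),\dots,\varphi^{(n)}(\zeta))$ (for analytic functions these are ordinary derivatives). Basic function with contact at $\zeta$: a rational $\varphi$ with $\varphi(\mathbb{D})\subset\mathbb{D}$, $\varphi(\zeta)\in\partial\mathbb{D}$, $\varphi(\partial\mathbb{D}\setminus\{\zeta\})\subset\mathbb{D}$, and $\varphi(\zeta)$ a regular value of $\varphi$ (its preimage consists of $\deg\varphi$ distinct points of the Riemann sphere). *)

(* Defs.v *)
From HB Require Import structures.
From mathcomp Require Import all_boot all_order all_algebra.
From mathcomp Require Import all_classical all_reals all_analysis.
From mathcomp Require Import complex.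

Set Implicit Arguments.
Unset Strict Implicit.
Unset Printing Implicit Defensive.

Import Order.TTheory GRing.Theory Num.Theory.
Local Open Scope classical_set_scope.
Local Open Scope ring_scope.

Section Defs.
Variable R : realType.
Local Notation C := R[i].

Definition cabs (z : C) : R := Num.sqrt (complex.Re z ^+ 2 + complex.Im z ^+ 2).

Definition expi (t : R) : C := Complex (cos t) (sin t).

Definition rC (r : R) : C := Complex r 0.

Definition inD (z : C) : Prop := cabs z < 1.
Definition onT (z : C) : Prop := cabs z = 1.

Definition holo_on_D (f : C -> C) : Prop :=
  forall z, inD z -> exists d : C, forall e : R, 0 < e -> exists2 del : R, 0 < del &
    forall w, 0 < cabs (w - z) < del -> cabs ((f w - f z) / (w - z) - d) < e.

Definition self_map (f : C -> C) : Prop :=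
  holo_on_D f /\ forall z, inD z -> inD (f z).

Definition ae_circle (P : R -> Prop) : Prop :=
  exists N : set R, [/\ measurable N, (lebesgue_measure N = 0)%E &
    forall t, 0 <= t <= 2 * pi -> ~ N t -> P t].

Definition radial_lim (f : C -> C) (t : R) (l : C) : Prop :=
  forall e : R, 0 < e -> exists2 del : R, 0 < del &
    forall r : R, 0 < r < 1 -> 1 - del < r -> cabs (f (rC r * expi t) - l) < e.

Definition stolz (zeta : C) (M : R) (z : C) : Prop :=
  inD z /\ cabs (z - zeta) < M * (1 - cabs z).

Definition nt_lim (f : C -> C) (zeta L : C) : Prop :=
  forall M : R, 1 < M -> forall e : R, 0 < e -> exists2 del : R, 0 < del &
    forall z, stolz zeta M z -> cabs (z - zeta) < del -> cabs (f z - L) < e.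

Definition has_fin_ang_deriv (f : C -> C) (zeta : C) : Prop :=
  onT zeta /\ exists eta d : C, [/\ onT eta, nt_lim f zeta eta &
    nt_lim (fun z => (f z - eta) / (z - zeta)) zeta d].

Definition Fset (f : C -> C) : set C := [set zeta | has_fin_ang_deriv f zeta].

Definition I02 : set R := [set t : R | 0 <= t < 2 * pi].
Definition I02c : set R := [set t : R | 0 <= t <= 2 * pi].

Definition poisson (z : C) (t : R) : R :=
  (1 - cabs z ^+ 2) / cabs (expi t - z) ^+ 2.

(** mu is the Clark measure of f for alpha (a finite positive Borel measure on
    the circle, transported to the parameter interval [0, 2 pi[) *)
Definition clark_measure (f : C -> C) (alpha : C)
    (mu : {measure set (measurableTypeR R) -> \bar R}) : Prop :=
  [/\ onT alpha,
      (mu (~` I02) = 0)%E,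
      (mu I02 < +oo)%E &
      forall z, inD z ->
        ((complex.Re ((alpha + f z) / (alpha - f z)))%:E =
          \int[mu]_(t in I02) (poisson z t)%:E)%E].

Definition in_sing_support (mu : {measure set (measurableTypeR R) -> \bar R})
    (zeta : C) : Prop :=
  exists mua mus : {measure set (measurableTypeR R) -> \bar R},
  [/\ forall A, measurable A -> mu A = (mua A + mus A)%E,
      forall A, measurable A -> lebesgue_measure A = 0%E -> mua A = 0%E,
      exists N : set R, [/\ measurable N, lebesgue_measure N = 0%E & mus (~` N) = 0%E] &
      forall e : R, 0 < e ->
        (0 < mus (I02 `&` [set t | (cabs (expi t - zeta) < e)%R]))%E].

Definition Eset (f : C -> C) : set C :=
  [set zeta | onT zeta /\ forall e : R, 0 < e -> exists zeta',
     cabs (zeta - zeta') < e /\ exists alpha mu,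
       clark_measure f alpha mu /\ in_sing_support mu zeta'].

(** phi has order of contact n with the unit circle at zeta; here phi(zeta)
    is the nontangential limit of phi at zeta and phi(e^{it}) the radial limit *)
Definition contact_order (f : C -> C) (zeta : C) (n : nat) : Prop :=
  exists eta : C, [/\ nt_lim f zeta eta, onT eta &
    exists del c c' : R, [/\ 0 < del, 0 < c, 0 < c' &
      ae_circle (fun t => cabs (expi t - zeta) < del ->
        exists l, radial_lim f t l /\
          c <= (1 - cabs l ^+ 2) / cabs (eta - l) ^+ n <= c')]].

Definition has_expansion (f : C -> C) (zeta : C) (n : nat) (a : nat -> C) : Prop :=
  forall e : R, 0 < e -> exists2 del : R, 0 < del &
    forall z, inD z -> cabs (z - zeta) < del ->
      cabs (f z - \sum_(k < n.+1) a k * (z - zeta) ^+ k) <= e * cabs (z - zeta) ^+ n.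

Definition classS (f : C -> C) : Prop :=
  [/\ self_map f,
      ae_circle (fun t => exists l, radial_lim f t l /\ cabs l < 1),
      finite_set (Eset f) &
      forall zeta, Fset f zeta -> exists n : nat,
        [/\ ~~ odd n, contact_order f zeta n & exists a, has_expansion f zeta n a]].

(** D_n(f, zeta) = D_n(g, zeta): the (generalized) Taylor coefficients
    a_0, ..., a_n at zeta agree (phi^(k)(zeta) := k! a_k) *)
Definition same_D (n : nat) (f g : C -> C) (zeta : C) : Prop :=
  exists a : nat -> C, has_expansion f zeta n a /\ has_expansion g zeta n a.

(** rational functions p/q on the Riemann sphere (None = infinity) *)
Definition rat_ext (p q : {poly C}) (x : option C) : option C :=
  match x with
  | Some z => if q.[z] == 0 then None else Some (p.[z] / q.[z])
  | None => if (size q < size p)%N then None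
            else if size p == size q then Some (lead_coef p / lead_coef q)
            else Some 0
  end.

(** degree of the reduced rational function p/q *)
Definition rat_deg (p q : {poly C}) : nat := maxn (size p).-1 (size q).-1.

Definition regular_value (p q : {poly C}) (w : C) : Prop :=
  exists s : seq (option C), [/\ uniq s, size s = rat_deg p q &
    forall x, (rat_ext p q x == Some w) = (x \in s)].

Definition basic_fun (f : C -> C) (zeta : C) (d : nat) : Prop :=
  exists p q : {poly C}, [/\ coprimep p q, q != 0, rat_deg p q = d,
    forall z, cabs z <= 1 -> q.[z] != 0 /\ f z = p.[z] / q.[z] &
    [/\ forall z, inD z -> inD (f z),
        onT (f zeta),
        forall z, onT z -> z <> zeta -> inD (f z) &
        regular_value p q (f zeta)]].

(** squared H^2 norm: sup_{0<r<1} int_0^{2pi} |f(r e^{it})|^2 dt (up to 1/2pi) *)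
Definition h2sq (f : C -> C) : \bar R :=
  ereal_sup [set (\int[lebesgue_measure]_(t in I02c)
                    (cabs (f (rC r * expi t)) ^+ 2)%:E)%E | r in `]0, 1[].

Definition inH2 (f : C -> C) : Prop := holo_on_D f /\ (h2sq f < +oo)%E.

Definition Cop (phi : C -> C) (f : C -> C) : C -> C := fun z => f (phi z).

Definition compact_on_H2 (T : (C -> C) -> (C -> C)) : Prop :=
  forall u : nat -> (C -> C), (forall k, inH2 (u k)) ->
    (exists M : R, forall k, (h2sq (u k) <= M%:E)%E) ->
    exists sigma : nat -> nat, (forall k, (sigma k < sigma k.+1)%N) /\
      exists2 g, inH2 g &
        (fun k => h2sq (fun z => T (u (sigma k)) z - g z)) @ \oo --> 0%E.

End Defs.

(* Main.v *)
Require Import Defs.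
From HB Require Import structures.
From mathcomp Require Import all_boot all_order all_algebra.
From mathcomp Require Import all_classical all_reals all_analysis.
From mathcomp Require Import measurable_realfun.
From mathcomp Require Import complex separable ring lra zify.
Set Implicit Arguments.
Unset Strict Implicit.
Unset Printing Implicit Defensive.
Import Order.TTheory GRing.Theory Num.Theory.
Import numFieldNormedType.Exports.
Local Open Scope classical_set_scope.
Local Open Scope ring_scope.

(** Near a contact point [zeta] with image [eta], Cayley transforms at [zeta] and [eta] turn [phi]
    into a function [Psi] of positive real part on the right half-plane, with a boundary zero.
    Writing [1 / Psi = A / v + b + Psi1] with [A > 0] and [Re b = 0] lowers the order of contact by
    two and keeps positivity; iterating gives a continued fraction, and replacing its last tail by
    a generic rational function of positive real part produces a rational function with the same
    jet as [Psi]: this is the basic function, genericity making [eta] a regular value.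

    Equality of the jets up to the order of contact forces [phi - phi_j = o(1 - |phi|)] on the
    circle near [zeta_j], so Poisson integrals bound [f o phi - f o phi_j] there by a small multiple
    of the Poisson extension of [|f|^2] at [phi]. Away from the [zeta_j] the Clark measures have no
    singular part, which makes the Poisson kernels at the boundary values of [phi] uniformly
    integrable. Together, [||T f||^2 <= eps ||f||^2 + K sup_(|z| <= 1 - h) |f z|^2] for
    [T = C_phi - sum_j C_(phi_j)], and Montel's theorem concludes. *)

(** The degree [m + 1] comes from a count. Contact of order [2 m] allows [m - 1] reductions with
    [Re b = 0]; the next one leaves a constant [b] with [Re b > 0], and the tail [1 / (A / v + b)]
    would give degree [m]. The added term [e v / (1 + p v)] vanishes at [v = 0], so the jet does not
    see it; it keeps the real part positive, raises the degree by one and brings the parameters that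
    make the zeros simple.

    Finiteness of [Eset phi] only says where singular parts can sit. On a finite set they are atoms,
    an atom of a Clark measure forces a finite angular derivative, and so nothing singular remains
    off [Fset phi]. The norm estimate integrates over the kernel variable [s], that is over all
    Clark measures at once, so uniform integrability is needed with bounds independent of [s]; a
    Dini argument on the circle supplies it.

    Holomorphy enters mainly through the mean value property and the Poisson formula: values,
    differences and second-order remainders are estimated under the Poisson integral. Clark measures
    are handled through a quantile function, as images of Lebesgue measure on a segment. *)

Section ComplexBasics.
Variable R : realType.
Local Notation C := R[i].
Local Notation Re := complex.Re.
Local Notation Im := complex.Im.
Implicit Types (a b z w : C).

(** * Modulus, coordinates and the parametrization of the circle *)

Lemma cabsE z : `|z| = (cabs z)%:C%C.
Proof. by case: z. Qed.

Lemma cabs_ge0 z : 0 <= cabs z.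
Proof. exact: sqrtr_ge0. Qed.

Lemma cabs0 : cabs (0 : C) = 0.
Proof. by rewrite /cabs /= expr0n /= addr0 sqrtr0. Qed.

Lemma cabs1 : cabs (1 : C) = 1.
Proof. by rewrite /cabs /= expr0n /= addr0 expr1n sqrtr1. Qed.

Lemma cabs_eq0 z : (cabs z == 0) = (z == 0).
Proof. by rewrite -[RHS]normr_eq0 cabsE -(inj_eq (@complexI R)). Qed.

Lemma cabs_gt0 z : (0 < cabs z) = (z != 0).
Proof. by rewrite lt_neqAle cabs_ge0 andbT eq_sym cabs_eq0. Qed.

Lemma cabsM z w : cabs (z * w) = cabs z * cabs w.
Proof. by apply: (@complexI R); rewrite rmorphM /= -!cabsE normrM. Qed.

Lemma cabsN z : cabs (- z) = cabs z.
Proof. by apply: (@complexI R); rewrite -!cabsE normrN. Qed.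

Lemma cabsB z w : cabs (z - w) = cabs (w - z).
Proof. by rewrite -cabsN opprB. Qed.

Lemma cabsV z : cabs z^-1 = (cabs z)^-1.
Proof. by apply: (@complexI R); rewrite fmorphV /= -!cabsE normfV. Qed.

Lemma cabsf_div z w : cabs (z / w) = cabs z / cabs w.
Proof. by rewrite cabsM cabsV. Qed.

Lemma cabsX z n : cabs (z ^+ n) = cabs z ^+ n.
Proof. by elim: n => [|n IH]; rewrite ?expr0 ?cabs1// !exprS cabsM IH. Qed.

Lemma ler_cabsD z w : cabs (z + w) <= cabs z + cabs w.
Proof. by rewrite -lecR rmorphD /= -!cabsE ler_normD. Qed.

Lemma ler_cabsB z w : cabs (z - w) <= cabs z + cabs w.
Proof. by rewrite (le_trans (ler_cabsD _ _))// cabsN. Qed.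

Lemma ler_cabs_dist z w : cabs z - cabs w <= cabs (z - w).
Proof. by rewrite lerBlDr (le_trans _ (ler_cabsD _ _))// subrK. Qed.

Lemma ler_cabs_distD z w u : cabs (z - w) <= cabs (z - u) + cabs (u - w).
Proof. by rewrite (le_trans _ (ler_cabsD _ _))// addrA subrK. Qed.

Lemma cabs_sum (I : Type) (s : seq I) (F : I -> C) :
  cabs (\sum_(i <- s) F i) <= \sum_(i <- s) cabs (F i).
Proof.
elim: s => [|i s IH]; first by rewrite !big_nil cabs0.
by rewrite !big_cons (le_trans (ler_cabsD _ _))// lerD2l.
Qed.

Lemma sqr_cabs z : cabs z ^+ 2 = Re z ^+ 2 + Im z ^+ 2.
Proof. by rewrite sqr_sqrtr// addr_ge0 ?sqr_ge0. Qed.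

Lemma cabs_Re z : `|Re z| <= cabs z.
Proof.
rewrite -(@ler_pXn2r _ 2)// ?nnegrE ?cabs_ge0//.
by rewrite sqr_cabs real_normK ?num_real// lerDl sqr_ge0.
Qed.

Lemma cabs_Im z : `|Im z| <= cabs z.
Proof.
rewrite -(@ler_pXn2r _ 2)// ?nnegrE ?cabs_ge0//.
by rewrite sqr_cabs real_normK ?num_real// lerDr sqr_ge0.
Qed.

Lemma ler_Re_cabs z : Re z <= cabs z.
Proof. exact: le_trans (ler_norm _) (cabs_Re _). Qed.

Lemma cabs_le_ReIm z : cabs z <= `|Re z| + `|Im z|.
Proof.
rewrite -(@ler_pXn2r _ 2)// ?nnegrE ?cabs_ge0 ?addr_ge0//.
rewrite sqr_cabs sqrrD !real_normK ?num_real//.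
by rewrite -addrA [leRHS]addrCA addrC lerDl mulrn_wge0// mulr_ge0.
Qed.

Lemma creD z w : Re (z + w) = Re z + Re w. Proof. by case: z w => [? ?] []. Qed.
Lemma cimD z w : Im (z + w) = Im z + Im w. Proof. by case: z w => [? ?] []. Qed.
Lemma creN z : Re (- z) = - Re z. Proof. by case: z. Qed.
Lemma cimN z : Im (- z) = - Im z. Proof. by case: z. Qed.
Lemma creB z w : Re (z - w) = Re z - Re w. Proof. by rewrite creD creN. Qed.
Lemma cimB z w : Im (z - w) = Im z - Im w. Proof. by rewrite cimD cimN. Qed.
Lemma creM z w : Re (z * w) = Re z * Re w - Im z * Im w.
Proof. by case: z w => [? ?] []. Qed.
Lemma cimM z w : Im (z * w) = Re z * Im w + Im z * Re w.
Proof. by case: z w => [? ?] []. Qed.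
Lemma creV z : Re z^-1 = Re z / cabs z ^+ 2.
Proof. by rewrite sqr_cabs; case: z. Qed.
Lemma cimV z : Im z^-1 = - Im z / cabs z ^+ 2.
Proof. by rewrite sqr_cabs mulNr; case: z. Qed.

Lemma rCD (x y : R) : rC (x + y) = rC x + rC y.
Proof. by rewrite /rC; congr Complex; rewrite addr0. Qed.
Lemma rCB (x y : R) : rC (x - y) = rC x - rC y.
Proof. by rewrite /rC; congr Complex; rewrite subr0. Qed.
Lemma rCM (x y : R) : rC (x * y) = rC x * rC y.
Proof. by rewrite /rC; congr Complex => /=; ring. Qed.
Lemma rC1 : rC (1 : R) = 1. Proof. by []. Qed.
Lemma rC0 : rC (0 : R) = 0. Proof. by []. Qed.
Lemma rC_eq0 (x : R) : (rC x == 0) = (x == 0).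
Proof. by rewrite eq_complex /= eqxx andbT. Qed.
Lemma rCV (x : R) : rC x^-1 = (rC x)^-1.
Proof. exact: (fmorphV (real_complex R)). Qed.
Lemma rCX (x : R) n : rC (x ^+ n) = rC x ^+ n.
Proof. exact: (rmorphXn (real_complex R)). Qed.
Lemma cabs_rC (x : R) : cabs (rC x) = `|x|.
Proof. by rewrite /cabs /= expr0n /= addr0 sqrtr_sqr. Qed.
Lemma Re_rCM (x : R) z : Re (rC x * z) = x * Re z.
Proof. by rewrite creM /= mul0r subr0. Qed.
Lemma Im_rCM (x : R) z : Im (rC x * z) = x * Im z.
Proof. by rewrite cimM /= mul0r addr0. Qed.

Lemma complex_ext z w : Re z = Re w -> Im z = Im w -> z = w.
Proof. by case: z w => [? ?] [? ?] /= -> ->. Qed.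

Lemma cabs_expi t : cabs (expi t : C) = 1.
Proof. by rewrite /cabs /= cos2Dsin2 sqrtr1. Qed.

Lemma expi_neq0 t : expi t != 0 :> C.
Proof. by rewrite -cabs_gt0 cabs_expi. Qed.

Lemma expiD (s t : R) : expi (s + t) = expi s * expi t.
Proof. by rewrite /expi cosD sinD; congr Complex => /=; ring. Qed.

Lemma expi0 : expi (0 : R) = 1.
Proof. by rewrite /expi cos0 sin0. Qed.

Lemma expi2pi : expi (2 * pi : R) = 1.
Proof. by rewrite mulr_natl /expi cos2pi sin2pi. Qed.

Lemma pi2_gt0 : 0 < 2 * pi :> R.
Proof. by rewrite mulr_gt0 ?pi_gt0. Qed.

Lemma onT_expi z : onT z -> exists2 t : R, 0 <= t < 2 * pi & z = expi t.
Proof.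
case: z => x y; rewrite /onT /cabs /= => h.
have h2 : x ^+ 2 + y ^+ 2 = 1.
  by rewrite -(sqr_sqrtr (addr_ge0 (sqr_ge0 x) (sqr_ge0 y))) h expr1n.
have hx : -1 <= x <= 1.
  have : x ^+ 2 <= 1 by rewrite -h2 lerDl sqr_ge0.
  by move=> ?; apply/andP; split; nra.
have sx : sin (acos x) = Num.sqrt (1 - x ^+ 2) by apply: sin_acos.
have y2 : y ^+ 2 = 1 - x ^+ 2 by rewrite -h2; ring.
have ap := @pi_gt0 R.
have a0 := acos_ge0 hx; have api := acos_lepi hx.
case: (leP 0 y) => hy.
  exists (acos x); first by apply/andP; split => //; lra.
  by rewrite /expi acosK// sx -y2 sqrtr_sqr ger0_norm.
exists (2 * pi - acos x).
  have : 0 < acos x; last by move=> ?; lra.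
  rewrite lt_neqAle a0 andbT; apply/eqP => e0.
  have : y ^+ 2 = 0 by rewrite y2 -(acosK hx) -e0 cos0 expr1n subrr.
  by move=> /eqP; rewrite sqrf_eq0 => /eqP y0; rewrite y0 ltxx in hy.
rewrite expiD expi2pi mul1r /expi cosN sinN acosK// sx -y2 sqrtr_sqr.
by rewrite ltr0_norm// opprK.
Qed.

Lemma cabs_polar z : exists2 t : R, 0 <= t < 2 * pi & z = rC (cabs z) * expi t.
Proof.
have [->|z0] := eqVneq z 0.
  by exists 0; rewrite ?lexx ?pi2_gt0// cabs0 mul0r.
have [t ht e] : exists2 t : R, 0 <= t < 2 * pi & z / rC (cabs z) = expi t.
  apply: onT_expi; rewrite /onT cabsf_div cabs_rC ger0_norm ?cabs_ge0//.
  by rewrite divff// cabs_eq0.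
exists t => //; rewrite -e mulrC divfK// rC_eq0 cabs_eq0//.
Qed.

(** Turns an estimate of a modulus into an estimate of a real part, for which a Poisson formula is
    available. *)
Lemma exists_rotation z : exists2 c : C, cabs c = 1 & Re (c * z) = cabs z.
Proof.
have [t _ e] := cabs_polar z.
exists (expi (- t)); first exact: cabs_expi.
by rewrite {1}e mulrCA -expiD addNr expi0 mulr1.
Qed.

(** * Limits and derivatives of complex functions *)

Definition cnbhs z : set_system C :=
  [set A | exists2 d : R, 0 < d & forall w, cabs (w - z) < d -> A w].

Global Instance cnbhs_filter z : ProperFilter (cnbhs z).
Proof.
split; first by move=> [d d0 /(_ z)]; rewrite subrr cabs0; exact.
split; first by exists 1.
  move=> A B [d d0 hA] [d' d'0 hB]; exists (Num.min d d').
    by rewrite lt_min d0.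
  by move=> w; rewrite lt_min => /andP[/hA ? /hB ?].
by move=> A B AB [d d0 hA]; exists d => // w /hA /AB.
Qed.

(** Encoded as a real limit of the distance, so that no topology on the complex field enters;
    [ccvgP] then transfers the rules for real limits coordinatewise. *)
Definition ccvg (T : Type) (F : set_system T) (f : T -> C) (l : C) :=
  (fun x => cabs (f x - l)) @ F --> 0.

Definition ccont (f : C -> C) z := ccvg (cnbhs z) f (f z).

Section Ccvg.
Variables (T : Type) (F : set_system T).
Context {FF : Filter F}.
Implicit Types (f g : T -> C).

Lemma ccvg_lt f a : ccvg F f a <->
  forall e : R, 0 < e -> \forall x \near F, cabs (f x - a) < e.
Proof.
split=> [/cvgrPdist_lt H e /H|H].
  apply: filterS => x; rewrite sub0r normrN ger0_norm ?cabs_ge0//.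
apply/cvgrPdist_lt => e /H; apply: filterS => x.
by rewrite sub0r normrN ger0_norm ?cabs_ge0.
Qed.

Lemma ccvgP f a : ccvg F f a <->
  (fun x => Re (f x)) @ F --> Re a /\ (fun x => Im (f x)) @ F --> Im a.
Proof.
split=> [/ccvg_lt H|[hr hi]].
  split; apply/cvgrPdist_lt => e /H; apply: filterS => x;
  rewrite distrC; apply: le_lt_trans.
  by rewrite -creB cabs_Re.
  by rewrite -cimB cabs_Im.
apply/ccvg_lt => e e0.
have e2 : 0 < e / 2 by rewrite divr_gt0.
move/cvgrPdist_lt : hr => /(_ _ e2) hr; move/cvgrPdist_lt : hi => /(_ _ e2) hi.
near=> x; rewrite (le_lt_trans (cabs_le_ReIm _))// creB cimB (splitr e) ltrD//.
  by rewrite distrC; near: x.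
by rewrite distrC; near: x.
Unshelve. all: by end_near. Qed.

Lemma ccvg_cst a : ccvg F (fun=> a) a.
Proof. by apply/ccvgP; split; exact: cvg_cst. Qed.

Lemma ccvgD f g a b : ccvg F f a -> ccvg F g b -> ccvg F (fun x => f x + g x) (a + b).
Proof.
move=> /ccvgP[fr fi] /ccvgP[gr gi]; apply/ccvgP; split.
  by under eq_fun do rewrite creD; rewrite creD; exact: cvgD.
by under eq_fun do rewrite cimD; rewrite cimD; exact: cvgD.
Qed.

Lemma ccvgN f a : ccvg F f a -> ccvg F (fun x => - f x) (- a).
Proof.
move=> /ccvgP[fr fi]; apply/ccvgP; split.
  by under eq_fun do rewrite creN; rewrite creN; exact: cvgN.
by under eq_fun do rewrite cimN; rewrite cimN; exact: cvgN.
Qed.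

Lemma ccvgB f g a b : ccvg F f a -> ccvg F g b -> ccvg F (fun x => f x - g x) (a - b).
Proof. by move=> hf hg; apply: ccvgD => //; exact: ccvgN. Qed.

Lemma ccvgM f g a b : ccvg F f a -> ccvg F g b -> ccvg F (fun x => f x * g x) (a * b).
Proof.
move=> /ccvgP[fr fi] /ccvgP[gr gi]; apply/ccvgP; split.
  under eq_fun do rewrite creM; rewrite creM; apply: cvgB; exact: cvgM.
under eq_fun do rewrite cimM; rewrite cimM; apply: cvgD; exact: cvgM.
Qed.

Lemma ccvg_cabs f a : ccvg F f a -> (fun x => cabs (f x)) @ F --> cabs a.
Proof.
move=> /ccvg_lt H; apply/cvgrPdist_lt => e /H; apply: filterS => x.
apply: le_lt_trans; rewrite ler_norml; apply/andP; split.
  by rewrite lerNl opprB ler_cabs_dist.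
by rewrite cabsB ler_cabs_dist.
Qed.

Lemma ccvgV f a : a != 0 -> ccvg F f a -> ccvg F (fun x => (f x)^-1) a^-1.
Proof.
move=> a0 h.
have h2 : (fun x => cabs (f x) ^+ 2) @ F --> cabs a ^+ 2.
  under eq_fun do rewrite expr2.
  by rewrite expr2; apply: cvgM; exact: ccvg_cabs.
have a2 : cabs a ^+ 2 != 0 by rewrite expf_neq0// cabs_eq0.
move/ccvgP : (h) => [fr fi]; apply/ccvgP; split.
  by under eq_fun do rewrite creV; rewrite creV; apply: cvgM => //; exact: cvgV.
under eq_fun do rewrite cimV; rewrite cimV; apply: cvgM; last exact: cvgV.
exact: cvgN.
Qed.

Lemma ccvgX f a n : ccvg F f a -> ccvg F (fun x => f x ^+ n) (a ^+ n).
Proof.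
move=> h; elim: n => [|n IH]; first exact: ccvg_cst.
by rewrite exprS; under eq_fun do rewrite exprS; exact: ccvgM.
Qed.

Lemma ccvg_comp f (h : C -> C) a b : ccvg F f a -> ccvg (cnbhs a) h b ->
  ccvg F (fun x => h (f x)) b.
Proof.
move=> /ccvg_lt hf hh; apply/ccvg_lt => e e0.
have : cnbhs a [set w | cabs (h w - b) < e].
  move/cvgrPdist_lt : hh => /(_ _ e0); apply: filterS => w.
  by rewrite sub0r normrN ger0_norm ?cabs_ge0.
move=> [d d0 hd]; move: (hf d d0); apply: filterS => x; exact: hd.
Qed.

Lemma eq_ccvg f g a : (\forall x \near F, f x = g x) -> ccvg F f a -> ccvg F g a.
Proof.
move=> fg /ccvg_lt H; apply/ccvg_lt => e /H h.
by move: h fg; apply: filterS2 => x h <-.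
Qed.

Lemma ccvg_Re f a : ccvg F f a -> (fun x => Re (f x)) @ F --> Re a.
Proof. by move=> /ccvgP[]. Qed.
Lemma ccvg_Im f a : ccvg F f a -> (fun x => Im (f x)) @ F --> Im a.
Proof. by move=> /ccvgP[]. Qed.
Lemma ccvg_rC (g : T -> R) x : g @ F --> x -> ccvg F (fun t => rC (g t)) (rC x).
Proof. by move=> h; apply/ccvgP; split => //=; exact: cvg_cst. Qed.
Lemma ccvg_expi (g : T -> R) x : g @ F --> x -> ccvg F (fun t => expi (g t)) (expi x).
Proof.
move=> h; apply/ccvgP; split => /=.
  exact: (continuous_cvg _ (@continuous_cos R x) h).
exact: (continuous_cvg _ (@continuous_sin R x) h).
Qed.
End Ccvg.

Implicit Types (f g : C -> C).

Lemma ccvg_id z : ccvg (cnbhs z) id z.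
Proof. by apply/ccvg_lt => e e0; exists e. Qed.

Lemma ccont_poly (p : {poly C}) z : ccont (fun x => p.[x]) z.
Proof.
rewrite /ccont; elim/poly_ind: p => [|p c IH].
  under eq_fun do rewrite horner0; rewrite horner0; exact: ccvg_cst.
under eq_fun do rewrite hornerMXaddC; rewrite hornerMXaddC.
by apply: ccvgD; [apply: ccvgM => //; exact: ccvg_id|exact: ccvg_cst].
Qed.

Lemma ccvg_unique (T : Type) (F : set_system T) {FF : ProperFilter F} (f : T -> C) a b :
  ccvg F f a -> ccvg F f b -> a = b.
Proof.
move=> /ccvgP[ar ai] /ccvgP[br bi]; apply: complex_ext.
  exact: (cvg_unique _ ar br).
exact: (cvg_unique _ ai bi).
Qed.

(** Caratheodory's form of differentiability: the difference quotient is replaced by a function [q]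
    continuous at [z]. Product and chain rules become algebra, with no division by [w - z]. *)
Definition cderiv (f : C -> C) z d := exists q : C -> C,
  [/\ ccvg (cnbhs z) q d & forall w, f w = f z + q w * (w - z)].

Lemma holoP (f : C -> C) :
  holo_on_D f <-> forall z, inD z -> exists d, cderiv f z d.
Proof.
split=> H z /H [d hd]; exists d.
  exists (fun w => if w == z then d else (f w - f z) / (w - z)); split.
    apply/ccvg_lt => e e0; have [del d0 hdel] := hd e e0.
    exists del => // w hw; case: eqP => wz; first by rewrite subrr cabs0.
    by apply: hdel; rewrite hw andbT cabs_gt0 subr_eq0; apply/eqP.
  move=> w; case: eqP => [->|/eqP wz]; first by rewrite subrr mulr0 addr0.
  by rewrite divfK ?subr_eq0// addrC subrK.
move: hd => [q [qd fq]] e e0.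
have [del d0 hdel] := (ccvg_lt q d).1 qd e e0.
exists del => // w /andP[w0 wdel].
by rewrite fq addrAC subrr add0r mulfK ?hdel// -cabs_gt0.
Qed.

Lemma cderiv_cont f z d : cderiv f z d -> ccont f z.
Proof.
move=> [q [qd fq]]; rewrite /ccont.
have h : ccvg (cnbhs z) (fun w => f z + q w * (w - z)) (f z + d * (z - z)).
  apply: ccvgD; first exact: ccvg_cst.
  apply: ccvgM => //; apply: ccvgB; [exact: ccvg_id|exact: ccvg_cst].
rewrite subrr mulr0 addr0 in h; apply: eq_ccvg h.
by apply: filterE => w; rewrite -fq.
Qed.

Lemma holo_cont f z : holo_on_D f -> inD z -> ccont f z.
Proof. by move=> /holoP H /H[d]; exact: cderiv_cont. Qed.

Lemma inD_cnbhs z : inD z -> \forall w \near cnbhs z, inD w.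
Proof.
move=> zD; exists (1 - cabs z); first by rewrite subr_gt0.
by move=> w hw; rewrite /inD; have := ler_cabs_dist w z; lra.
Qed.

Lemma cderiv_ext f g z d : f z = g z -> (\forall w \near cnbhs z, f w = g w) ->
  cderiv f z d -> cderiv g z d.
Proof.
move=> fgz fg [q [qd fq]].
exists (fun w => if pselect (f w = g w) then q w else (g w - g z) / (w - z)); split.
  apply: eq_ccvg qd; move: fg; apply: filterS => w fg.
  by case: pselect.
move=> w; case: pselect => [e|ne] /=; first by rewrite -e -fgz fq.
rewrite divfK; first by rewrite addrC subrK.
by rewrite subr_eq0; apply/eqP => wz; apply: ne; rewrite wz.
Qed.

Lemma holo_ext f g : (forall z, inD z -> f z = g z) -> holo_on_D f -> holo_on_D g.
Proof.
move=> fg /holoP hf; apply/holoP => z zD; have [d hd] := hf z zD; exists d.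
apply: cderiv_ext hd; first exact: fg.
by apply: filterS (inD_cnbhs zD) => w; exact: fg.
Qed.

Lemma cderiv_cst a z : cderiv (fun=> a) z 0.
Proof. by exists (fun=> 0); split=> [|w]; [exact: ccvg_cst|rewrite mul0r addr0]. Qed.
Lemma cderiv_id z : cderiv id z 1.
Proof. by exists (fun=> 1); split=> [|w]; [exact: ccvg_cst|rewrite mul1r addrC subrK]. Qed.

Lemma cderivD f g z a b : cderiv f z a -> cderiv g z b ->
  cderiv (fun x => f x + g x) z (a + b).
Proof.
move=> [q [qd fq]] [p [pd fp]]; exists (fun x => q x + p x); split.
  exact: ccvgD.
by move=> w; rewrite fq fp; ring.
Qed.

Lemma cderivM f g z a b : cderiv f z a -> cderiv g z b ->
  cderiv (fun x => f x * g x) z (a * g z + f z * b).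
Proof.
move=> hf hg; move: (hf) (hg) => [q [qd fq]] [p [pd fp]].
exists (fun x => q x * g x + f z * p x); split.
  apply: ccvgD; apply: ccvgM => //; [exact: (cderiv_cont hg)|exact: ccvg_cst].
by move=> w; rewrite fq fp; ring.
Qed.

Lemma cderivV f z a : f z != 0 -> cderiv f z a ->
  cderiv (fun x => (f x)^-1) z (- a / (f z * f z)).
Proof.
move=> fz0 hf; have fc := cderiv_cont hf; move: (hf) => [q [qd fq]].
have n0 : \forall w \near cnbhs z, f w != 0.
  move/ccvg_lt : fc => /(_ (cabs (f z))); rewrite cabs_gt0 => /(_ fz0).
  apply: filterS => w; apply: contraPneq => ->.
  by rewrite sub0r cabsN ltxx.
(* The identity in [cderiv] is global, so the zeros of [f] are patched with the value at [z]; near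
   [z] the patched function is [1 / f]. *)
have h : cderiv (fun x => if f x == 0 then (f z)^-1 else (f x)^-1) z (- a / (f z * f z)).
  exists (fun w => if f w == 0 then 0 else - q w / (f z * f w)); split.
    apply: (eq_ccvg (f := fun w => - q w / (f z * f w))).
      by move: n0; apply: filterS => w /negPf ->.
    apply: ccvgM; first exact: ccvgN.
    apply: ccvgV; first by rewrite mulf_neq0.
    apply: ccvgM => //; exact: ccvg_cst.
  move=> w; rewrite (negPf fz0); case: eqP => [e|/eqP e].
    by rewrite mul0r addr0.
  have qe : q w * (w - z) = f w - f z by rewrite [f w]fq; ring.
  rewrite mulrAC mulNr qe; field.
  by rewrite e fz0.
apply: cderiv_ext h; first by rewrite (negPf fz0).
by move: n0; apply: filterS => w /negPf ->.
Qed.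

Lemma cderiv_comp f g z a b : cderiv f z a -> cderiv g (f z) b ->
  cderiv (fun x => g (f x)) z (b * a).
Proof.
move=> hf [p [pd fp]]; move: (hf) => [q [qd fq]].
exists (fun x => p (f x) * q x); split.
  apply: ccvgM => //; apply: ccvg_comp pd; exact: (cderiv_cont hf).
move=> w; rewrite fp; congr (_ + _); rewrite -mulrA; congr (_ * _).
by rewrite [f w]fq; ring.
Qed.

Lemma holo_cst a : holo_on_D (fun=> a).
Proof. by apply/holoP => z _; exists 0; exact: cderiv_cst. Qed.
Lemma holo_id : holo_on_D (@id C).
Proof. by apply/holoP => z _; exists 1; exact: cderiv_id. Qed.
Lemma holoD f g : holo_on_D f -> holo_on_D g -> holo_on_D (fun x => f x + g x).
Proof.
move=> /holoP hf /holoP hg; apply/holoP => z zD.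
have [a ha] := hf z zD; have [b hb] := hg z zD.
by exists (a + b); exact: cderivD.
Qed.
Lemma holoM f g : holo_on_D f -> holo_on_D g -> holo_on_D (fun x => f x * g x).
Proof.
move=> /holoP hf /holoP hg; apply/holoP => z zD.
have [a ha] := hf z zD; have [b hb] := hg z zD.
by eexists; exact: (cderivM ha hb).
Qed.
Lemma holoN f : holo_on_D f -> holo_on_D (fun x => - f x).
Proof.
move=> hf; apply: (holo_ext (f := fun x => -1 * f x)).
  by move=> z _; rewrite mulN1r.
by apply: holoM => //; exact: holo_cst.
Qed.
Lemma holoB f g : holo_on_D f -> holo_on_D g -> holo_on_D (fun x => f x - g x).
Proof. by move=> hf hg; apply: holoD => //; exact: holoN. Qed.
Lemma holoV f : holo_on_D f -> (forall z, inD z -> f z != 0) ->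
  holo_on_D (fun x => (f x)^-1).
Proof.
move=> /holoP hf f0; apply/holoP => z zD; have [a ha] := hf z zD.
by eexists; exact: (cderivV (f0 z zD) ha).
Qed.
Lemma holo_comp f g : holo_on_D f -> (forall z, inD z -> inD (f z)) ->
  holo_on_D g -> holo_on_D (fun x => g (f x)).
Proof.
move=> /holoP hf fD /holoP hg; apply/holoP => z zD.
have [a ha] := hf z zD; have [b hb] := hg _ (fD z zD).
by exists (b * a); exact: cderiv_comp.
Qed.
Lemma holo_poly (p : {poly C}) : holo_on_D (fun x => p.[x]).
Proof.
elim/poly_ind: p => [|p c IH].
  by apply: holo_ext (holo_cst 0) => z _; rewrite horner0.
apply: (holo_ext (f := fun z => p.[z] * z + c)).
  by move=> z _; rewrite hornerMXaddC.
by apply: holoD (holo_cst _); apply: holoM => //; exact: holo_id.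
Qed.
Lemma holo_sum (I : Type) (s : seq I) (f : I -> C -> C) :
  (forall i, holo_on_D (f i)) -> holo_on_D (fun z => \sum_(i <- s) f i z).
Proof.
move=> hf; elim: s => [|i s IH].
  by apply: holo_ext (holo_cst 0) => z _; rewrite big_nil.
apply: (holo_ext (f := fun z => f i z + \sum_(j <- s) f j z)).
  by move=> z _; rewrite big_cons.
exact: holoD.
Qed.
End ComplexBasics.

(** * Integrals over segments *)

Section IntervalIntegral.
Variable R : realType.
Implicit Types (a b c : R) (f g : R -> R).
Local Notation mu := (@lebesgue_measure R).

Definition RI a b f : R := \int[mu]_(x in `[a, b]) f x.
Definition rint a b f := mu.-integrable `[a, b] (EFin \o f).

Lemma cont_rint a b f : {within `[a, b], continuous f} -> rint a b f.
Proof. by move=> h; apply: continuous_compact_integrable => //; exact: segment_compact. Qed.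

Lemma contT_rint a b f : continuous f -> rint a b f.
Proof. by move=> h; apply: cont_rint; exact: continuous_subspaceT. Qed.

Lemma rintD a b f g : rint a b f -> rint a b g -> rint a b (fun x => f x + g x).
Proof. move=> hf hg; apply: (@integrableD _ _ _ mu _ _ (EFin \o f) (EFin \o g)) hf hg; exact: measurable_itv. Qed.

Lemma rintB a b f g : rint a b f -> rint a b g -> rint a b (fun x => f x - g x).
Proof. move=> hf hg; apply: (@integrableB _ _ _ mu _ _ (EFin \o f) (EFin \o g)) hf hg; exact: measurable_itv. Qed.

Lemma rintZ a b f k : rint a b f -> rint a b (fun x => k * f x).
Proof. move=> hf; apply: (@integrableZl _ _ _ mu _ _ k (EFin \o f)) hf; exact: measurable_itv. Qed.

Lemma rint_cst a b k : rint a b (fun=> k).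
Proof. by apply: contT_rint; exact: cst_continuous. Qed.

Lemma RI_cst a b k : a <= b -> RI a b (fun=> k) = k * (b - a).
Proof.
move=> ab; rewrite /RI Rintegral_cst//= lebesgue_measure_itv /= lte_fin.
by case: ltP => //= h; rewrite (le_anti (introT andP (conj ab h))) subrr.
Qed.

Lemma RID a b f g : rint a b f -> rint a b g ->
  RI a b (fun x => f x + g x) = RI a b f + RI a b g.
Proof. by move=> hf hg; exact: RintegralD. Qed.

Lemma RIB a b f g : rint a b f -> rint a b g ->
  RI a b (fun x => f x - g x) = RI a b f - RI a b g.
Proof. by move=> hf hg; exact: RintegralB. Qed.

Lemma RIZ a b f k : rint a b f -> RI a b (fun x => k * f x) = k * RI a b f.
Proof. by move=> hf; exact: RintegralZl. Qed.

Lemma le_RI a b f g : rint a b f -> rint a b g ->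
  (forall x, a <= x <= b -> f x <= g x) -> RI a b f <= RI a b g.
Proof.
move=> hf hg fg; apply: le_Rintegral => // x /=; rewrite in_itv /=; exact: fg.
Qed.

Lemma eq_RI a b f g : (forall x, a <= x <= b -> f x = g x) -> RI a b f = RI a b g.
Proof.
move=> fg; apply: eq_Rintegral => x; rewrite inE /= in_itv /=; exact: fg.
Qed.

Lemma eq_rint a b f g : (forall x, a <= x <= b -> f x = g x) -> rint a b f -> rint a b g.
Proof.
move=> fg; apply: eq_integrable => // x; rewrite inE /= in_itv /= => h.
by rewrite fg.
Qed.

Lemma RI_ge0 a b f : (forall x, a <= x <= b -> 0 <= f x) -> 0 <= RI a b f.
Proof.
by move=> h; apply: Rintegral_ge0 => x /=; rewrite in_itv /=; exact: h.
Qed.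

Lemma RI_bound a b f k : a <= b -> rint a b f ->
  (forall x, a <= x <= b -> `|f x| <= k) -> `|RI a b f| <= k * (b - a).
Proof.
move=> ab hf h; rewrite -(RI_cst k ab) ler_norml; apply/andP; split.
  rewrite -mulN1r -RIZ; last exact: rint_cst.
  apply: le_RI => //; first by apply: rintZ; exact: rint_cst.
  by move=> x /h; rewrite ler_norml mulN1r => /andP[].
apply: le_RI => //; first exact: rint_cst.
by move=> x /h; rewrite ler_norml => /andP[].
Qed.

Lemma RI_split a b c f : a <= c <= b -> rint a b f -> RI a b f = RI a c f + RI c b f.
Proof.
move=> /andP[ac cb] hf; apply/eqP; rewrite addrC -subr_eq; apply/eqP.
rewrite /RI (Rintegral_itvB hf) ?bnd_simp//.
apply: Rintegral_itv_obnd_cbnd.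
by apply: integrableS hf => //; apply: subset_itvr; rewrite bnd_simp.
Qed.

Lemma cauchy_ne_0 (x : R) : (forall e, 0 < e -> `|x| <= e) -> x = 0.
Proof.
move=> h; apply/eqP; rewrite -normr_le0; apply/ler_addgt0Pr => e e0.
by rewrite add0r; exact: h.
Qed.
End IntervalIntegral.

(** * Goursat's lemma and the mean value property *)

Section Goursat.
Variables (R : realType) (u v : R -> R -> R) (L : R).

Hypothesis duv : forall x y, x < L -> exists al be be' : R, forall e : R, 0 < e ->
  exists2 d : R, 0 < d & forall x' y', `|x' - x| < d -> `|y' - y| < d ->
    `|u x' y' - u x y - (al * (x' - x) + be * (y' - y))| <= e * (`|x' - x| + `|y' - y|) /\
    `|v x' y' - v x y - (be' * (x' - x) + al * (y' - y))| <= e * (`|x' - x| + `|y' - y|).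
Hypothesis intu : forall x c d, x < L -> rint c d (u x).
Hypothesis intv : forall y a b, b < L -> rint a b (v^~ y).

(** The imaginary part of the contour integral of [u + i v] around the rectangle, that is the
    integral of [v dx + u dy]. The common coefficient [al] in [duv] is the equation [u_x = v_y] that
    makes this form closed. *)
Definition flux a b c d : R :=
  RI a b (v^~ c) - RI a b (v^~ d) + (RI c d (u b) - RI c d (u a)).

Let flux_split a b c d x y : a <= x <= b -> c <= y <= d -> b < L ->
  flux a b c d = flux a x c y + flux x b c y + (flux a x y d + flux x b y d).
Proof.
move=> /andP[ax xb] /andP[cy yd] bL.
have xL : x < L by exact: le_lt_trans bL.
have aL : a < L by exact: le_lt_trans xL.
rewrite /flux.
rewrite (@RI_split _ a b x (v^~ c)) ?ax//; last exact: intv.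
rewrite (@RI_split _ a b x (v^~ d)) ?ax//; last exact: intv.
rewrite (@RI_split _ c d y (u b)) ?cy//; last exact: intu.
rewrite (@RI_split _ c d y (u a)) ?cy//; last exact: intu.
ring.
Qed.

(** The affine parts of [u] and [v] at [(x0, y0)] contribute [al] times the area with opposite signs
    along the two pairs of sides; only the first-order errors survive. *)
Let flux_small x0 y0 (e : R) : x0 < L -> 0 < e -> exists2 d : R, 0 < d &
  forall a b c k, a <= x0 <= b -> c <= y0 <= k -> b < L -> b - a < d -> k - c < d ->
  `|flux a b c k| <= e * (b - a + (k - c)) ^+ 2.
Proof.
move=> xL e0; have [al [be [be' H]]] := duv y0 xL.
have e4 : 0 < e / 2 by rewrite divr_gt0.
have [d d0 hd] := H _ e4; exists d => // a b c k /andP[ax xb] /andP[cy yk] bL hab hck.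
have ab : a <= b by exact: le_trans xb.
have ck : c <= k by exact: le_trans yk.
have aL : a < L by exact: le_lt_trans bL.
set s := b - a + (k - c).
have cs x y : a <= x <= b -> c <= y <= k ->
    `|u x y - u x0 y0 - (al * (x - x0) + be * (y - y0))| <= e / 2 * s /\
    `|v x y - v x0 y0 - (be' * (x - x0) + al * (y - y0))| <= e / 2 * s.
  move=> /andP[h1 h2] /andP[h3 h4].
  have hx : `|x - x0| <= b - a by rewrite ler_norml; lra.
  have hy : `|y - y0| <= k - c by rewrite ler_norml; lra.
  have [] := hd x y (le_lt_trans hx hab) (le_lt_trans hy hck).
  have le : e / 2 * (`|x - x0| + `|y - y0|) <= e / 2 * s.
    by rewrite ler_wpM2l ?(ltW e4)// lerD.
  by move=> /le_trans -/(_ _ le) ? /le_trans -/(_ _ le) ?.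
have h1 : `|RI a b (v^~ c) - RI a b (v^~ k) + al * (k - c) * (b - a)| <= e * s * (b - a).
  rewrite -RIB; [|exact: intv|exact: intv].
  rewrite -RI_cst// -RID; [|apply: rintB; exact: intv|exact: rint_cst].
  apply: RI_bound => //.
    apply: rintD; last exact: rint_cst.
    by apply: rintB; exact: intv.
  move=> x hx; have [_ A] := cs x c hx (introT andP (conj (lexx c) ck)).
  have [_ B] := cs x k hx (introT andP (conj ck (lexx k))).
  have -> : v x c - v x k + al * (k - c) =
    (v x c - v x0 y0 - (be' * (x - x0) + al * (c - y0))) -
    (v x k - v x0 y0 - (be' * (x - x0) + al * (k - y0))) by ring.
  apply: le_trans (ler_normB _ _) _.
  by apply: le_trans (lerD A B) _; lra.
have h2 : `|RI c k (u b) - RI c k (u a) - al * (b - a) * (k - c)| <= e * s * (k - c).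
  rewrite -RIB; [|exact: intu|exact: intu].
  rewrite -[X in _ - X](RI_cst _ ck) -RIB; [|apply: rintB; exact: intu|exact: rint_cst].
  apply: RI_bound => //.
    apply: rintB; last exact: rint_cst.
    by apply: rintB; exact: intu.
  move=> y hy; have [A _] := cs b y (introT andP (conj ab (lexx b))) hy.
  have [B _] := cs a y (introT andP (conj (lexx a) ab)) hy.
  have -> : u b y - u a y - al * (b - a) =
    (u b y - u x0 y0 - (al * (b - x0) + be * (y - y0))) -
    (u a y - u x0 y0 - (al * (a - x0) + be * (y - y0))) by ring.
  apply: le_trans (ler_normB _ _) _.
  by apply: le_trans (lerD A B) _; lra.
have -> : flux a b c k = (RI a b (v^~ c) - RI a b (v^~ k) + al * (k - c) * (b - a)) +
   (RI c k (u b) - RI c k (u a) - al * (b - a) * (k - c)).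
  by rewrite /flux; ring.
apply: le_trans (ler_normD _ _) _; apply: le_trans (lerD h1 h2) _.
by rewrite -mulrDr -/s expr2 mulrA.
Qed.

Let rect := (R * R * R * R)%type.
Let fl (q : rect) := let: (a, b, c, d) := q in flux a b c d.
Let valid (q : rect) := let: (a, b, c, d) := q in [/\ a <= b, b < L & c <= d].
Let quarter (q q' : rect) := let: (a, b, c, d) := q in let: (a', b', c', d') := q' in
  [/\ a <= a', b' <= b, b' - a' = (b - a) / 2 &
   [/\ c <= c', d' <= d, d' - c' = (d - c) / 2 & valid q'] ].

(** One bisection keeps a quarter rectangle carrying at least a quarter of the flux. Validity is a
    premise inside the existential so that [choice] yields a total map on rectangles. *)
Let step q : exists q', valid q -> quarter q q' /\ `|fl q| <= 4 * `|fl q'|.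
Proof.
case: q => [[[a b] c] d].
have [vq|nv] := pselect (valid (a, b, c, d)); last by exists (a, b, c, d).
have [ab bL cd] := vq.
set x := (a + b) / 2; set y := (c + d) / 2.
have hx : a <= x <= b by rewrite /x; apply/andP; split; lra.
have hy : c <= y <= d by rewrite /y; apply/andP; split; lra.
have /andP[ax xb] := hx; have /andP[cy yd] := hy.
have e := flux_split hx hy bL.
pose M := Num.max (Num.max `|flux a x c y| `|flux x b c y|)
                  (Num.max `|flux a x y d| `|flux x b y d|).
have le4 : `|flux a b c d| <= 4 * M.
  rewrite e; apply: le_trans (ler_normD _ _) _.
  apply: le_trans (lerD (ler_normD _ _) (ler_normD _ _)) _.
  have : [/\ `|flux a x c y| <= M, `|flux x b c y| <= M, `|flux a x y d| <= M & `|flux x b y d| <= M].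
    by rewrite /M; split; rewrite !le_max lexx ?orbT.
  by case; lra.
have ex q' : quarter (a, b, c, d) q' -> M = `|fl q'| ->
    exists q', valid (a, b, c, d) -> quarter (a, b, c, d) q' /\ `|fl (a, b, c, d)| <= 4 * `|fl q'|.
  by move=> hq e'; exists q' => _; split => //; rewrite -e'.
have eb1 : x - a = (b - a) / 2 by rewrite /x; field.
have eb2 : b - x = (b - a) / 2 by rewrite /x; field.
have ed1 : y - c = (d - c) / 2 by rewrite /y; field.
have ed2 : d - y = (d - c) / 2 by rewrite /y; field.
have xL := le_lt_trans xb bL.
move: ex; rewrite {1}/M maxEle; case: ifP => _; rewrite maxEle; case: ifP => _ ex.
- by apply: (ex (x, b, y, d)).
- by apply: (ex (a, x, y, d)).
- by apply: (ex (x, b, c, y)).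
- by apply: (ex (a, x, c, y)).
Qed.

(** Bisection uses differentiability at single points only: the flux loses at most a factor 4 at
    each halving, while [flux_small] at the common point of the nested rectangles bounds it by a
    small multiple of the squared size. *)
Lemma goursat a b c d : a <= b -> b < L -> c <= d -> flux a b c d = 0.
Proof.
move=> ab bL cd.
have [nx hnx] := choice step.
pose s n := iter n nx (a, b, c, d).
have vs n : valid (s n).
  elim: n => [//|n IH] /=; have [] := hnx _ IH.
  rewrite -/(s n); case: (s n) (nx (s n)) => [[[? ?] ?] ?] [[[? ?] ?] ?] /=.
  by move=> [_ _ _ [_ _ _ ]].
have qs n : quarter (s n) (s n.+1) by have [] := hnx _ (vs n).
have fs n : `|flux a b c d| <= 4 ^+ n * `|fl (s n)|.
  elim: n => [|n IH]; first by rewrite expr0 mul1r.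
  apply: le_trans IH _; rewrite exprSr -mulrA ler_wpM2l ?exprn_ge0//.
  by have [] := hnx _ (vs n).
pose A n := (s n).1.1.1; pose B n := (s n).1.1.2; pose Cc n := (s n).1.2; pose Dd n := (s n).2.
have sE n : s n = (A n, B n, Cc n, Dd n) by rewrite /A /B /Cc /Dd; case: (s n) => [[[]]].
have hq n : [/\ A n <= A n.+1, B n.+1 <= B n, B n.+1 - A n.+1 = (B n - A n) / 2 &
   [/\ Cc n <= Cc n.+1, Dd n.+1 <= Dd n & Dd n.+1 - Cc n.+1 = (Dd n - Cc n) / 2] ].
  by have := qs n; rewrite !sE /= => -[? ? ? [? ? ? _]].
have hv n : [/\ A n <= B n, B n < L & Cc n <= Dd n] by have := vs n; rewrite sE.
have szx n : B n - A n = (b - a) / 2 ^+ n.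
  elim: n => [|n IH]; first by rewrite expr0 divr1.
  by have [_ _ -> _] := hq n; rewrite IH exprSr invfM mulrA.
have szy n : Dd n - Cc n = (d - c) / 2 ^+ n.
  elim: n => [|n IH]; first by rewrite expr0 divr1.
  by have [_ _ _ [_ _ ->]] := hq n; rewrite IH exprSr invfM mulrA.
have Amon n m : (n <= m)%N -> A n <= A m.
  elim: m => [|m IH]; first by rewrite leqn0 => /eqP ->.
  rewrite leq_eqVlt => /predU1P[->//|]; rewrite ltnS => /IH /le_trans; apply.
  by have [] := hq m.
have Bmon n m : (n <= m)%N -> B m <= B n.
  elim: m => [|m IH]; first by rewrite leqn0 => /eqP ->.
  rewrite leq_eqVlt => /predU1P[->//|]; rewrite ltnS => /IH; apply: le_trans.
  by have [] := hq m.
have Cmon n m : (n <= m)%N -> Cc n <= Cc m.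
  elim: m => [|m IH]; first by rewrite leqn0 => /eqP ->.
  rewrite leq_eqVlt => /predU1P[->//|]; rewrite ltnS => /IH /le_trans; apply.
  by have [_ _ _ []] := hq m.
have Dmon n m : (n <= m)%N -> Dd m <= Dd n.
  elim: m => [|m IH]; first by rewrite leqn0 => /eqP ->.
  rewrite leq_eqVlt => /predU1P[->//|]; rewrite ltnS => /IH; apply: le_trans.
  by have [_ _ _ []] := hq m.
have AB n m : A n <= B m.
  have := Amon _ _ (leq_maxl n m); have := Bmon _ _ (leq_maxr n m).
  by have [h _ _] := hv (maxn n m); lra.
have CD n m : Cc n <= Dd m.
  have := Cmon _ _ (leq_maxl n m); have := Dmon _ _ (leq_maxr n m).
  by have [_ _ h] := hv (maxn n m); lra.
pose x0 := sup (range A); pose y0 := sup (range Cc).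
have hx0 n : A n <= x0 <= B n.
  apply/andP; split.
    by apply: ub_le_sup; [exists (B 0%N) => _ [m _ <-]; exact: AB|exists n].
  by apply: ge_sup; [exists (A 0%N); exists 0%N|move=> _ [m _ <-]; exact: AB].
have hy0 n : Cc n <= y0 <= Dd n.
  apply/andP; split.
    by apply: ub_le_sup; [exists (Dd 0%N) => _ [m _ <-]; exact: CD|exists n].
  by apply: ge_sup; [exists (Cc 0%N); exists 0%N|move=> _ [m _ <-]; exact: CD].
have x0L : x0 < L by have [_ h _] := hv 0%N; have /andP[_ h'] := hx0 0%N; exact: le_lt_trans h.
apply: cauchy_ne_0 => e e0.
set t := b - a + (d - c).
have t1 : 0 < t ^+ 2 + 1 by rewrite ltr_wpDl ?sqr_ge0.
(* The factor [4^n] of the bisection cancels the [(t / 2^n)^2] of the size, leaving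
   [e t^2 / (t^2 + 1) <= e]; the [+ 1] covers a degenerate rectangle. *)
have [del del0 hdel] := flux_small y0 x0L (divr_gt0 e0 t1).
have [n hn] : exists n, t / 2 ^+ n < del.
  have h0 : (fun n => t / 2 ^+ n) @ \oo --> (0 : R).
    by apply: cvg_geometric_eq0 || (rewrite (_ : (fun n => _) = geometric t (1 / 2)); [apply: cvg_geometric; rewrite ger0_norm; lra|apply/funext => n; rewrite /geometric /= expr_div_n expr1n div1r]).
  move/cvgrPdist_lt : h0 => /(_ _ del0)[n _ /(_ n (leqnn n))] h.
  by exists n; move: h; rewrite sub0r normrN; apply: le_lt_trans; exact: ler_norm.
have p2 : 0 < 2 ^+ n :> R by rewrite exprn_gt0.
have [abn bLn cdn] := hv n.
have tx : B n - A n < del.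
  apply: le_lt_trans hn; rewrite szx ler_pM2r ?invr_gt0// /t; lra.
have ty : Dd n - Cc n < del.
  apply: le_lt_trans hn; rewrite szy ler_pM2r ?invr_gt0// /t; lra.
have := hdel _ _ _ _ (hx0 n) (hy0 n) bLn tx ty.
rewrite szx szy -mulrDl -/t => h.
apply: le_trans (fs n) _; rewrite sE /=.
have q4 : 4 ^+ n = 2 ^+ n * 2 ^+ n :> R by rewrite -exprMn -natrM.
apply: le_trans (ler_wpM2l _ h) _; first by rewrite exprn_ge0.
rewrite q4 exprMn exprVn.
have -> : 2 ^+ n * 2 ^+ n * (e / (t ^+ 2 + 1) * (t ^+ 2 * (2 ^+ n) ^- 2)) =
   e * (t ^+ 2 / (t ^+ 2 + 1)).
  by field; rewrite !gt_eqF.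
rewrite ger_pMr// ler_pdivrMr// mul1r; lra.
Qed.
End Goursat.

Section MeanValue.
Variable R : realType.
Local Notation C := R[i].
Local Notation Re := complex.Re.
Local Notation Im := complex.Im.

Lemma is_derive_eps (f : R -> R) (x d : R) : is_derive x 1 f d ->
  forall e : R, 0 < e -> exists2 del : R, 0 < del & forall h, `|h| < del ->
    `|f (x + h) - f x - d * h| <= e * `|h|.
Proof.
move=> [df <-] e e0.
have /cvgrPdist_le /(_ _ e0) := df.
move=> /nbhs_ballP[del /= del0 H]; exists del => // h hdel.
have [->|h0] := eqVneq h 0; first by rewrite addr0 subrr mulr0 subr0 normr0 mulr0.
have : ball 0 del h by rewrite /ball /= sub0r normrN.
move=> /H /(_ h0) /=; rewrite /GRing.scale /= mulr1 => hh.
rewrite -ler_pdivrMr ?normr_gt0// -normf_div.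
apply: le_trans hh; rewrite -normrN.
rewrite le_eqVlt; apply/orP; left; apply/eqP; congr (`|_|).
by rewrite -/('D_1 f x) [x + h]addrC; field.
Qed.

Definition zpol (r t : R) : C := rC r * expi t.

Lemma cabs_zpol r t : cabs (zpol r t) = `|r|.
Proof. by rewrite cabsM cabs_rC cabs_expi mulr1. Qed.

Lemma zpol_cvg (T : Type) (F : set_system T) {FF : Filter F} (g h : T -> R) r t :
  g @ F --> r -> h @ F --> t -> ccvg F (fun x => zpol (g x) (h x)) (zpol r t).
Proof. by move=> hg hh; apply: ccvgM; [exact: ccvg_rC|exact: ccvg_expi]. Qed.

Lemma circ_ccvg (f : C -> C) r t : holo_on_D f -> `|r| < 1 ->
  ccvg (nbhs t) (fun s => f (zpol r s)) (f (zpol r t)).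
Proof.
move=> hf r1; apply: ccvg_comp (zpol_cvg (g := fun=> r) (h := id) _ _) _.
- exact: cvg_cst.
- exact: cvg_id.
- by apply: holo_cont => //; rewrite /inD cabs_zpol.
Qed.

Lemma circ_contRe (f : C -> C) r : holo_on_D f -> `|r| < 1 ->
  continuous (fun t => Re (f (zpol r t))).
Proof. by move=> hf r1 t; apply: ccvg_Re; exact: circ_ccvg. Qed.

Lemma circ_contIm (f : C -> C) r : holo_on_D f -> `|r| < 1 ->
  continuous (fun t => Im (f (zpol r t))).
Proof. by move=> hf r1 t; apply: ccvg_Im; exact: circ_ccvg. Qed.

(** Complex differentiability of the exponential at the origin, with [exp (h + i k)] in polar
    form. *)
Lemma exp_polar_eps (e : R) : 0 < e -> exists2 del : R, 0 < del & forall h k : R,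
  `|h| < del -> `|k| < del ->
  cabs (zpol (expR h) k - 1 - Complex h k) <= e * (`|h| + `|k|).
Proof.
move=> e0.
have e1 : 0 < Num.min (e / 8) (1 / 8) by rewrite lt_min !divr_gt0.
set e' := Num.min (e / 8) (1 / 8) in e1.
have ee : e' <= e / 8 by rewrite ge_min lexx.
have ee1 : e' <= 1 / 8 by rewrite ge_min lexx orbT.
have [d1 d10 H1] := is_derive_eps (is_derive_expR 0) e1.
have [d2 d20 H2] := is_derive_eps (is_derive_sin 0) e1.
have [d3 d30 H3] := is_derive_eps (is_derive_cos 0) e1.
exists (Num.min (Num.min d1 d2) (Num.min d3 e')).
  by rewrite 3!lt_min d10 d20 d30 e1.
move=> h k; rewrite 3!lt_min => /andP[/andP[h1 _] /andP[_ h4]].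
rewrite 3!lt_min => /andP[/andP[k1 k2] /andP[k3 k4]].
have A := H1 h h1; have B := H2 k k2; have D := H3 k k3.
rewrite !add0r in A B D; rewrite expR0 cos0 sin0 in A B D.
rewrite mul1r in A; rewrite mul1r subr0 in B; rewrite oppr0 mul0r subr0 in D.
have cA : cabs (rC (expR h) - 1 - rC h) <= e' * `|h|.
  by rewrite -rC1 -!rCB cabs_rC.
have cB : cabs (expi k - 1 - Complex 0 k) <= 2 * (e' * `|k|).
  apply: le_trans (cabs_le_ReIm _) _; rewrite /= !subr0.
  by apply: le_trans (lerD D B) _; lra.
have -> : zpol (expR h) k - 1 - Complex h k =
  (rC (expR h) - 1 - rC h) * expi k + (1 + rC h) * (expi k - 1 - Complex 0 k) + rC h * Complex 0 k.
  have -> : Complex h k = rC h + Complex 0 k by rewrite /rC; congr Complex => /=; ring.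
  rewrite /zpol; ring.
apply: le_trans (ler_cabsD _ _) _.
apply: le_trans (lerD (ler_cabsD _ _) (lexx _)) _.
rewrite !cabsM cabs_expi mulr1 -rC1 -rCD !cabs_rC.
have -> : cabs (Complex 0 k) = `|k| by rewrite /cabs /= expr0n /= add0r sqrtr_sqr.
have n1 : `|1 + h| <= 2.
  by rewrite (le_trans (ler_normD _ _))// normr1; lra.
have p1 : `|1 + h| * cabs (expi k - 1 - Complex 0 k) <= 2 * (2 * (e' * `|k|)).
  by apply: ler_pM => //; exact: cabs_ge0.
have p2 : `|h| * `|k| <= e' * `|k| by rewrite ler_wpM2r// ltW.
have p3 : e' * `|h| <= e / 8 * `|h| by rewrite ler_wpM2r.
have p4 : e' * `|k| <= e / 8 * `|k| by rewrite ler_wpM2r.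
apply: (@le_trans _ _ (e' * `|h| + 2 * (2 * (e' * `|k|)) + e' * `|k|)).
  by apply: lerD => //; apply: lerD.
have k0 : 0 <= e * `|k| by rewrite mulr_ge0// ltW.
have h0 : 0 <= e * `|h| by rewrite mulr_ge0// ltW.
lra.
Qed.

(** In the coordinate [x + i y = log z] the punctured disc becomes the half-plane [x < 0] and
    circles become vertical segments, so that a statement about rectangles yields one about
    circles. *)
Lemma holo_log_deriv (f : C -> C) x y : holo_on_D f -> x < 0 -> exists d : C,
  forall e : R, 0 < e -> exists2 del : R, 0 < del & forall x' y',
   `|x' - x| < del -> `|y' - y| < del ->
   cabs (f (zpol (expR x') y') - f (zpol (expR x) y) - d * Complex (x' - x) (y' - y))
     <= e * (`|x' - x| + `|y' - y|).
Proof.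
move=> /holoP hf x0; set z := zpol (expR x) y.
have zn : cabs z = expR x by rewrite cabs_zpol ger0_norm// expR_ge0.
have zD : inD z by rewrite /inD zn expR_lt1.
have [d [q [qd fq]]] := hf z zD; exists (d * z) => e e0.
have dz : 0 < cabs d + 3 by rewrite ltr_wpDl// cabs_ge0.
have e1 : 0 < Num.min 1 (e / (cabs d + 3)) by rewrite lt_min ltr01 divr_gt0.
set e' := Num.min 1 (e / (cabs d + 3)) in e1.
have e'1 : e' <= 1 by rewrite ge_min lexx.
have e'2 : e' * (cabs d + 3) <= e.
  by rewrite -ler_pdivlMr// ge_min lexx orbT.
move/ccvg_lt : qd => /(_ _ e1)[d1 d10 H1].
have [d2 d20 H2] := exp_polar_eps e1.
have m0 : 0 < Num.min d2 (d1 / 4) by rewrite lt_min d20 divr_gt0.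
exists (Num.min d2 (d1 / 4)) => // x' y'.
rewrite !lt_min => /andP[hx hx'] /andP[hy hy'].
set h := x' - x; set k := y' - y; set z' := zpol (expR x') y'.
have zz : z' = z * zpol (expR h) k.
  rewrite /z' /z /zpol mulrACA -rCM -expiD -expRD.
  by rewrite /h /k [x + _]addrC [y + _]addrC !subrK.
have A := H2 h k hx hy.
set s := `|h| + `|k| in A *.
have s0 : 0 <= s by rewrite addr_ge0.
have ch : cabs (Complex h k) <= s by exact: cabs_le_ReIm.
have zl : cabs z < 1 by [].
have A1 : cabs (z' - z - z * Complex h k) <= e' * s.
  have -> : z' - z - z * Complex h k = z * (zpol (expR h) k - 1 - Complex h k).
    by rewrite zz; ring.
  rewrite cabsM; apply: le_trans A.
  by rewrite ler_piMl ?cabs_ge0// ltW.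
have A2 : cabs (z' - z) <= 2 * s.
  have -> : z' - z = (z' - z - z * Complex h k) + z * Complex h k by ring.
  apply: le_trans (ler_cabsD _ _) _.
  have : cabs (z * Complex h k) <= s.
    rewrite cabsM; apply: le_trans ch.
    by rewrite ler_piMl ?cabs_ge0// ltW.
  have : e' * s <= 1 * s by rewrite ler_wpM2r.
  lra.
have A3 : cabs (z' - z) < d1 by move: hx' hy' A2; rewrite /s /h /k; lra.
have A4 := H1 z' A3.
have -> : f z' - f z - d * z * Complex h k =
   (q z' - d) * (z' - z) + d * (z' - z - z * Complex h k).
  by rewrite [f z']fq; ring.
apply: le_trans (ler_cabsD _ _) _; rewrite !cabsM.
have B1 : cabs (q z' - d) * cabs (z' - z) <= e' * (2 * s).
  by apply: ler_pM; rewrite ?cabs_ge0// ltW.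
have B2 : cabs d * cabs (z' - z - z * Complex h k) <= cabs d * (e' * s).
  by rewrite ler_wpM2l ?cabs_ge0.
apply: le_trans (lerD B1 B2) _.
apply: (@le_trans _ _ (e' * (cabs d + 3) * s)); last by rewrite ler_wpM2r.
have : 0 <= e' * s by rewrite mulr_ge0// ltW.
lra.
Qed.

Lemma RI_2pi (k : R) : RI 0 (2 * pi) (fun=> k) = 2 * pi * k.
Proof. by rewrite RI_cst; [rewrite subr0 mulrC|exact/ltW/pi2_gt0]. Qed.

(** Goursat's lemma on [[a, ln r] x [0, 2 pi]] in logarithmic coordinates: the horizontal sides
    cancel by periodicity, hence the circle integral does not depend on the radius, and continuity
    at 0 evaluates it for [a] very negative. *)
Lemma mean_value (f : C -> C) r : holo_on_D f -> 0 <= r < 1 ->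
  RI 0 (2 * pi) (fun t => Re (f (zpol r t))) = 2 * pi * Re (f 0).
Proof.
move=> hf /andP[r0 r1].
have [->|rn0] := eqVneq r 0.
  rewrite (eq_RI (g := fun=> Re (f 0))).
    exact: RI_2pi.
  by move=> t _; rewrite /zpol rC0 mul0r.
have {}r0 : 0 < r by rewrite lt_neqAle eq_sym rn0.
pose u x y := Re (f (zpol (expR x) y)).
pose v x y := Im (f (zpol (expR x) y)).
have nx (x : R) : x < 0 -> `|expR x| < 1 by move=> x0; rewrite ger0_norm ?expR_ge0// expR_lt1.
have cu x : x < 0 -> continuous (u x) by move=> x0; apply: circ_contRe => //; exact: nx.
have cv x y : x < 0 -> {for x, continuous (v^~ y)}.
  move=> x0; apply: ccvg_Im.
  apply: ccvg_comp (zpol_cvg (g := expR) (h := fun=> y) _ _) _.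
  - exact: continuous_expR.
  - exact: cvg_cst.
  - by apply: holo_cont => //; rewrite /inD cabs_zpol nx.
have lr : ln r < 0 by rewrite ln_lt0// r0.
have flux0 a : a <= ln r -> flux u v a (ln r) 0 (2 * pi) = 0.
  move=> ar; apply: (@goursat _ u v 0) => //.
  - move=> x y x0; have [d H] := holo_log_deriv y hf x0.
    exists (Re d), (- Im d), (Im d) => e /H[del del0 hd]; exists del => // x' y' hx hy.
    have h := hd _ _ hx hy; split; apply: le_trans h.
      apply: le_trans (cabs_Re _).
      by rewrite le_eqVlt !creB creM /= /u; apply/orP; left; apply/eqP; congr (`|_|); ring.
    apply: le_trans (cabs_Im _).
    by rewrite le_eqVlt !cimB cimM /= /v; apply/orP; left; apply/eqP; congr (`|_|); ring.
  - by move=> x c d x0; apply: contT_rint; exact: cu.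
  - move=> y c d d0; apply: cont_rint; apply: continuous_in_subspaceT => x.
    by rewrite inE /= in_itv /= => /andP[_ xd]; apply: cv; exact: le_lt_trans d0.
  - exact/ltW/pi2_gt0.
have per x : v x 0 = v x (2 * pi) by rewrite /v /zpol expi0 expi2pi.
have J a : a <= ln r -> RI 0 (2 * pi) (u (ln r)) = RI 0 (2 * pi) (u a).
  move=> /flux0; rewrite /flux.
  have -> : v^~ 0 = v^~ (2 * pi) by apply/funext => x; exact: per.
  by rewrite subrr add0r => /eqP; rewrite subr_eq0 => /eqP.
have -> : (fun t => Re (f (zpol r t))) = u (ln r).
  by apply/funext => t; rewrite /u lnK.
apply/eqP; rewrite -subr_eq0; apply/eqP/cauchy_ne_0 => e e0.
have p0 := @pi2_gt0 R.
have e1 : 0 < e / (2 * pi) by rewrite divr_gt0.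
have D0 : inD (0 : C) by rewrite /inD cabs0.
have := holo_cont hf D0 => /ccvg_lt /(_ _ e1)[del del0 H].
have [a [ar al]] : exists a, a <= ln r /\ expR a < del.
  exists (Num.min (ln r) (ln (del / 2))); split; first by rewrite ge_min lexx.
  apply: le_lt_trans (_ : expR (ln (del / 2)) < _).
    by rewrite ler_expR ge_min lexx orbT.
  by rewrite lnK ?posrE ?divr_gt0//; lra.
rewrite (J a ar).
have a0 : a < 0 by exact: le_lt_trans lr.
have -> : 2 * pi * Re (f 0) = RI 0 (2 * pi) (fun=> Re (f 0)).
  by rewrite RI_2pi.
rewrite -RIB; [|by apply: contT_rint; exact: cu|exact: rint_cst].
apply: le_trans (RI_bound (k := e / (2 * pi)) _ _ _) _.
- exact: ltW.
- by apply: rintB; [apply: contT_rint; exact: cu|exact: rint_cst].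
- move=> t _; rewrite /u -creB; apply: le_trans (cabs_Re _) _.
  by apply/ltW/H; rewrite subr0 cabs_zpol ger0_norm// expR_ge0.
- by rewrite subr0 divfK// gt_eqF.
Qed.
End MeanValue.

(** * Exchange of integrals *)

Section Tonelli.
Variable R : realType.
Local Notation GR := (measurableTypeR R).
Local Notation mu := (@lebesgue_measure R).

Lemma tonelli_on (D1 D2 : set GR) (f : GR * GR -> \bar R) :
  measurable D1 -> measurable D2 -> measurable_fun setT f -> (forall p, 0 <= f p)%E ->
  (\int[mu]_(x in D1) \int[mu]_(y in D2) f (x, y) =
   \int[mu]_(y in D2) \int[mu]_(x in D1) f (x, y))%E.
Proof.
move=> m1 m2 mf f0.
pose g := f \_ (D1 `*` D2).
have mg : measurable_fun setT g.
  apply/(measurable_restrictT f (measurableX m1 m2)).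
  exact: measurable_funS mf.
have g0 p : (0 <= g p)%E by apply: erestrict_ge0 => q _; exact: f0.
have := @fubini_tonelli _ _ _ _ R mu mu g mg g0.
have e1 : (\int[mu]_x \int[mu]_y g (x, y) = \int[mu]_(x in D1) \int[mu]_(y in D2) f (x, y))%E.
  rewrite [RHS]integral_mkcond; apply: eq_integral => x _.
  rewrite [in RHS]patchE; case: ifPn => xD.
    rewrite [RHS]integral_mkcond; apply: eq_integral => y _.
    by rewrite /g !patchE in_setX xD.
  rewrite integral0_eq// => y _.
  by rewrite /g patchE in_setX (negPf xD).
have e2 : (\int[mu]_y \int[mu]_x g (x, y) = \int[mu]_(y in D2) \int[mu]_(x in D1) f (x, y))%E.
  rewrite [RHS]integral_mkcond; apply: eq_integral => y _.
  rewrite [in RHS]patchE; case: ifPn => yD.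
    rewrite [RHS]integral_mkcond; apply: eq_integral => x _.
    by rewrite /g !patchE in_setX yD andbT.
  rewrite integral0_eq// => x _.
  by rewrite /g patchE in_setX (negPf yD) andbF.
by rewrite e1 e2.
Qed.

Lemma bounded_rint (f : GR -> R) (a b M : R) : measurable_fun setT f ->
  (forall x, a <= x <= b -> `|f x| <= M) -> rint a b f.
Proof.
move=> mf hM; apply: measurable_bounded_integrable => //.
- by apply: compact_finite_measure; exact: segment_compact.
- exact: measurable_funS mf.
- exists M; split; first exact: num_real.
  move=> y My x /=; rewrite in_itv /= => /hM /le_trans; apply; exact: ltW.
Qed.

Lemma RI_EFin (f : R -> R) a b : rint a b f -> ((RI a b f)%:E = \int[mu]_(x in `[a, b]) (f x)%:E)%E.
Proof. by move=> h; rewrite /RI /Rintegral fineK//; apply: integrable_fin_num. Qed.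

Lemma RI_swap (F : GR -> GR -> R) a b c d M :
  measurable_fun setT (fun p : GR * GR => F p.1 p.2) ->
  (forall s t, 0 <= F s t) ->
  (forall s t, a <= s <= b -> c <= t <= d -> F s t <= M) ->
  RI a b (fun s => RI c d (F s)) = RI c d (fun t => RI a b (F^~ t)).
Proof.
move=> mF F0 FM.
have mS s : measurable_fun setT (F s).
  by apply: (measurableT_comp mF (pair1_measurable s)).
have mT t : measurable_fun setT (F^~ t).
  by apply: (measurableT_comp mF (pair2_measurable t)).
have := @tonelli_on `[a, b] `[c, d] (fun p => (F p.1 p.2)%:E) (measurable_itv _) (measurable_itv _).
move=> /(_ ((measurable_EFinP _ _).2 mF)) H; rewrite /RI /Rintegral; congr fine.
transitivity (\int[mu]_(x in `[a, b]) \int[mu]_(y in `[c, d]) (F x y)%:E)%E.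
  apply: eq_integral => s; rewrite inE /= in_itv /= => hs.
  apply: RI_EFin; apply: (bounded_rint (M := M)) => // t ht.
  by rewrite ger0_norm//; exact: FM.
rewrite H; last by move=> p; rewrite lee_fin.
apply: eq_integral => t; rewrite inE /= in_itv /= => ht.
symmetry; apply: RI_EFin; apply: (bounded_rint (M := M)) => // s hs.
by rewrite ger0_norm//; exact: FM.
Qed.
End Tonelli.

(** * The Poisson kernel *)

Section PoissonKernel.
Variable R : realType.
Local Notation C := R[i].
Local Notation Re := complex.Re.
Local Notation Im := complex.Im.
Local Notation GR := (measurableTypeR R).
Implicit Types (z w a : C) (s t : R).

Lemma expi_sub_neq0 z t : inD z -> expi t - z != 0.
Proof.
move=> zD; rewrite subr_eq0; apply/eqP => e.
by move: zD; rewrite /inD -e cabs_expi ltxx.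
Qed.

Lemma poissonE z t : inD z -> poisson z t = Re ((expi t + z) / (expi t - z)).
Proof.
move=> zD; have n0 := expi_sub_neq0 t zD.
rewrite /poisson -(cabs_eq0) in n0 *.
rewrite creM creV cimV !mulrA -mulrBl; congr (_ / _).
rewrite sqr_cabs creB cimB creD cimD /=.
by have h := cos2Dsin2 t; rewrite -h; ring.
Qed.

Lemma poisson_gt0 z t : inD z -> 0 < poisson z t.
Proof.
move=> zD; rewrite /poisson divr_gt0 ?exprn_gt0 ?cabs_gt0 ?expi_sub_neq0//.
by rewrite subr_gt0 expr_lt1// cabs_ge0.
Qed.

Lemma poisson_le z t : inD z -> poisson z t <= (1 + cabs z) / (1 - cabs z).
Proof.
move=> zD; have z1 : 0 < 1 - cabs z by rewrite subr_gt0.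
have := ler_cabs_dist (expi t) z; rewrite cabs_expi => h.
have d0 : 0 < cabs (expi t - z) by rewrite cabs_gt0 expi_sub_neq0.
rewrite /poisson ler_pdivrMr ?exprn_gt0// mulrAC ler_pdivlMr//.
have -> : (1 - cabs z ^+ 2) * (1 - cabs z) = (1 + cabs z) * (1 - cabs z) ^+ 2 by ring.
rewrite ler_wpM2l ?addr_ge0 ?cabs_ge0// ler_pXn2r// nnegrE ltW//.
Qed.

Lemma poisson_ge z t : inD z -> (1 - cabs z) / (1 + cabs z) <= poisson z t.
Proof.
move=> zD; have z1 : 0 < 1 - cabs z by rewrite subr_gt0.
have p1 : 0 < 1 + cabs z by rewrite ltr_wpDr ?cabs_ge0.
have := ler_cabsB (expi t) z; rewrite cabs_expi => h.
have d0 : 0 < cabs (expi t - z) by rewrite cabs_gt0 expi_sub_neq0.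
rewrite /poisson ler_pdivlMr ?exprn_gt0// mulrAC ler_pdivrMr//.
have -> : (1 - cabs z ^+ 2) * (1 + cabs z) = (1 - cabs z) * (1 + cabs z) ^+ 2 by ring.
rewrite ler_wpM2l ?(ltW z1)// ler_pXn2r// nnegrE ltW//.
Qed.

(** This symmetry allows integration in the angle of the interior point to replace integration in
    the boundary variable; every exchange of integrals below rests on it. *)
Lemma poisson_zpolC r s t : poisson (zpol r s : C) t = poisson (zpol r t : C) s.
Proof.
rewrite /poisson !cabs_zpol !sqr_cabs; congr (_ / _).
rewrite /zpol !creB !cimB !Re_rCM !Im_rCM /=.
have h1 := cos2Dsin2 s; have h2 := cos2Dsin2 t.
apply/eqP; rewrite -subr_eq0; apply/eqP.
have -> : (cos t - r * cos s) ^+ 2 + (sin t - r * sin s) ^+ 2 -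
   ((cos s - r * cos t) ^+ 2 + (sin s - r * sin t) ^+ 2) =
   (1 - r ^+ 2) * ((cos t ^+ 2 + sin t ^+ 2) - (cos s ^+ 2 + sin s ^+ 2)) by ring.
by rewrite h1 h2 subrr mulr0.
Qed.

Lemma holo_herglotz t : holo_on_D (fun z => (expi t + z) / (expi t - z)).
Proof.
apply: holoM; first by apply: holoD; [exact: holo_cst|exact: holo_id].
apply: holoV; first by apply: holoB; [exact: holo_cst|exact: holo_id].
by move=> z zD; exact: expi_sub_neq0.
Qed.

Lemma measurable_poisson (d : measure_display) (T : measurableType d)
    (x y t : T -> R) :
  measurable_fun setT x -> measurable_fun setT y -> measurable_fun setT t ->
  (forall p, inD (Complex (x p) (y p))) ->
  measurable_fun setT (fun p => poisson (Complex (x p) (y p)) (t p)).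
Proof.
move=> mx my mt hD.
(* The division is written as [expR (- ln _)], legitimate since the denominator is positive on the
   disc, so that measurability follows by composition. *)
rewrite (_ : (fun p => _) = fun p => (1 - (x p ^+ 2 + y p ^+ 2)) *
   expR (- ln ((cos (t p) - x p) ^+ 2 + (sin (t p) - y p) ^+ 2))); last first.
  apply/funext => p; have := expi_sub_neq0 (t p) (hD p); rewrite -cabs_gt0 => h.
  rewrite /poisson !sqr_cabs /= expRN lnK// posrE.
  by have := exprn_gt0 2 h; rewrite sqr_cabs.
have mc : measurable_fun setT (cos \o t).
  by apply: measurableT_comp mt; apply: continuous_measurable_fun; exact: continuous_cos.
have ms : measurable_fun setT (sin \o t).
  by apply: measurableT_comp mt; apply: continuous_measurable_fun; exact: continuous_sin.
apply: measurable_funM.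
  apply: measurable_funB => //; apply: measurable_funD; exact: measurable_funX.
apply: measurableT_comp => //; apply: measurableT_comp => //.
apply: (measurableT_comp (@measurable_ln R)).
by apply: measurable_funD; apply: measurable_funX; exact: measurable_funB.
Qed.

Lemma measurable_poissonC (d : measure_display) (T : measurableType d)
    (w : T -> C) (t : T -> R) :
  measurable_fun setT (fun p => Re (w p)) -> measurable_fun setT (fun p => Im (w p)) ->
  measurable_fun setT t -> (forall p, inD (w p)) ->
  measurable_fun setT (fun p => poisson (w p) (t p)).
Proof.
move=> mr mi mt hD; have eC z : Complex (Re z) (Im z) = z by case: z.
rewrite (_ : (fun p => _) = fun p => poisson (Complex (Re (w p)) (Im (w p))) (t p)).
  by apply: measurable_poisson => // p; rewrite eC.
by apply/funext => p; rewrite eC.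
Qed.

Lemma poisson_ccvg (T : Type) (F : set_system T) {FF : Filter F} (g : T -> C) (h : T -> R) z t :
  inD z -> ccvg F g z -> h @ F --> t -> (fun x => poisson (g x) (h x)) @ F --> poisson z t.
Proof.
move=> zD hg hh; rewrite /poisson; apply: cvgM.
  apply: cvgB; first exact: cvg_cst.
  under eq_fun do rewrite expr2.
  by rewrite expr2; apply: cvgM; exact: ccvg_cabs.
apply: cvgV; first by rewrite expf_neq0// cabs_eq0 expi_sub_neq0.
under eq_fun do rewrite expr2.
rewrite expr2; apply: cvgM; apply: ccvg_cabs; apply: ccvgB => //; exact: ccvg_expi.
Qed.

Lemma poisson_continuous z : inD z -> continuous (poisson z).
Proof.
move=> zD t; apply: (poisson_ccvg (g := fun=> z) (h := id)) => //.
exact: ccvg_cst.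
Qed.

(** The kernel is the real part of [(expi t + z) / (expi t - z)], holomorphic in [z] with value 1 at
    the origin. *)
Lemma mean_poissonl r t : 0 <= r < 1 -> RI 0 (2 * pi) (fun s => poisson (zpol r s : C) t) = 2 * pi.
Proof.
move=> r1; have /andP[r0 r1'] := r1.
rewrite (eq_RI (g := fun s => Re ((expi t + zpol r s) / (expi t - zpol r s)))); last first.
  by move=> s _; rewrite poissonE// /inD cabs_zpol ger0_norm.
rewrite (mean_value (holo_herglotz t))// addr0 subr0 divff ?expi_neq0//=.
by rewrite mulr1.
Qed.

Lemma mean_poisson z : inD z -> RI 0 (2 * pi) (poisson z) = 2 * pi.
Proof.
move=> zD; have [t _ ->] := cabs_polar z; rewrite -/(zpol _ _).
rewrite -[RHS](@mean_poissonl (cabs z) t) ?cabs_ge0//.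
by apply: eq_RI => s _; exact: poisson_zpolC.
Qed.

Lemma poisson_rint z (F : R -> R) : inD z -> continuous F ->
  rint 0 (2 * pi) (fun t => F t * poisson z t).
Proof.
move=> zD cF; apply: contT_rint => t; apply: cvgM; first exact: cF.
exact: poisson_continuous.
Qed.
End PoissonKernel.

(** * Disc automorphisms and the Poisson formula *)

Section PoissonFormula.
Variable R : realType.
Local Notation C := R[i].
Local Notation Re := complex.Re.
Local Notation Im := complex.Im.
Local Notation GR := (measurableTypeR R).
Implicit Types (z w a : C) (s t : R).

Lemma cabs_conj a : cabs (conjc a) = cabs a.
Proof. by case: a => x y; rewrite /cabs /= sqrrN. Qed.

Definition mobius a w : C := (w + a) / (1 + conjc a * w).

Lemma mobius_id a w : cabs (1 + conjc a * w) ^+ 2 - cabs (w + a) ^+ 2 =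
  (1 - cabs a ^+ 2) * (1 - cabs w ^+ 2).
Proof. by case: a w => [x y] [p q]; rewrite !sqr_cabs /=; ring. Qed.

Lemma mobius_den_ge a w : cabs w <= 1 -> 1 - cabs a <= cabs (1 + conjc a * w).
Proof.
move=> w1; have := ler_cabs_dist 1 (- (conjc a * w)).
rewrite opprK cabs1 cabsN cabsM cabs_conj; apply: le_trans.
by rewrite lerB// ler_piMr// cabs_ge0.
Qed.

Lemma mobius_den_neq0 a w : inD a -> cabs w <= 1 -> 1 + conjc a * w != 0.
Proof.
move=> aD w1; rewrite -cabs_gt0; apply: lt_le_trans (mobius_den_ge a w1).
by rewrite subr_gt0.
Qed.

Lemma mobius_inD a w : inD a -> inD w -> inD (mobius a w).
Proof.
move=> aD wD; have d0 := mobius_den_neq0 aD (ltW wD).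
rewrite /inD cabsf_div ltr_pdivrMr ?cabs_gt0// mul1r.
rewrite -(@ltr_pXn2r _ 2)// ?nnegrE ?cabs_ge0// -subr_gt0 mobius_id.
by rewrite mulr_gt0// subr_gt0 expr_lt1// cabs_ge0.
Qed.

Lemma mobius_onT a w : inD a -> onT w -> onT (mobius a w).
Proof.
move=> aD wT; have d0 : 1 + conjc a * w != 0 by rewrite mobius_den_neq0// wT.
rewrite /onT cabsf_div.
have -> : cabs (w + a) = cabs (1 + conjc a * w).
  apply/eqP; rewrite -(@eqrXn2 _ 2)// ?cabs_ge0// eq_sym -subr_eq0 mobius_id wT.
  by rewrite expr1n subrr mulr0.
by rewrite divff// cabs_eq0.
Qed.

Lemma mobius0 a : mobius a 0 = a.
Proof. by rewrite /mobius add0r mulr0 addr0 divr1. Qed.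

Lemma mobius_lip a w w' : inD a -> cabs w <= 1 -> cabs w' <= 1 ->
  cabs (mobius a w - mobius a w') <= cabs (w - w') * (2 / (1 - cabs a) ^+ 2).
Proof.
move=> aD w1 w1'; have d0 := mobius_den_neq0 aD w1; have d0' := mobius_den_neq0 aD w1'.
have -> : mobius a w - mobius a w' = (w - w') * (1 - a * conjc a) /
    ((1 + conjc a * w) * (1 + conjc a * w')).
  by rewrite /mobius; field; rewrite d0 d0'.
have a1 : 0 < 1 - cabs a by rewrite subr_gt0.
rewrite cabsf_div 2!cabsM -mulrA ler_wpM2l ?cabs_ge0//.
apply: ler_pM; rewrite ?cabs_ge0 ?invr_ge0 ?mulr_ge0 ?cabs_ge0//.
  apply: le_trans (ler_cabsB _ _) _; rewrite cabs1 cabsM cabs_conj.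
  have : cabs a * cabs a <= 1 by rewrite mulr_ile1 ?cabs_ge0// ltW.
  lra.
rewrite lef_pV2 ?posrE ?exprn_gt0 ?mulr_gt0 ?cabs_gt0//.
rewrite expr2; apply: ler_pM; rewrite ?(ltW a1)//; exact: mobius_den_ge.
Qed.

Lemma holo_mobius a : inD a -> holo_on_D (mobius a).
Proof.
move=> aD; apply: holoM; first by apply: holoD; [exact: holo_id|exact: holo_cst].
apply: holoV.
  by apply: holoD; [exact: holo_cst|apply: holoM; [exact: holo_cst|exact: holo_id]].
by move=> z zD; rewrite mobius_den_neq0// ltW.
Qed.

(** Compactness of the parameter interval makes the modulus of continuity uniform along the circle;
    the second point [w] may leave the circle. *)
Lemma unif_circle (f : C -> C) r : (forall t, ccont f (zpol r t)) ->
  forall e : R, 0 < e -> exists2 d : R, 0 < d & forall t w, 0 <= t <= 2 * pi ->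
    cabs (w - zpol r t) < d -> cabs (f w - f (zpol r t)) < e.
Proof.
move=> cf e e0.
have /compact_near_coveringP := @segment_compact R 0 (2 * pi).
move=> /(_ _ (0 : R)^'+ (fun d t => forall w, cabs (w - zpol r t) < d ->
   cabs (f w - f (zpol r t)) < e)).
move=> /(_ _ _)/wrap[].
  move=> x _.
  have e2 : 0 < e / 2 by rewrite divr_gt0.
  have /ccvg_lt /(_ _ e2)[d d0 H] := cf x.
  have hx : \forall t \near x, cabs (zpol r t - zpol r x) < d / 2.
    have : ccvg (nbhs x) (zpol r) (zpol r x) by apply: zpol_cvg; [exact: cvg_cst|exact: cvg_id].
    by move=> /ccvg_lt; apply; rewrite divr_gt0.
  have hd : \forall k \near (0 : R)^'+, k < d / 2 by apply: nbhs_right_lt; rewrite divr_gt0.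
  near=> t k => w /= hw.
  have ht : cabs (zpol r t - zpol r x) < d / 2 by near: t.
  have hk : k < d / 2 by near: k.
  have h1 : cabs (f (zpol r t) - f (zpol r x)) < e / 2 by apply: H; lra.
  have h2 : cabs (f w - f (zpol r x)) < e / 2.
    by apply: H; apply: le_lt_trans (ler_cabs_distD _ _ (zpol r t)) _; lra.
  apply: le_lt_trans (ler_cabs_distD _ _ (f (zpol r x))) _.
  by rewrite [X in _ + X]cabsB; lra.
move=> hd; have [d [h d0]] := filter_ex (filterI hd (nbhs_right_gt (0 : R))).
exists d => // t w ht; apply: h; by rewrite /= in_itv.
Unshelve. all: by end_near. Qed.

Lemma cont_bounded (F : R -> R) (b : R) : continuous F ->
  exists M : R, 0 < M /\ forall t, 0 <= t <= b -> `|F t| <= M.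
Proof.
move=> cF; have [M hM] : bounded_set (F @` `[0, b]).
  apply: compact_bounded; apply: continuous_compact; last exact: segment_compact.
  exact: continuous_subspaceT.
exists (`|M| + 1); split; first by rewrite ltr_wpDl.
move=> t ht; apply: hM.2; first by rewrite (le_lt_trans (ler_norm _))// ltrDl.
by exists t => //=; rewrite in_itv.
Qed.

Lemma poisson_diff z w t : inD z -> inD w ->
  `|poisson z t - poisson w t| <= 2 * cabs (z - w) / (cabs (expi t - z) * cabs (expi t - w)).
Proof.
move=> zD wD; have z0 := expi_sub_neq0 t zD; have w0 := expi_sub_neq0 t wD.
rewrite !poissonE// -creB; apply: le_trans (cabs_Re _) _.
have -> : (expi t + z) / (expi t - z) - (expi t + w) / (expi t - w) =
   2 * expi t * (z - w) / ((expi t - z) * (expi t - w)).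
  by field; rewrite z0 w0.
rewrite cabsf_div !cabsM cabs_expi mulr1.
by have -> : cabs (2 : C) = 2 by rewrite (_ : 2 = rC 2) ?cabs_rC ?ger0_norm// -[2]/(1 + 1) rCD.
Qed.

Lemma poisson_int_ccvg (T : Type) (G : set_system T) {FG : Filter G} (g : T -> C) (F : R -> R) z :
  continuous F -> inD z -> (\forall x \near G, inD (g x)) -> ccvg G g z ->
  (fun x => RI 0 (2 * pi) (fun t => F t * poisson (g x) t)) @ G -->
     RI 0 (2 * pi) (fun t => F t * poisson z t).
Proof.
move=> cF zD gD gz; have [M [M0 hM]] := cont_bounded (2 * pi) cF.
apply/cvgrPdist_lt => e e0.
have z1 : 0 < 1 - cabs z by rewrite subr_gt0.
pose K := M * (4 / (1 - cabs z) ^+ 2) * (2 * pi).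
have K0 : 0 < K by rewrite !mulr_gt0 ?invr_gt0 ?exprn_gt0// ?pi_gt0.
move/ccvg_lt : gz => H.
have d0 : 0 < Num.min ((1 - cabs z) / 2) (e / (2 * K)) by rewrite lt_min !divr_gt0// mulr_gt0.
have := H _ d0; apply: filterS2 gD => x xD; rewrite lt_min => /andP[h1 h2].
rewrite -RIB; [|exact: poisson_rint|exact: poisson_rint].
have h3 : (1 - cabs z) / 2 <= 1 - cabs (g x).
  by have := ler_cabs_dist (g x) z; lra.
apply: (@le_lt_trans _ _ (M * (4 * cabs (g x - z) / (1 - cabs z) ^+ 2) * (2 * pi - 0))).
  apply: RI_bound; first exact/ltW/pi2_gt0.
    by apply: rintB; exact: poisson_rint.
  move=> t ht; rewrite -mulrBr normrM; apply: ler_pM => //; first exact: hM.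
  apply: le_trans (poisson_diff t zD xD) _; rewrite [cabs (z - _)]cabsB.
  have -> : 4 * cabs (g x - z) / (1 - cabs z) ^+ 2 =
     (2 * cabs (g x - z)) / ((1 - cabs z) * ((1 - cabs z) / 2)).
    by field; rewrite gt_eqF.
  rewrite ler_wpM2l ?mulr_ge0 ?cabs_ge0// lef_pV2 ?posrE ?mulr_gt0 ?divr_gt0 ?cabs_gt0 ?expi_sub_neq0//.
  have A := ler_cabs_dist (expi t) z; have B := ler_cabs_dist (expi t) (g x).
  rewrite cabs_expi in A B.
  by apply: ler_pM; rewrite ?divr_ge0 ?(ltW z1)//; lra.
have -> : M * (4 * cabs (g x - z) / (1 - cabs z) ^+ 2) * (2 * pi - 0) = K * cabs (g x - z).
  by rewrite /K; field; rewrite gt_eqF.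
rewrite mulrC -ltr_pdivlMr//; apply: lt_le_trans h2 _.
rewrite invfM mulrCA ler_piMl ?divr_ge0 ?(ltW e0) ?(ltW K0)//; lra.
Qed.

(** Uniform continuity for the distance on the circle rather than between parameters, so that it
    also compares parameters near 0 with parameters near [2 pi]. *)
Definition ucirc (F : R -> R) := forall e : R, 0 < e -> exists2 d : R, 0 < d &
  forall s t, 0 <= s <= 2 * pi -> 0 <= t <= 2 * pi -> cabs (expi s - expi t : C) < d ->
  `|F s - F t| < e.

(** Close to [expi s] the oscillation of [F] is small; elsewhere the kernel is small because
    [1 - cabs z] is. *)
Lemma approx_id (F : R -> R) : continuous F -> ucirc F ->
  forall e : R, 0 < e -> exists2 d : R, 0 < d & forall z s, inD z -> 0 <= s <= 2 * pi ->
  cabs (z - expi s) < d ->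
  `|RI 0 (2 * pi) (fun t => F t * poisson z t) - 2 * pi * F s| <= e.
Proof.
move=> cF uF e e0.
have p0 := @pi2_gt0 R.
have [M [M0 hM]] := cont_bounded (2 * pi) cF.
pose e1 := e / (4 * pi).
have pi0 := pi_gt0 R.
have e10 : 0 < e1 by rewrite divr_gt0// mulr_gt0.
have [d1 d10 H1] := uF _ e10.
(* Away from [expi s] the kernel is at most [8 d2 / d1^2] and [F t - F s] at most [2 M]; their
   product is then [e1]. *)
pose d2 := e1 * d1 ^+ 2 / (16 * M).
have d20 : 0 < d2 by rewrite /d2 divr_gt0// mulr_gt0// exprn_gt0.
exists (Num.min (d1 / 2) d2); first by rewrite lt_min divr_gt0.
move=> z s zD hs; rewrite lt_min => /andP[hz1 hz2].
have cP := poisson_continuous zD.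
rewrite [2 * pi * F s]mulrC.
rewrite -[X in F s * X](mean_poisson zD) -RIZ; last exact: contT_rint.
rewrite -RIB; [|exact: poisson_rint|by apply: rintZ; exact: contT_rint].
have bnd t : 0 <= t <= 2 * pi ->
   `|F t * poisson z t - F s * poisson z t| <= e1 * poisson z t + e1.
  move=> ht; rewrite -mulrBl normrM (ger0_norm (ltW (poisson_gt0 t zD))).
  case: (ltP (cabs (expi t - expi s : C)) d1) => hd.
    apply: (@le_trans _ _ (e1 * poisson z t)); last by rewrite lerDl ltW.
    by rewrite ler_wpM2r ?(ltW (poisson_gt0 _ _))// ltW// H1.
  apply: (@le_trans _ _ e1); last by rewrite lerDr mulr_ge0 ?(ltW e10)// ltW// poisson_gt0.
  have hzt : d1 / 2 <= cabs (expi t - z).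
    by have := ler_cabs_distD (expi t) (expi s) z; lra.
  have zn := ler_cabs_dist (expi s) z; rewrite cabs_expi cabsB in zn.
  have hP : poisson z t <= 8 * d2 / d1 ^+ 2.
    rewrite /poisson; apply: (@le_trans _ _ ((2 * d2) / (d1 / 2) ^+ 2)); last first.
      by rewrite le_eqVlt; apply/orP; left; apply/eqP; field; rewrite gt_eqF.
    apply: ler_pM.
    - by rewrite subr_ge0 expr_le1 ?cabs_ge0// ltW.
    - by rewrite invr_ge0 exprn_ge0// cabs_ge0.
    - have -> : 1 - cabs z ^+ 2 = (1 - cabs z) * (1 + cabs z) by ring.
      rewrite [leRHS]mulrC; apply: ler_pM; rewrite ?subr_ge0 ?(ltW zD)//.
      + by rewrite addr_ge0// cabs_ge0.
      + by lra.
      + by have := zD; rewrite /inD; lra.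
    - rewrite lef_pV2 ?posrE ?exprn_gt0 ?divr_gt0//.
        by rewrite ler_pXn2r// nnegrE ?cabs_ge0// ltW// divr_gt0.
      by rewrite cabs_gt0 expi_sub_neq0.
  have hF : `|F t - F s| <= 2 * M.
    by apply: le_trans (ler_normB _ _) _; have := hM t ht; have := hM s hs; lra.
  apply: le_trans (ler_pM _ _ hF hP) _ => //; first exact/ltW/poisson_gt0.
  by rewrite le_eqVlt; apply/orP; left; apply/eqP; rewrite /d2; field; rewrite !gt_eqF.
have int1 : rint 0 (2 * pi) (fun t => F t * poisson z t - F s * poisson z t).
  by apply: rintB; [exact: poisson_rint|apply: rintZ; exact: contT_rint].
apply: le_trans (le_normr_Rintegral _ int1) _ => //.
apply: (@le_trans _ _ (RI 0 (2 * pi) (fun t => e1 * poisson z t + e1))).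
  apply: le_RI => //.
    by have := integrable_abse int1; apply: eq_integrable.
  by apply: rintD; [apply: rintZ; exact: contT_rint|exact: rint_cst].
rewrite RID; [|by apply: rintZ; exact: contT_rint|exact: rint_cst].
rewrite RIZ; last exact: contT_rint.
rewrite mean_poisson// RI_2pi le_eqVlt; apply/orP; left; apply/eqP.
have E (p x : R) : 0 < p -> x / (4 * p) * (2 * p) + 2 * p * (x / (4 * p)) = x.
  by move=> hp; field; rewrite gt_eqF.
exact: E.
Qed.

Lemma ucirc_holo (f : C -> C) r : holo_on_D f -> 0 <= r < 1 ->
  ucirc (fun t => Re (f (zpol r t))).
Proof.
move=> hf /andP[r0 r1] e e0.
have [|d d0 H] := @unif_circle f r _ e e0.
  by move=> t; apply: holo_cont => //; rewrite /inD cabs_zpol ger0_norm.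
exists d => // s t hs ht hd; rewrite -creB.
apply: le_lt_trans (cabs_Re _) _; apply: H => //.
rewrite /zpol -mulrBr cabsM cabs_rC ger0_norm//.
by apply: le_lt_trans hd; rewrite ler_piMl ?cabs_ge0// ltW.
Qed.

(** No change of variables is made. Both the Poisson extension [U] and [f] have the mean value
    property after composition with the automorphism sending 0 to [a]. On the image of a circle of
    radius [r] close to 1 they differ by little, by [approx_id]; equating means gives the formula at
    [a]. *)
Theorem poisson_formula (f : C -> C) rho a : holo_on_D f -> 0 <= rho < 1 -> inD a ->
  RI 0 (2 * pi) (fun t => Re (f (zpol rho t)) * poisson a t) = 2 * pi * Re (f (rC rho * a)).
Proof.
move=> hf rho1 aD; have /andP[rho0 rho1'] := rho1.
have p0 := @pi2_gt0 R.
have nrho : `|rho| < 1 by rewrite ger0_norm.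
(* Adding a constant makes the boundary values nonnegative, as Tonelli's theorem requires. *)
wlog fpos : f hf / forall t, 0 <= Re (f (zpol rho t)).
  move=> W.
  have cF := circ_contRe hf nrho.
  have [K [K0 hM]] := cont_bounded (2 * pi) cF.
  have hK t : 0 <= Re (f (zpol rho t)) + K.
    have [s hs e] : exists2 s : R, 0 <= s < 2 * pi & expi t = expi s :> C.
      by apply: onT_expi; rewrite /onT cabs_expi.
    have : `|Re (f (zpol rho s))| <= K by apply: hM; case/andP: hs => -> /ltW ->.
    by rewrite /zpol e ler_norml; lra.
  have hfK : holo_on_D (fun z => f z + rC K) by apply: holoD => //; exact: holo_cst.
  have hK' t : 0 <= Re (f (zpol rho t) + rC K) by rewrite creD.
  have := W _ hfK hK'; rewrite creD /=.
  rewrite (eq_RI (g := fun t => Re (f (zpol rho t)) * poisson a t + K * poisson a t)); last first.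
    by move=> t _; rewrite creD mulrDl.
  rewrite RID; [|exact: poisson_rint|by apply: rintZ; apply: contT_rint; exact: poisson_continuous].
  rewrite RIZ; last by apply: contT_rint; exact: poisson_continuous.
  by rewrite mean_poisson// => h; lra.
pose F t := Re (f (zpol rho t)).
have cF : continuous F := circ_contRe hf nrho.
have uF : ucirc F := ucirc_holo hf rho1.
pose U z := RI 0 (2 * pi) (fun t => F t * poisson z t).
apply/eqP; rewrite -subr_eq0; apply/eqP/cauchy_ne_0 => e e0.
pose e1 := e / (8 * pi).
have pi0 := pi_gt0 R.
have e10 : 0 < e1 by rewrite divr_gt0// mulr_gt0.
have e20 : 0 < 2 * pi * e1 by rewrite mulr_gt0.
have [d1 d10 H1] := approx_id cF uF e20.
have cfr t : ccont f (zpol rho t) by apply: holo_cont => //; rewrite /inD cabs_zpol.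
have [d2 d20 H2] := unif_circle cfr e10.
pose K := 2 / (1 - cabs a) ^+ 2.
have K0 : 0 < K by rewrite divr_gt0// exprn_gt0// subr_gt0.
(* The automorphism is Lipschitz with constant [K], so the image of the circle of radius [r] lies
   within [(1 - r) K] of the unit circle; [r] brings this below both thresholds. *)
have [r [r0 r1 hr1 hr2]] : exists r : R, [/\ 0 <= r, r < 1, (1 - r) * K < d1 & (1 - r) * K < d2].
  pose m := Num.min (1 / 2) (Num.min (d1 / 2 / K) (d2 / 2 / K)).
  have m0 : 0 < m.
    by rewrite /m !lt_min; apply/and3P; split; repeat apply: divr_gt0 => //.
  exists (1 - m); have m1 : m <= 1 / 2 by rewrite ge_min lexx.
  have m2 : m * K <= d1 / 2 by rewrite -ler_pdivlMr// !ge_min lexx orbT.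
  have m3 : m * K <= d2 / 2 by rewrite -ler_pdivlMr// !ge_min lexx !orbT.
  by split; lra.
have rr : 0 <= r < 1 by rewrite r0.
have nr : `|r| < 1 by rewrite ger0_norm.
pose T s := mobius a (zpol r s).
have zrD s : inD (zpol r s) by rewrite /inD cabs_zpol ger0_norm.
have TD s : inD (T s) by exact: mobius_inD.
have near s : exists2 th : R, 0 <= th <= 2 * pi & cabs (T s - expi th) <= (1 - r) * K.
  have [th hth e'] : exists2 th : R, 0 <= th < 2 * pi & mobius a (zpol 1 s) = expi th.
    by apply: onT_expi; apply: mobius_onT => //; rewrite /onT cabs_zpol normr1.
  exists th; first by case/andP: hth => -> /ltW.
  rewrite -e'; apply: le_trans (mobius_lip aD _ _) _.
  - by rewrite cabs_zpol ltW.
  - by rewrite cabs_zpol normr1.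
  - by rewrite /zpol -mulrBl cabsM cabs_expi mulr1 -rCB cabs_rC distrC ger0_norm ?lexx// subr_ge0 ltW.
have close s : `|U (T s) - 2 * pi * Re (f (rC rho * T s))| <= 4 * pi * e1.
  have [th hth ht] := near s.
  have A := H1 (T s) th (TD s) hth (le_lt_trans ht hr1).
  have B : cabs (f (rC rho * T s) - f (zpol rho th)) < e1.
    apply: H2 => //; rewrite /zpol -mulrBr cabsM cabs_rC ger0_norm//.
    apply: le_lt_trans (le_lt_trans ht hr2).
    by rewrite ler_piMl ?cabs_ge0// ltW.
  have B' : `|Re (f (zpol rho th)) - Re (f (rC rho * T s))| <= e1.
    by rewrite distrC -creB; apply: le_trans (cabs_Re _) (ltW B).
  have -> : U (T s) - 2 * pi * Re (f (rC rho * T s)) =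
    (U (T s) - 2 * pi * F th) + 2 * pi * (F th - Re (f (rC rho * T s))) by ring.
  apply: le_trans (ler_normD _ _) _.
  have : `|2 * pi * (F th - Re (f (rC rho * T s)))| <= 2 * pi * e1.
    by rewrite normrM (gtr0_norm p0) ler_wpM2l// ltW.
  by move: A; rewrite -/(U _); lra.
have hfT : holo_on_D (fun z => f (rC rho * mobius a z)).
  have hm : holo_on_D (fun z => rC rho * mobius a z).
    by apply: holoM; [exact: holo_cst|exact: holo_mobius].
  apply: (holo_comp hm) hf => z zD; rewrite /inD cabsM cabs_rC ger0_norm//.
  by apply: le_lt_trans rho1'; rewrite ler_piMr// ltW// mobius_inD.
have M1 := mean_value hfT rr; rewrite mobius0 in M1.
have cT s : ccvg (nbhs s) T (T s) by exact: (circ_ccvg (f := mobius a) s (holo_mobius aD) nr).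

have cUT : continuous (fun s => U (T s)).
  by move=> s; apply: (poisson_int_ccvg (g := T)) (cT s) => //; exact: nearW.
(* Exchanging integrals reduces the mean of [U] to that of a single kernel, and a kernel composed
   with the automorphism is again the real part of a holomorphic function. *)
have M2 : RI 0 (2 * pi) (fun s => U (T s)) = 2 * pi * U a.
  have [Mf [Mf0 hMf]] := cont_bounded (2 * pi) cF.
  have [c _ hc] : exists2 c, c \in `[0, 2 * pi]%R &
      forall t, t \in `[0, 2 * pi]%R -> cabs (T t) <= cabs (T c).
    apply: (EVT_max (f := fun t => cabs (T t))); first exact: ltW.
    by apply: continuous_subspaceT => s; apply: ccvg_cabs; exact: cT.
  rewrite /U (@RI_swap _ (fun s t => F t * poisson (T s) t) _ _ _ _
    (Mf * ((1 + cabs (T c)) / (1 - cabs (T c))))).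
  - rewrite -RIZ; last exact: poisson_rint.
    apply: eq_RI => t _.
    rewrite RIZ; last first.
      by apply: contT_rint => s; apply: (poisson_ccvg (g := T) (h := fun=> t)) => //; [exact: cT|exact: cvg_cst].
    have hh := holo_comp (holo_mobius aD) (fun z zD => mobius_inD aD zD) (holo_herglotz t).
    have := mean_value hh rr; rewrite mobius0 -poissonE// => E.
    rewrite [RHS]mulrCA -E; congr (_ * _).
    by apply: eq_RI => s _; rewrite poissonE.
  - apply: measurable_funM.
      by apply: measurableT_comp => //; exact: continuous_measurable_fun.
    have mT : measurable_fun setT (fun s => Re (T s)).
      by apply: continuous_measurable_fun => s; apply: ccvg_Re; exact: cT.
    have mT' : measurable_fun setT (fun s => Im (T s)).
      by apply: continuous_measurable_fun => s; apply: ccvg_Im; exact: cT.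
    apply: (@measurable_poissonC R _ (GR * GR)%type (fun p => T p.1) snd) => //.
    + exact: (measurableT_comp mT).
    + exact: (measurableT_comp mT').
  - by move=> s t; rewrite mulr_ge0 ?fpos// ltW// poisson_gt0.
  - move=> s t hs ht; apply: ler_pM; rewrite ?fpos//; first exact/ltW/poisson_gt0.
      by have := hMf t ht; apply: le_trans; exact: ler_norm.
    apply: le_trans (poisson_le t (TD s)) _.
    have le := hc s; rewrite in_itv /= in le; have {}le := le hs.
    have c1 := TD c; rewrite /inD in c1.
    apply: ler_pM; rewrite ?addr_ge0 ?cabs_ge0 ?invr_ge0 ?subr_ge0 ?(ltW (TD s))//.
      by rewrite lerD2l.
    by rewrite lef_pV2 ?posrE ?subr_gt0//; [lra|exact: TD].
have E : 2 * pi * (U a - 2 * pi * Re (f (rC rho * a))) =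
    RI 0 (2 * pi) (fun s => U (T s) - 2 * pi * Re (f (rC rho * T s))).
  have cfT := circ_contRe hfT nr.
  rewrite RIB; [|exact: contT_rint|by apply: rintZ; exact: contT_rint].
  by rewrite RIZ ?M2 ?M1; [ring|exact: contT_rint].
have : `|2 * pi * (U a - 2 * pi * Re (f (rC rho * a)))| <= (4 * pi * e1) * (2 * pi - 0).
  rewrite E; apply: RI_bound => //; first exact: ltW.
  apply: rintB; first exact: contT_rint.
  by apply: rintZ; apply: contT_rint; exact: (circ_contRe hfT nr).
rewrite subr0 normrM (gtr0_norm p0) [leRHS]mulrC ler_pM2l// => h.
apply: le_trans h _.
have E' (p x : R) : 0 < p -> 4 * p * (x / (8 * p)) = x / 2.
  by move=> hp; field; rewrite gt_eqF.
rewrite /e1 E'//.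
by lra.
Qed.
End PoissonFormula.

(** * Harnack bounds and other consequences of the Poisson formula *)

Section Harnack.
Variable R : realType.
Local Notation C := R[i].
Local Notation Re := complex.Re.
Local Notation Im := complex.Im.
Implicit Types (z w a : C) (s t : R).

Lemma inD0 : inD (0 : C). Proof. by rewrite /inD cabs0. Qed.
Hint Resolve inD0 : core.

Lemma inD_rCM (r : R) z : 0 <= r <= 1 -> inD z -> inD (rC r * z).
Proof.
move=> /andP[r0 r1] zD; rewrite /inD cabsM cabs_rC ger0_norm//.
by apply: le_lt_trans zD; rewrite ler_piMl// cabs_ge0.
Qed.

Lemma rad_ccvg (f : C -> C) z : holo_on_D f -> inD z ->
  ccvg ((1 : R)^'-) (fun r => f (rC r * z)) (f z).
Proof.
move=> hf zD; apply: (ccvg_comp (a := z)); last exact: holo_cont.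
rewrite -[X in ccvg _ _ X]mul1r -rC1; apply: ccvgM; last exact: ccvg_cst.
by apply: ccvg_rC; exact: cvg_at_left_filter.
Qed.

Lemma near1_01 : \forall r \near (1 : R)^'-, 0 <= r < 1.
Proof.
near=> r; apply/andP; split.
  by apply: ltW; near: r; exact: nbhs_left_gt.
by near: r; exact: nbhs_left_lt.
Unshelve. all: by end_near. Qed.

Lemma cvg_le_near (F : set_system R) {FF : ProperFilter F} (f g : R -> R) (a b : R) :
  f @ F --> a -> g @ F --> b -> (\forall x \near F, f x <= g x) -> a <= b.
Proof. by move=> fa gb h; apply: (ler_cvg_to fa gb). Qed.

Section Positive.
Variable f : C -> C.
Hypothesis hf : holo_on_D f.

(** Minimum principle: the kernel is positive with total mass [2 pi], so a lower bound on circles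
    close to the boundary passes inside. *)
Lemma poisson_ge_lim z (k : R) : inD z ->
  (\forall r \near (1 : R)^'-, forall t, k <= Re (f (zpol r t))) -> k <= Re (f z).
Proof.
move=> zD h; apply: (@cvg_le_near (1 : R)^'- _ (fun=> k) (fun r => Re (f (rC r * z)))).
- exact: cvg_cst.
- by apply: ccvg_Re; exact: rad_ccvg.
apply: filterS2 near1_01 h => r r01 hr.
have /andP[r0 r1] := r01; have nr : `|r| < 1 by rewrite ger0_norm.
have := poisson_formula hf r01 zD => E.
have p0 := @pi2_gt0 R.
rewrite -(ler_pM2l p0) -E [leLHS]mulrC -[X in k * X](mean_poisson zD) -RIZ; last first.
  by apply: contT_rint; exact: poisson_continuous.
apply: le_RI.
- by apply: rintZ; apply: contT_rint; exact: poisson_continuous.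
- by apply: poisson_rint => //; exact: circ_contRe.
- by move=> t _; rewrite ler_wpM2r// ltW// poisson_gt0.
Qed.

Hypothesis f0 : forall z, inD z -> 0 <= Re (f z).

Let zpD (r t : R) : 0 <= r < 1 -> inD (zpol r t).
Proof. by move=> /andP[r0 r1]; rewrite /inD cabs_zpol ger0_norm. Qed.

Let harn z (k k' : R) : inD z -> (forall t, k <= poisson z t <= k') ->
  k * Re (f 0) <= Re (f z) <= k' * Re (f 0).
Proof.
move=> zD hk; have p0 := @pi2_gt0 R.
have key r : 0 <= r < 1 -> k * Re (f 0) <= Re (f (rC r * z)) <= k' * Re (f 0).
  move=> r01; have /andP[r0 r1] := r01; have nr : `|r| < 1 by rewrite ger0_norm.
  have cF := circ_contRe hf nr.
  have E := poisson_formula hf r01 zD.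
  have E0 := mean_value hf r01.
  apply/andP; split.
    rewrite -(ler_pM2l p0) -E mulrCA -E0 -RIZ; last exact: contT_rint.
    apply: le_RI; [by apply: rintZ; exact: contT_rint|exact: poisson_rint|].
    move=> t _; rewrite [k * _]mulrC; apply: ler_wpM2l; first exact/f0/zpD.
    by case/andP: (hk t).
  rewrite -(ler_pM2l p0) -E mulrCA -E0 -RIZ; last exact: contT_rint.
  apply: le_RI; [exact: poisson_rint|by apply: rintZ; exact: contT_rint|].
  move=> t _; rewrite [leRHS]mulrC; apply: ler_wpM2l; first exact/f0/zpD.
  by case/andP: (hk t).
have cv : (fun r => Re (f (rC r * z))) @ (1 : R)^'- --> Re (f z).
  by apply: ccvg_Re; exact: rad_ccvg.
apply/andP; split.
  apply: (@cvg_le_near (1 : R)^'- _ _ _ _ _ (cvg_cst _) cv).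
  by apply: filterS near1_01 => r /key /andP[].
apply: (@cvg_le_near (1 : R)^'- _ _ _ _ _ cv (cvg_cst _)).
by apply: filterS near1_01 => r /key /andP[].
Qed.

Lemma harnack z : inD z ->
  (1 - cabs z) / (1 + cabs z) * Re (f 0) <= Re (f z) <= (1 + cabs z) / (1 - cabs z) * Re (f 0).
Proof. by move=> zD; apply: harn => // t; rewrite poisson_ge// poisson_le. Qed.

(** The two Harnack inequalities link both values to the value at the origin. *)
Lemma positive_or_zero z : inD z -> Re (f z) = 0 -> forall w, inD w -> Re (f w) = 0.
Proof.
move=> zD e w wD; have /andP[h1 _] := harnack zD; have /andP[_ h2] := harnack wD.
have k0 : 0 < (1 - cabs z) / (1 + cabs z).
  by rewrite divr_gt0 ?subr_gt0// ltr_wpDr// cabs_ge0.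
have e0 : Re (f 0) = 0.
  apply/eqP; rewrite eq_le f0// andbT.
  by move: h1; rewrite e pmulr_rle0.
apply/eqP; rewrite eq_le f0// andbT.
by move: h2; rewrite e0 mulr0.
Qed.
End Positive.

(** Harnack's lower bound for [1 - c g], with the rotation [c] making [c g z] real and nonnegative.
    The constant is weaker than in Schwarz's lemma, but it keeps [g z] away from modulus 1. *)
Lemma schwarz_weak (g : C -> C) z : holo_on_D g -> (forall w, inD w -> cabs (g w) <= 1) ->
  g 0 = 0 -> inD z -> cabs (g z) <= 2 * cabs z / (1 + cabs z).
Proof.
move=> hg g1 g0 zD; have [c c1 e] := exists_rotation (g z).
have hh : holo_on_D (fun w => 1 - c * g w).
  by apply: holoB; [exact: holo_cst|apply: holoM => //; exact: holo_cst].
have pos w : inD w -> 0 <= Re (1 - c * g w).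
  move=> wD; rewrite creB subr_ge0 /=; apply: le_trans (ler_Re_cabs _) _.
  by rewrite cabsM c1 mul1r g1.
have /andP[+ _] := harnack hh pos zD.
rewrite g0 mulr0 subr0 /= mulr1 creB e /=.
have n0 : 0 < 1 + cabs z by rewrite ltr_wpDr// cabs_ge0.
rewrite !(ler_pdivrMr,ler_pdivlMr)//; lra.
Qed.

(** The quotient [G] of [g - g 0] by [g] plus the conjugate of [g 0] maps the half-plane into the
    disc and vanishes at 0, so the weak Schwarz bound applies; solving for [g] gives the estimate. A
    small added constant reduces to strictly positive real part. *)
Lemma borel_caratheodory (f : C -> C) z : holo_on_D f ->
  (forall w, inD w -> 0 <= Re (f w)) -> inD z ->
  cabs (f z - Complex 0 (Im (f 0))) <= 4 * Re (f 0) / (1 - cabs z).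
Proof.
move=> hf f0 zD; have z1 : 0 < 1 - cabs z by rewrite subr_gt0.
have n0 : 0 < 1 + cabs z by rewrite ltr_wpDr// cabs_ge0.
suff key (g : C -> C) : holo_on_D g -> (forall w, inD w -> 0 < Re (g w)) ->
   cabs (g z - Complex 0 (Im (g 0))) <= 4 * Re (g 0) / (1 - cabs z).
  apply/ler_addgt0Pl => e e0.
  pose e1 := e / (1 + 4 / (1 - cabs z)).
  have k0 : 0 < 1 + 4 / (1 - cabs z) by rewrite ltr_wpDr// divr_ge0// ltW.
  have e10 : 0 < e1 by rewrite divr_gt0.
  have hg : holo_on_D (fun w => f w + rC e1) by apply: holoD => //; exact: holo_cst.
  have := key _ hg; rewrite !creD !cimD /= addr0 => /(_ _)/wrap[].
    by move=> w wD; rewrite creD /= ltr_wpDl// f0.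
  set a := f z; set b := Complex _ _ => h.
  have : cabs (a - b) <= cabs (a + rC e1 - b) + e1.
    have -> : a - b = (a + rC e1 - b) - rC e1 by ring.
    by apply: le_trans (ler_cabsB _ _) _; rewrite cabs_rC gtr0_norm.
  have : e1 * (1 + 4 / (1 - cabs z)) = e by rewrite /e1 divfK// gt_eqF.
  have : 4 * (Re (f 0) + e1) / (1 - cabs z) = 4 * Re (f 0) / (1 - cabs z) + 4 / (1 - cabs z) * e1.
    by field; rewrite gt_eqF.
  lra.
move=> hg g0.
pose a := Re (g 0); pose b := conjc (g 0).
have a0 : 0 < a by exact: g0.
have rb : Re b = a by rewrite /b /a; case: (g 0).
have den w : inD w -> g w + b != 0.
  move=> wD; apply/eqP => e; have : Re (g w + b) = 0 by rewrite e.
  by rewrite creD rb; have := g0 w wD; lra.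
pose G w := (g w - g 0) / (g w + b).
have hG : holo_on_D G.
  apply: holoM; first by apply: holoB => //; exact: holo_cst.
  by apply: holoV => //; apply: holoD => //; exact: holo_cst.
have G1 w : inD w -> cabs (G w) <= 1.
  move=> wD; rewrite cabsf_div ler_pdivrMr ?cabs_gt0 ?den// mul1r.
  rewrite -(@ler_pXn2r _ 2)// ?nnegrE ?cabs_ge0// !sqr_cabs.
  rewrite !(creB,cimB,creD,cimD).
  have -> : Re b = Re (g 0) by rewrite /b; case: (g 0).
  have -> : Im b = - Im (g 0) by rewrite /b; case: (g 0).
  have := g0 w wD; have := g0 0 inD0; nra.
have Gz := schwarz_weak hG G1 _ zD; have {}Gz : cabs (G z) <= 2 * cabs z / (1 + cabs z).
  by apply: Gz; rewrite /G subrr mul0r.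
have G1' : (1 - cabs z) / (1 + cabs z) <= 1 - cabs (G z).
  have : 2 * cabs z / (1 + cabs z) + (1 - cabs z) / (1 + cabs z) = 1.
    by field; rewrite gt_eqF.
  by move: Gz; lra.
have q0 : 0 < (1 - cabs z) / (1 + cabs z) by rewrite divr_gt0.
have Gn : 0 < cabs (1 - G z).
  by have := ler_cabs_dist 1 (G z); rewrite cabs1; lra.
have e : g z - Complex 0 (Im (g 0)) = rC a * (1 + G z) / (1 - G z).
  have dz := den z zD.
  have G0 : 1 - G z != 0 by rewrite -cabs_gt0.
  apply: (mulIf G0); rewrite divfK//.
  have E1 : g 0 = rC a + Complex 0 (Im (g 0)) by rewrite /a /rC; case: (g 0) => x y /=; congr Complex => /=; ring.
  have E2 : b = rC a - Complex 0 (Im (g 0)) by rewrite /a /b /rC; case: (g 0) => x y /=; congr Complex => /=; ring.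
  suff alg (x y A i0 bb : C) : y = A + i0 -> bb = A - i0 -> x + bb != 0 ->
      (x - i0) * (1 - (x - y) / (x + bb)) = A * (1 + (x - y) / (x + bb)).
    exact: (alg _ _ _ _ _ E1 E2 dz).
  by move=> -> -> h; field.
rewrite e cabsf_div cabsM cabs_rC gtr0_norm//.
rewrite ler_pdivrMr//.
have h1 : cabs (1 + G z) <= 2.
  by apply: le_trans (ler_cabsD _ _) _; rewrite cabs1; have := G1 z zD; lra.
have h2 : (1 - cabs z) / (1 + cabs z) <= cabs (1 - G z).
  by apply: le_trans G1' _; have := ler_cabs_dist 1 (G z); rewrite cabs1.
have h3 : 1 <= 2 * cabs (1 - G z) / (1 - cabs z).
  rewrite ler_pdivlMr// mul1r.
  move: h2; rewrite ler_pdivrMr// => h2; apply: le_trans h2 _.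
  by rewrite mulrC ler_wpM2r ?cabs_ge0//; move: zD; rewrite /inD; lra.
apply: (@le_trans _ _ (a * 2)); first by rewrite ler_wpM2l// ltW.
have -> : 4 * Re (g 0) / (1 - cabs z) * cabs (1 - G z) = a * 2 * (2 * cabs (1 - G z) / (1 - cabs z)).
  by rewrite /a; field; rewrite gt_eqF.
by rewrite ler_peMr// mulr_ge0// ltW.
Qed.

Section Representation.
Variables (f : C -> C) (rho : R).
Hypotheses (hf : holo_on_D f) (rho01 : 0 <= rho < 1).
Let F t := cabs (f (zpol rho t)).
Let nrho : `|rho| < 1. Proof. by case/andP: rho01 => h1 h2; rewrite ger0_norm. Qed.

Lemma circ_contcabs : continuous F.
Proof. by move=> t; apply: ccvg_cabs; exact: circ_ccvg. Qed.

Lemma cauchy_bound w : inD w ->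
  2 * pi * cabs (f (rC rho * w)) <= RI 0 (2 * pi) (fun t => F t * poisson w t).
Proof.
move=> wD; have [c c1 e] := exists_rotation (f (rC rho * w)).
have hc : holo_on_D (fun z => c * f z) by apply: holoM => //; exact: holo_cst.
rewrite -e -(poisson_formula hc)//; apply: le_RI.
- exact: (poisson_rint wD (circ_contRe hc nrho)).
- exact: (poisson_rint wD circ_contcabs).
- move=> t _; rewrite ler_wpM2r ?(ltW (poisson_gt0 _ _))//.
  by apply: le_trans (ler_Re_cabs _) _; rewrite cabsM c1 mul1r.
Qed.

Lemma cauchy_diff w w' : inD w -> inD w' ->
  2 * pi * cabs (f (rC rho * w) - f (rC rho * w')) <=
  RI 0 (2 * pi) (fun t => F t * `|poisson w t - poisson w' t|).
Proof.
move=> wD wD'; have [c c1 e] := exists_rotation (f (rC rho * w) - f (rC rho * w')).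
have hc : holo_on_D (fun z => c * f z) by apply: holoM => //; exact: holo_cst.
rewrite -e mulrBr creB mulrBr -!(poisson_formula hc)// -RIB.
- apply: le_RI.
  + by apply: rintB; apply: poisson_rint => //; exact: (circ_contRe hc nrho).
  + apply: contT_rint => t; apply: cvgM; first exact: circ_contcabs.
    by apply: cvg_norm; apply: cvgB; exact: poisson_continuous.
  + move=> t _; rewrite -mulrBr; apply: le_trans (ler_norm _) _; rewrite normrM.
    rewrite ler_wpM2r//; apply: le_trans (cabs_Re _) _.
    by rewrite cabsM c1 mul1r.
- exact: (poisson_rint wD (circ_contRe hc nrho)).
- exact: (poisson_rint wD' (circ_contRe hc nrho)).
Qed.

(** Obtained by integrating [(F - c)^2 >= 0] against the kernel, with [c] the Poisson mean of
    [F]. *)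
Lemma jensen_poisson w : inD w ->
  RI 0 (2 * pi) (fun t => F t * poisson w t) ^+ 2 <=
  2 * pi * RI 0 (2 * pi) (fun t => F t ^+ 2 * poisson w t).
Proof.
move=> wD; have p0 := @pi2_gt0 R.
set I := RI _ _ _; pose c := I / (2 * pi).
have cF := circ_contcabs.
have cF2 : continuous (fun t => F t ^+ 2) by move=> t; exact: (cvgM (cF t) (cF t)).
have cP := poisson_continuous wD.
have h : 2 * c * I <= RI 0 (2 * pi) (fun t => F t ^+ 2 * poisson w t) + c ^+ 2 * (2 * pi).
  rewrite -[X in _ + _ * X](mean_poisson wD) -!RIZ; [|exact: poisson_rint|exact: contT_rint].
  rewrite -RID; [|exact: poisson_rint|by apply: rintZ; exact: contT_rint].
  apply: le_RI.
  - by apply: rintZ; exact: poisson_rint.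
  - by apply: rintD; [exact: poisson_rint|apply: rintZ; exact: contT_rint].
  - move=> t _; rewrite mulrA -mulrDl ler_wpM2r ?(ltW (poisson_gt0 _ _))//.
    by rewrite -subr_ge0 (_ : _ - _ = (F t - c) ^+ 2) ?sqr_ge0//; ring.
move: h; have E (p x y : R) : 0 < p -> 2 * (x / p) * x <= y + (x / p) ^+ 2 * p -> x ^+ 2 <= p * y.
  move=> hp; have -> : 2 * (x / p) * x = 2 * x ^+ 2 / p by field; rewrite gt_eqF.
  have -> : (x / p) ^+ 2 * p = x ^+ 2 / p by field; rewrite gt_eqF.
  rewrite -lerBlDr -mulrBl ler_pdivrMr// [y * p]mulrC => h; apply: le_trans h; lra.
exact: E.
Qed.

Lemma sqr_bound w : inD w ->
  cabs (f (rC rho * w)) ^+ 2 <= (2 * pi)^-1 * RI 0 (2 * pi) (fun t => F t ^+ 2 * poisson w t).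
Proof.
move=> wD; have p0 := @pi2_gt0 R.
have h := le_trans (_ : _ <= _) (jensen_poisson wD).
rewrite -(@ler_pM2l _ ((2 * pi) ^+ 2)) ?exprn_gt0// -exprMn.
have -> : (2 * pi) ^+ 2 * ((2 * pi)^-1 * RI 0 (2 * pi) (fun t => F t ^+ 2 * poisson w t)) =
   2 * pi * RI 0 (2 * pi) (fun t => F t ^+ 2 * poisson w t).
  by rewrite mulrA expr2 mulfK// gt_eqF.
apply: h; rewrite ler_pXn2r//; [exact: cauchy_bound|rewrite nnegrE..].
  exact: (mulr_ge0 (ltW p0) (cabs_ge0 _)).
by apply: RI_ge0 => t _; rewrite mulr_ge0 ?cabs_ge0// ltW// poisson_gt0.
Qed.

(** A displacement that is small relative to the distance to the circle changes the kernel by a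
    small relative amount, uniformly in [t]. *)
Lemma poisson_close w w' (e : R) t : inD w -> 0 <= e <= 1 / 2 ->
  cabs (w - w') <= e * (1 - cabs w) ->
  inD w' /\ `|poisson w t - poisson w' t| <= 4 * e * poisson w t.
Proof.
move=> wD /andP[e0 e1] h; have w1 : 0 < 1 - cabs w by rewrite subr_gt0.
have h2 : cabs (w - w') <= (1 - cabs w) / 2.
  by apply: le_trans h _; rewrite mulrC ler_wpM2l// ?(ltW w1)//; lra.
have wD' : inD w'.
  by rewrite /inD; have := ler_cabs_dist w' w; rewrite cabsB; lra.
split=> //; apply: le_trans (poisson_diff t wD wD') _.
have A := ler_cabs_dist (expi t) w; rewrite cabs_expi in A.
have B := ler_cabs_distD (expi t) w w'.
have a0 : 0 < cabs (expi t - w) by lra.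
have b0 : cabs (expi t - w) / 2 <= cabs (expi t - w') by rewrite [cabs (w' - w)]cabsB in B; lra.
rewrite /poisson; set x := cabs (expi t - w) in a0 b0 A *.
have -> : 4 * e * ((1 - cabs w ^+ 2) / x ^+ 2) = (2 * (e * (1 - cabs w) * (1 + cabs w))) / (x * (x / 2)).
  by field; rewrite gt_eqF.
apply: ler_pM; rewrite ?mulr_ge0 ?cabs_ge0 ?invr_ge0 ?mulr_ge0 ?cabs_ge0 ?(ltW a0)//.
  rewrite ler_pM2l//; apply: le_trans h _.
  by rewrite ler_peMr ?mulr_ge0 ?(ltW w1)// lerDl cabs_ge0.
rewrite lef_pV2 ?posrE ?mulr_gt0 ?divr_gt0//; last by lra.
by rewrite ler_pM2l.
Qed.

(** Here closeness relative to [1 - cabs w] becomes a gain of [e^2] against the Poisson mean of the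
    squared modulus: the estimate that makes [f o phi - f o phi_j] small near a contact point. *)
Lemma sqr_diff w w' (e : R) : inD w -> 0 <= e <= 1 / 2 ->
  cabs (w - w') <= e * (1 - cabs w) ->
  cabs (f (rC rho * w) - f (rC rho * w')) ^+ 2 <=
  16 * e ^+ 2 * ((2 * pi)^-1 * RI 0 (2 * pi) (fun t => F t ^+ 2 * poisson w t)).
Proof.
move=> wD e01 h; have p0 := @pi2_gt0 R.
have wD' : inD w' by have [] := poisson_close 0 wD e01 h.
have /andP[e0 _] := e01.
have cF := circ_contcabs.
have A : 2 * pi * cabs (f (rC rho * w) - f (rC rho * w')) <=
   4 * e * RI 0 (2 * pi) (fun t => F t * poisson w t).
  apply: le_trans (cauchy_diff wD wD') _; rewrite -RIZ; last exact: poisson_rint.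
  apply: le_RI.
  - apply: contT_rint => t; apply: cvgM; first exact: circ_contcabs.
    by apply: cvg_norm; apply: cvgB; exact: poisson_continuous.
  - by apply: rintZ; exact: poisson_rint.
  - move=> t _; rewrite mulrCA ler_wpM2l ?cabs_ge0//.
    by have [] := poisson_close t wD e01 h.
have I0 : 0 <= RI 0 (2 * pi) (fun t => F t * poisson w t).
  by apply: RI_ge0 => t _; rewrite mulr_ge0 ?cabs_ge0// ltW// poisson_gt0.
rewrite -(@ler_pM2l _ ((2 * pi) ^+ 2)) ?exprn_gt0// -exprMn.
set J := RI 0 (2 * pi) (fun t => F t ^+ 2 * poisson w t).
have -> : (2 * pi) ^+ 2 * (16 * e ^+ 2 * ((2 * pi)^-1 * J)) = 16 * e ^+ 2 * (2 * pi * J).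
  have E (p : R) : 0 < p -> p ^+ 2 * (16 * e ^+ 2 * (p^-1 * J)) = 16 * e ^+ 2 * (p * J).
    by move=> hp; field; rewrite gt_eqF.
  exact: E.
apply: (@le_trans _ _ ((4 * e * RI 0 (2 * pi) (fun t => F t * poisson w t)) ^+ 2)).
  rewrite ler_pXn2r// nnegrE; first exact: (mulr_ge0 (ltW p0) (cabs_ge0 _)).
  by rewrite mulr_ge0// mulr_ge0.
rewrite exprMn (_ : (4 * e) ^+ 2 = 16 * e ^+ 2); last by ring.
by rewrite ler_wpM2l ?mulr_ge0 ?sqr_ge0//; exact: jensen_poisson.
Qed.
End Representation.
End Harnack.

Ltac nneg := repeat first [ assumption | exact: cabs_ge0 | exact: ltW | apply: exprn_ge0
  | apply: divr_ge0 | apply: mulr_ge0 | apply: addr_ge0 | by [] ].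

(** * Normal families *)

Section Montel.
Variable R : realType.
Local Notation C := R[i].
Local Notation Re := complex.Re.
Local Notation Im := complex.Im.
Implicit Types (z w a : C) (s t : R).

Lemma cabs_small_inD z s : cabs z <= s -> s < 1 -> inD z.
Proof. by move=> h1 h2; exact: le_lt_trans h2. Qed.

Lemma lip_inside (f : C -> C) rho B s w z : holo_on_D f -> 0 <= rho < 1 ->
  (forall t, cabs (f (zpol rho t)) <= B) -> s < 1 -> cabs w <= s -> cabs z <= s ->
  cabs (f (rC rho * w) - f (rC rho * z)) <= 2 * B / (1 - s) ^+ 2 * cabs (w - z).
Proof.
move=> hf r01 hB s1 ws zs; have p0 := @pi2_gt0 R.
have B0 : 0 <= B := le_trans (cabs_ge0 _) (hB 0).
have wD := cabs_small_inD ws s1; have zD := cabs_small_inD zs s1.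
rewrite -(ler_pM2l p0); apply: le_trans (cauchy_diff hf r01 wD zD) _.
rewrite -RI_2pi; apply: le_RI.
- apply: contT_rint => t; apply: cvgM; first exact: circ_contcabs.
  by apply: cvg_norm; apply: cvgB; exact: poisson_continuous.
- exact: rint_cst.
- move=> t _.
  have -> : 2 * B / (1 - s) ^+ 2 * cabs (w - z) = B * (2 * cabs (w - z) / ((1 - s) * (1 - s))).
    by field; rewrite gt_eqF// subr_gt0.
  apply: ler_pM; rewrite ?cabs_ge0//.
  apply: le_trans (poisson_diff t wD zD) _; rewrite ler_wpM2l ?mulr_ge0 ?cabs_ge0//.
  have s0 : 0 < 1 - s by rewrite subr_gt0.
  have A := ler_cabs_dist (expi t) w; have A' := ler_cabs_dist (expi t) z.
  rewrite cabs_expi in A A'.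
  rewrite lef_pV2 ?posrE ?mulr_gt0 ?cabs_gt0 ?expi_sub_neq0//.
  by apply: ler_pM; rewrite ?(ltW s0)//; lra.
Qed.

(** Taylor expansion of the kernel under the integral: [k] is the derivative of
    [(expi t + z) / (expi t - z)] in [z], and the remainder is an explicit fraction. The constant
    depends on [B] and [s] only, so it survives limits of functions. *)
Lemma real_second_order (f : C -> C) rho B s z : holo_on_D f -> 0 <= rho < 1 ->
  (forall t, cabs (f (zpol rho t)) <= B) -> s < 1 -> cabs z <= s ->
  exists d : C, forall w, cabs w <= s ->
   `|Re (f (rC rho * w)) - Re (f (rC rho * z)) - Re (d * (w - z))| <=
   2 * B / (1 - s) ^+ 3 * cabs (w - z) ^+ 2.
Proof.
move=> hf r01 hB s1 zs; have p0 := @pi2_gt0 R.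
have B0 : 0 <= B := le_trans (cabs_ge0 _) (hB 0).
have s0 : 0 < 1 - s by rewrite subr_gt0.
have zD := cabs_small_inD zs s1.
have nr : `|rho| < 1 by case/andP: r01 => h1 h2; rewrite ger0_norm.
pose F t := Re (f (zpol rho t)).
have cF : continuous F := circ_contRe hf nr.
pose k t : C := 2 * expi t / (expi t - z) ^+ 2.
have ck t : ccvg (nbhs t) k (k t).
  have ce : ccvg (nbhs t) (@expi R) (expi t) by apply: (ccvg_expi (g := id)); exact: cvg_id.
  apply: ccvgM; first by apply: ccvgM => //; exact: ccvg_cst.
  apply: ccvgV; first by rewrite expf_neq0// expi_sub_neq0.
  by apply: ccvgX; apply: ccvgB => //; exact: ccvg_cst.
have ckr : continuous (fun t => F t * Re (k t)).
  by move=> t; apply: cvgM; [exact: cF|exact: (ccvg_Re (ck t))].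
have cki : continuous (fun t => F t * Im (k t)).
  by move=> t; apply: cvgM; [exact: cF|exact: (ccvg_Im (ck t))].
exists (rC (2 * pi)^-1 * Complex (RI 0 (2 * pi) (fun t => F t * Re (k t)))
          (RI 0 (2 * pi) (fun t => F t * Im (k t)))) => w ws.
have wD := cabs_small_inD ws s1.
rewrite -(ler_pM2l p0) -{1}(gtr0_norm p0) -normrM.
rewrite -[_ * _ * (w - z)]mulrA Re_rCM creM /=.
have -> : 2 * pi * (Re (f (rC rho * w)) - Re (f (rC rho * z)) -
   (2 * pi)^-1 * (RI 0 (2 * pi) (fun t => F t * Re (k t)) * Re (w - z) -
    RI 0 (2 * pi) (fun t => F t * Im (k t)) * Im (w - z))) =
   RI 0 (2 * pi) (fun t => F t * poisson w t - F t * poisson z t -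
     (Re (w - z) * (F t * Re (k t)) - Im (w - z) * (F t * Im (k t)))).
  rewrite !RIB; try (repeat first [apply: rintB|apply: rintZ|exact: poisson_rint|exact: contT_rint]).
  rewrite !RIZ; [|exact: contT_rint|exact: contT_rint].
  rewrite !(poisson_formula hf)//.
  by rewrite !mulrBr mulVKf ?gt_eqF// mulVKf ?gt_eqF//; congr (_ - (_ - _)); rewrite mulrC.
have -> : 2 * pi * (2 * B / (1 - s) ^+ 3 * cabs (w - z) ^+ 2) = (2 * B / (1 - s) ^+ 3 * cabs (w - z) ^+ 2) * (2 * pi - 0).
  by rewrite subr0 mulrC.
apply: RI_bound; first exact: ltW.
  by repeat first [apply: rintB|apply: rintZ|exact: poisson_rint|exact: contT_rint].
move=> t _.
have z0 := expi_sub_neq0 t zD; have w0 := expi_sub_neq0 t wD.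
have -> : F t * poisson w t - F t * poisson z t -
     (Re (w - z) * (F t * Re (k t)) - Im (w - z) * (F t * Im (k t))) =
   F t * Re (2 * expi t * (w - z) ^+ 2 / ((expi t - w) * (expi t - z) ^+ 2)).
  have -> : 2 * expi t * (w - z) ^+ 2 / ((expi t - w) * (expi t - z) ^+ 2) =
     (expi t + w) / (expi t - w) - (expi t + z) / (expi t - z) - k t * (w - z).
    by rewrite /k; field; rewrite z0 w0.
  by rewrite [in RHS]creB [in RHS]creB -!poissonE// [in RHS]creM; ring.
rewrite normrM.
have -> : 2 * B / (1 - s) ^+ 3 * cabs (w - z) ^+ 2 =
   B * (2 * cabs (w - z) ^+ 2 / ((1 - s) * (1 - s) ^+ 2)) by field; rewrite gt_eqF.
apply: ler_pM => //; first by apply: le_trans (cabs_Re _) _.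
apply: le_trans (cabs_Re _) _.
rewrite cabsf_div [cabs (2 * expi t * _)]cabsM [cabs (2 * expi t)]cabsM [cabs ((expi t - w) * _)]cabsM !cabsX cabs_expi mulr1.
have -> : cabs (2 : C) = 2 by rewrite (_ : 2 = rC 2) ?cabs_rC ?ger0_norm// -[2]/(1 + 1) rCD.
rewrite ler_wpM2l ?mulr_ge0 ?exprn_ge0 ?cabs_ge0//.
have A := ler_cabs_dist (expi t) w; have A' := ler_cabs_dist (expi t) z.
rewrite cabs_expi in A A'.
have a0 : 0 < cabs (expi t - w) by rewrite cabs_gt0.
have a1 : 0 < cabs (expi t - z) by rewrite cabs_gt0.
rewrite lef_pV2 ?posrE; [|by rewrite mulr_gt0// exprn_gt0..].
apply: ler_pM; rewrite ?(ltW s0) ?exprn_ge0 ?(ltW s0)//; first by lra.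
by rewrite ler_pXn2r// ?nnegrE ?(ltW s0) ?(ltW a1)//; lra.
Qed.

(** Applying the real expansion to [f] and [- i f] gives a real-homogeneous first-order part [L].
    Comparison with the complex derivative [D] along rays through [z] shows [L] is multiplication by
    [D]; the Lipschitz bound then controls [D]. *)
Lemma second_order (f : C -> C) rho B s z : holo_on_D f -> 0 <= rho < 1 ->
  (forall t, cabs (f (zpol rho t)) <= B) -> s < 1 -> cabs z < s ->
  exists D : C, cabs D <= 2 * B / (1 - s) ^+ 2 /\ forall w, cabs w <= s ->
   cabs (f (rC rho * w) - f (rC rho * z) - D * (w - z)) <=
   4 * B / (1 - s) ^+ 3 * cabs (w - z) ^+ 2.
Proof.
move=> hf r01 hB s1 zs.
have [rho0 rho1] := andP r01.
have hg : holo_on_D (fun w => f (rC rho * w)).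
  apply: (@holo_comp _ (fun w => rC rho * w) f) => //.
    by apply: holoM; [exact: holo_cst|exact: holo_id].
  by move=> w; apply: inD_rCM; rewrite rho0 ltW.
have zD := cabs_small_inD (ltW zs) s1.
have /holoP /(_ z zD)[D [q [qD gq]]] := hg.
have [d1 h1] := real_second_order hf r01 hB s1 (ltW zs).
have hif : holo_on_D (fun w => Complex 0 (-1) * f w) by apply: holoM => //; exact: holo_cst.
have hiB t : cabs (Complex 0 (-1) * f (zpol rho t)) <= B.
  by rewrite cabsM (_ : cabs _ = 1) ?mul1r// /cabs /= expr0n add0r sqrrN expr1n sqrtr1.
have [d2 h2] := real_second_order hif r01 hiB s1 (ltW zs).
have reI x : Re (Complex 0 (-1) * x) = Im x by case: x => a b /=; ring.
pose L ze : C := Complex (Re (d1 * ze)) (Re (d2 * ze)).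
set K := 4 * B / (1 - s) ^+ 3.
have hL w : cabs w <= s -> cabs (f (rC rho * w) - f (rC rho * z) - L (w - z)) <= K * cabs (w - z) ^+ 2.
  move=> ws; apply: le_trans (cabs_le_ReIm _) _.
  rewrite !creB !cimB /= -!reI.
  have A := h1 w ws; have A' := h2 w ws.
  apply: le_trans (lerD A A') _.
  by rewrite le_eqVlt; apply/orP; left; apply/eqP; rewrite /K; field; rewrite gt_eqF// subr_gt0.
have K0 : 0 <= K.
  have B0 : 0 <= B := le_trans (cabs_ge0 _) (hB 0).
  by apply: divr_ge0; [exact: mulr_ge0|rewrite exprn_ge0// subr_ge0 ltW].
have Lhom (x : R) ze : L (rC x * ze) = rC x * L ze.
  apply: complex_ext; first by rewrite Re_rCM /= mulrCA Re_rCM.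
  by rewrite Im_rCM /= mulrCA Re_rCM.
have LD ze : L ze = D * ze.
  apply/eqP; rewrite -subr_eq0 -cabs_eq0; apply/eqP/cauchy_ne_0 => e e0.
  rewrite ger0_norm ?cabs_ge0//.
  have n0 : 0 < cabs ze + 1 by rewrite ltr_wpDl// cabs_ge0.
  have e1 : 0 < e / 2 / (cabs ze + 1) by rewrite !divr_gt0.
  move/ccvg_lt : qD => /(_ _ e1)[del del0 hq].
  have k0 : 0 < 2 * K * (cabs ze ^+ 2 + 1) + 1.
    by apply: ltr_wpDl => //; nneg.
  pose x := Num.min (Num.min (del / 2 / (cabs ze + 1)) ((s - cabs z) / (cabs ze + 1))) (e / (2 * K * (cabs ze ^+ 2 + 1) + 1)).
  have x0 : 0 < x.
    rewrite /x !lt_min; apply/andP; split; last exact: divr_gt0.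
    by apply/andP; split; apply: divr_gt0 => //; rewrite ?divr_gt0 ?subr_gt0.
  have x1 : x * (cabs ze + 1) <= del / 2 by rewrite -ler_pdivlMr// /x !ge_min lexx.
  have x2 : x * (cabs ze + 1) <= s - cabs z by rewrite -ler_pdivlMr// /x !ge_min lexx orbT.
  have x3 : x * (2 * K * (cabs ze ^+ 2 + 1) + 1) <= e by rewrite -ler_pdivlMr// /x !ge_min lexx orbT.
  pose w := z + rC x * ze.
  have wz : w - z = rC x * ze by rewrite /w; ring.
  have cwz : cabs (w - z) = x * cabs ze by rewrite wz cabsM cabs_rC gtr0_norm.
  have ws : cabs w <= s.
    apply: le_trans (ler_cabsD _ _) _; rewrite -wz cwz.
    by move: x2; rewrite mulrDr mulr1; lra.
  have A := hL w ws; rewrite cwz in A.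
  have A' : cabs (q w - D) < e / 2 / (cabs ze + 1).
    by apply: hq; rewrite cwz; move: x1; rewrite mulrDr mulr1; lra.
  have E : rC x * (L ze - D * ze) = - (f (rC rho * w) - f (rC rho * z) - L (w - z)) + (q w - D) * (w - z).
    by rewrite wz Lhom (gq w) wz; ring.
  have : x * cabs (L ze - D * ze) <= K * (x * cabs ze) ^+ 2 + e / 2 / (cabs ze + 1) * (x * cabs ze).
    rewrite -{1}(gtr0_norm x0) -cabs_rC -cabsM E.
    apply: le_trans (ler_cabsD _ _) _; rewrite cabsN cabsM cwz; apply: lerD => //.
    by apply: ler_wpM2r; [rewrite mulr_ge0 ?cabs_ge0// ltW|exact: ltW].
  have -> : K * (x * cabs ze) ^+ 2 + e / 2 / (cabs ze + 1) * (x * cabs ze) =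
     x * (x * (K * cabs ze ^+ 2) + e / 2 * (cabs ze / (cabs ze + 1))).
    by field; rewrite gt_eqF.
  rewrite ler_pM2l// => h; apply: le_trans h _.
  have : cabs ze / (cabs ze + 1) <= 1 by rewrite ler_pdivrMr// mul1r lerDl.
  move=> /(ler_wpM2l (_ : 0 <= e / 2)) -/(_ _)/wrap[]; first by rewrite divr_ge0// ltW.
  have : 0 <= x * K by rewrite mulr_ge0// ltW.
  have : x * K * (cabs ze ^+ 2) <= e / 2 by have := ltW x0; nra.
  rewrite mulr1 mulrA; lra.
exists D; split; last by move=> w ws; rewrite -LD; exact: hL.
apply/ler_addgt0Pr => e e0.
move/ccvg_lt : qD => /(_ _ e0)[del del0 hq].
pose x := Num.min (del / 2) (s - cabs z).
have x0 : 0 < x by rewrite lt_min divr_gt0 ?subr_gt0.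
have cw : cabs (z + rC x - z) = x by rewrite addrC addKr cabs_rC gtr0_norm.
have A : cabs (q (z + rC x) - D) < e.
  apply: hq; rewrite cw; apply: (@le_lt_trans _ _ (del / 2)); first by rewrite ge_min lexx.
  by lra.
have ws : cabs (z + rC x) <= s.
  apply: le_trans (ler_cabsD _ _) _; rewrite cabs_rC gtr0_norm//.
  have : x <= s - cabs z by rewrite ge_min lexx orbT.
  lra.
have := lip_inside hf r01 hB s1 ws (ltW zs).
rewrite (gq (z + rC x)) addrAC subrr add0r cabsM cw ler_pM2r// => A'.
have -> : D = q (z + rC x) - (q (z + rC x) - D) by ring.
by apply: le_trans (ler_cabsB _ _) _; apply: lerD => //; exact: ltW.
Qed.

(** A single ultrafilter gives limits at all points at once, where a sequence would need diagonal
    extraction over a dense set. *)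
Lemma ultra_lim (T : Type) (U : set_system T) (UU : UltraFilter U) (a : T -> R) (B : R) :
  (forall k, `|a k| <= B) -> exists l : R, a @ U --> l.
Proof.
move=> hB; have := @segment_compact R (- B) B; rewrite compact_ultra /=.
move=> H; have hU : U (a @^-1` `[- B, B]%classic).
  by apply: filterE => k; rewrite /= in_itv /= -ler_norml; exact: hB.
have UF : UltraFilter (a @ U).
  split; first exact: fmap_proper_filter.
  move=> G GF sG; rewrite predeqE => A; split; last exact: sG.
  move=> GA; have [//|nA] := in_ultra_setVsetC (a @^-1` A) UU.
  have GnA : G (~` A) by apply: sG.
  by have [x []] := filter_ex (filterI GA GnA).
by have [l [_ ?]] := H (a @ U) UF hU; exists l.
Qed.

Lemma ultra_lim_bounded_near (T : Type) (U : set_system T) (UU : UltraFilter U) (a : T -> C) (B : R) :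
  (forall k, cabs (a k) <= B) -> exists l, ccvg U a l.
Proof.
move=> hB.
have [x hx] := ultra_lim UU (a := fun k => Re (a k)) (B := B) (fun k => le_trans (cabs_Re _) (hB k)).
have [y hy] := ultra_lim UU (a := fun k => Im (a k)) (B := B) (fun k => le_trans (cabs_Im _) (hB k)).
by exists (Complex x y); apply/ccvgP.
Qed.

Lemma ccvg_cabs_le (T : Type) (U : set_system T) {UU : ProperFilter U} (a : T -> C) l B :
  ccvg U a l -> (\forall k \near U, cabs (a k) <= B) -> cabs l <= B.
Proof.
move=> /ccvg_lt al hB; apply/ler_addgt0Pr => e /al ae.
have [k [/= k1 k2]] := filter_ex (filterI ae hB).
by have := ler_cabs_dist l (a k); rewrite cabsB; lra.
Qed.

(** Pointwise limits are taken along an ultrafilter finer than [\oo]. Derivatives converge along it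
    too, and the uniform second-order remainder passes to the limit, so the limit is holomorphic;
    the subsequence is chosen only at the end. *)
Theorem montel (u : nat -> C -> C) (B : R -> R) : (forall k, holo_on_D (u k)) ->
  (forall rho, rho < 1 -> forall k z, cabs z <= rho -> cabs (u k z) <= B rho) ->
  exists2 v, holo_on_D v & exists2 sigma : nat -> nat,
    (forall k, (sigma k < sigma k.+1)%N) &
    forall rho, rho < 1 -> forall e : R, 0 < e -> exists K, forall k, (K <= k)%N ->
      forall z, cabs z <= rho -> cabs (u (sigma k) z - v z) <= e.
Proof.
move=> hu hB.
have [U [UU Uoo]] := @ultraFilterLemma nat \oo _.
have PU : ProperFilter U by exact: ultra_proper.
have ex z : exists l, inD z -> ccvg U (u^~ z) l.
  have [zD|nz] := pselect (inD z); last by exists 0.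
  by have [l hl] := ultra_lim_bounded_near UU (fun k => hB _ zD k z (lexx _)); exists l.
have [v hv] := choice ex.
have B0 rho : 0 <= rho -> rho < 1 -> 0 <= B rho.
  by move=> r0 r1; apply: le_trans (hB _ r1 0%N 0 _); rewrite ?cabs_ge0// cabs0.
have hBr rho : 0 <= rho -> rho < 1 -> forall k t, cabs (u k (zpol rho t)) <= B rho.
  by move=> r0 r1 k t; apply: hB => //; rewrite cabs_zpol ger0_norm.
have diff z w : inD z -> inD w -> ccvg U (fun k => u k w - u k z) (v w - v z).
  by move=> zD wD; apply: ccvgB; exact: hv.
have hhol : holo_on_D v.
  apply/holoP => z zD.
  pose rho := (1 + cabs z) / 2.
  have zr : cabs z < rho by rewrite /rho; move: zD; rewrite /inD; lra.
  have r1 : rho < 1 by rewrite /rho; move: zD; rewrite /inD; lra.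
  have r0 : 0 < rho by exact: le_lt_trans (cabs_ge0 z) zr.
  have r01 : 0 <= rho < 1 by rewrite (ltW r0).
  pose z' := rC rho^-1 * z.
  have cz' : cabs z' < 1 by rewrite cabsM cabs_rC ger0_norm ?invr_ge0 ?ltW// mulrC ltr_pdivrMr// mul1r.
  pose s := (1 + cabs z') / 2.
  have zs : cabs z' < s by rewrite /s; lra.
  have s1 : s < 1 by rewrite /s; lra.
  have rz w : rC rho * (rC rho^-1 * w) = w.
    by rewrite mulrA -rCM divff ?mul1r// gt_eqF.
  have so k : exists D : C, cabs D <= 2 * B rho / (1 - s) ^+ 2 /\ forall w, cabs w <= s ->
     cabs (u k (rC rho * w) - u k (rC rho * z') - D * (w - z')) <=
     4 * B rho / (1 - s) ^+ 3 * cabs (w - z') ^+ 2.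
    by apply: second_order => //; exact: hBr (ltW r0) r1 k.
  have [D hD] := choice so.
  have [d hd] := ultra_lim_bounded_near UU (fun k => (hD k).1).
  exists (d * rC rho^-1).
  have est w : cabs (rC rho^-1 * w) <= s ->
     cabs (v w - v z - d * rC rho^-1 * (w - z)) <=
     4 * B rho / (1 - s) ^+ 3 * (rho^-1 * cabs (w - z)) ^+ 2.
    move=> ws; have wD : inD w.
      rewrite -(rz w); apply: inD_rCM; first by rewrite (ltW r0) ltW.
      exact: cabs_small_inD ws s1.
    have cc : ccvg U (fun k => u k w - u k z - D k * (rC rho^-1 * (w - z))) (v w - v z - d * rC rho^-1 * (w - z)).
      rewrite -mulrA; apply: ccvgB; first exact: diff.
      by apply: ccvgM => //; exact: ccvg_cst.
    apply: (ccvg_cabs_le cc); apply: filterE => k.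
    have := (hD k).2 _ ws; rewrite !rz -mulrBr cabsM cabs_rC ger0_norm//.
    by rewrite invr_ge0 ltW.
  exists (fun w => if w == z then d * rC rho^-1 else (v w - v z) / (w - z)); split; last first.
    move=> w; case: eqP => [->|/eqP wz]; first by rewrite subrr mulr0 addr0.
    by rewrite divfK ?subr_eq0// addrC subrK.
  apply/ccvg_lt => e e0.
  set K := 4 * B rho / (1 - s) ^+ 3 * rho^-1 ^+ 2.
  have K0 : 0 <= K.
    apply: mulr_ge0; last exact: sqr_ge0.
    apply: divr_ge0; first by rewrite mulr_ge0// B0// ltW.
    by rewrite exprn_ge0// subr_ge0 ltW.
  exists (Num.min (rho * (s - cabs z')) (e / (K + 1))).
    by rewrite lt_min mulr_gt0 ?subr_gt0// divr_gt0// ltr_wpDl.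
  move=> w; rewrite lt_min => /andP[w1 w2].
  case: eqP => [_|/eqP wz]; first by rewrite subrr cabs0.
  have wz0 : 0 < cabs (w - z) by rewrite cabs_gt0 subr_eq0.
  have ws : cabs (rC rho^-1 * w) <= s.
    have -> : rC rho^-1 * w = rC rho^-1 * (w - z) + z' by rewrite /z'; ring.
    apply: le_trans (ler_cabsD _ _) _; rewrite cabsM cabs_rC ger0_norm ?invr_ge0 ?(ltW r0)//.
    have : rho^-1 * cabs (w - z) <= s - cabs z' by rewrite mulrC ler_pdivrMr// mulrC ltW.
    lra.
  have := est w ws; rewrite exprMn mulrA -/K => h.
  have -> : (v w - v z) / (w - z) - d * rC rho^-1 = (v w - v z - d * rC rho^-1 * (w - z)) / (w - z).
    by field; rewrite subr_eq0.
  rewrite cabsf_div ltr_pdivrMr//; apply: le_lt_trans h _.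
  rewrite expr2 mulrA ltr_pM2r//.
  apply: (@le_lt_trans _ _ ((K + 1) * cabs (w - z))).
    by rewrite ler_wpM2r ?cabs_ge0// lerDl.
  by rewrite mulrC -ltr_pdivlMr// ltr_wpDl.
(* Uniformity comes from a Lipschitz constant common to all [u k] and to [v], with compactness of
   the closed disc in polar coordinates. *)
have unif (rho e : R) : rho < 1 -> 0 < e ->
   \forall k \near U, forall z, cabs z <= rho -> cabs (u k z - v z) <= e.
  move=> r1 e0.
  case: (ltP rho 0) => [rn|r0].
    by apply: filterE => k z hz; have := le_lt_trans hz rn; rewrite ltNge cabs_ge0.
  have cK : compact (`[0, rho] `*` `[0, 2 * pi] : set (R * R)%type).
    by apply: compact_setX; exact: segment_compact.
  move/compact_near_coveringP : cK => /(_ _ U (fun k (x : R * R) =>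
     cabs (u k (zpol x.1 x.2) - v (zpol x.1 x.2)) <= e) _) cK.
  have {}cK := cK _; have : \forall k \near U, (`[0, rho] `*` `[0, 2 * pi]) `<=`
      (fun x : R * R => cabs (u k (zpol x.1 x.2) - v (zpol x.1 x.2)) <= e).
    apply: cK => -[r t] [/= hr ht].
    rewrite !in_itv /= in hr ht.
    have zD : inD (zpol r t) by rewrite /inD cabs_zpol; case/andP: hr => h1 h2; rewrite ger0_norm// (le_lt_trans h2).
    set z := zpol r t.
    pose rh := (1 + rho) / 2.
    have rr : rho < rh by rewrite /rh; lra.
    have rh1 : rh < 1 by rewrite /rh; lra.
    have rh0 : 0 < rh by exact: le_lt_trans rr.
    pose rg := (1 + rh) / 2.
    have rgr : rh < rg by rewrite /rg; lra.
    have rg1 : rg < 1 by rewrite /rg; lra.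
    have rg0 : 0 < rg by exact: lt_trans rgr.
    have rg01 : 0 <= rg < 1 by rewrite (ltW rg0).
    pose s := rh / rg.
    have s1 : s < 1 by rewrite /s ltr_pdivrMr// mul1r.
    have rz w : rC rg * (rC rg^-1 * w) = w.
      by rewrite mulrA -rCM divff ?mul1r// gt_eqF.
    set L := 2 * B rg / (1 - s) ^+ 2 * rg^-1.
    have L0 : 0 <= L.
      have := B0 _ (ltW rg0) rg1 => ?; have : 0 <= 1 - s by rewrite subr_ge0 ltW.
      by move=> ?; rewrite /L; nneg.
    have lipu k w w' : cabs w <= rh -> cabs w' <= rh -> cabs (u k w - u k w') <= L * cabs (w - w').
      move=> hw hw'.
      have sc x : cabs x <= rh -> cabs (rC rg^-1 * x) <= s.
        by move=> hx; rewrite cabsM cabs_rC ger0_norm ?invr_ge0 ?(ltW rg0)// mulrC ler_pM2r// invr_gt0.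
      have := lip_inside (hu k) rg01 (hBr _ (ltW rg0) rg1 k) s1 (sc _ hw) (sc _ hw').
      by rewrite !rz -mulrBr cabsM cabs_rC ger0_norm ?invr_ge0 ?(ltW rg0)// mulrA.
    have lipv w w' : cabs w <= rh -> cabs w' <= rh -> cabs (v w - v w') <= L * cabs (w - w').
      move=> hw hw'.
      have cc := diff w' w (cabs_small_inD hw' rh1) (cabs_small_inD hw rh1).
      by apply: (ccvg_cabs_le cc); apply: filterE => k; exact: lipu.
    have e3 : 0 < e / 3 by rewrite divr_gt0.
    have nk : \forall k \near U, cabs (u k z - v z) < e / 3.
      by have /ccvg_lt := hv z zD; apply.
    have zr : cabs z <= rho by rewrite cabs_zpol; case/andP: hr => h1 h2; rewrite ger0_norm.
    have nx : \forall x \near (r, t), cabs (zpol x.1 x.2 - z) < Num.min (rh - rho) (e / 3 / (L + 1)).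
      have : ccvg (nbhs (r, t)) (fun x : R * R => zpol x.1 x.2) z.
        by apply: (zpol_cvg (g := fst) (h := snd)); [exact: cvg_fst|exact: cvg_snd].
      by move=> /ccvg_lt; apply; rewrite lt_min subr_gt0 rr divr_gt0// ltr_wpDl.
    near=> x k => /=.
    have h1 : cabs (u k z - v z) < e / 3 by near: k.
    have : cabs (zpol x.1 x.2 - z) < Num.min (rh - rho) (e / 3 / (L + 1)) by near: x.
    rewrite lt_min => /andP[h2 h3].
    have xr : cabs (zpol x.1 x.2) <= rh.
      by have := ler_cabs_dist (zpol x.1 x.2) z; lra.
    have zrh : cabs z <= rh by lra.
    have A := lipu k _ _ xr zrh; have A' := lipv _ _ xr zrh.
    have LL : L * cabs (zpol x.1 x.2 - z) <= e / 3.
      apply: (@le_trans _ _ ((L + 1) * cabs (zpol x.1 x.2 - z))).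
        by rewrite ler_wpM2r ?cabs_ge0// lerDl.
      by rewrite mulrC -ler_pdivlMr ?ltW// ltr_wpDl.
    have -> : u k (zpol x.1 x.2) - v (zpol x.1 x.2) = (u k (zpol x.1 x.2) - u k z) + (u k z - v z) - (v (zpol x.1 x.2) - v z) by ring.
    apply: le_trans (ler_cabsB _ _) _; apply: le_trans (lerD (ler_cabsD _ _) (lexx _)) _.
    lra.
  apply: filterS => k hk z zr.
  have [t ht e'] := cabs_polar z.
  have := hk (cabs z, t); rewrite /= -/(zpol _ _) in e' *; rewrite -e'; apply.
  by split => /=; rewrite in_itv /= ?cabs_ge0//; case/andP: ht => -> /ltW ->.
(* Since [U] refines [\oo], an index that is accurate to [1 / (n + 1)] on the disc of radius
   [1 - 1 / (n + 1)] can be taken beyond the previously chosen one. *)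
pose ok n k := forall z, cabs z <= 1 - n.+1%:R^-1 -> cabs (u k z - v z) <= n.+1%:R^-1.
have exn (nm : nat * nat) : exists k, ok nm.1 k /\ (nm.2 < k)%N.
  have Am : \forall k \near U, (nm.2 < k)%N by apply: Uoo; exact: nbhs_infty_gt.
  have An : \forall k \near U, ok nm.1 k.
    by apply: unif; rewrite ?ltrBlDr ?ltrDl invr_gt0 ltr0n.
  by have [k [? ?]] := filter_ex (filterI An Am); exists k.
have [nx hnx] := choice exn.
pose sigma := fix sg n := if n is m.+1 then nx (n, sg m) else nx (0%N, 0%N).
exists v => //; exists sigma.
  by move=> k; have [_] := hnx (k.+1, sigma k).
have oks n : ok n (sigma n) by case: n => [|n]; [exact: (hnx (0%N, 0%N)).1|exact: (hnx (n.+1, sigma n)).1].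
move=> rho r1 e e0.
have [K hK] : exists K : nat, forall k, (K <= k)%N -> k.+1%:R^-1 <= Num.min e (1 - rho).
  have m0 : 0 < Num.min e (1 - rho) by rewrite lt_min e0 subr_gt0.
  exists (Num.truncn (Num.min e (1 - rho))^-1) => k Kk.
  rewrite -[leRHS]invrK lef_pV2 ?posrE ?invr_gt0//.
  have := truncnS_gt (Num.min e (1 - rho))^-1 => /ltW /le_trans; apply.
  by rewrite ler_nat ltnS.
exists K => k /hK; rewrite le_min => /andP[k1 k2] z zr.
apply: le_trans (oks k z _) k1; apply: le_trans zr _.
by rewrite lerBrDr addrC -lerBrDr.
Unshelve. all: by end_near. Qed.
End Montel.

(** * The Herglotz representation *)

Section Herglotz.
Variable R : realType.
Local Notation C := R[i].
Local Notation Re := complex.Re.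
Local Notation Im := complex.Im.
Local Notation GR := (measurableTypeR R).
Local Notation mu := (@lebesgue_measure R).
Implicit Types (z w a : C) (s t : R).

(** The shift by 2 keeps every radius in [[1/2, 1[], in particular positive. *)
Definition rk (n : nat) : R := 1 - n.+2%:R^-1.

Lemma rk01 n : 0 <= rk n < 1.
Proof.
have h : 0 < n.+2%:R^-1 :> R by rewrite invr_gt0 ltr0n.
have h' : n.+2%:R^-1 <= 1 :> R by rewrite invf_le1 ?ltr0n// ler1n.
by rewrite /rk subr_ge0 h' ltrBlDr ltrDl.
Qed.

Lemma rk_ge0 n : 0 <= rk n. Proof. by case/andP: (rk01 n). Qed.
Lemma rk_lt1 n : rk n < 1. Proof. by case/andP: (rk01 n). Qed.
Lemma normrk n : `|rk n| < 1. Proof. by rewrite ger0_norm ?rk_ge0// rk_lt1. Qed.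

Lemma rk_cvg : rk @ \oo --> (1 : R).
Proof.
rewrite -[X in _ --> X]subr0; apply: cvgB; first exact: cvg_cst.
apply/cvgrPdist_lt => e e0.
have h := @cvg_harmonic R; move/cvgrPdist_lt : h => /(_ e e0).
move=> -[N _ H]; exists N => // n Nn /=.
have := H n.+1 (leq_trans Nn (leqnSn n)); rewrite /harmonic /=.
by rewrite !sub0r !normrN.
Qed.

Lemma rk_left : rk @ \oo --> (1 : R)^'-.
Proof.
move=> A /= [e /= e0 H]; have h := rk_cvg.
move/cvgrPdist_lt : h => /(_ e e0); apply: filterS => n hn.
by apply: H => //=; exact: rk_lt1.
Qed.

Lemma RI_dct (f : nat -> R -> R) (g : R -> R) (a b K : R) :
  (forall n, measurable_fun setT (f n)) ->
  (forall n x, a <= x <= b -> `|f n x| <= K) ->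
  (forall x, a <= x <= b -> f^~ x @ \oo --> g x) ->
  rint a b g /\ (fun n => RI a b (f n)) @ \oo --> RI a b g.
Proof.
move=> mf hK fg.
have mg : measurable_fun `[a, b] g.
  apply: (measurable_fun_cvg (h := f)); first by move=> n; exact: measurable_funTS.
  by move=> x /=; rewrite in_itv /=; exact: fg.
have gK x : a <= x <= b -> `|g x| <= K.
  move=> hx; have h : (fun n => `|f n x|) @ \oo --> `|g x| by apply: cvg_norm; exact: fg.
  by apply: (ler_cvg_to h (cvg_cst K)); apply: filterE => n; exact: hK.
have ig : rint a b g.
  apply: measurable_bounded_integrable => //.
  - by apply: compact_finite_measure; exact: segment_compact.
  - exists K; split; first exact: num_real.
    by move=> y My x /=; rewrite in_itv /= => /gK /le_trans; apply; exact: ltW.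
split=> //.
have mfE n : measurable_fun `[a, b] (EFin \o f n).
  by apply/measurable_EFinP; exact: measurable_funS measurableT (@subsetT _ _) (mf n).
have fgE x : `[a, b]%classic x -> (fun n => (EFin \o f n) x) @ \oo --> (EFin \o g) x.
  by rewrite /= in_itv /= => hx; apply: cvg_EFin; [exact: nearW|exact: fg].
have bd n x : `[a, b]%classic x -> (`|(EFin \o f n) x| <= cst K%:E x)%E.
  by rewrite /= in_itv /= lee_fin; exact: hK.
have H := @dominated_cvg _ _ R mu `[a, b] (measurable_itv _) (fun n => EFin \o f n)
  (EFin \o g) (cst K%:E) mfE fgE (fun _ _ => isT) (rint_cst a b K) bd.
rewrite /RI /Rintegral; apply: fine_cvg; rewrite fineK; first exact: H.
exact: integrable_fin_num.
Qed.

(** The bound is asked on the half-open interval because a quantile function is located only for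
    [F x < y <= F x']. *)
Lemma RI_ocbound (a b : R) (f : R -> R) (c k : R) : a <= b -> rint a b f ->
  (forall x, a < x <= b -> `|f x - c| <= k) -> `|RI a b f - c * (b - a)| <= k * (b - a).
Proof.
move=> ab hf h.
rewrite -(RI_cst c ab) -RIB//; last exact: rint_cst.
have hg : rint a b (fun x => f x - c) by apply: rintB => //; exact: rint_cst.
have hs : mu.-integrable `]a, b] (EFin \o (fun x => f x - c)).
  by apply: integrableS hg => //; exact: subset_itv_oc_cc.
rewrite /RI -(Rintegral_itv_obnd_cbnd hs).
apply: le_trans (le_normr_Rintegral _ hs) _ => //.
apply: (@le_trans _ _ (\int[mu]_(x in `]a, b]) k)).
  apply: le_Rintegral => //.
  - by have := integrable_abse hs; apply: eq_integrable.
  - have hk : rint a b (fun=> k) by exact: rint_cst.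
    by apply: integrableS hk => //; exact: subset_itv_oc_cc.
rewrite Rintegral_cst//= lebesgue_measure_itv /= lte_fin.
by case: ltP => //= h'; rewrite (le_anti (introT andP (conj ab h'))) subrr.
Qed.

Section Rep.
Variable h : C -> C.
Hypothesis hh : holo_on_D h.
Hypothesis h0 : forall z, inD z -> 0 <= Re (h z).
Let M := Re (h 0).
Let pk n t := Re (h (zpol (rk n) t)).
Let cpk n : continuous (pk n). Proof. exact: (circ_contRe hh (normrk n)). Qed.
Let pk0 n t : 0 <= pk n t.
Proof. by apply: h0; rewrite /inD cabs_zpol normrk. Qed.
Let p2 : 0 < 2 * pi :> R := @pi2_gt0 R.
Let Fk n x : R := (2 * pi)^-1 * RI 0 x (pk n).
Let FkM n : Fk n (2 * pi) = M.
Proof. by rewrite /Fk (mean_value hh (rk01 n)) mulKf// gt_eqF. Qed.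
Let Fk_mono n x y : 0 <= x -> x <= y -> Fk n x <= Fk n y.
Proof.
move=> x0 xy; rewrite /Fk ler_wpM2l ?invr_ge0 ?(ltW p2)//.
rewrite (@RI_split _ 0 y x); [|by rewrite x0|exact: contT_rint].
by rewrite lerDl; apply: RI_ge0.
Qed.
Let Fk0 n : Fk n 0 = 0.
Proof.
rewrite /Fk; have -> : RI 0 0 (pk n) = 0; last by rewrite mulr0.
apply/eqP; rewrite -normr_le0; have [K [K0 hK]] := cont_bounded 0 (@cpk n).
have := @RI_bound _ 0 0 (pk n) K (lexx _) (contT_rint 0 0 (@cpk n)) hK.
by rewrite subrr mulr0.
Qed.
Let Fk_bd n x : 0 <= x <= 2 * pi -> `|Fk n x| <= M.
Proof.
move=> /andP[x0 x2]; rewrite ger0_norm; last by rewrite -(Fk0 n) Fk_mono.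
by rewrite -(FkM n) Fk_mono.
Qed.

(** The representing measure is the image of Lebesgue measure on [[0, M]] under [q]. As in Helly's
    theorem, the distribution functions [Fk n] of the densities on circles of radius [rk n] converge
    along an ultrafilter, and [q] is the generalized inverse of their limit [F]. Integrals against
    the measure thus stay integrals over a segment. *)
Theorem herglotz : exists q : R -> R,
  [/\ measurable_fun setT q, (forall y, 0 <= q y < 2 * pi) &
      forall z, inD z -> Re (h z) = RI 0 M (fun y => poisson z (q y))].
Proof.
have alg (T a b c d f p q m k : R) : T <= a + (b + c + d) -> a <= f + k / 2 -> b <= p -> d <= q ->
    q <= p + m -> c + m <= k / 2 -> T <= f + 2 * p + k by lra.
have [U [UU Uoo]] := @ultraFilterLemma nat \oo _.
have PU : ProperFilter U by exact: ultra_proper.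
have exF x : exists l : R, 0 <= x <= 2 * pi -> Fk^~ x @ U --> l.
  have [hx|nx] := pselect (0 <= x <= 2 * pi); last by exists 0.
  by have [l hl] := ultra_lim UU (fun n => Fk_bd n hx); exists l.
have [F hF] := choice exF.
have i0 : 0 <= (0 : R) <= 2 * pi by rewrite lexx ltW.
have i2 : 0 <= (2 * pi : R) <= 2 * pi by rewrite lexx ltW.
have F0 : F 0 = 0.
  have hc : Fk^~ 0 @ U --> (0 : R).
    by rewrite (_ : Fk^~ 0 = cst 0); [exact: cvg_cst|apply/funext => n; exact: Fk0].
  exact: (cvg_unique _ (hF 0 i0) hc).
have FM : F (2 * pi) = M.
  have hc : Fk^~ (2 * pi) @ U --> M.
    by rewrite (_ : Fk^~ (2 * pi) = cst M); [exact: cvg_cst|apply/funext => n; exact: FkM].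
  exact: (cvg_unique _ (hF _ i2) hc).
have Fmono x y : 0 <= x -> x <= y -> y <= 2 * pi -> F x <= F y.
  move=> x0 xy y2.
  have hx : 0 <= x <= 2 * pi by rewrite x0 (le_trans xy).
  have hy : 0 <= y <= 2 * pi by rewrite y2 (le_trans x0).
  by apply: (ler_cvg_to (hF x hx) (hF y hy)); apply: filterE => n; exact: Fk_mono.
(* The point 0 is always included, which keeps the set nonempty and the supremum meaningful for
   every [y]. *)
pose S y := [set x : R | 0 <= x <= 2 * pi /\ (x = 0 \/ F x < y)].
pose q y := sup (S y).
have S0 y : S y 0 by split => //; left.
have Sub y : has_ubound (S y) by exists (2 * pi) => x [/andP[]].
have q0 y : 0 <= q y by apply: ub_le_sup.
have q2 y : q y <= 2 * pi by apply: ge_sup; [exists 0; exact: S0|move=> x [/andP[]]].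
have qmono : {homo q : x y / x <= y}.
  move=> x y xy; apply: ge_sup; first by exists 0; exact: S0.
  move=> u [hu hu']; apply: ub_le_sup => //; split=> //.
  by case: hu' => [->|hu']; [left|right; exact: lt_le_trans xy].
have mq : measurable_fun setT q by apply: nondecreasing_measurable.
have qloc x x' y : 0 <= x -> x <= x' -> x' <= 2 * pi -> F x < y <= F x' -> x <= q y <= x'.
  move=> x0 xx x2 /andP[h1 h2]; apply/andP; split.
    by apply: ub_le_sup => //; split; [rewrite x0 (le_trans xx)|right].
  apply: ge_sup; first by exists 0; exact: S0.
  move=> u [/andP[u0 u2] [->|hu]]; first exact: le_trans xx.
  rewrite leNgt; apply/negP => xu.
  by have := Fmono _ _ (le_trans x0 xx) (ltW xu) u2; rewrite leNgt (lt_le_trans hu).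
have M0 : 0 <= M by rewrite -FM -F0; apply: Fmono => //; exact: ltW.
(* Weak convergence, by comparing both integrals with a Riemann-Stieltjes sum of [chi] over a fine
   partition. *)
have key (chi : R -> R) : continuous chi ->
   (fun n => (2 * pi)^-1 * RI 0 (2 * pi) (fun t => pk n t * chi t)) @ U --> RI 0 M (fun y => chi (q y)).
  move=> cchi.
  have ichi (n : nat) (a b : R) : rint a b (fun t => pk n t * chi t).
    by apply: contT_rint => t; apply: cvgM; [exact: cpk|exact: cchi].
  have [Kc [Kc0 hKc]] := cont_bounded (2 * pi) cchi.
  have iq (a b : R) : rint a b (fun y => chi (q y)).
    apply: (bounded_rint (M := Kc)).
      by apply: measurableT_comp => //; exact: continuous_measurable_fun.
    by move=> y _; apply: hKc; rewrite q0 q2.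
  apply/cvgrPdist_le => e0 e00.
  pose e := e0 / (2 * M + 2).
  have k0 : 0 < 2 * M + 2 by rewrite ltr_wpDl// mulr_ge0.
  have e1 : 0 < e by rewrite divr_gt0.
  have [del del0 hdel] : exists2 del : R, 0 < del & forall x y, 0 <= x <= 2 * pi ->
      0 <= y <= 2 * pi -> `|x - y| < del -> `|chi x - chi y| < e.
    have cc : {within `[0, 2 * pi], continuous chi} by exact: continuous_subspaceT.
    have := @segment_compact R 0 (2 * pi) => /compact_near_coveringP.
    move=> /(_ _ (0 : R)^'+ (fun d x => forall y, `|x - y| < d -> `|chi x - chi y| < e) _) H.
    have {}H := H _; have [|d [hd d0]] := filter_ex (filterI (H _) (nbhs_right_gt (0 : R))).
      move=> x _; have e2 : 0 < e / 2 by rewrite divr_gt0.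
      have /cvgrPdist_lt /(_ _ e2) /nbhs_ballP[r /= r0 hr] := cchi x.
      have hx : \forall x' \near x, `|x - x'| < r / 2.
        by apply/nbhs_ballP; exists (r / 2) => //=; rewrite divr_gt0.
      have hd : \forall d \near (0 : R)^'+, d < r / 2 by apply: nbhs_right_lt; rewrite divr_gt0.
      near=> x' d => /= y xy.
      have x'1 : `|x - x'| < r / 2 by near: x'.
      have d1 : d < r / 2 by near: d.
      have A : `|chi x - chi x'| < e / 2 by apply: hr; rewrite /ball /=; lra.
      have A' : `|chi x - chi y| < e / 2.
        apply: hr; rewrite /ball /=; apply: le_lt_trans (ler_distD x' _ _) _; lra.
      apply: le_lt_trans (ler_distD (chi x) _ _) _; rewrite [`|chi x' - _|]distrC; lra.
    by exists d => // x y hx _; apply: hd; rewrite /= in_itv.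
  have [N N0 hN] : exists2 N : nat, (0 < N)%N & 2 * pi / N%:R < del.
    exists (Num.truncn (2 * pi / del)).+1 => //.
    rewrite ltr_pdivrMr ?ltr0n// [ltRHS]mulrC -ltr_pdivrMr//.
    exact: truncnS_gt.
  have NR : 0 < N%:R :> R by rewrite ltr0n.
  pose x i : R := 2 * pi * i%:R / N%:R.
  have x0E : x 0%N = 0 by rewrite /x mulr0 mul0r.
  have xNE : x N = 2 * pi by rewrite /x mulfK// gt_eqF.
  have xge i : 0 <= x i by rewrite /x; apply: divr_ge0 => //; apply: mulr_ge0 => //; exact: ltW.
  have xS i : x i.+1 = x i + 2 * pi / N%:R.
    by rewrite /x -[i.+1%:R]natr1 [2 * pi * (_ + 1)]mulrDr mulr1 mulrDl.
  have dx0 : 0 < 2 * pi / N%:R :> R by rewrite divr_gt0.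
  have xle i : (i <= N)%N -> x i <= 2 * pi.
    by move=> iN; rewrite -xNE /x ler_pM2r ?invr_gt0// ler_pM2l// ler_nat.
  pose G n y : R := (2 * pi)^-1 * RI 0 y (fun t => pk n t * chi t).
  (* Induction along the partition. The term [2 e F (x i)] pays for the oscillation of [chi] on the
     cells, once for each integral; [eta], halved at every node, pays for replacing [F] by
     [Fk n]. *)
  have ind i : (i <= N)%N -> forall eta, 0 < eta -> \forall n \near U,
      `|RI 0 (F (x i)) (fun y => chi (q y)) - G n (x i)| <= 2 * e * F (x i) + eta.
    elim: i => [_|i IH iN] eta eta0.
      rewrite x0E F0; apply: filterE => n.
      have z1 (f : R -> R) : rint 0 0 f -> RI 0 0 f = 0.
        move=> hf; have := @RI_ocbound 0 0 f 0 0 (lexx _) hf.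
        rewrite subrr !mul0r subr0 normr_le0 => H; apply/eqP; apply: H.
        by move=> y /andP[y1 y2]; have := lt_le_trans y1 y2; rewrite ltxx.
      rewrite (z1 _ (iq _ _)) /G (z1 _ (ichi n _ _)) mulr0 subr0 normr0.
      by rewrite mulr0 add0r ltW.
    have iN' := ltnW iN.
    have hxi : 0 <= x i <= 2 * pi by rewrite xge xle.
    have hxi1 : 0 <= x i.+1 <= 2 * pi by rewrite xge xle.
    have xx : x i <= x i.+1 by rewrite xS lerDl ltW.
    have FF := Fmono _ _ (xge i) xx (xle _ iN).
    pose K := `|chi (x i)| + e + 1.
    have K0 : 0 < K by rewrite /K -addrA ltr_wpDl// addr_gt0.
    have et4 : 0 < eta / (4 * K) by rewrite divr_gt0// mulr_gt0.
    have et2 : 0 < eta / 2 by rewrite divr_gt0.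
    have c1 := hF _ hxi; have c2 := hF _ hxi1.
    move/cvgrPdist_lt : c1 => /(_ _ et4) c1; move/cvgrPdist_lt : c2 => /(_ _ et4) c2.
    have I := IH iN' _ et2.
    near=> n.
    have A1 : `|F (x i) - Fk n (x i)| < eta / (4 * K) by near: n.
    have A2 : `|F (x i.+1) - Fk n (x i.+1)| < eta / (4 * K) by near: n.
    have A3 : `|RI 0 (F (x i)) (fun y => chi (q y)) - G n (x i)| <= 2 * e * F (x i) + eta / 2 by near: n.
    have Fi0 : 0 <= F (x i) by rewrite -F0; apply: Fmono => //; exact: xle.
    have B1 : `|RI (F (x i)) (F (x i.+1)) (fun y => chi (q y)) - chi (x i) * (F (x i.+1) - F (x i))| <= e * (F (x i.+1) - F (x i)).
      apply: RI_ocbound => // y hy.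
      have /andP[l1 l2] := qloc _ _ _ (xge i) xx (xle _ iN) hy.
      apply/ltW/hdel => //; first by rewrite q0 q2.
      by rewrite ger0_norm ?subr_ge0//; apply: le_lt_trans hN; rewrite lerBlDl -xS.
    have B2 : `|(2 * pi)^-1 * RI (x i) (x i.+1) (fun t => pk n t * chi t) - chi (x i) * (Fk n (x i.+1) - Fk n (x i))| <= e * (Fk n (x i.+1) - Fk n (x i)).
      have -> : Fk n (x i.+1) - Fk n (x i) = (2 * pi)^-1 * RI (x i) (x i.+1) (pk n).
        rewrite /Fk (@RI_split _ 0 (x i.+1) (x i)); [|by rewrite xge|exact: contT_rint].
        by ring.
      have -> : (2 * pi)^-1 * RI (x i) (x i.+1) (fun t => pk n t * chi t) - chi (x i) * ((2 * pi)^-1 * RI (x i) (x i.+1) (pk n)) =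
        (2 * pi)^-1 * RI (x i) (x i.+1) (fun t => pk n t * chi t - chi (x i) * pk n t).
        by rewrite RIB//; [rewrite RIZ; [ring|exact: contT_rint]|apply: rintZ; exact: contT_rint].
      rewrite normrM ger0_norm ?invr_ge0 ?(ltW p2)// mulrCA ler_pM2l ?invr_gt0//.
      have ii : rint (x i) (x i.+1) (fun t => pk n t * chi t - chi (x i) * pk n t).
        by apply: rintB => //; apply: rintZ; exact: contT_rint.
      apply: le_trans (le_normr_Rintegral _ ii) _ => //.
      rewrite -/(RI _ _ _) -RIZ; last exact: contT_rint.
      apply: le_RI.
      - by have := integrable_abse ii; apply: eq_integrable.
      - by apply: rintZ; exact: contT_rint.
      - move=> t /andP[t1 t2]; rewrite [chi (x i) * _]mulrC -mulrBr normrM (ger0_norm (pk0 n t)) mulrC.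
        rewrite ler_wpM2r// ltW// hdel//.
          by rewrite (le_trans (xge i) t1) (le_trans t2)// xle.
        by rewrite ger0_norm ?subr_ge0//; apply: le_lt_trans hN; rewrite lerBlDl -xS.
    have E1 : RI 0 (F (x i.+1)) (fun y => chi (q y)) = RI 0 (F (x i)) (fun y => chi (q y)) + RI (F (x i)) (F (x i.+1)) (fun y => chi (q y)).
      by apply: RI_split; rewrite ?Fi0.
    have E2 : G n (x i.+1) = G n (x i) + (2 * pi)^-1 * RI (x i) (x i.+1) (fun t => pk n t * chi t).
      by rewrite /G (@RI_split _ 0 (x i.+1) (x i)) ?mulrDr// xge.
    rewrite E1 E2.
    set X1 := RI 0 (F (x i)) _ in A3 *; set X2 := RI (F (x i)) _ _ in B1 *; set Y := _ * RI (x i) _ _ in B2 *.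
    set dF := F (x i.+1) - F (x i) in B1; set dFk := Fk n (x i.+1) - Fk n (x i) in B2.
    have dd : `|dF - dFk| <= eta / (2 * K).
      have -> : dF - dFk = (F (x i.+1) - Fk n (x i.+1)) - (F (x i) - Fk n (x i)) by rewrite /dF /dFk; ring.
      apply: le_trans (ler_normB _ _) _.
      have -> : eta / (2 * K) = eta / (4 * K) + eta / (4 * K) by field; rewrite gt_eqF.
      by apply: lerD; exact: ltW.
    have cd : `|chi (x i) * dF - chi (x i) * dFk| + e * `|dF - dFk| <= eta / 2.
      rewrite -mulrBr normrM -mulrDl.
      apply: le_trans (ler_wpM2l _ dd) _; first by rewrite addr_ge0// ltW.
      have -> : eta / 2 = K * (eta / (2 * K)) by field; rewrite gt_eqF.
      by rewrite ler_wpM2r ?divr_ge0 ?mulr_ge0 ?(ltW eta0) ?(ltW K0)// /K lerDl.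
    have : `|X1 + X2 - (G n (x i) + Y)| <= `|X1 - G n (x i)| + (`|X2 - chi (x i) * dF| + `|chi (x i) * dF - chi (x i) * dFk| + `|Y - chi (x i) * dFk|).
      have -> : X1 + X2 - (G n (x i) + Y) = (X1 - G n (x i)) + ((X2 - chi (x i) * dF) + (chi (x i) * dF - chi (x i) * dFk) - (Y - chi (x i) * dFk)) by ring.
      apply: le_trans (ler_normD _ _) _; rewrite lerD2l.
      apply: le_trans (ler_normB _ _) _; rewrite lerD2r.
      exact: ler_normD.
    have : e * dFk <= e * dF + e * `|dF - dFk|.
      rewrite -mulrDr ler_wpM2l ?(ltW e1)//.
      by rewrite -lerBlDl distrC; exact: ler_norm.
    have -> : 2 * e * F (x i.+1) = 2 * e * F (x i) + 2 * (e * dF) by rewrite /dF; ring.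
    by move=> H1 H2; exact: alg H2 A3 B1 B2 H1 cd.
  have e2 : 0 < e by [].
  have := ind N (leqnn N) e e2; rewrite xNE FM; apply: filterS => n hn.
  apply: le_trans hn _.
  have -> : e0 = e * (2 * M + 2) by rewrite /e divfK// gt_eqF.
  by move: e1; nra.
(* The value [2 pi] is folded to 0, the same point of the circle, so that the representation lives
   on [I02]. *)
exists (fun y => if q y < 2 * pi then q y else 0); split.
- have mb : measurable_fun setT (fun y => q y < 2 * pi).
    by apply: measurable_fun_ltr => //; exact: measurable_cst.
  by apply: (measurable_fun_ifT mb) => //; exact: measurable_cst.
- by move=> y; case: ltP => [->|_]; rewrite ?q0// lexx p2.
- move=> z zD.
  have -> : RI 0 M (fun y => poisson z (if q y < 2 * pi then q y else 0)) = RI 0 M (fun y => poisson z (q y)).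
    apply: eq_RI => y _; case: ltP => // hy.
    have -> : q y = 2 * pi by apply/eqP; rewrite eq_le q2 hy.
    by rewrite /poisson expi2pi expi0.
  have c1 := key _ (poisson_continuous zD).
  have c2 : (fun n => (2 * pi)^-1 * RI 0 (2 * pi) (fun t => pk n t * poisson z t)) @ U --> Re (h z).
    rewrite (_ : (fun n => _) = fun n => Re (h (rC (rk n) * z))); last first.
      by apply/funext => n; rewrite (poisson_formula hh (rk01 n) zD) mulKf// gt_eqF.
    have : (fun n => Re (h (rC (rk n) * z))) @ \oo --> Re (h z).
      apply: (@cvg_comp _ _ _ rk (fun r => Re (h (rC r * z))) \oo ((1 : R)^'-) _ rk_left).
      by apply: ccvg_Re; exact: rad_ccvg.
    by move=> H A /H; exact: Uoo.
  exact: (cvg_unique _ c2 c1).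
Unshelve. all: by end_near. Qed.
End Rep.
End Herglotz.

(** * Angular derivatives *)

Section JuliaCaratheodory.
Variable R : realType.
Local Notation C := R[i].
Local Notation Re := complex.Re.
Local Notation Im := complex.Im.
Implicit Types (z w a : C) (s t : R).

Definition ntfilter (zeta : C) (M : R) : set_system C := within (stolz zeta M) (cnbhs zeta).

Global Instance ntfilter_filter zeta M : Filter (ntfilter zeta M).
Proof. exact: within_filter. Qed.

Lemma nt_limP (f : C -> C) zeta L :
  nt_lim f zeta L <-> forall M, 1 < M -> ccvg (ntfilter zeta M) f L.
Proof.
split=> [h M M1|h M M1 e e0].
  apply/ccvg_lt => e /(h M M1)[d d0 hd]; exists d => // w wd wS; exact: hd.
have /ccvg_lt /(_ e e0) [d d0 hd] := h M M1.
by exists d => // z zS zd; exact: hd.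
Qed.

Lemma near_nt zeta M (P : C -> Prop) (d : R) : 0 < d ->
  (forall z, stolz zeta M z -> cabs (z - zeta) < d -> P z) -> \forall z \near ntfilter zeta M, P z.
Proof. by move=> d0 h; exists d => // z zd zS; exact: h. Qed.

Lemma ccvg_nt_id zeta M : ccvg (ntfilter zeta M) id zeta.
Proof. by apply/ccvg_lt => e e0; apply: (near_nt e0). Qed.

Lemma holo_cayley (phi : C -> C) s : self_map phi ->
  holo_on_D (fun z => (expi s + phi z) / (expi s - phi z)).
Proof. by move=> [hp Dp]; apply: (holo_comp hp Dp (holo_herglotz s)). Qed.

Lemma mobius_inv a z : inD a -> inD z -> mobius a (mobius (- a) z) = z.
Proof.
move=> aD zD; have aN : inD (- a) by rewrite /inD cabsN.
have d0 := mobius_den_neq0 aN (ltW zD).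
have d1 := mobius_den_neq0 aD (ltW (mobius_inD aN zD)).
rewrite /mobius in d1 *.
have cN : (- a)^*%C = - (a^*)%C by exact: rmorphN.
rewrite cN in d0 d1 *; set b := conjc a in d0 d1 *.
have E : 1 + b * ((z - a) / (1 + - b * z)) = (1 - b * a) / (1 + - b * z).
  by field.
rewrite E in d1 *.
have d2 : 1 - b * a != 0 by apply: contraNneq d1 => ->; rewrite mul0r.
by field; rewrite d2 d0.
Qed.

Lemma expi_conj (t : R) : expi t * conjc (expi t) = 1 :> C.
Proof.
by apply: complex_ext; rewrite /= ?mulrN ?opprK -?expr2 ?cos2Dsin2// mulrC addNr.
Qed.

(** With [A] the infimum of [Re Phi / Re u], the function [Psi = Phi - A u] still has nonnegative
    real part, and nothing of it remains at [zeta]: [(zeta - z) Psi] tends to 0 nontangentially.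
    Hence [(zeta - z) (Phi + 1)] tends to [2 A zeta], which is nonzero as [A >= c], and inverting
    gives the difference quotient of [phi]. *)
Lemma julia_caratheodory (phi : C -> C) (c s tau : R) : self_map phi -> 0 < c ->
  (forall z, inD z -> c * poisson z tau <= poisson (phi z) s) -> Fset phi (expi tau).
Proof.
move=> sphi c0 hc; have [hphi Dphi] := sphi.
pose zeta : C := expi tau; pose al : C := expi s.
pose u z := (zeta + z) / (zeta - z); pose Phi z := (al + phi z) / (al - phi z).
have Reu z : inD z -> Re (u z) = poisson z tau by move=> zD; rewrite poissonE.
have RePhi z : inD z -> Re (Phi z) = poisson (phi z) s by move=> zD; rewrite poissonE//; exact: Dphi.
pose S := [set x : R | exists2 z, inD z & x = Re (Phi z) / Re (u z)].
have Slb : lbound S c.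
  move=> x [z zD ->]; rewrite Reu// RePhi// ler_pdivlMr; last exact: poisson_gt0.
  exact: hc.
have S0 : S !=set0 by exists (Re (Phi 0) / Re (u 0)); exists 0 => //; exact: inD0.
pose A := inf S.
have Ac : c <= A by apply: lb_le_inf.
have A0 : 0 < A by exact: lt_le_trans Ac.
pose Psi z := Phi z - rC A * u z.
have hPsi : holo_on_D Psi.
  apply: holoB; first exact: holo_cayley.
  by apply: holoM; [exact: holo_cst|exact: holo_herglotz].
have Psi0 z : inD z -> 0 <= Re (Psi z).
  move=> zD; rewrite /Psi creB Re_rCM subr_ge0 -ler_pdivlMr; last by rewrite Reu// poisson_gt0.
  by apply: ge_inf; [exists c|exists z].
have key M : 1 < M -> ccvg (ntfilter zeta M) (fun z => (zeta - z) * Psi z) 0.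
  move=> M1; apply/ccvg_lt => e e0.
  (* The factor 4 of [borel_caratheodory] and the 8 in [kw] make 32; the remaining 2 leaves [e / 2]
     for the bounded imaginary part. *)
  pose e' := e / (64 * M).
  have M0 : 0 < M by exact: lt_trans M1.
  have e'0 : 0 < e' by rewrite divr_gt0// mulr_gt0.
  have [x [z0 z0D ->] hz0] : exists2 x, S x & x < A + e'.
    by apply: inf_adherent => //; split=> //; exists c.
  have {}hz0 : Re (Psi z0) <= e' * poisson z0 tau.
    move: hz0; rewrite ltr_pdivrMr; last by rewrite Reu// poisson_gt0.
    by rewrite /Psi creB Re_rCM Reu// mulrDl; lra.
  pose B := cabs (zeta - z0).
  have B0 : 0 < B by rewrite cabs_gt0 expi_sub_neq0.
  pose I := `|Im (Psi z0)|.
  have I0 : 0 <= I by exact: normr_ge0.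
  apply: (near_nt (d := Num.min B (e / (2 * (I + 1))))).
    by rewrite lt_min B0 divr_gt0// mulr_gt0// ltr_wpDl.
  move=> z [zD zM]; rewrite lt_min => /andP[zB zI].
  have z0N : inD (- z0) by rewrite /inD cabsN.
  (* The estimate is recentred at the near-minimizer [z0], where [Re Psi] is at most [e'] times the
     Poisson kernel; [w] is the position of [z] seen from [z0]. *)
  pose w := mobius (- z0) z.
  have wD : inD w by exact: mobius_inD.
  have hf : holo_on_D (fun x => Psi (mobius z0 x)).
    by apply: holo_comp => //; [exact: holo_mobius|move=> ?; exact: mobius_inD].
  have := @borel_caratheodory _ _ w hf _ wD; rewrite mobius0 mobius_inv//.
  move=> /(_ (fun x xD => Psi0 _ (mobius_inD z0D xD))) bc.
  have k1 : 0 < 1 - cabs z by rewrite subr_gt0.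
  have k2 : 0 < 1 - cabs z0 ^+ 2 by rewrite subr_gt0 exprn_ilt1// cabs_ge0.
  have den : cabs (1 + conjc (- z0) * z) <= 2 * B.
    have -> : 1 + conjc (- z0) * z = zeta * conjc (zeta - z0) + conjc z0 * (zeta - z).
      by rewrite !rmorphB /= rmorphN mulrBr expi_conj; ring.
    apply: le_trans (ler_cabsD _ _) _; rewrite !cabsM cabs_expi mul1r !cabs_conj mulrDl mul1r.
    rewrite lerD2l; apply: le_trans (ltW zB); rewrite cabsB ler_piMl ?cabs_ge0//.
    exact: ltW.
  have kw : (1 - cabs z0 ^+ 2) * (1 - cabs z) / (8 * B ^+ 2) <= 1 - cabs w.
    have d0 := mobius_den_neq0 z0N (ltW zD).
    have w1 : 1 - cabs w ^+ 2 = (1 - cabs z0 ^+ 2) * (1 - cabs z ^+ 2) / cabs (1 + conjc (- z0) * z) ^+ 2.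
      rewrite -(cabsN z0) -mobius_id /w /mobius cabsf_div expr_div_n mulrBl divff//.
      by rewrite expf_eq0 /= cabs_eq0.
    have w2 : (1 - cabs w ^+ 2) <= 2 * (1 - cabs w).
      by move: wD (cabs_ge0 w); rewrite /inD; nra.
    suff : (1 - cabs z0 ^+ 2) * (1 - cabs z) / (4 * B ^+ 2) <= 1 - cabs w ^+ 2.
      have -> : 8 * B ^+ 2 = 2 * (4 * B ^+ 2) by ring.
      by rewrite invfM mulrCA; lra.
    rewrite w1; apply: ler_pM.
    - by apply: mulr_ge0; exact: ltW.
    - by rewrite invr_ge0 mulr_ge0 ?exprn_ge0 ?ltW.
    - by rewrite ler_pM2l//; move: zD (cabs_ge0 z); rewrite /inD; nra.
    - rewrite lef_pV2 ?posrE ?exprn_gt0 ?cabs_gt0 ?mulr_gt0 ?exprn_gt0//.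
      by move: den (cabs_ge0 (1 + conjc (- z0) * z)); nra.
  have kk : 0 < (1 - cabs z0 ^+ 2) * (1 - cabs z) / (8 * B ^+ 2).
    by rewrite divr_gt0 ?mulr_gt0 ?exprn_gt0.
  have bc2 : 4 * Re (Psi z0) / (1 - cabs w) <= 32 * e' / (1 - cabs z).
    apply: (@le_trans _ _ (4 * (e' * poisson z0 tau) / ((1 - cabs z0 ^+ 2) * (1 - cabs z) / (8 * B ^+ 2)))).
      apply: ler_pM.
      - by rewrite mulr_ge0 ?Psi0.
      - by rewrite invr_ge0 subr_ge0 ltW.
      - by rewrite ler_pM2l.
      - by rewrite lef_pV2 ?posrE ?subr_gt0.
    rewrite /poisson -/zeta -/B le_eqVlt; apply/orP; left; apply/eqP.
    by field; rewrite !gt_eqF.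
  rewrite subr0 cabsM.
  have Pz : cabs (Psi z) <= I + 32 * e' / (1 - cabs z).
    have -> : Psi z = (Psi z - Complex 0 (Im (Psi z0))) + Complex 0 (Im (Psi z0)) by rewrite subrK.
    apply: le_trans (ler_cabsD _ _) _; rewrite addrC lerD//.
      by apply: le_trans (cabs_le_ReIm _) _; rewrite /= normr0 add0r.
    exact: le_trans bc bc2.
  rewrite [cabs (zeta - z)]cabsB.
  set x1 := cabs (z - zeta) in zI zM zB *.
  have x10 : 0 <= x1 by exact: cabs_ge0.
  apply: le_lt_trans (ler_wpM2l x10 Pz) _.
  rewrite mulrDr.
  have b1 : x1 * I <= e / 2.
    move: zI; rewrite ltr_pdivlMr ?mulr_gt0 ?ltr_wpDl//; nra.
  have b2 : x1 * (32 * e' / (1 - cabs z)) < e / 2.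
    have -> : e / 2 = M * (1 - cabs z) * (32 * e' / (1 - cabs z)).
      by rewrite /e'; field; rewrite !gt_eqF.
    by rewrite ltr_pM2r// divr_gt0// mulr_gt0.
  lra.
have z2 : rC (2 * A) * zeta != 0.
  by rewrite mulf_neq0 ?expi_neq0// rC_eq0 gt_eqF ?mulr_gt0.
have q M : 1 < M -> ccvg (ntfilter zeta M) (fun z => (zeta - z) * (Phi z + 1)) (rC (2 * A) * zeta).
  move=> M1.
  have c1 : ccvg (ntfilter zeta M) (fun z => (zeta - z) * Psi z + rC A * (zeta + z) + (zeta - z))
      (0 + rC A * (zeta + zeta) + (zeta - zeta)).
    have cid := @ccvg_nt_id zeta M; have cc a : ccvg (ntfilter zeta M) (fun=> a) a by exact: ccvg_cst.
    apply: ccvgD; last exact: ccvgB.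
    by apply: ccvgD; [exact: key|apply: ccvgM => //; exact: ccvgD].
  have E0 : 0 + rC A * (zeta + zeta) + (zeta - zeta) = rC (2 * A) * zeta.
    by rewrite mulr_natl mulr2n rCD; ring.
  rewrite E0 in c1; apply: eq_ccvg c1; apply: (near_nt (d := 1)) => // z [zD _] _.
  rewrite /Psi /u; field; exact: expi_sub_neq0.
have quo M : 1 < M -> ccvg (ntfilter zeta M) (fun z => (phi z - al) / (z - zeta)) (2 * al / (rC (2 * A) * zeta)).
  move=> M1.
  have c1 : ccvg (ntfilter zeta M) (fun z => 2 * al * ((zeta - z) * (Phi z + 1))^-1) (2 * al / (rC (2 * A) * zeta)).
    by apply: ccvgM; [exact: ccvg_cst|apply: ccvgV => //; exact: q].
  apply: eq_ccvg c1; apply: (near_nt (d := 1)) => // z [zD _] _.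
  have d1 : zeta - z != 0 by exact: expi_sub_neq0.
  have d2 : al - phi z != 0 by apply: expi_sub_neq0; exact: Dphi.
  have a0 : al != 0 by exact: expi_neq0.
  have -> : Phi z + 1 = 2 * al / (al - phi z) by rewrite /Phi; field.
  have d3 : z - zeta != 0 by rewrite -opprB oppr_eq0.
  by field; rewrite d3 d1 d2 a0.
split; first exact: cabs_expi.
exists al, (2 * al / (rC (2 * A) * zeta)); split; [exact: cabs_expi| |exact/nt_limP].
apply/nt_limP => M M1.
have c1 : ccvg (ntfilter zeta M) (fun z => (phi z - al) / (z - zeta) * (z - zeta) + al)
    (2 * al / (rC (2 * A) * zeta) * (zeta - zeta) + al).
  apply: ccvgD; last exact: ccvg_cst.
  apply: ccvgM; first exact: quo.
  by apply: ccvgB; [exact: ccvg_nt_id|exact: ccvg_cst].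
rewrite subrr mulr0 add0r in c1; apply: eq_ccvg c1.
apply: (near_nt (d := 1)) => // z [zD _] _.
by rewrite divfK ?subrK// -opprB oppr_eq0 expi_sub_neq0.
Qed.
End JuliaCaratheodory.

(** * Clark measures *)

Section ClarkMeasure.
Variable R : realType.
Local Notation C := R[i].
Local Notation Re := complex.Re.
Local Notation Im := complex.Im.
Local Notation GR := (measurableTypeR R).
Local Notation lam := (@lebesgue_measure R).
Implicit Types (z w a : C) (s t : R).

Lemma poisson_ge0 z t : inD z -> 0 <= poisson z t.
Proof. by move=> zD; exact/ltW/poisson_gt0. Qed.

Lemma poisson_norm_le z t : inD z -> `|poisson z t| <= (1 + cabs z) / (1 - cabs z).
Proof. by move=> zD; rewrite ger0_norm ?poisson_ge0// poisson_le. Qed.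

Lemma push_measure (q : GR -> GR) (M : R) : 0 < M -> measurable_fun setT q ->
  exists m : {measure set GR -> \bar R},
  (forall A, measurable A -> m A = lam (`[0, M] `&` q @^-1` A)) /\
  (forall D (f : GR -> \bar R), measurable D -> (forall y, D (q y)) -> measurable_fun setT f ->
     (forall x, 0 <= f x)%E -> (\int[m]_(x in D) f x = \int[lam]_(y in `[0%R, M]) f (q y))%E).
Proof.
move=> M0 mq.
have mqA A : measurable A -> measurable (q @^-1` A).
  by move=> mA; rewrite -[X in measurable X]setTI; exact: mq.
pose U : {measure set GR -> \bar R} := uniform_prob M0.
pose m0 : {measure set GR -> \bar R} := mscale (NngNum (ltW M0)) (pushforward U q).
pose m : {measure set GR -> \bar R} := m0 mq.
have mE D (f : GR -> \bar R) : measurable D -> (forall y, D (q y)) -> measurable_fun setT f ->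
     (forall x, 0 <= f x)%E -> (\int[m]_(x in D) f x = \int[lam]_(y in `[0%R, M]) f (q y))%E.
  move=> mD Dq mf f0.
  have mfD : measurable_fun D f by exact: measurable_funTS.
  rewrite ge0_integral_mscale// (ge0_integral_pushforward mq)//=.
  have -> : q @^-1` D = setT by apply/seteqP; split => // y _; exact: Dq.
  rewrite integral_uniform//=; last exact: measurableT_comp.
  by rewrite muleA subr0 -EFinM mulfV ?gt_eqF// mul1e.
exists m; split=> // A mA.
have -> : m A = (\int[m]_(x in setT) (\1_A x)%:E)%E by rewrite integral_indic// setIT.
rewrite mE//; last by apply/measurable_EFinP; exact: measurable_indic.
rewrite (_ : (fun y => _) = fun y => (\1_(q @^-1` A) y)%:E)//.
by rewrite (integral_indic _ _ (mqA A mA))// setIC.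
Qed.

(** Lebesgue decomposition without densities: [N] is a null set of maximal mass, so a null set
    charged outside [N] could be added to it, contradicting maximality. *)
Lemma max_null (m : {measure set GR -> \bar R}) : (m setT < +oo)%E ->
  exists N : set GR, [/\ measurable N, lam N = 0%E &
    forall A, measurable A -> lam A = 0%E -> m (A `&` ~` N) = 0%E].
Proof.
move=> mfin.
have fin A : measurable A -> m A \is a fin_num.
  move=> mA; rewrite ge0_fin_numE ?measure_ge0//.
  by apply: le_lt_trans mfin; apply: le_measure; rewrite ?inE.
pose S := [set m A | A in [set A : set GR | measurable A /\ lam A = 0%E]].
pose sp := ereal_sup S.
have S0 : S (m set0) by exists set0 => //; split=> //; exact: measure0.
have spfin : sp \is a fin_num.
  rewrite ge0_fin_numE; last by apply: le_trans (ereal_sup_ubound S0); exact: measure_ge0.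
  apply: le_lt_trans mfin; apply: ub_ereal_sup => _ [A [mA _] <-].
  by apply: le_measure; rewrite ?inE.
have ex (n : nat) : exists A : set GR, [/\ measurable A, lam A = 0%E & (sp - (n.+1%:R^-1)%:E < m A)%E].
  have h : 0 < n.+1%:R^-1 :> R by rewrite invr_gt0.
  by have [_ [A [mA lA] <-] h'] := ub_ereal_sup_adherent h spfin; exists A.
have [F hF] := choice ex.
have mF n : measurable (F n) by case: (hF n).
have mU : measurable (\bigcup_n F n) by exact: bigcupT_measurable.
have lU : lam (\bigcup_n F n) = 0%E.
  apply/negligibleP => //; apply: negligible_bigcup => n; apply/negligibleP => //.
  by case: (hF n).
exists (\bigcup_n F n); split=> // A mA lA.
set N := \bigcup_n F n.
have mAN : measurable (A `&` ~` N) by apply: measurableI => //; exact: measurableC.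
have lAN : lam (A `&` ~` N) = 0%E.
  by apply: (subset_measure0 _ mA _ lA) => // x [].
have h1 : (m N + m (A `&` ~` N) <= sp)%E.
  rewrite -measureU//; last by rewrite setICA setICr setI0.
  apply: ereal_sup_ubound; exists (N `|` A `&` ~` N) => //; split.
    exact: measurableU.
  by rewrite measureU0.
have h2 : (sp <= m N)%E.
  apply/lee_addgt0Pr => e e0.
  have [n hn] : exists n : nat, n.+1%:R^-1 < e.
    exists (Num.truncn e^-1); rewrite -[ltRHS]invrK ltf_pV2 ?posrE ?invr_gt0//.
    exact: truncnS_gt.
  have [_ _ /ltW h] := hF n.
  rewrite -leeBlDr//; apply: le_trans (_ : (sp - (n.+1%:R^-1)%:E <= _)%E).
    by apply: leeB => //; rewrite lee_fin ltW.
  apply: le_trans h _; apply: le_measure; rewrite ?inE//; exact: bigcup_sup.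
apply/eqP; rewrite eq_le measure_ge0 andbT.
have : (m N + m (A `&` ~` N) <= m N + 0)%E by rewrite adde0; exact: le_trans h1 h2.
by rewrite leeD2lE// fin.
Qed.

Lemma expi_inj (s t : R) : 0 <= s < 2 * pi -> 0 <= t < 2 * pi -> expi s = expi t -> s = t.
Proof.
wlog ts : s t / t <= s.
  move=> H hs ht e; have [/H|/ltW /H h] := leP t s; first exact.
  by apply/esym/h.
move=> /andP[s0 s2] /andP[t0 t2] e.
have : expi (s - t) = 1 by rewrite expiD e -expiD subrr expi0.
have d0 : 0 <= s - t by rewrite subr_ge0.
have d2 : s - t < 2 * pi by lra.
set d := s - t in d0 d2 *; move=> [c1 _].
suff : d = 0 by rewrite /d; lra.
have [dp|dp] := leP d pi.
  by rewrite -[d]cosK ?c1 ?acos1// in_itv /= d0.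
have h : cos (2 * pi - d) = 1.
  have := cos2pi R => /=.
  have -> : 2 * pi - d = - d + pi *+ 2 by rewrite mulr2n; ring.
  by rewrite cosD2pi cosN.
have : 2 * pi - d = 0.
  by rewrite -[LHS]cosK ?h ?acos1// in_itv /=; apply/andP; split; lra.
lra.
Qed.

(** Otherwise sets of Lebesgue measure at most [2^-n] would each have mass above [e]; their upper
    limit is null by Borel-Cantelli, yet finiteness of [m] gives it mass at least [e]. *)
Lemma ac_eps (m : {measure set GR -> \bar R}) : (m setT < +oo)%E ->
  (forall A, measurable A -> lam A = 0%E -> m A = 0%E) ->
  forall e : R, 0 < e -> exists2 d : R, 0 < d &
    forall A, measurable A -> (lam A <= d%:E)%E -> (m A <= e%:E)%E.
Proof.
move=> mfin ac e e0; apply: contrapT => H.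
have ex (n : nat) : exists A : set GR, [/\ measurable A, (lam A <= ((2^-1) ^+ n)%:E)%E & (e%:E < m A)%E].
  apply: contrapT => H'; apply: H; exists ((2^-1) ^+ n); first by rewrite exprn_gt0// invr_gt0.
  by move=> A mA lA; rewrite leNgt; apply/negP => h; apply: H'; exists A.
have [F hF] := choice ex.
have mF n : measurable (F n) by case: (hF n).
have l0 : lam (lim_sup_set F) = 0%E.
  apply: lim_sup_set_cvg0 => //.
  apply: (@le_lt_trans _ _ (\sum_(n <oo) ((2^-1 : R) ^+ n)%:E)%E).
    by apply: lee_nneseries => n // _; case: (hF n).
  have c := @cvg_geometric_series R 1 2^-1.
  have h2 : `|2^-1 : R| < 1 by rewrite ger0_norm ?invr_ge0// invf_lt1// ltr1n.
  have {}c := c h2.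
  rewrite (_ : (\sum_(n <oo) _)%E = (1 / (1 - 2^-1))%:E); first exact: ltry.
  apply/cvg_lim => //; rewrite (_ : (fun n => _) = EFin \o series (geometric 1 (2^-1 : R))).
    by apply: cvg_EFin => //; exact: nearW.
  apply/funext => n /=; rewrite -sumEFin; apply: eq_bigr => i _.
  by rewrite /geometric /= mul1r.
have mL : measurable (lim_sup_set F).
  by apply: bigcap_measurable => // k _; exact: bigcup_measurable.
have m0 := ac _ mL l0.
have bfin : (m (\bigcup_(k in [set k | (0 <= k)%N]) F k) < +oo)%E.
  by apply: le_lt_trans mfin; apply: le_measure; rewrite ?inE//; exact: bigcup_measurable.
have := lim_sup_set_cvg m F mF bfin; rewrite m0 => c.
have : (e%:E <= 0)%E.
  rewrite -(cvg_lim _ c)//; apply: lime_ge; first by apply/cvg_ex; exists 0%E.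
  apply: nearW => n; have [_ _ /ltW h] := hF n; apply: le_trans h _.
  apply: le_measure; rewrite ?inE//; first exact: bigcup_measurable.
  by apply: bigcup_sup => /=.
by rewrite lee_fin leNgt e0.
Qed.

Section AbsolutelyContinuous.
Variables (phi : C -> C) (s : R).
Hypothesis sphi : self_map phi.
Hypothesis finE : finite_set (Eset phi).
Let M := poisson (phi 0) s.
Let M0 : 0 < M. Proof. by apply: poisson_gt0; case: sphi => _; apply; exact: inD0. Qed.
Variable q : R -> R.
Hypothesis mq : measurable_fun (setT : set GR) (q : GR -> GR).
Hypothesis q02 : forall y, 0 <= q y < 2 * pi.
Hypothesis qrep : forall z, inD z -> poisson (phi z) s = RI 0 M (fun y => poisson z (q y)).

(** An atom of mass [c] contributes [c * poisson z t] to the Herglotz integral, which is the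
    domination assumed in [julia_caratheodory]. *)
Lemma clark_atom t (c : R) : 0 < c -> (c%:E <= lam (`[0%R, M] `&` q @^-1` [set t]))%E ->
  Fset phi (expi t).
Proof.
move=> c0 hc; apply: (julia_caratheodory (s := s) sphi c0) => z zD.
have mS : measurable (q @^-1` [set t]).
  by rewrite -[X in measurable X]setTI; exact: mq.
have mp : measurable_fun setT (fun y => poisson z (q y)).
  by apply: measurable_poissonC => //; exact: measurable_cst.
have ip : rint 0 M (fun y => poisson z (q y)).
  apply: (bounded_rint (M := (1 + cabs z) / (1 - cabs z))) => // y _.
  exact: poisson_norm_le.
rewrite qrep// -lee_fin RI_EFin//.
apply: (@le_trans _ _ (\int[lam]_(y in `[0%R, M]) (poisson z t * \1_(q @^-1` [set t]) y)%:E)%E).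
  under eq_integral do rewrite EFinM.
  rewrite ge0_integralZl//=; last 2 first.
  - by apply/measurable_EFinP; exact: measurable_indic.
  - by rewrite lee_fin poisson_ge0.
  rewrite integral_indic// setIC mulrC EFinM; apply: lee_wpmul2l => //.
  by rewrite lee_fin poisson_ge0.
apply: ge0_le_integral => //=.
- by move=> y _; rewrite lee_fin mulr_ge0// poisson_ge0.
- apply/measurable_EFinP; apply: measurable_funM; first exact: measurable_cst.
  exact: measurable_indic.
- by apply/measurable_EFinP; exact: measurable_funTS.
- move=> y _; rewrite lee_fin indicE; case: (boolP (y \in _)); rewrite ?mulr1 ?mulr0.
    by rewrite inE /= => ->.
  by move=> _; rewrite poisson_ge0.
Qed.

(** Outside [Eset phi] every point has a neighbourhood without singular mass, and countably many
    such neighbourhoods suffice; the finitely many points of [Eset phi] off [Fset phi] carry no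
    atom. *)
Lemma clark_null (A : set R) : measurable A -> lam A = 0%E ->
  lam.-negligible [set y | [/\ 0 <= y <= M, A (q y) & ~ Fset phi (expi (q y))]].
Proof.
move=> mA lA.
have [m [mE mI]] := push_measure M0 mq.
have mI02 : measurable (@I02 R).
  rewrite (_ : I02 (R := R) = `[0, 2 * pi[%classic)//.
have mfin : (m setT < +oo)%E.
  rewrite mE// setIT lebesgue_measure_itv /= lte_fin M0; exact: ltry.
have clk : clark_measure phi (expi s) m.
  split; first exact: cabs_expi.
  - rewrite mE; last exact: measurableC.
    rewrite (_ : _ `&` _ = set0) ?measure0//.
    by apply/seteqP; split => // y [_ /=]; apply; exact: q02.
  - by apply: le_lt_trans mfin; apply: le_measure; rewrite ?inE.
  - move=> z zD; have pD : inD (phi z) by case: sphi => _; apply.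
    rewrite -poissonE// mI//; last 2 first.
    + by apply/measurable_EFinP; apply: measurable_poissonC => //; exact: measurable_cst.
    + by move=> x; rewrite lee_fin poisson_ge0.
    rewrite qrep// RI_EFin//.
    apply: (bounded_rint (M := (1 + cabs z) / (1 - cabs z))) => [|y _].
      by apply: measurable_poissonC => //; exact: measurable_cst.
    exact: poisson_norm_le.
have [N [mN lN hN]] := max_null mfin.
have mNC : measurable (~` N) by exact: measurableC.
(* Cutting [m] along its maximal null set gives a decomposition of the kind [in_sing_support] asks
   for. *)
pose mus : {measure set GR -> \bar R} := mrestr m mN.
pose mua : {measure set GR -> \bar R} := mrestr m mNC.
have sing t : I02 t -> ~ Eset phi (expi t) -> exists2 e : R, 0 < e &
    m (@I02 R `&` [set t' | cabs (expi t' - expi t) < e] `&` N) = 0%E.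
  move=> t02 nE; apply: contrapT => H; apply: nE; split; first exact: cabs_expi.
  move=> e0 e00; exists (expi t); split; first by rewrite subrr cabs0.
  exists (expi s), m; split=> //; exists mua, mus; split.
  - move=> B mB; rewrite /mua /mus /= /mrestr addeC -measureU//.
    + by rewrite -setIUr setUv setIT.
    + exact: measurableI.
    + exact: measurableI.
    + by rewrite setIACA setICr setI0.
  - by move=> B mB lB; rewrite /mua /= /mrestr hN.
  - by exists N; split => //; rewrite /mus /= /mrestr setICl measure0.
  - move=> e e0'; rewrite lt_neqAle measure_ge0 andbT eq_sym; apply/eqP => H'.
    by apply: H; exists e.
have mball t (e : R) : measurable [set t' : R | cabs (expi t' - expi t) < e].
  have c : continuous (fun t' => cabs (expi t' - expi t)).
    move=> x; apply: ccvg_cabs; apply: ccvgB; last exact: ccvg_cst.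
    by apply: ccvg_expi; exact: cvg_id.
  rewrite (_ : [set _ | _] = (fun t' => cabs (expi t' - expi t)) @^-1` `]-oo, e[%classic); last first.
    by apply/seteqP; split => x; rewrite /= in_itv.
  by rewrite -[X in measurable X]setTI; exact: (continuous_measurable_fun c).
have mBall t (e : R) : measurable (@I02 R `&` [set t' | cabs (expi t' - expi t) < e] `&` N).
  exact: (@measurableI _ GR _ _ (@measurableI _ GR _ _ mI02 (mball _ _)) mN).
have bad B : measurable B -> m B = 0%E -> lam.-negligible [set y | 0 <= y <= M /\ B (q y)].
  move=> mB h; exists (`[0, M] `&` q @^-1` B); split.
  - by apply: measurableI => //; rewrite -[X in measurable X]setTI; exact: mq.
  - by rewrite -mE.
  - by move=> y [y0 By]; split => //=; rewrite in_itv.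
(* Enumerates balls with rational centre parameter and radius [1 / (k + 1)]. Codes that fail to
   decode fall back to a default pair, which only repeats a ball. *)
pose pt (n : nat) : rat * nat := odflt (0, 0%N) (unpickle n).
pose Bn n := @I02 R `&` [set t' | cabs (expi t' - expi (ratr (pt n).1)) < (pt n).2.+1%:R^-1] `&` N.
have nB : lam.-negligible (\bigcup_n [set y | m (Bn n) = 0%E /\ (0 <= y <= M /\ Bn n (q y))]).
  apply: negligible_bigcup => n; have [h|h] := pselect (m (Bn n) = 0%E).
    apply: negligibleS (bad (Bn n) _ h) => [y []//|].
    exact: mBall.
  by apply: negligibleS (negligible_set0 _) => y [/h].
have [sE hsE] : exists sE : seq C, Eset phi = [set` sE] by apply/finite_seqP.
(* On a finite set the mass is atomic, and [clark_atom] rules out atoms off [Fset phi]. *)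
have nE (l : seq C) : lam.-negligible [set y | [/\ 0 <= y <= M, expi (q y) \in l & ~ Fset phi (expi (q y))]].
  elim: l => [|e l IH]; first by apply: negligibleS (negligible_set0 _) => y [].
  have [[t [t02 te nF]]|H] := pselect (exists t, [/\ I02 t, expi t = e & ~ Fset phi (expi t)]).
    have m1 : m [set t] = 0%E.
      have [//|pos] := eqVneq (m [set t]) 0%E.
      exfalso; apply: nF.
      have fm : m [set t] \is a fin_num.
        rewrite ge0_fin_numE ?measure_ge0//.
        by apply: le_lt_trans mfin; apply: le_measure; rewrite ?inE.
      apply: (@clark_atom t (fine (m [set t]))).
        by rewrite fine_gt0// lt_neqAle eq_sym pos measure_ge0 /= -ge0_fin_numE ?measure_ge0.
      by rewrite fineK// mE.
    have n1 := bad [set t] (measurable_set1 t) m1.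
    apply: negligibleS (negligibleU n1 IH) => y [y0].
    rewrite inE => /orP[/eqP he|hl] hF; [left|right] => //.
    by split=> //=; apply: expi_inj => //; rewrite he.
  apply: negligibleS IH => y [y0]; rewrite inE => /orP[/eqP he|hl] hF //.
  by exfalso; apply: H; exists (q y); split => //; exact: q02.
have nN := bad (A `&` ~` N) (measurableI _ _ mA mNC) (hN _ mA lA).
apply: negligibleS (negligibleU (negligibleU nN nB) (nE sE)) => y [y0 Ay nF].
have [Ny|nNy] := pselect (N (q y)); last by left; left.
have [Ey|nEy] := pselect (Eset phi (expi (q y))).
  by right; split => //; move: Ey; rewrite hsE.
left; right.
have [e e0 he] := sing _ (q02 y) nEy.
have [k hk] : exists k : nat, k.+1%:R^-1 < e / 2.
  exists (Num.truncn (e / 2)^-1); rewrite -[ltRHS]invrK ltf_pV2 ?posrE ?invr_gt0 ?divr_gt0//.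
  exact: truncnS_gt.
have k0 : 0 < k.+1%:R^-1 :> R by rewrite invr_gt0.
have cexpi : ccvg (nbhs (q y)) (@expi R) (expi (q y)) by apply: ccvg_expi; exact: cvg_id.
have nb : \forall x \near (q y : R), cabs (expi x - expi (q y)) < k.+1%:R^-1.
  by move/ccvg_lt : cexpi; exact.
move/nbhs_ballP : nb => [d /= d0 hd].
have [a ha] : exists a : rat, ratr a \in `](q y), (q y + d)[ by apply: rat_in_itvoo; rewrite ltrDl.
have ad : cabs (expi (ratr a) - expi (q y)) < k.+1%:R^-1.
  apply: hd; rewrite /ball /=; move: ha; rewrite in_itv /= => /andP[h1 h2].
  by rewrite distrC gtr0_norm ?subr_gt0// ltrBlDl.
have [n pE] : exists n, pt n = (a, k) by exists (pickle (a, k)); rewrite /pt pickleK.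
exists n => //; split; last first.
  split=> //; split=> //; split; first exact: q02.
  by rewrite /= pE /= cabsB.
apply/eqP; rewrite -measure_le0 -he; apply: le_measure; rewrite ?inE.
- exact: mBall.
- exact: mBall.
- move=> t [[t1 t2] t3]; split => //; split => //=; move: t2; rewrite /= pE /= => t2.
  apply: le_lt_trans (ler_cabs_distD _ _ (expi (ratr a))) _.
  by apply: lt_trans (ltrD t2 ad) _; rewrite [e]splitr; exact: ltrD.
Qed.

(** By [clark_null] the Clark measure restricted to the complement of [Fset phi] is absolutely
    continuous; this is the epsilon-delta form, read on the quantile segment. *)
Lemma clark_equi (finF : finite_set (Fset phi)) (e : R) : 0 < e -> exists2 d : R, 0 < d &
  forall B : set R, measurable B -> (lam B <= d%:E)%E ->
    let Y := [set y | [/\ 0 <= y <= M, B (q y) & ~ Fset phi (expi (q y))]] in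
    measurable Y /\ (lam Y <= e%:E)%E.
Proof.
move=> e0; have [m [mE _]] := push_measure M0 mq.
have [F hF] : exists F : seq C, Fset phi = [set` F] by apply/finite_seqP.
have mFa : measurable [set t : GR | expi t \in F].
  elim: {hF} F => [|z F IH]; first by rewrite (_ : [set _ | _] = set0); [exact: measurable0|apply/seteqP; split].
  rewrite (_ : [set _ | _] = [set t : R | cabs (expi t - z) <= 0] `|` [set t | expi t \in F]).
    apply: measurableU => //.
    have c : continuous (fun t => cabs (expi t - z)).
      move=> x; apply: ccvg_cabs; apply: ccvgB; last exact: ccvg_cst.
      by apply: ccvg_expi; exact: cvg_id.
    rewrite (_ : [set _ | _] = (fun t => cabs (expi t - z)) @^-1` `]-oo, 0]%classic); last first.
      by apply/seteqP; split => x; rewrite /= in_itv.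
    by rewrite -[X in measurable X]setTI; exact: (continuous_measurable_fun c).
  have E t : (cabs (expi t - z) <= 0) = (expi t == z).
    by rewrite -subr_eq0 -cabs_eq0 eq_le cabs_ge0 andbT.
  apply/seteqP; split => t; rewrite /= inE E.
    by case/orP => ->; [left|right].
  by case=> ->; rewrite ?orbT.
have mFC : measurable (~` [set t : GR | expi t \in F]) by exact: measurableC.
pose m' : {measure set GR -> \bar R} := mrestr m mFC.
have mfin : (m' setT < +oo)%E.
  rewrite /m' /= /mrestr setTI mE//.
  apply: (@le_lt_trans _ _ (lam `[0, M])).
    apply: le_measure; rewrite ?inE//.
    by apply: measurableI => //; rewrite -[X in measurable X]setTI; exact: mq.
  rewrite lebesgue_measure_itv /= lte_fin M0; exact: ltry.
have m'E B : measurable B -> m' B = lam [set y | [/\ 0 <= y <= M, B (q y) & ~ Fset phi (expi (q y))]].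
  move=> mB; rewrite /m' /= /mrestr mE; last exact: measurableI.
  congr (lam _); rewrite hF; apply/seteqP; split=> y /=.
    by rewrite in_itv /= => -[? []].
  by case=> ? ? ?; rewrite in_itv.
have mY B : measurable B -> measurable [set y | [/\ 0 <= y <= M, B (q y) & ~ Fset phi (expi (q y))]].
  move=> mB; rewrite (_ : [set _ | _] = `[0, M] `&` q @^-1` (B `&` ~` [set t : GR | expi t \in F])).
    apply: measurableI => //; rewrite -[X in measurable X]setTI; apply: mq => //.
    exact: measurableI.
  rewrite hF; apply/seteqP; split=> y /=.
    by case=> ? ? ?; rewrite in_itv.
  by rewrite in_itv /= => -[? []].
have ac A : measurable A -> lam A = 0%E -> m' A = 0%E.
  by move=> mA lA; rewrite m'E//; apply/negligibleP; [exact: mY|exact: clark_null].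
have [d d0 hd] := ac_eps mfin ac e0.
by exists d => // B mB lB; split; [exact: mY|rewrite -m'E// hd].
Qed.
End AbsolutelyContinuous.
End ClarkMeasure.

Ltac ppos := repeat first [ assumption | exact: pi_gt0 | apply: exprn_gt0
  | apply: divr_gt0 | apply: mulr_gt0 | apply: addr_gt0 | by [] ].

(** * Boundary values and uniform integrability *)

Section Boundary.
Variable R : realType.
Local Notation C := R[i].
Local Notation Re := complex.Re.
Local Notation Im := complex.Im.
Local Notation GR := (measurableTypeR R).
Local Notation lam := (@lebesgue_measure R).
Local Notation mfunR f := (measurable_fun (setT : set GR) (f : GR -> R)).
Implicit Types (z w a : C) (s t : R).

Lemma RI_dct_ae (f : nat -> R -> R) (g : R -> R) (a b K : R) (N : set R) :
  (forall n, mfunR (f n)) -> mfunR g ->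
  (forall n x, a <= x <= b -> `|f n x| <= K) ->
  measurable N -> lam N = 0%E ->
  (forall x, a <= x <= b -> ~ N x -> f^~ x @ \oo --> g x) ->
  rint a b g /\ (fun n => RI a b (f n)) @ \oo --> RI a b g.
Proof.
move=> mf mg hK mN N0 fg.
have mfE n : measurable_fun `[a, b] (EFin \o f n).
  by apply/measurable_EFinP; exact: measurable_funS measurableT (@subsetT _ _) (mf n).
have mgE : measurable_fun `[a, b] (EFin \o g).
  by apply/measurable_EFinP; exact: measurable_funS measurableT (@subsetT _ _) mg.
have nN : lam.-negligible N by exact/negligibleP.
have fgE : {ae lam, forall x, `[a, b]%classic x -> (fun n => (EFin \o f n) x) @ \oo --> (EFin \o g) x}.
  apply: negligibleS nN => x /= H; apply: contrapT => nx; apply: H.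
  by rewrite /= in_itv /= => hx; apply: cvg_EFin; [exact: nearW|exact: fg].
have bd : {ae lam, forall x, forall n, `[a, b]%classic x -> (`|(EFin \o f n) x| <= cst K%:E x)%E}.
  by apply: aeW => x n; rewrite /= in_itv /= lee_fin; exact: hK.
have [ig _ H] := @dominated_convergence _ _ R lam `[a, b] (measurable_itv _) (fun n => EFin \o f n)
  (EFin \o g) (cst K%:E) mfE mgE fgE (rint_cst a b K) bd.
split=> //.
rewrite /RI /Rintegral; apply: fine_cvg; rewrite fineK; first exact: H.
exact: integrable_fin_num.
Qed.

Lemma cvg_minl (T : Type) (F : set_system T) {FF : Filter F} (f : T -> R) (a K : R) :
  f @ F --> a -> (fun x => Num.min (f x) K) @ F --> Num.min a K.
Proof.
move=> fa; apply/cvgrPdist_lt => e e0; move/cvgrPdist_lt : fa => /(_ e e0).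
apply: filterS => x; apply: le_lt_trans.
rewrite ler_norml !minEle; apply/andP; split.
  by case: (leP a K) => h1; case: (leP (f x) K) => h2; have := ler_norm (f x - a);
    rewrite distrC; have := normr_ge0 (a - f x); lra.
by case: (leP a K) => h1; case: (leP (f x) K) => h2; have := ler_norm (a - f x);
    have := normr_ge0 (a - f x); lra.
Qed.

(** Monotone convergence for truncations: integrability is deduced from a bound common to all
    truncated integrals, the only quantities to which bounded convergence gives access. *)
Lemma rint_trunc (f : R -> R) (a b B : R) : a <= b ->
  mfunR f -> (forall t, 0 <= f t) ->
  (forall n : nat, RI a b (fun t => Num.min (f t) n%:R) <= B) ->
  [/\ rint a b f, RI a b f <= B & (fun n : nat => RI a b (fun t => Num.min (f t) n%:R)) @ \oo --> RI a b f].
Proof.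
move=> ab mf f0 hB.
pose g n t := Num.min (f t) n%:R.
have mg n : mfunR (g n).
  by apply: measurable_minr => //; exact: measurable_cst.
have g0 n t : 0 <= g n t by rewrite /g le_min f0 ler0n.
have ig n : rint a b (g n).
  apply: (bounded_rint (M := n%:R) (mg n)) => t _.
  by rewrite ger0_norm// /g ge_min lexx orbT.
have := @cvg_monotone_convergence _ _ R lam `[a, b] (measurable_itv _) (fun n t => (g n t)%:E).
have h1 n : measurable_fun `[a, b] (fun t => (g n t)%:E).
  by apply/measurable_EFinP; exact: measurable_funTS (mg n).
have h2 n t : `[a, b]%classic t -> (0 <= (g n t)%:E)%E by rewrite lee_fin.
have h3 t : `[a, b]%classic t -> {homo (fun n => (g n t)%:E) : n m / (n <= m)%N >-> (n <= m)%E}.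
  move=> _ n m nm; rewrite lee_fin /g le_min ge_min lexx /= ge_min.
  by rewrite ler_nat nm orbT.
move=> /(_ h1 h2 h3).
have lE t : limn (fun n => (g n t)%:E) = (f t)%:E.
  apply/cvg_lim => //; apply: cvg_EFin; first exact: nearW.
  apply: cvg_near_cst; exists (Num.truncn (f t)).+1 => // n /= hn.
  apply/min_idPl; apply: ltW; apply: lt_le_trans (_ : (Num.truncn (f t)).+1%:R <= _).
    exact: truncnS_gt.
  by rewrite ler_nat.
under [X in _ --> X -> _]eq_integral do rewrite lE.
move=> c.
have le : (\int[lam]_(x in `[a, b]) (f x)%:E <= B%:E)%E.
  rewrite -(cvg_lim _ c)//; apply: lime_le; first by apply/cvg_ex; eexists; exact: c.
  by apply: nearW => n; rewrite -RI_EFin// lee_fin hB.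
have i : rint a b f.
  apply/integrableP; split; first by apply/measurable_EFinP; exact: measurable_funTS.
  under eq_integral do rewrite /= ger0_norm//.
  by apply: le_lt_trans le _; exact: ltry.
split=> //; first by rewrite -lee_fin RI_EFin.
rewrite /RI /Rintegral; apply: fine_cvg; rewrite fineK; first exact: c.
exact: integrable_fin_num.
Qed.

Lemma RI_markov (f : R -> R) (a b k : R) : mfunR f -> (forall t, 0 <= f t) ->
  rint a b f -> 0 < k ->
  (lam ([set t | (k < f t)%R] `&` `[a, b]) <= (RI a b f / k)%:E)%E.
Proof.
move=> mf f0 fi k0.
have mS : measurable [set t | k < f t].
  rewrite (_ : [set _ | _] = f @^-1` `]k, +oo[%classic); last first.
    by apply/seteqP; split => x; rewrite /= in_itv /= andbT.
  by rewrite -[X in measurable X]setTI; exact: mf.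
have -> : lam ([set t | k < f t] `&` `[a, b]) = (\int[lam]_(x in `[a, b]) (\1_[set t | (k < f t)%R] x)%:E)%E.
  by rewrite integral_indic.
rewrite mulrC EFinM -lee_pdivrMl ?invr_gt0// invrK.
rewrite -ge0_integralZl//=; last 2 first.
- by apply/measurable_EFinP; exact: measurable_indic.
- by rewrite lee_fin ltW.
rewrite RI_EFin//; apply: ge0_le_integral => //=.
- by move=> y _; rewrite -EFinM lee_fin mulr_ge0// ltW.
- by apply/measurable_EFinP; apply: measurable_funM; [exact: measurable_cst|exact: measurable_indic].
- by apply/measurable_EFinP; exact: measurable_funTS.
- move=> y _; rewrite -EFinM lee_fin indicE; case: (boolP (y \in _)); rewrite ?mulr1 ?mulr0//.
  by rewrite inE /= => /ltW.
Qed.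

Lemma radial_seq (f : C -> C) t l : radial_lim f t l -> ccvg \oo (fun n => f (zpol (rk R n) t)) l.
Proof.
move=> h; apply/ccvg_lt => e /h[d d0 hd].
have c := @rk_cvg R; move/cvgrPdist_lt : c => /(_ d d0); apply: filterS => n.
rewrite ger0_norm ?subr_ge0 ?(ltW (rk_lt1 _ _))// => hn.
apply: hd; last by lra.
rewrite rk_lt1 andbT /rk subr_gt0 invf_lt1 ?ltr0n// ltr1n//.
Qed.

(** Where no radial limit inside the disc is guaranteed, [w] takes the default value 0; it is then
    measurable and disc-valued everywhere, while the null set is kept for the limit statement
    only. *)
Lemma boundary_fun (phi : C -> C) : self_map phi ->
  ae_circle (fun t => exists l, radial_lim phi t l /\ cabs l < 1) ->
  exists w : R -> C, [/\ mfunR (fun t => Re (w t)), mfunR (fun t => Im (w t)),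
    (forall t, inD (w t)) & exists N, [/\ measurable N, lam N = 0%E &
      forall t, 0 <= t <= 2 * pi -> ~ N t -> radial_lim phi t (w t)]].
Proof.
move=> [hphi Dphi] [N [mN lN hN]].
have ex t : exists l : C, inD l /\ (((`[0, 2 * pi] `\` N) t -> radial_lim phi t l) /\
    (~ (`[0, 2 * pi] `\` N) t -> l = 0)).
  have [Dt|nDt] := pselect ((`[0, 2 * pi] `\` N) t).
    have [l [hl l1]] : exists l, radial_lim phi t l /\ cabs l < 1.
      by move: Dt => [] /=; rewrite in_itv /=; exact: hN.
    by exists l; do !split => //.
  by exists 0; do !split => //; exact: inD0.
have [w hw] := choice ex.
have mD : measurable (`[0, 2 * pi] `\` N) by exact: measurableD.
have m (P : C -> R) : P 0 = 0 -> (forall n, continuous (fun t => P (phi (zpol (rk R n) t)))) ->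
    (forall (f : nat -> C) l, ccvg \oo f l -> (fun n => P (f n)) @ \oo --> P l) ->
    mfunR (fun t => P (w t)).
  move=> P0 cP hP.
  rewrite (_ : (fun t => P (w t)) = (fun t => P (w t)) \_ (`[0, 2 * pi] `\` N)); last first.
    apply/funext => t; rewrite patchE; case: ifPn => // /negP nt.
    by have [_ [_ ->]] := hw t => // h; apply: nt; rewrite inE.
  apply: (iffLR (measurable_restrictT (D := `[0, 2 * pi] `\` N) (fun t => P (w t)) mD)).
  apply: (measurable_fun_cvg (h := fun n t => P (phi (zpol (rk R n) t)))).
    by move=> n; apply: measurable_funTS; exact: continuous_measurable_fun.
  move=> t Dt; apply: hP; apply: radial_seq.
  by have [_ [h _]] := hw t; exact: h.
exists w; split.
- by apply: m => // [n|f l]; [exact: circ_contRe (normrk _ _)|exact: ccvg_Re].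
- by apply: m => // [n|f l]; [exact: circ_contIm (normrk _ _)|exact: ccvg_Im].
- by move=> t; case: (hw t).
- exists N; split=> // t ht nN; have [_ [h _]] := hw t.
  by apply: h; split => //=; rewrite in_itv.
Qed.

Lemma zpol_expi (r t : R) : r <= 1 -> cabs (zpol r t - expi t) = 1 - r.
Proof.
move=> r1; rewrite /zpol -{2}[expi _]mul1r -mulrBl cabsM cabs_expi mulr1 -rC1 -rCB cabs_rC.
by rewrite distrC ger0_norm// subr_ge0.
Qed.

Lemma poisson_lip z s s' : inD z ->
  `|poisson z s - poisson z s'| <= 2 / (1 - cabs z) ^+ 2 * cabs (expi s - expi s').
Proof.
move=> zD; rewrite !poissonE// -creB.
have d1 := expi_sub_neq0 s zD; have d2 := expi_sub_neq0 s' zD.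
have -> : (expi s + z) / (expi s - z) - (expi s' + z) / (expi s' - z) =
  2 * z * (expi s' - expi s) / ((expi s - z) * (expi s' - z)) by field; rewrite d1 d2.
apply: le_trans (cabs_Re _) _.
have k x : 1 - cabs z <= cabs (expi x - z) by rewrite -(@cabs_expi _ x) ler_cabs_dist.
have z0 : 0 < 1 - cabs z by rewrite subr_gt0.
rewrite cabsf_div !cabsM (_ : cabs (2 : C) = 2); last first.
  have -> : (2 : C) = rC (1 + 1) by rewrite rCD rC1.
  by rewrite cabs_rC ger0_norm.
rewrite [cabs (expi s' - _)]cabsB mulrAC; apply: ler_wpM2r; first exact: cabs_ge0.
apply: ler_pM.
- by rewrite mulr_ge0 ?cabs_ge0.
- by rewrite invr_ge0 mulr_ge0 ?cabs_ge0.
- by rewrite ler_piMr ?ltW.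
- rewrite lef_pV2 ?posrE ?exprn_gt0 ?mulr_gt0 ?cabs_gt0// expr2.
  by apply: ler_pM => //; exact: ltW.
Qed.

Section Uniform.
Variable phi : C -> C.
Hypothesis sphi : self_map phi.
Hypothesis finE : finite_set (Eset phi).
Hypothesis finF : finite_set (Fset phi).
Variables (w : R -> C) (N : set R).
Hypothesis mRe : mfunR (fun t => Re (w t)).
Hypothesis mIm : mfunR (fun t => Im (w t)).
Hypothesis wD : forall t, inD (w t).
Hypothesis mN : measurable N.
Hypothesis lN : lam N = 0%E.
Hypothesis hN : forall t, 0 <= t <= 2 * pi -> ~ N t -> radial_lim phi t (w t).

Let hphi : holo_on_D phi. Proof. by case: sphi. Qed.
Let Dphi z : inD z -> inD (phi z). Proof. by case: sphi => _; apply. Qed.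
Let p n t s := poisson (phi (zpol (rk R n) t)) s.
Let P t s := poisson (w t) s.
Let M s := poisson (phi 0) s.
Let pi2 : 0 < 2 * pi :> R := @pi2_gt0 R.
Let zD n t : inD (zpol (rk R n) t). Proof. by rewrite /inD cabs_zpol normrk. Qed.
Let p0 n t s : 0 <= p n t s. Proof. by apply: poisson_ge0; apply: Dphi; exact: zD. Qed.
Let P0 t s : 0 <= P t s. Proof. exact: poisson_ge0. Qed.
Let M0 s : 0 < M s. Proof. by apply: poisson_gt0; apply: Dphi; exact: inD0. Qed.

Let pcont n s : continuous (p n ^~ s).
Proof.
move=> t; apply: poisson_ccvg; [by apply: Dphi; exact: zD| |exact: cvg_cst].
exact: circ_ccvg (normrk _ _).
Qed.

Let pmeas n s : mfunR (p n ^~ s).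
Proof. exact: (continuous_measurable_fun (@pcont n s)). Qed.

Let Pmeas s : mfunR (P ^~ s).
Proof. by apply: measurable_poissonC => //; exact: measurable_cst. Qed.

Let pP s t : 0 <= t <= 2 * pi -> ~ N t -> p ^~ t ^~ s @ \oo --> P t s.
Proof.
move=> ht nt; apply: poisson_ccvg; [exact: wD| |exact: cvg_cst].
by apply: radial_seq; exact: hN.
Qed.

Let Rep n s : RI 0 (2 * pi) (p n ^~ s) = 2 * pi * M s.
Proof.
have -> : p n ^~ s = fun t => Re ((expi s + phi (zpol (rk R n) t)) / (expi s - phi (zpol (rk R n) t))).
  by apply/funext => t; rewrite /p poissonE//; apply: Dphi; exact: zD.
have := mean_value (holo_cayley s sphi) (rk01 R n) => /= ->.
by rewrite /M poissonE//; apply: Dphi; exact: inD0.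
Qed.

(** Fatou's inequality, reached through truncations. It is only an inequality: the boundary kernel
    is the density of the absolutely continuous part of a Clark measure, and the singular part is
    missing. *)
Lemma boundary_poisson s : [/\ rint 0 (2 * pi) (P ^~ s), RI 0 (2 * pi) (P ^~ s) <= 2 * pi * M s &
  (fun n : nat => RI 0 (2 * pi) (fun t => Num.min (P t s) n%:R)) @ \oo --> RI 0 (2 * pi) (P ^~ s)].
Proof.
apply: rint_trunc => //; first exact: ltW.
move=> K; have K0 : 0 <= K%:R :> R by [].
have [_ c] := @RI_dct_ae (fun n t => Num.min (p n t s) K%:R) (fun t => Num.min (P t s) K%:R)
  0 (2 * pi) K%:R N (fun n => measurable_minr (pmeas n s) (measurable_cst _))
  (measurable_minr (Pmeas s) (measurable_cst _))
  (fun n t _ => ltac:(by rewrite ger0_norm ?ge_min ?lexx ?orbT// le_min p0 K0)) mN lN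
  (fun t ht nt => cvg_minl (K := K%:R) (@pP s t ht nt)).
apply: (ler_cvg_to c (cvg_cst _)); apply: filterE => n; rewrite -(Rep n s).
apply: le_RI.
- apply: (bounded_rint (M := K%:R)); first exact: measurable_minr (pmeas n s) (measurable_cst _).
  by move=> t _; rewrite ger0_norm ?ge_min ?lexx ?orbT// le_min p0 K0.
- exact: contT_rint.
- by move=> t _; rewrite ge_min lexx.
Qed.

Lemma clark_rep s : exists q : R -> R, [/\ measurable_fun (setT : set GR) (q : GR -> GR), (forall y, 0 <= q y < 2 * pi) &
  forall z, inD z -> poisson (phi z) s = RI 0 (M s) (fun y => poisson z (q y))].
Proof.
have E z : inD z -> Re ((expi s + phi z) / (expi s - phi z)) = poisson (phi z) s.
  by move=> zD'; rewrite poissonE//; exact: Dphi.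
have [|q [mq q02 qr]] := herglotz (holo_cayley s sphi).
  by move=> z zD'; rewrite E//; apply: poisson_ge0; exact: Dphi.
by exists q; split => // z zD'; rewrite -E// qr// E//; exact: inD0.
Qed.

Let rbd n := (1 + rk R n) / (1 - rk R n).
Let zple n t x : 0 <= poisson (zpol (rk R n) t : C) x <= rbd n.
Proof.
rewrite poisson_ge0//=; have := poisson_le x (zD n t).
by rewrite cabs_zpol ger0_norm ?rk_ge0.
Qed.

(** By Fubini and the symmetry of the kernel, integrating [g] against [p n] amounts to integrating
    the Poisson extension of [g], on the circle of radius [rk n], against the Clark measure. *)
Lemma clark_swap n s q (g : R -> R) : measurable_fun (setT : set GR) (q : GR -> GR) ->
  (forall z, inD z -> poisson (phi z) s = RI 0 (M s) (fun y => poisson z (q y))) ->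
  mfunR g -> (forall t, 0 <= g t <= 1) ->
  RI 0 (2 * pi) (fun t => g t * p n t s) =
  RI 0 (M s) (fun y => RI 0 (2 * pi) (fun t => g t * poisson (zpol (rk R n) (q y)) t)).
Proof.
move=> mq qr mg g01.
have mp t : mfunR (fun y => poisson (zpol (rk R n) t) (q y)).
  by apply: measurable_poissonC => //; exact: measurable_cst.
transitivity (RI 0 (2 * pi) (fun t => RI 0 (M s) (fun y => g t * poisson (zpol (rk R n) t) (q y)))).
  apply: eq_RI => t _; rewrite RIZ; first by rewrite /p qr.
  apply: (bounded_rint (M := rbd n)) => // y _.
  by have /andP[h1 h2] := zple n t (q y); rewrite ger0_norm.
rewrite (@RI_swap _ (fun t y => g t * poisson (zpol (rk R n) t) (q y)) _ _ _ _ (rbd n)).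
- by apply: eq_RI => y _; apply: eq_RI => t _; rewrite poisson_zpolC.
- apply: measurable_funM; first exact: measurableT_comp mg measurable_fst.
  apply: measurable_poissonC => //.
  + have cR : continuous (fun t : R => Re (zpol (rk R n) t)).
      by move=> t; apply: ccvg_Re; apply: zpol_cvg; [exact: cvg_cst|exact: cvg_id].
    exact: measurableT_comp (continuous_measurable_fun cR) measurable_fst.
  + have cR : continuous (fun t : R => Im (zpol (rk R n) t)).
      by move=> t; apply: ccvg_Im; apply: zpol_cvg; [exact: cvg_cst|exact: cvg_id].
    exact: measurableT_comp (continuous_measurable_fun cR) measurable_fst.
  + exact: measurableT_comp mq measurable_snd.
- by move=> t y; have /andP[? _] := g01 t; rewrite mulr_ge0// poisson_ge0.
- move=> t y _ _; have /andP[? ?] := g01 t; have /andP[? ?] := zple n t (q y).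
  by rewrite -[rbd n]mul1r ler_pM.
Qed.

Variables (X : C -> R) (L d0 : R).
Hypothesis X01 : forall z, 0 <= X z <= 1.
Hypothesis L0 : 0 < L.
Hypothesis XL : forall z z', `|X z - X z'| <= L * cabs (z - z').
Hypothesis d00 : 0 < d0.
Hypothesis Xvan : forall zeta z, Fset phi zeta -> cabs (z - zeta) <= d0 -> X z = 0.
Let chi t := X (expi t).
Let chi01 t : 0 <= chi t <= 1. Proof. exact: X01. Qed.
Let chi0 t : 0 <= chi t. Proof. by case/andP: (chi01 t). Qed.
Let chi1 t : chi t <= 1. Proof. by case/andP: (chi01 t). Qed.

Let chic : continuous chi.
Proof.
move=> t; apply/cvgrPdist_lt => e e0.
have c : ccvg (nbhs t) (@expi R) (expi t) by apply: ccvg_expi; exact: cvg_id.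
have eL : 0 < e / L by rewrite divr_gt0.
have : \forall x \near t, cabs (expi x - expi t) < e / L by move/ccvg_lt : c; exact.
apply: filterS => x; rewrite ltr_pdivlMr// => h.
by apply: le_lt_trans (XL _ _) _; rewrite cabsB mulrC.
Qed.

Let chiu : ucirc chi.
Proof.
move=> e e0; exists (e / L); first by rewrite divr_gt0.
move=> s t _ _; rewrite ltr_pdivlMr// => h.
by apply: le_lt_trans (XL _ _) _; rewrite mulrC.
Qed.

Let chim : mfunR chi. Proof. exact: (continuous_measurable_fun chic). Qed.
Let G n s := RI 0 (2 * pi) (fun t => chi t * p n t s).
Let M1 := (1 + cabs (phi 0)) / (1 - cabs (phi 0)).
Let MM1 s : M s <= M1. Proof. by apply: poisson_le; apply: Dphi; exact: inD0. Qed.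
Let M10 : 0 < M1. Proof. exact: lt_le_trans (M0 0) (MM1 0). Qed.

(** Weak convergence to the Clark measure at a rate independent of [s]: approximating [chi] by its
    Poisson extension involves neither [phi] nor [s], and the masses [M s] are bounded by [M1]. *)
Lemma clark_weak : exists Ginf : R -> R, forall e : R, 0 < e ->
  \forall n \near \oo, forall s, `|G n s - Ginf s| <= e.
Proof.
have [q hq] := choice clark_rep.
exists (fun s => 2 * pi * RI 0 (M s) (fun y => chi (q s y))) => e e0.
have eM : 0 < e / M1 by rewrite divr_gt0.
have [d dd0 hd] := approx_id chic chiu eM.
have c := @rk_cvg R; move/cvgrPdist_lt : c => /(_ d dd0); apply: filterS => n.
rewrite ger0_norm ?subr_ge0 ?(ltW (rk_lt1 _ _))// => hn s.
have [mq q02 qr] := hq s.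
have iq : rint 0 (M s) (fun y => chi (q s y)).
  apply: (bounded_rint (M := 1)); first exact: measurableT_comp chim mq.
  by move=> y _; rewrite ger0_norm.
rewrite /G (clark_swap n mq qr chim chi01) -RIZ//.
set U := fun y => _.
have mU : mfunR U.
  have cU : continuous (fun x => RI 0 (2 * pi) (fun t => chi t * poisson (zpol (rk R n) x) t)).
    move=> x; apply: poisson_int_ccvg => //; first by apply: nearW => ?; exact: zD.
    by apply: zpol_cvg; [exact: cvg_cst|exact: cvg_id].
  exact: measurableT_comp (continuous_measurable_fun cU) mq.
have bd y : `|U y - 2 * pi * chi (q s y)| <= e / M1.
  apply: hd => //; first by case/andP: (q02 y) => -> /ltW ->.
  by rewrite zpol_expi// ltW// rk_lt1.
have iU : rint 0 (M s) U.
  apply: (bounded_rint (M := e / M1 + 2 * pi)) => // y _.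
  rewrite -[U y](subrK (2 * pi * chi (q s y))); apply: le_trans (ler_normD _ _) _.
  rewrite lerD// ger0_norm; last by rewrite mulr_ge0// ltW.
  by apply: ler_piMr => //; exact: ltW.
rewrite -RIB//; last exact: rintZ.
apply: (le_trans (RI_bound (ltW (M0 s)) _ (fun y _ => bd y))); first by apply: rintB => //; exact: rintZ.
by rewrite subr0 mulrAC ler_pdivrMr// ler_pM2l.
Qed.

Let RIchi s (K : R) : 0 <= K ->
  (fun n => RI 0 (2 * pi) (fun t => chi t * Num.min (p n t s) K)) @ \oo -->
  RI 0 (2 * pi) (fun t => chi t * Num.min (P t s) K).
Proof.
move=> K0.
have bd (x t : R) : 0 <= x -> `|chi t * Num.min x K| <= K.
  move=> x0; rewrite ger0_norm ?mulr_ge0 ?le_min ?x0//.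
  apply: le_trans (_ : Num.min x K <= _); last by rewrite ge_min lexx orbT.
  by rewrite ler_piMl// le_min x0.
have [] // := @RI_dct_ae (fun n t => chi t * Num.min (p n t s) K) (fun t => chi t * Num.min (P t s) K)
  0 (2 * pi) K N.
- by move=> k; apply: measurable_funM => //; exact: measurable_minr (pmeas k s) (measurable_cst _).
- by apply: measurable_funM => //; exact: measurable_minr (Pmeas s) (measurable_cst _).
- by move=> k t _; exact: bd.
- by move=> t ht nt; apply: cvgM; [exact: cvg_cst|apply: cvg_minl; exact: pP].
Qed.

Section Limit.
Variable Ginf : R -> R.
Hypothesis hG : forall e : R, 0 < e -> \forall n \near \oo, forall s, `|G n s - Ginf s| <= e.

Let Gcvg s : G ^~ s @ \oo --> Ginf s.
Proof.
apply/cvgrPdist_le => e /hG; apply: filterS => n h; rewrite distrC; exact: h.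
Qed.

Let ichi (f : R -> R) (K : R) : mfunR f -> (forall t, 0 <= f t <= K) ->
  rint 0 (2 * pi) (fun t => chi t * f t).
Proof.
move=> mf fK; apply: (bounded_rint (M := K)); first exact: measurable_funM.
move=> t _; have /andP[f0 fk] := fK t; rewrite ger0_norm ?mulr_ge0//.
by apply: le_trans fk; rewrite ler_piMl.
Qed.

Let ichip n s : rint 0 (2 * pi) (fun t => chi t * p n t s).
Proof. by apply: contT_rint => t; apply: cvgM; [exact: chic|exact: pcont]. Qed.

Let trunc_le s (K : R) : 0 <= K -> RI 0 (2 * pi) (fun t => chi t * Num.min (P t s) K) <= Ginf s.
Proof.
move=> K0; apply: (ler_cvg_to (@RIchi s K K0) (@Gcvg s)); apply: filterE => n.
apply: le_RI => //.
  apply: (ichi (K := K)); first exact: measurable_minr (pmeas n s) (measurable_cst _).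
  by move=> t; rewrite le_min p0 K0 ge_min lexx orbT.
by move=> t _; rewrite ler_wpM2l// ge_min lexx.
Qed.

Let full_le s : rint 0 (2 * pi) (fun t => chi t * P t s) /\ RI 0 (2 * pi) (fun t => chi t * P t s) <= Ginf s.
Proof.
have [iP _ cP] := boundary_poisson s.
have i : rint 0 (2 * pi) (fun t => chi t * P t s).
  apply: le_integrable iP => //.
    by apply/measurable_EFinP; apply: measurable_funTS; exact: measurable_funM.
  move=> t _ /=; rewrite lee_fin (ger0_norm (P0 t s)) ger0_norm; last exact: mulr_ge0.
  exact: ler_piMl.
split=> //.
have mm n : mfunR (fun t => Num.min (P t s) n%:R) by exact: measurable_minr (Pmeas s) (measurable_cst _).
have m0 n t : 0 <= Num.min (P t s) n%:R <= n%:R by rewrite le_min P0 ler0n ge_min lexx orbT.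
have im n : rint 0 (2 * pi) (fun t => Num.min (P t s) n%:R).
  by apply: (bounded_rint (M := n%:R)) => // t _; have /andP[h1 h2] := m0 n t; rewrite ger0_norm.
have c : (fun n : nat => Ginf s + (RI 0 (2 * pi) (P ^~ s) - RI 0 (2 * pi) (fun t => Num.min (P t s) n%:R)))
    @ \oo --> Ginf s + (RI 0 (2 * pi) (P ^~ s) - RI 0 (2 * pi) (P ^~ s)).
  by apply: cvgD; [exact: cvg_cst|apply: cvgB => //; exact: cvg_cst].
rewrite subrr addr0 in c; apply: (ler_cvg_to (cvg_cst _) c); apply: filterE => n.
apply: le_trans (lerD (trunc_le s (ler0n R n)) (lexx _)); rewrite -RIB// -RID//; last 2 first.
- exact: (ichi (K := n%:R)).
- exact: rintB.
apply: le_RI => //.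
  by apply: rintD; [exact: (ichi (K := n%:R))|exact: rintB].
move=> t _; have : Num.min (P t s) n%:R <= P t s by rewrite ge_min lexx.
by move: (chi1 t) (chi0 t); nra.
Qed.

(** Reverse Fatou inequality off [Fset phi]. The part of [p n] above level [K] is seen by the Clark
    measure as the Poisson extension [U] of a function with small integral. [U] exceeds [b] only on
    a set of small Lebesgue measure, charged little by [clark_equi]; at points of [Fset phi] it is
    small because the cutoff vanishes nearby. *)
Let equi_le s (e : R) : 0 < e -> exists2 K : R, 0 < K &
  Ginf s <= RI 0 (2 * pi) (fun t => chi t * Num.min (P t s) K) + e.
Proof.
move=> e0; have [q [mq q02 qr]] := clark_rep s.
have p4 : 0 < 4 * pi :> R by move: pi2; lra.
pose b := e / (2 * M s); pose e1 := e / (4 * pi).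
have b0 : 0 < b by rewrite divr_gt0// mulr_gt0.
have e10 : 0 < e1 by rewrite divr_gt0.
have [d1 d10 hd1] := clark_equi sphi finE mq q02 qr finF e10.
(* The integral of [U] is at most [(2 pi)^2 M s / K], so Markov's inequality at level [b] gives
   measure at most [d1]. *)
pose K := (2 * pi) ^+ 2 * M s / (b * d1).
have K0 : 0 < K.
  by apply: divr_gt0; [apply: mulr_gt0 => //; exact: exprn_gt0|exact: mulr_gt0].
exists K => //.
have cl : (fun n => RI 0 (2 * pi) (fun t => chi t * Num.min (p n t s) K) + e) @ \oo -->
    RI 0 (2 * pi) (fun t => chi t * Num.min (P t s) K) + e.
  by apply: cvgD; [exact: (@RIchi s K (ltW K0))|exact: cvg_cst].
apply: (ler_cvg_to (@Gcvg s) cl).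
(* The first bound keeps the point of radius [rho] at distance at least [d0 / 2] from the support of
   the cutoff; the second makes the integral of the kernel there at most [b]. *)
pose r1 := Num.min (d0 / 2) (b * d0 ^+ 2 / (16 * pi)).
have r10 : 0 < r1.
  by rewrite lt_min; apply/andP; split; ppos.
have c := @rk_cvg R; move/cvgrPdist_lt : c => /(_ r1 r10); apply: filterS => n.
rewrite ger0_norm ?subr_ge0 ?(ltW (rk_lt1 _ _))// lt_min => /andP[hn1 hn2].
set rho := rk R n in hn1 hn2.
have rho0 : 0 <= rho by exact: rk_ge0.
have rho1 : rho < 1 by exact: rk_lt1.
have zr x : inD (zpol rho x) by exact: zD.
(* The proportion of [p n] lying above [K]: continuous, between 0 and 1, and at most [p n / K]. *)
pose psi t := 1 - Num.min (p n t s) K / p n t s.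
have pp t : 0 < p n t s by apply: poisson_gt0; apply: Dphi; exact: zD.
have psi01 t : 0 <= psi t <= 1.
  rewrite /psi subr_ge0 ler_pdivrMr// mul1r ge_min lexx /= lerBlDr lerDl.
  by rewrite divr_ge0// le_min p0 ltW.
have psic : continuous psi.
  move=> t; apply: cvgB; first exact: cvg_cst.
  apply: cvgM; first by apply: cvg_minl; exact: pcont.
  by apply: cvgV; [rewrite gt_eqF|exact: pcont].
have psiE t : p n t s = Num.min (p n t s) K + psi t * p n t s.
  by rewrite /psi mulrBl divfK ?gt_eqF// mul1r addrCA subrr addr0.
have psiK t : psi t <= p n t s / K.
  have [h|h] := leP (p n t s) K.
    by rewrite /psi (min_idPl h) divff ?gt_eqF// subrr divr_ge0// ltW.
  case/andP: (psi01 t) => _ /le_trans; apply.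
  by rewrite ler_pdivlMr// mul1r ltW.
pose g t := chi t * psi t.
have g01 t : 0 <= g t <= 1.
  by have /andP[h1 h2] := psi01 t; rewrite mulr_ge0//= mulr_ile1.
have gc : continuous g by move=> t; apply: cvgM; [exact: chic|exact: psic].
have gm : mfunR g by exact: (continuous_measurable_fun gc).
have gi : rint 0 (2 * pi) g by exact: contT_rint.
have -> : G n s = RI 0 (2 * pi) (fun t => chi t * Num.min (p n t s) K) + RI 0 (2 * pi) (fun t => g t * p n t s).
  rewrite -RID.
  - by apply: eq_RI => t _; rewrite /g -mulrA -mulrDr -psiE.
  - by apply: contT_rint => t; apply: cvgM; [exact: chic|apply: cvg_minl; exact: pcont].
  - by apply: contT_rint => t; apply: cvgM; [exact: gc|exact: pcont].
rewrite lerD2l (clark_swap n mq qr gm g01).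
pose U x := RI 0 (2 * pi) (fun t => g t * poisson (zpol rho x : C) t).
rewrite (_ : RI 0 (M s) _ = RI 0 (M s) (fun y => U (q y)))//.
have Uc : continuous U.
  move=> x; apply: poisson_int_ccvg => //; first by apply: nearW => ?; exact: zD.
  by apply: zpol_cvg; [exact: cvg_cst|exact: cvg_id].
have Um : mfunR U by exact: (continuous_measurable_fun Uc).
have ig x : rint 0 (2 * pi) (fun t => g t * poisson (zpol rho x : C) t) by apply: poisson_rint => //; exact: zD.
have U0 x : 0 <= U x.
  by apply: RI_ge0 => t _; case/andP: (g01 t) => h _; rewrite mulr_ge0// poisson_ge0//; exact: zD.
have U2 x : U x <= 2 * pi.
  rewrite -(mean_poisson (zD n x)); apply: le_RI => //.
    by apply: contT_rint; apply: poisson_continuous; exact: zD.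
  move=> t _; case/andP: (g01 t) => _ h; rewrite ler_piMl// poisson_ge0//; exact: zD.
have gK : RI 0 (2 * pi) g <= 2 * pi * M s / K.
  rewrite -(Rep n s) [leRHS]mulrC -RIZ; last exact: contT_rint.
  apply: le_RI => //; first by apply: rintZ; exact: contT_rint.
  move=> t _; rewrite [leRHS]mulrC; apply: le_trans (psiK t).
  by rewrite /g ler_piMl//; case/andP: (psi01 t).
have UI : RI 0 (2 * pi) U = 2 * pi * RI 0 (2 * pi) g.
  rewrite /U (@RI_swap _ (fun x t => g t * poisson (zpol rho x : C) t) _ _ _ _ (rbd n)).
  - rewrite -RIZ//; apply: eq_RI => t _; rewrite RIZ.
      by rewrite mean_poissonl ?rk01// mulrC.
    apply: contT_rint => x; apply: poisson_ccvg; [exact: zD| |exact: cvg_cst].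
    by apply: zpol_cvg; [exact: cvg_cst|exact: cvg_id].
  - apply: measurable_funM; first exact: measurableT_comp gm measurable_snd.
    apply: measurable_poissonC => //.
    + have cR : continuous (fun t : R => Re (zpol rho t)).
        by move=> t; apply: ccvg_Re; apply: zpol_cvg; [exact: cvg_cst|exact: cvg_id].
      exact: measurableT_comp (continuous_measurable_fun cR) measurable_fst.
    + have cR : continuous (fun t : R => Im (zpol rho t)).
        by move=> t; apply: ccvg_Im; apply: zpol_cvg; [exact: cvg_cst|exact: cvg_id].
      exact: measurableT_comp (continuous_measurable_fun cR) measurable_fst.
  - by move=> x t; case/andP: (g01 t) => h _; rewrite mulr_ge0// poisson_ge0//; exact: zD.
  - move=> x t _ _; have /andP[? ?] := g01 t; have /andP[? ?] := zple n x t.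
    by rewrite -[rbd n]mul1r ler_pM.
pose B := [set x | b < U x] `&` `[0, 2 * pi].
have mB : measurable B.
  apply: measurableI => //.
  rewrite (_ : [set _ | _] = U @^-1` `]b, +oo[%classic); last first.
    by apply/seteqP; split => x; rewrite /= in_itv /= andbT.
  by rewrite -[X in measurable X]setTI; exact: Um.
have lB : (lam B <= d1%:E)%E.
  apply: le_trans (RI_markov Um U0 (contT_rint 0 (2 * pi) Uc) b0) _.
  rewrite lee_fin UI ler_pdivrMr//; apply: le_trans (ler_wpM2l (ltW pi2) gK) _.
  have -> : 2 * pi * (2 * pi * M s / K) = (2 * pi) ^+ 2 * M s / K by rewrite expr2 !mulrA.
  by rewrite ler_pdivrMr// /K [d1 * b]mulrC [leRHS]mulrC divfK// gt_eqF// mulr_gt0.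
have [mY lY] := hd1 B mB lB; set Y := [set y | _] in mY lY.
have key y : 0 <= y <= M s -> U (q y) <= b + 2 * pi * \1_Y y.
  move=> hy; have [nF|hF] := pselect (~ Fset phi (expi (q y))).
    have [h|h] := leP (U (q y)) b.
      by apply: le_trans h _; rewrite lerDl mulr_ge0// ltW.
    have -> : \1_Y y = 1 :> R.
      rewrite indicE mem_set//; split => //; split => //=.
      by have /andP[h1 /ltW h2] := q02 y; rewrite in_itv /= h1.
    by rewrite mulr1; apply: le_trans (U2 _) _; rewrite lerDr ltW.
  have {}hF : Fset phi (expi (q y)) by exact: contrapT.
  apply: (@le_trans _ _ b); last by rewrite lerDl mulr_ge0// ltW.
  have k t : g t * poisson (zpol rho (q y) : C) t <= 8 * (1 - rho) / d0 ^+ 2.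
    have r0 : 0 <= 8 * (1 - rho) / d0 ^+ 2.
      by rewrite divr_ge0 ?exprn_ge0 ?mulr_ge0 ?subr_ge0 ?ltW.
    have [h|h] := leP (cabs (expi t - expi (q y))) d0.
      by rewrite /g /chi (Xvan hF h) !mul0r.
    apply: (@le_trans _ _ (poisson (zpol rho (q y) : C) t)).
      by rewrite ler_piMl//; [exact: poisson_ge0|case/andP: (g01 t)].
    rewrite /poisson cabs_zpol ger0_norm//.
    have h2 : d0 / 2 <= cabs (expi t - zpol rho (q y)).
      have := lt_le_trans h (ler_cabs_distD (expi t) (expi (q y)) (zpol rho (q y))).
      rewrite (zpol_expi _ (ltW rho1)); set u := cabs _; lra.
    apply: (@le_trans _ _ ((1 - rho ^+ 2) / (d0 / 2) ^+ 2)).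
      have d2 : 0 < d0 / 2 by ppos.
      apply: ler_wpM2l; first by rewrite subr_ge0 exprn_ile1// ltW.
      rewrite lef_pV2 ?posrE ?exprn_gt0//; last exact: lt_le_trans h2.
      by rewrite lerXn2r ?nnegrE ?cabs_ge0// ltW.
    rewrite expr_div_n invf_div mulrA ler_pM2r ?invr_gt0 ?exprn_gt0//.
    nra.
  apply: (@le_trans _ _ (8 * (1 - rho) / d0 ^+ 2 * (2 * pi))).
    rewrite -[X in _ * X]subr0 -RI_cst ?(ltW pi2)//; apply: le_RI => //; exact: rint_cst.
  move: hn2; rewrite ltr_pdivlMr ?mulr_gt0 ?pi_gt0// => hn2.
  rewrite mulrAC ler_pdivrMr ?exprn_gt0//; apply: le_trans (ltW hn2).
  by rewrite le_eqVlt; apply/orP; left; apply/eqP; ring.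
have iY : rint 0 (M s) (fun y => 2 * pi * \1_Y y).
  apply: (bounded_rint (M := 2 * pi)).
    by apply: measurable_funM; [exact: measurable_cst|exact: measurable_indic].
  move=> y _; rewrite indicE; case: (_ \in _); rewrite ?mulr1 ?mulr0 ?normr0 ?(ltW pi2)//.
  by rewrite ger0_norm// ltW.
apply: (@le_trans _ _ (RI 0 (M s) (fun y => b + 2 * pi * \1_Y y))).
  apply: le_RI => //.
    apply: (bounded_rint (M := 2 * pi)); first exact: measurableT_comp Um mq.
    by move=> y _; rewrite ger0_norm.
  by apply: rintD => //; exact: rint_cst.
rewrite RID//; last exact: rint_cst.
rewrite RI_cst ?(ltW (M0 s))// subr0.
have i1 : rint 0 (M s) (\1_Y).
  apply: (bounded_rint (M := 1)); first exact: measurable_indic.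
  by move=> y _; rewrite indicE; case: (_ \in _); rewrite ?normr1 ?normr0.
rewrite RIZ//.
have : RI 0 (M s) (\1_Y) <= e1.
  rewrite -lee_fin RI_EFin// integral_indic//.
  apply: le_trans lY; apply: le_measure; rewrite ?inE//.
  exact: measurableI.
move=> h; have := ler_wpM2l (ltW pi2) h.
have -> : b * M s = e / 2 by rewrite /b; move: (M0 s); set z := M s => z0; field; rewrite gt_eqF.
have -> : 2 * pi * e1 = e / 2.
  have E (z : R) : 0 < z -> 2 * z * (e / (4 * z)) = e / 2 by move=> z0; field; rewrite gt_eqF.
  exact: E (pi_gt0 R).
lra.
Qed.

Let Ginf_cont s0 (e : R) : 0 < e -> \forall s \near s0, `|Ginf s - Ginf s0| < e.
Proof.
move=> e0; have e3 : 0 < e / 4 by ppos.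
have [n hn] := filter_ex (hG e3).
have cc : {within `[0, 2 * pi], continuous (fun t => cabs (phi (zpol (rk R n) t)))}.
  apply: continuous_subspaceT => t; apply: ccvg_cabs; exact: circ_ccvg (normrk _ _).
have [t0 _ ht0] := EVT_max (ltW pi2) cc.
set c0 := cabs (phi (zpol (rk R n) t0)) in ht0.
have c01 : 0 < 1 - c0 by rewrite subr_gt0; apply: Dphi; exact: zD.
pose k := 2 / (1 - c0) ^+ 2 * (2 * pi).
have k0 : 0 < k by ppos.
have c : ccvg (nbhs s0) (@expi R) (expi s0) by apply: ccvg_expi; exact: cvg_id.
have ek : 0 < e / 4 / k by ppos.
have : \forall x \near s0, cabs (expi x - expi s0) < e / 4 / k by move/ccvg_lt : c; exact.
apply: filterS => s hs.
have GG : `|G n s - G n s0| <= e / 4.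
  have ib : rint 0 (2 * pi) (fun t => chi t * p n t s - chi t * p n t s0) by exact: rintB.
  rewrite -RIB//; apply: (le_trans (RI_bound (k := e / 4 / (2 * pi)) (ltW pi2) ib _)); last first.
    by rewrite subr0 divfK// gt_eqF.
  move=> t ht; rewrite -mulrBr normrM (ger0_norm (chi0 t)).
  have l1 : `|p n t s - p n t s0| <= e / 4 / (2 * pi).
    apply: le_trans (poisson_lip _ _ _) _; first by apply: Dphi; exact: zD.
    have ct : cabs (phi (zpol (rk R n) t)) <= c0 by apply: ht0; rewrite in_itv.
    apply: (@le_trans _ _ (2 / (1 - c0) ^+ 2 * (e / 4 / k))).
      apply: ler_pM; [|exact: cabs_ge0| |exact: ltW].
        by apply: divr_ge0 => //; apply: exprn_ge0; rewrite subr_ge0 ltW//; apply: Dphi; exact: zD.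
      rewrite ler_pM2l// lef_pV2 ?posrE ?exprn_gt0//; last by move: ct c01; lra.
      by rewrite lerXn2r ?nnegrE; move: ct c01; lra.
    rewrite le_eqVlt; apply/orP; left; apply/eqP; rewrite /k.
    move: pi2 c01; set z := 2 * pi; set u := 1 - c0 => z0 u0.
    by field; rewrite !gt_eqF.
  by apply: le_trans l1; rewrite ler_piMl.
have h1 := hn s; have h2 := hn s0; rewrite distrC in h1.
have -> : Ginf s - Ginf s0 = (Ginf s - G n s) + (G n s - G n s0) + (G n s0 - Ginf s0) by ring.
apply: le_lt_trans (ler_normD _ _) _.
have := ler_normD (Ginf s - G n s) (G n s - G n s0).
lra.
Qed.

(** The part of the boundary mass coming from parameters where [w] stays at depth [h] inside the
    disc; there the kernel is bounded and Lipschitz in [s]. *)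
Let H (h s : R) := RI 0 (2 * pi) (fun t => chi t * (if cabs (w t) <= 1 - h then P t s else 0)).

Let mw : mfunR (fun t => cabs (w t)).
Proof.
have -> : (fun t => cabs (w t)) = fun t => Num.sqrt (Re (w t) ^+ 2 + Im (w t) ^+ 2) by [].
apply: (measurableT_comp (continuous_measurable_fun (@sqrt_continuous R))).
by apply: measurable_funD; apply: measurable_funX.
Qed.

Let mif (h : R) (f : R -> R) : mfunR f -> mfunR (fun t => if cabs (w t) <= 1 - h then f t else 0).
Proof.
move=> mf; apply: measurable_fun_ifT => //.
by apply: measurable_fun_ler => //; exact: measurable_cst.
Qed.

Let Ple (h s t : R) : 0 < h -> cabs (w t) <= 1 - h -> P t s <= 2 / h.
Proof.
move=> h0 hw; apply: le_trans (poisson_le _ (wD t)) _.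
apply: ler_pM; [|by rewrite invr_ge0; lra| |].
- by have := cabs_ge0 (w t); lra.
- by lra.
- by rewrite lef_pV2 ?posrE; lra.
Qed.

Let iH (h s : R) : 0 < h -> rint 0 (2 * pi) (fun t => chi t * (if cabs (w t) <= 1 - h then P t s else 0)).
Proof.
move=> h0; apply: (ichi (K := 2 / h)); first exact: mif.
by move=> t; case: ifPn => hw; rewrite ?P0 ?Ple// lexx divr_ge0// ltW.
Qed.

Let H_near s0 (e : R) : 0 < e -> exists2 h : R, 0 < h < 1 & Ginf s0 <= H h s0 + e.
Proof.
move=> e0; have e2 : 0 < e / 2 by ppos.
have [K K0 hK] := equi_le s0 e2.
have mK : mfunR (fun t => Num.min (P t s0) K) by exact: measurable_minr (Pmeas s0) (measurable_cst _).
have bK t : 0 <= Num.min (P t s0) K <= K by rewrite le_min P0 (ltW K0) ge_min lexx orbT.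
pose f n t := chi t * (if cabs (w t) <= 1 - (1 - rk R n) then Num.min (P t s0) K else 0).
have fb n t : 0 <= (if cabs (w t) <= 1 - (1 - rk R n) then Num.min (P t s0) K else 0) <= K.
  by case: ifP => _; rewrite ?bK// lexx ltW.
have [_ c] : rint 0 (2 * pi) (fun t => chi t * Num.min (P t s0) K) /\
    (fun n => RI 0 (2 * pi) (f n)) @ \oo --> RI 0 (2 * pi) (fun t => chi t * Num.min (P t s0) K).
  apply: (@RI_dct _ f _ _ _ K).
  - by move=> n; apply: measurable_funM => //; exact: mif.
  - move=> n t _; have /andP[b0 b1] := fb n t; rewrite ger0_norm ?mulr_ge0//.
    by apply: le_trans b1; rewrite ler_piMl.
  - move=> t _; apply: cvg_near_cst.
    have c := @rk_cvg R; move/cvgrPdist_lt : c => /(_ (1 - cabs (w t))).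
    rewrite subr_gt0 => /(_ (wD t)); apply: filterS => n.
    rewrite ger0_norm ?subr_ge0 ?(ltW (rk_lt1 _ _))// => h.
    by rewrite /f subKr ifT//; lra.
move/cvgrPdist_lt : c => /(_ _ e2) [n _ /(_ n (leqnn n)) hn].
exists (1 - rk R n).
  by rewrite subr_gt0 rk_lt1 /= ltrBlDr ltrDl /rk subr_gt0 invf_lt1 ?ltr0n// ltr1n.
have fH : RI 0 (2 * pi) (f n) <= H (1 - rk R n) s0.
  apply: le_RI.
  - by apply: (ichi (K := K)) => //; exact: mif.
  - by apply: iH; rewrite subr_gt0 rk_lt1.
  - by move=> t _; apply: ler_wpM2l => //; case: ifP => // _; rewrite ge_min lexx.
have := ler_norm (RI 0 (2 * pi) (fun t => chi t * Num.min (P t s0) K) - RI 0 (2 * pi) (f n)).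
lra.
Qed.

Let H_cont (h s0 e : R) : 0 < h -> 0 < e -> \forall s \near s0, `|H h s - H h s0| < e.
Proof.
move=> h0 e0.
pose k := 2 / h ^+ 2 * (2 * pi).
have k0 : 0 < k by ppos.
have c : ccvg (nbhs s0) (@expi R) (expi s0) by apply: ccvg_expi; exact: cvg_id.
have ek : 0 < e / 2 / k by ppos.
have : \forall x \near s0, cabs (expi x - expi s0) < e / 2 / k by move/ccvg_lt : c; exact.
apply: filterS => s hs.
have ib := rintB (iH s h0) (iH s0 h0).
rewrite /H -RIB; [|exact: iH|exact: iH].
apply: (le_lt_trans (RI_bound (k := e / 2 / (2 * pi)) (ltW pi2) ib _)); last first.
  by rewrite subr0 divfK ?gt_eqF//; lra.
move=> t ht; rewrite -mulrBr normrM (ger0_norm (chi0 t)).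
set X1 := `|_|; suff l1 : X1 <= e / 2 / (2 * pi) by apply: le_trans l1; rewrite ler_piMl// normr_ge0.
rewrite /X1; case: ifPn => hw; last by rewrite subrr normr0; apply: ltW; ppos.
apply: le_trans (poisson_lip _ _ _) _ => //.
apply: (@le_trans _ _ (2 / h ^+ 2 * (e / 2 / k))).
  apply: ler_pM; [|exact: cabs_ge0| |exact: ltW].
    by apply: divr_ge0 => //; apply: exprn_ge0; rewrite subr_ge0 ltW// wD.
  rewrite ler_pM2l// lef_pV2 ?posrE ?exprn_gt0//; last by lra.
  by rewrite lerXn2r ?nnegrE; lra.
rewrite le_eqVlt; apply/orP; left; apply/eqP; rewrite /k.
by move: pi2; set z := 2 * pi => z0; field; rewrite !gt_eqF.
Qed.

Let H_mono (h h' s : R) : 0 < h' -> h' <= h -> H h s <= H h' s.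
Proof.
move=> h0 hh; apply: le_RI; [by apply: iH; exact: lt_le_trans hh|exact: iH|].
move=> t _; apply: ler_wpM2l => //.
case: ifPn => h1; case: ifPn => h2 //; exfalso; move: h2; rewrite -ltNge; lra.
Qed.

(** Dini's argument: [H h s] increases as [h] decreases, comes as near to [Ginf s] as wanted at each
    [s], and both depend continuously on [s]; compactness makes [h] uniform. *)
Let dini (e : R) : 0 < e -> exists2 h : R, 0 < h < 1 & forall s, 0 <= s <= 2 * pi -> Ginf s - H h s <= e.
Proof.
have alg (g g0 k k0 l c : R) : `|g - g0| < c / 4 -> `|k - k0| < c / 4 -> g0 <= k0 + c / 4 -> k <= l -> g - l <= c.
  by rewrite !ltr_norml => /andP[? ?] /andP[? ?]; lra.
move=> e0.
have := @segment_compact R 0 (2 * pi) => /compact_near_coveringP.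
move=> /(_ _ (0 : R)^'+ (fun h s => Ginf s - H h s <= e) _) cov.
have {}cov : \forall h \near (0 : R)^'+, `[0, 2 * pi]%classic `<=` [set s | Ginf s - H h s <= e].
  apply: cov => s0 _.
  have e4 : 0 < e / 4 by ppos.
  have [h1 /andP[h10 h11] hh1] := H_near s0 e4.
  have n1 := Ginf_cont s0 e4; have n2 := H_cont s0 h10 e4.
  have n3 : \forall h \near (0 : R)^'+, 0 < h <= h1.
    near=> h; apply/andP; split; [by near: h; exact: nbhs_right_gt|by near: h; exact: nbhs_right_le].
  near=> s h => /=.
  have a1 : `|Ginf s - Ginf s0| < e / 4 by near: s.
  have a2 : `|H h1 s - H h1 s0| < e / 4 by near: s.
  have /andP[a3 a4] : 0 < h <= h1 by near: h.
  have a5 := @H_mono h1 h s a3 a4.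
  exact: alg a1 a2 hh1 a5.
have n01 : \forall h \near (0 : R)^'+, 0 < h < 1.
  near=> h; apply/andP; split; [by near: h; exact: nbhs_right_gt|by near: h; exact: nbhs_right_lt].
have [h [c h1]] : exists h, `[0, 2 * pi]%classic `<=` [set s | Ginf s - H h s <= e] /\ 0 < h < 1.
  near ((0 : R)^'+) => h; exists h; split; by near: h.
by exists h.
Unshelve. all: by end_near. Qed.

(** The whole boundary integral is at most [Ginf s] by [full_le], so the tail is at most
    [Ginf s - H h s]. *)
Lemma boundary_tail_lim (e : R) : 0 < e -> exists2 h : R, 0 < h < 1 & forall s, 0 <= s <= 2 * pi ->
  RI 0 (2 * pi) (fun t => chi t * (if 1 - h < cabs (w t) then P t s else 0)) <= e.
Proof.
move=> /dini[h /andP[h0 h1] hh]; exists h; first by rewrite h0.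
move=> s /hh; apply: le_trans.
have [i l] := full_le s.
rewrite lerBrDr; apply: le_trans l; rewrite /H -RID; last exact: iH.
  rewrite le_eqVlt; apply/orP; left; apply/eqP; apply: eq_RI => t _.
  by rewrite -mulrDr; case: ltP => _; rewrite ?addr0 ?add0r.
have := rintB i (iH s h0); apply: eq_rint => t _.
by rewrite -mulrBr; case: ltP => _; rewrite ?subr0 ?subrr.
Qed.

End Limit.

Lemma boundary_tail (e : R) : 0 < e -> exists2 h : R, 0 < h < 1 & forall s, 0 <= s <= 2 * pi ->
  RI 0 (2 * pi) (fun t => X (expi t) * (if 1 - h < cabs (w t) then poisson (w t) s else 0)) <= e.
Proof. by have [Ginf hG] := clark_weak; exact: (boundary_tail_lim hG). Qed.
End Uniform.
End Boundary.

(** * Jets at a boundary point *)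

Section Jets.
Variable R : realType.
Local Notation C := R[i].
Local Notation Re := complex.Re.
Local Notation Im := complex.Im.
Implicit Types (z w a : C) (s t : R).

Lemma poly_root0 (S : {poly C}) : S.[0] = 0 -> exists S', S = 'X * S'.
Proof.
move=> /eqP; rewrite -/(root S 0) => /factor_theorem[S' ->].
by exists S'; rewrite polyC0 subr0 mulrC.
Qed.

Lemma trunc_inverse (S : {poly C}) k : S.[0] != 0 -> exists U V, U * S = 1 + 'X^k * V.
Proof.
move=> S0; elim: k => [|k [U [V UV]]]; first by exists 0, (-1); rewrite mul0r expr0 mul1r subrr.
have [V' hV'] : exists V', V - (V.[0] / S.[0])%:P * S = 'X * V'.
  by apply: poly_root0; rewrite !hornerE divfK// subrr.
exists (U - (V.[0] / S.[0])%:P * 'X^k), V'.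
rewrite mulrBl UV exprSr -mulrA -hV'; ring.
Qed.

Lemma ccvg_neq0 (T : Type) (F : set_system T) {FF : Filter F} (f : T -> C) a :
  ccvg F f a -> a != 0 -> \forall x \near F, f x != 0.
Proof.
move=> fa a0; move/ccvg_lt : fa => /(_ (cabs a)); rewrite cabs_gt0 => /(_ a0).
apply: filterS => x h; apply/eqP => fx; move: h.
by rewrite fx sub0r cabsN ltxx.
Qed.

Lemma cvg_expn (T : Type) (F : set_system T) {FF : Filter F} (f : T -> R) (a : R) n :
  f @ F --> a -> (fun x => f x ^+ n) @ F --> a ^+ n.
Proof.
move=> fa; elim: n => [|n IH]; first by rewrite expr0; exact: cvg_cst.
by rewrite exprS; under eq_fun do rewrite exprS; exact: cvgM.
Qed.

Section Point.
Variable zeta : C.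
Hypothesis zT : onT zeta.

Definition cay z : C := (zeta - z) / (zeta + z).
Definition bfilter : set_system C := within (@inD R) (cnbhs zeta).
Global Instance bfilter_filter : Filter bfilter.
Proof. exact: within_filter. Qed.

Lemma zeta_neq0 : zeta != 0.
Proof. by rewrite -cabs_gt0 zT. Qed.

Lemma zetaD_neq0 z : inD z -> zeta + z != 0.
Proof.
move=> zD; apply/eqP => h; move: zD; rewrite /inD.
by rewrite -[z](addKr zeta) h addr0 cabsN zT ltxx.
Qed.

Lemma zetaB_neq0 z : inD z -> zeta - z != 0.
Proof.
move=> zD; rewrite subr_eq0; apply/eqP => h; move: zD.
by rewrite /inD -h zT ltxx.
Qed.

Lemma cay_neq0 z : inD z -> cay z != 0.
Proof.
move=> zD; apply: mulf_neq0; [exact: zetaB_neq0|].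
by rewrite invr_eq0; exact: zetaD_neq0.
Qed.

Lemma near_bfilter (P : C -> Prop) : (forall z, inD z -> P z) -> \forall z \near bfilter, P z.
Proof. by move=> h; exists 1 => // z _; exact: h. Qed.

Lemma ccvg_b_id : ccvg bfilter id zeta.
Proof. by apply/ccvg_lt => e e0; exists e. Qed.

Lemma holo_cay : holo_on_D cay.
Proof.
apply: holoM; first by apply: holoB; [exact: holo_cst|exact: holo_id].
apply: holoV; last exact: zetaD_neq0.
by apply: holoD; [exact: holo_cst|exact: holo_id].
Qed.

Lemma cay_cvg : ccvg bfilter cay 0.
Proof.
have -> : (0 : C) = (zeta - zeta) / (zeta + zeta) by rewrite subrr mul0r.
apply: ccvgM; first by apply: ccvgB; [exact: ccvg_cst|exact: ccvg_b_id].
apply: ccvgV; last by apply: ccvgD; [exact: ccvg_cst|exact: ccvg_b_id].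
by rewrite -mulr2n mulrn_eq0 /= zeta_neq0.
Qed.

Lemma Re_cayV z : inD z -> Re (cay z)^-1 = (1 - cabs z ^+ 2) / cabs (zeta - z) ^+ 2.
Proof.
move=> zD; have [t _ ht] := onT_expi zT.
by rewrite invf_div ht -poissonE// /poisson.
Qed.

Lemma Re_cay_gt0 z : inD z -> 0 < Re (cay z).
Proof.
move=> zD; have : 0 < Re (cay z)^-1.
  rewrite Re_cayV// divr_gt0 ?exprn_gt0 ?cabs_gt0 ?zetaB_neq0//.
  by rewrite subr_gt0 exprn_ilt1 ?cabs_ge0.
by rewrite creV pmulr_lgt0// invr_gt0 exprn_gt0// cabs_gt0 cay_neq0.
Qed.

(** Expansion in the coordinate [cay z], in which the circle is the imaginary axis and [zeta] is 0.
    Polynomials are not truncated at degree [k], so jets of products are plain products. *)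
Definition jet k (f : C -> C) (S : {poly C}) :=
  ccvg bfilter (fun z => (f z - S.[cay z]) / cay z ^+ k) 0.

Lemma poly_cay_cvg (S : {poly C}) : ccvg bfilter (fun z => S.[cay z]) S.[0].
Proof. by apply: (ccvg_comp cay_cvg); exact: ccont_poly. Qed.

Lemma jet_ext k f g S : (forall z, inD z -> f z = g z) -> jet k f S -> jet k g S.
Proof. by move=> fg; apply: eq_ccvg; apply: near_bfilter => z /fg ->. Qed.

Lemma jet_poly k (S : {poly C}) : jet k (fun z => S.[cay z]) S.
Proof.
rewrite /jet; apply: (eq_ccvg (f := fun=> 0)); last exact: ccvg_cst.
by apply: near_bfilter => z _; rewrite subrr mul0r.
Qed.

Lemma jet_lim k f S : jet k f S -> ccvg bfilter f S.[0].
Proof.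
move=> h.
have h1 : ccvg bfilter (fun z => (f z - S.[cay z]) / cay z ^+ k * cay z ^+ k + S.[cay z]) (0 * 0 ^+ k + S.[0]).
  apply: ccvgD; last exact: poly_cay_cvg.
  by apply: ccvgM => //; apply: ccvgX; exact: cay_cvg.
rewrite mul0r add0r in h1; apply: eq_ccvg h1; apply: near_bfilter => z zD.
by rewrite divfK ?subrK// expf_neq0// cay_neq0.
Qed.

Lemma jetD k f g S T : jet k f S -> jet k g T -> jet k (fun z => f z + g z) (S + T).
Proof.
move=> h1 h2; have h3 := @ccvgD _ _ _ bfilter_filter _ _ _ _ h1 h2.
rewrite addr0 in h3; apply: eq_ccvg h3.
by apply: near_bfilter => z _; rewrite hornerD -mulrDl; congr (_ / _); ring.
Qed.

Lemma jetN k f S : jet k f S -> jet k (fun z => - f z) (- S).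
Proof.
move=> h1; have h3 := @ccvgN _ _ _ bfilter_filter _ _ h1.
rewrite oppr0 in h3; apply: eq_ccvg h3.
by apply: near_bfilter => z _; rewrite hornerN -mulNr; congr (_ / _); ring.
Qed.

Lemma jetM k f g S T : jet k f S -> jet k g T -> jet k (fun z => f z * g z) (S * T).
Proof.
move=> h1 h2.
have h3 := @ccvgD _ _ _ bfilter_filter _ _ _ _ (@ccvgM _ _ _ bfilter_filter _ _ _ _ h1 (jet_lim h2))
  (@ccvgM _ _ _ bfilter_filter _ _ _ _ (poly_cay_cvg S) h2).
rewrite mul0r mulr0 addr0 in h3; apply: eq_ccvg h3.
by apply: near_bfilter => z zD; rewrite hornerM; field; rewrite expf_neq0// cay_neq0.
Qed.

Lemma jetV k f S : S.[0] != 0 -> jet k f S -> exists U, jet k (fun z => (f z)^-1) U.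
Proof.
move=> S0 h; have [U [V UV]] := trunc_inverse k.+1 S0.
exists U.
have UVz z : U.[z] * S.[z] = 1 + z ^+ k.+1 * V.[z].
  by rewrite -hornerM UV !hornerE.
have fl := jet_lim h.
have h1 := @ccvgV _ _ _ bfilter_filter _ _ S0 fl.
have h2 : ccvg bfilter (fun z => - (cay z * V.[cay z]) - U.[cay z] * ((f z - S.[cay z]) / cay z ^+ k))
    (- (0 * V.[0]) - U.[0] * 0).
  apply: ccvgB; first by apply: ccvgN; apply: ccvgM; [exact: cay_cvg|exact: poly_cay_cvg].
  by apply: ccvgM => //; exact: poly_cay_cvg.
have h3 := @ccvgM _ _ _ bfilter_filter _ _ _ _ h2 h1.
rewrite mul0r mulr0 oppr0 addr0 mul0r in h3.
apply: eq_ccvg h3.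
have fn0 : \forall z \near bfilter, f z != 0 by exact: ccvg_neq0 fl S0.
have dD : \forall z \near bfilter, inD z by apply: near_bfilter.
apply: filterS2 fn0 dD => z fz zD.
have c0 : cay z ^+ k != 0 by rewrite expf_neq0// cay_neq0.
have -> : - (cay z * V.[cay z]) = (1 - U.[cay z] * S.[cay z]) / cay z ^+ k.
  by rewrite UVz opprD addrA subrr add0r exprS; field; rewrite c0.
by field; rewrite fz c0.
Qed.

Definition iR (y : R) : C := Complex 0 y.

Lemma cabs_iR y : cabs (iR y) = `|y|.
Proof. by rewrite /cabs /= expr0n add0r sqrtr_sqr. Qed.

Lemma iR_neq0 y : y != 0 -> iR y != 0.
Proof. by apply: contra_neq => -[]. Qed.

Lemma dnbhs_id : (fun y : R => y) @ (0 : R)^' --> (0 : R).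
Proof. by move=> A /nbhs_ballP[e /= e0 h]; exists e => // y ye _; exact: h. Qed.

Lemma iR_cvg : ccvg ((0 : R)^') iR 0.
Proof.
apply/ccvgP; split; first exact: cvg_cst.
exact: dnbhs_id.
Qed.

Lemma poly_iR_cvg (S : {poly C}) : ccvg ((0 : R)^') (fun y => S.[iR y]) S.[0].
Proof. by apply: (ccvg_comp iR_cvg); exact: ccont_poly. Qed.

Lemma near0_neq0 : \forall y \near (0 : R)^', y != 0.
Proof. by exists 1 => //= y _. Qed.

(** Order of contact read on the jet: on the imaginary axis, which represents the circle, the real
    part is the defect from the boundary. *)
Definition contact (S : {poly C}) k (kap : R) := (fun y => Re S.[iR y] / y ^+ k) @ (0 : R)^' --> kap.

Lemma radial_bfilter (P : C -> Prop) : (\forall z \near bfilter, P z) ->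
  \forall r \near (1 : R)^'-, P (rC r * zeta).
Proof.
move=> [d d0 hd]; near=> r.
have /andP[r0 r1] : 0 <= r < 1 by near: r; exact: near1_01.
have rd : 1 - d < r by near: r; apply: nbhs_left_gt; rewrite ltrBlDr ltrDl.
apply: hd; last by rewrite /inD cabsM zT cabs_rC ger0_norm// mulr1.
rewrite -{2}[zeta]mul1r -mulrBl cabsM zT mulr1 -rC1 -rCB cabs_rC distrC ger0_norm; last by lra.
by lra.
Unshelve. all: by end_near. Qed.

Lemma cay_radial (r : R) : 0 <= r < 1 -> cay (rC r * zeta) = rC ((1 - r) / (1 + r)).
Proof.
move=> /andP[r0 r1]; have z0 := zeta_neq0.
have r10 : rC (1 + r) != 0 by rewrite rC_eq0; lra.
rewrite rCM rCV rCB rC1 in r10 *; rewrite rCD rC1 in r10 *.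
rewrite /cay (_ : zeta - rC r * zeta = zeta * (1 - rC r)); last by ring.
rewrite (_ : zeta + rC r * zeta = zeta * (1 + rC r)); last by ring.
by field; rewrite r10 z0.
Qed.

Lemma jet_div k f S : jet k.+1 f ('X * S) -> ccvg bfilter (fun z => f z / cay z) S.[0].
Proof.
move=> h.
have h3 : ccvg bfilter (fun z => (f z - ('X * S).[cay z]) / cay z ^+ k.+1 * cay z ^+ k + S.[cay z])
    (0 * 0 ^+ k + S.[0]).
  apply: ccvgD; last exact: poly_cay_cvg.
  by apply: ccvgM => //; apply: ccvgX; exact: cay_cvg.
rewrite mul0r add0r in h3; apply: eq_ccvg h3; apply: near_bfilter => z zD.
have c0 := cay_neq0 zD.
by rewrite hornerM hornerX exprS; field; rewrite expf_neq0// c0.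
Qed.

Lemma jet_lead_Re k Psi S : holo_on_D Psi -> (forall z, inD z -> 0 < Re (Psi z)) ->
  jet k.+1 Psi ('X * S) -> Re (Psi 0) <= Re S.[0].
Proof.
move=> hPsi Psi0 jS; have cq := jet_div jS.
have c1 : (fun r => Re (Psi (rC r * zeta) / cay (rC r * zeta))) @ (1 : R)^'- --> Re S.[0].
  have c2 := @ccvg_Re _ _ _ bfilter_filter _ _ cq.
  by move=> A /c2 /radial_bfilter.
apply: (ler_cvg_to (cvg_cst _) c1); near=> r.
have r01 : 0 <= r < 1 by near: r; exact: near1_01.
have /andP[r0 r1] := r01.
have rD : inD (rC r * zeta) by rewrite /inD cabsM zT cabs_rC ger0_norm// mulr1.
have := harnack hPsi (fun z zD => ltW (Psi0 z zD)) rD => /andP[h _].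
rewrite cay_radial// -rCV mulrC Re_rCM.
move: h; rewrite cabsM zT cabs_rC ger0_norm// mulr1.
by rewrite invf_div -ler_pdivrMl ?divr_gt0 ?subr_gt0 ?ltr_wpDr// invf_div.
Unshelve. all: by end_near. Qed.

(** Contact of order at least 2 forces the leading coefficient to be real, and the Hopf-type bound
    makes it positive; [A] is its inverse. On the axis [A / v] is imaginary and [Re (1 / Psi)] is
    [Re Psi] over [cabs Psi] squared, whence the loss of two orders. The real part of [b] is kept in
    the limit because it is positive for [k = 0] and zero for larger [k]. *)
Lemma jet_reduce k Psi S (kap : R) : holo_on_D Psi -> (forall z, inD z -> 0 < Re (Psi z)) ->
  jet k.+2 Psi S -> S.[0] = 0 -> 0 < kap -> contact S k.+2 kap ->
  exists (A : R) b S1 (kap' : R), [/\ 0 < A, S1.[0] = 0, 0 < kap',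
    ccvg bfilter (fun z => Psi z / cay z) (rC A)^-1 &
    jet k (fun z => (Psi z)^-1 - rC A / cay z - b) S1 /\
    (fun y => (Re b + Re S1.[iR y]) / y ^+ k) @ (0 : R)^' --> kap'].
Proof.
move=> hPsi Psi0 jS S0 kap0 cS; have [S' SE] := poly_root0 S0.
rewrite SE in jS cS; set s1 := S'.[0].
have cq := jet_div jS.
have R1 : Re (Psi 0) <= Re s1 by exact: jet_lead_Re jS.
have s10 : 0 < Re s1 by apply: lt_le_trans R1; apply: Psi0; exact: inD0.
have I1 : Im s1 = 0.
  have c1 : (fun y => - Im S'.[iR y]) @ (0 : R)^' --> - Im s1.
    by apply: cvgN; exact: (ccvg_Im (poly_iR_cvg S')).
  have c2 : (fun y => Re ('X * S').[iR y] / y ^+ k.+2 * y ^+ k.+1) @ (0 : R)^' --> kap * 0 ^+ k.+1.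
    by apply: cvgM => //; apply: cvg_expn; exact: dnbhs_id.
  have c3 : (fun y => Re ('X * S').[iR y] / y ^+ k.+2 * y ^+ k.+1) @ (0 : R)^' --> - Im s1.
    apply: cvg_trans c1; apply: near_eq_cvg; apply: filterS near0_neq0 => y y0.
    rewrite hornerM hornerX creM /= mul0r sub0r [y ^+ k.+2]exprS.
    by field; rewrite expf_neq0.
  have E : kap * 0 ^+ k.+1 = - Im s1 by exact: (cvg_unique _ c2 c3).
  by apply/eqP; rewrite -oppr_eq0 -E expr0n mulr0.
have s1E : s1 = rC (Re s1) by apply: complex_ext.
pose A := (Re s1)^-1.
have AE : (rC A)^-1 = s1 by rewrite /A rCV invrK -s1E.
have s1n : s1 != 0 by rewrite s1E rC_eq0 gt_eqF.
have [U [V UV]] := trunc_inverse k.+2 s1n.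
have U0 : U.[0] = rC A.
  have := congr1 (horner^~ 0) UV; rewrite !hornerE exprS !mul0r addr0 -/s1 => h.
  by rewrite -[rC A]invrK AE -[U.[0]](mulfK s1n) h mul1r.
have [U1 hU1] : exists U1, U - (U.[0])%:P = 'X * U1 by apply: poly_root0; rewrite !hornerE subrr.
pose b := U1.[0]; pose S1 := U1 - b%:P.
have Uz z : U.[z] = rC A + z * (b + S1.[z]).
  have := congr1 (horner^~ z) hU1; rewrite hornerD hornerN hornerC hornerM hornerX U0 => E.
  have -> : S1.[z] = U1.[z] - b by rewrite /S1 hornerD hornerN hornerC.
  by rewrite [b + _]addrC subrK -E addrC subrK.
have UVz z : U.[z] * S'.[z] = 1 + z ^+ k.+2 * V.[z] by rewrite -hornerM UV !hornerE.
exists A, b, S1, (kap / cabs s1 ^+ 2); split.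
- by rewrite invr_gt0.
- by rewrite /S1 !hornerE subrr.
- by rewrite divr_gt0// exprn_gt0// cabs_gt0.
- by rewrite AE.
split.
  have h2 : ccvg bfilter (fun z => - (cay z * V.[cay z]) - U.[cay z] * ((Psi z - ('X * S').[cay z]) / cay z ^+ k.+2))
      (- (0 * V.[0]) - U.[0] * 0).
    apply: ccvgB; first by apply: ccvgN; apply: ccvgM; [exact: cay_cvg|exact: poly_cay_cvg].
    by apply: ccvgM => //; exact: poly_cay_cvg.
  have h1 := @ccvgV _ _ _ bfilter_filter _ _ s1n cq.
  have h3 := @ccvgM _ _ _ bfilter_filter _ _ _ _ h2 h1.
  rewrite mul0r mulr0 oppr0 addr0 mul0r in h3.
  apply: eq_ccvg h3; apply: near_bfilter => z zD.
  have c0 := cay_neq0 zD.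
  have p0 : Psi z != 0 by apply/eqP => h; have := Psi0 z zD; rewrite h ltxx.
  have -> : cay z * V.[cay z] = (U.[cay z] * S'.[cay z] - 1) / cay z ^+ k.+1.
    by rewrite UVz addrC addKr [cay z ^+ k.+2]exprS; field; rewrite expf_neq0.
  rewrite hornerM hornerX Uz !exprS; field.
  by rewrite p0 c0 expf_neq0.
have sn : \forall y \near (0 : R)^', S'.[iR y] != 0 by exact: ccvg_neq0 (poly_iR_cvg S') s1n.
have c1 : (fun y => Re ('X * S').[iR y] / y ^+ k.+2 * (cabs S'.[iR y] ^+ 2)^-1 +
    y * Re (iR 1 ^+ k.+1 * (V.[iR y] / S'.[iR y]))) @ (0 : R)^' -->
    kap * (cabs s1 ^+ 2)^-1 + 0 * Re (iR 1 ^+ k.+1 * (V.[0] / s1)).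
  apply: cvgD.
    apply: cvgM => //; apply: cvgV; first by rewrite expf_neq0// cabs_eq0.
    by apply: cvg_expn; exact: (ccvg_cabs (poly_iR_cvg S')).
  apply: cvgM; first exact: dnbhs_id.
  apply: ccvg_Re; apply: ccvgM; first exact: ccvg_cst.
  by apply: ccvgM; [exact: poly_iR_cvg|apply: ccvgV => //; exact: poly_iR_cvg].
rewrite mul0r addr0 in c1.
apply: cvg_trans c1; apply: near_eq_cvg; apply: filterS2 sn near0_neq0 => y Sy y0.
have iy0 := iR_neq0 y0.
have E1 : Re b + Re S1.[iR y] = Re (U.[iR y] / iR y).
  have -> : U.[iR y] / iR y = rC A / iR y + (b + S1.[iR y]) by rewrite Uz; field.
  by rewrite !creD Re_rCM creV /= !mul0r mulr0 add0r.
have E2 : U.[iR y] / iR y = (iR y * S'.[iR y])^-1 + iR y ^+ k.+1 * (V.[iR y] / S'.[iR y]).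
  have -> : iR y ^+ k.+1 * (V.[iR y] / S'.[iR y]) = (U.[iR y] * S'.[iR y] - 1) / (iR y * S'.[iR y]).
    by rewrite UVz addrC addKr [iR y ^+ k.+2]exprS; field; rewrite iy0 Sy.
  by field; rewrite iy0 Sy.
have iE : iR y = rC y * iR 1 by apply: complex_ext; rewrite /= ?mulr0 ?mul0r ?mulr1 ?subrr ?addr0.
rewrite E1 E2 creD creV -[iR y * S'.[iR y]]/(iR y * _) hornerM hornerX.
have -> : iR y ^+ k.+1 = rC (y ^+ k.+1) * iR 1 ^+ k.+1 by rewrite iE exprMn rCX.
rewrite -[rC (y ^+ k.+1) * _ * _]mulrA Re_rCM.
have -> : cabs (iR y * S'.[iR y]) ^+ 2 = y ^+ 2 * cabs S'.[iR y] ^+ 2.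
  by rewrite cabsM exprMn; congr (_ * _); rewrite sqr_cabs /= expr0n add0r.
rewrite !exprS; set x1 := Re _; set x2 := Re _.
have : cabs S'.[iR y] != 0 by rewrite cabs_eq0.
move: (cabs S'.[iR y]) => x3 x30.
by field; rewrite x30 y0 expf_neq0.
Qed.

Definition bpt (y : R) : C := zeta * (1 - iR y) / (1 + iR y).

Lemma iR1_neq0 y : 1 + iR y != 0.
Proof. by apply/eqP => -[/eqP]; rewrite addr0 oner_eq0. Qed.

Lemma bpt_onT y : onT (bpt y).
Proof.
rewrite /onT /bpt cabsf_div cabsM zT mul1r.
have -> : cabs (1 - iR y) = cabs (1 + iR y) by rewrite /cabs /= !addr0 !add0r subr0 sqrrN.
by rewrite divff// cabs_eq0 iR1_neq0.
Qed.

Lemma bptD_neq0 y : zeta + bpt y != 0.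
Proof.
have d0 := iR1_neq0 y.
have -> : zeta + bpt y = zeta * 2 / (1 + iR y) by rewrite /bpt; field.
by rewrite !mulf_neq0 ?invr_eq0 ?zeta_neq0// pnatr_eq0.
Qed.

Lemma cay_bpt y : cay (bpt y) = iR y.
Proof.
have d0 := iR1_neq0 y; have z0 := zeta_neq0.
rewrite /cay (_ : zeta + bpt y = zeta * 2 / (1 + iR y)); last by rewrite /bpt; field.
rewrite (_ : zeta - bpt y = zeta * 2 * iR y / (1 + iR y)); last by rewrite /bpt; field.
by field; rewrite d0 z0.
Qed.

Lemma bpt_close y : cabs (bpt y - zeta) <= 2 * `|y|.
Proof.
have d0 := iR1_neq0 y.
have -> : bpt y - zeta = - (rC 2 * zeta * iR y / (1 + iR y)).
  have -> : rC 2 = 2 :> C by rewrite -[2]/(1 + 1 : R) rCD rC1.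
  by rewrite /bpt; field.
rewrite cabsN cabsf_div !cabsM zT cabs_rC ger0_norm// mulr1.
rewrite cabs_iR ler_pdivrMr ?cabs_gt0// ler_peMr ?mulr_ge0//.
by apply: le_trans (ler_Re_cabs _); rewrite /= addr0.
Qed.

Lemma cay_bpt_cvg y : ccvg ((1 : R)^'-) (fun r => cay (rC r * bpt y)) (iR y).
Proof.
rewrite -(cay_bpt y).
have c : ccvg ((1 : R)^'-) (fun r => rC r * bpt y) (bpt y).
  rewrite -{2}[bpt y]mul1r; apply: ccvgM; last exact: ccvg_cst.
  by rewrite -rC1; apply: ccvg_rC => A /nbhs_ballP[e /= e0 h]; exists e => // x xe _; exact: h.
apply: ccvgM; first by apply: ccvgB => //; exact: ccvg_cst.
by apply: ccvgV; [exact: bptD_neq0|apply: ccvgD => //; exact: ccvg_cst].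
Qed.

Lemma rad_inD (r : R) z : 0 <= r < 1 -> onT z -> inD (rC r * z).
Proof. by move=> /andP[r0 r1] zT'; rewrite /inD cabsM zT' cabs_rC ger0_norm// mulr1. Qed.

(** Near [zeta] the remainder tends to 0 by its jet; away from [zeta] the subtracted term has for
    real part a multiple of a Poisson kernel, vanishing at the circle. The minimum principle gives
    nonnegativity, and contact excludes the zero case. *)
Lemma reduce_gt0 k Psi (A : R) b S1 (kap : R) : holo_on_D Psi -> (forall z, inD z -> 0 < Re (Psi z)) ->
  0 < A -> Re b = 0 -> S1.[0] = 0 -> 0 < kap -> contact S1 k kap ->
  jet k (fun z => (Psi z)^-1 - rC A / cay z - b) S1 ->
  holo_on_D (fun z => (Psi z)^-1 - rC A / cay z - b) /\
  forall z, inD z -> 0 < Re ((Psi z)^-1 - rC A / cay z - b).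
Proof.
move=> hPsi Psi0 A0 b0 S10 kap0 cS jS; set P1 := fun z => _ - _ in jS *.
have Pn z : inD z -> Psi z != 0.
  by move=> zD; apply/eqP => h; have := Psi0 z zD; rewrite h ltxx.
have hP1 : holo_on_D P1.
  apply: holoB; last exact: holo_cst.
  apply: holoB; first exact: holoV.
  by apply: holoM; [exact: holo_cst|apply: holoV; [exact: holo_cay|exact: cay_neq0]].
have P1ge z : inD z -> - (A * ((1 - cabs z ^+ 2) / cabs (zeta - z) ^+ 2)) <= Re (P1 z).
  move=> zD; rewrite !creB b0 subr0 Re_rCM Re_cayV// lerBrDr addNr.
  by rewrite creV divr_ge0 ?exprn_ge0 ?cabs_ge0// ltW// Psi0.
have P10 z : inD z -> 0 <= Re (P1 z).
  move=> zD; apply/ler_addgt0Pr => e e0; rewrite -lerBlDr sub0r.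
  apply: poisson_ge_lim => //.
  have cP := jet_lim jS; rewrite S10 in cP; move/ccvg_lt : cP => /(_ e e0) [d d0 hd].
  (* Makes [A (1 - r^2) / d^2 <= e] for [1 - r < x], which bounds the subtracted kernel at distance
     [d] from [zeta]. *)
  pose x := e * d ^+ 2 / (2 * A).
  have x0 : 0 < x by ppos.
  near=> r => t.
  have /andP[r0 r1] : 0 <= r < 1 by near: r; exact: near1_01.
  have rx : 1 - x < r by near: r; apply: nbhs_left_gt; rewrite ltrBlDr ltrDl.
  have rD : inD (zpol r t) by rewrite /inD cabs_zpol ger0_norm.
  have [h|h] := ltP (cabs (zpol r t - zeta)) d.
    have := hd _ h rD; rewrite subr0 => /ltW h1.
    have := le_trans (ler_norm _) (cabs_Re (- P1 (zpol r t))).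
    by rewrite cabsN creN; lra.
  apply: le_trans (P1ge _ rD); rewrite lerN2 cabs_zpol ger0_norm//.
  rewrite mulrA ler_pdivrMr ?exprn_gt0 ?cabs_gt0 ?zetaB_neq0//.
  have h2 : d ^+ 2 <= cabs (zeta - zpol r t) ^+ 2.
    by rewrite lerXn2r ?nnegrE ?cabs_ge0 ?(ltW d0)// cabsB.
  apply: le_trans (ler_wpM2l (ltW e0) h2).
  have : 1 - r ^+ 2 <= 2 * x by nra.
  move=> /(ler_wpM2l (ltW A0)) /le_trans; apply.
  by rewrite le_eqVlt /x; apply/orP; left; apply/eqP; field; rewrite gt_eqF.
(* A single zero makes the real part vanish identically. Radial limits at [bpt y] then give
   [Re S1 <= kap / 4 * y^k], while contact gives more than [kap / 2 * y^k] for small [y > 0]. *)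
split=> // z zD; rewrite lt_neqAle P10// andbT; apply/eqP => /esym z0.
have zero := positive_or_zero hP1 P10 zD z0.
have k4 : 0 < kap / 4 by ppos.
move/ccvg_lt : jS => /(_ _ k4) [d d0 hd].
have k2 : 0 < kap / 2 by ppos.
move/cvgrPdist_lt : cS => /(_ _ k2) /nbhs_ballP[e /= e0 he].
pose y := Num.min (d / 4) (e / 2).
have y0 : 0 < y by rewrite lt_min; apply/andP; split; ppos.
have yd : y <= d / 4 by rewrite ge_min lexx.
have ye : y <= e / 2 by rewrite ge_min lexx orbT.
have yk : 0 < y ^+ k by exact: exprn_gt0.
have h1 : kap / 2 * y ^+ k < Re S1.[iR y].
  have := he y _ _; rewrite /ball /= sub0r normrN gtr0_norm// => /(_ _ (lt0r_neq0 y0)).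
  have yy : y < e by lra.
  move=> /(_ yy) h; have := le_lt_trans (ler_norm _) h.
  by rewrite ltrBlDr -ltrBlDl ltr_pdivlMr//; lra.
have h2 : Re S1.[iR y] <= kap / 4 * y ^+ k.
  have c1 : (fun r => Re S1.[cay (rC r * bpt y)]) @ (1 : R)^'- --> Re S1.[iR y].
    by apply: ccvg_Re; apply: (ccvg_comp (cay_bpt_cvg y)); exact: ccont_poly.
  have c2 : (fun r => kap / 4 * cabs (cay (rC r * bpt y)) ^+ k) @ (1 : R)^'- --> kap / 4 * y ^+ k.
    apply: cvgM; first exact: cvg_cst.
    have yE : cabs (iR y) = y by rewrite cabs_iR gtr0_norm.
    by apply: cvg_expn; rewrite -[X in _ --> X]yE; exact: (ccvg_cabs (cay_bpt_cvg y)).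
  apply: (ler_cvg_to c1 c2); near=> r.
  have r01 : 0 <= r < 1 by near: r; exact: near1_01.
  have /andP[r0 r1] := r01.
  have rx : 1 - d / 4 < r by near: r; apply: nbhs_left_gt; rewrite ltrBlDr ltrDl; ppos.
  have rD := rad_inD r01 (bpt_onT y).
  have rd : cabs (rC r * bpt y - zeta) < d.
    apply: le_lt_trans (ler_cabs_distD _ _ (bpt y)) _.
    rewrite -{2}[bpt y]mul1r -mulrBl cabsM bpt_onT mulr1 -rC1 -rCB cabs_rC distrC ger0_norm; last by lra.
    by have := bpt_close y; rewrite gtr0_norm//; lra.
  have := hd _ rd rD; rewrite subr0 cabsf_div cabsX ltr_pdivrMr; last first.
    by rewrite exprn_gt0// cabs_gt0 cay_neq0.
  move=> /ltW; apply: le_trans.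
  have := le_trans (ler_norm _) (cabs_Re (- (P1 (rC r * bpt y) - S1.[cay (rC r * bpt y)]))).
  by rewrite cabsN creN creB (zero _ rD) sub0r opprK.
have := lt_le_trans h1 h2; rewrite ltr_pM2r//; lra.
Unshelve. all: by end_near. Qed.

End Point.
End Jets.

(** * Continued fractions of positive functions *)

Section ContinuedFraction.
Variable R : realType.
Local Notation C := R[i].
Local Notation Re := complex.Re.
Local Notation Im := complex.Im.
Implicit Types (z v w a : C) (s t : R) (pq : {poly C} * {poly C}) (ab : R * C).

(* The numerator and denominator of [1 / (A / v + b + P / Q)] *)
Definition cfstep ab pq : {poly C} * {poly C} :=
  ('X * pq.2, ((rC ab.1)%:P + ab.2 *: 'X) * pq.2 + 'X * pq.1).
Definition cfrac (L : seq (R * C)) pq := foldr cfstep pq L.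
Definition cfcoef ab := 0 < ab.1 /\ Re ab.2 = 0.
(** The imaginary axis is included: it represents the circle, on which a basic function must stay
    strictly inside the disc except at the contact point [v = 0]. *)
Definition rpos pq := forall v, 0 <= Re v -> v != 0 ->
  pq.2.[v] != 0 /\ 0 < Re (pq.1.[v] / pq.2.[v]).

Lemma Re_gt0_neq0 z : 0 < Re z -> z != 0.
Proof. by move=> h; apply/eqP => z0; move: h; rewrite z0 ltxx. Qed.

Lemma Re_inv_gt0 z : 0 < Re z -> 0 < Re z^-1.
Proof. by move=> h; rewrite creV divr_gt0// exprn_gt0// cabs_gt0 Re_gt0_neq0. Qed.

Lemma cfstepE ab pq v : (cfstep ab pq).1.[v] = v * pq.2.[v] /\
  (cfstep ab pq).2.[v] = (rC ab.1 + ab.2 * v) * pq.2.[v] + v * pq.1.[v].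
Proof. by rewrite /cfstep /= !hornerE. Qed.

Lemma rpos_step ab pq : cfcoef ab -> rpos pq -> rpos (cfstep ab pq) /\
  forall v, 0 <= Re v -> v != 0 ->
    ((cfstep ab pq).1.[v] / (cfstep ab pq).2.[v])^-1 = rC ab.1 / v + ab.2 + pq.1.[v] / pq.2.[v].
Proof.
move=> [A0 b0] pos.
have E v : 0 <= Re v -> v != 0 -> 0 < Re (rC ab.1 / v + ab.2 + pq.1.[v] / pq.2.[v]).
  move=> v0 vn; have [_ p0] := pos v v0 vn.
  rewrite !creD b0 addr0 Re_rCM creV ltr_wpDl// mulr_ge0 ?(ltW A0)//.
  by rewrite divr_ge0// exprn_ge0// cabs_ge0.
have E2 v : 0 <= Re v -> v != 0 -> (cfstep ab pq).2.[v] =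
    v * pq.2.[v] * (rC ab.1 / v + ab.2 + pq.1.[v] / pq.2.[v]).
  move=> v0 vn; have [q0 _] := pos v v0 vn.
  by rewrite (cfstepE ab pq v).2; field; rewrite q0 vn.
have E3 v : 0 <= Re v -> v != 0 ->
    (cfstep ab pq).1.[v] / (cfstep ab pq).2.[v] = (rC ab.1 / v + ab.2 + pq.1.[v] / pq.2.[v])^-1.
  move=> v0 vn; have [q0 _] := pos v v0 vn; have := Re_gt0_neq0 (E v v0 vn).
  rewrite E2// (cfstepE ab pq v).1; set x := rC _ / _ + _ + _ => x0.
  by field; rewrite x0 q0 vn.
split=> [v v0 vn|v v0 vn]; last by rewrite E3// invrK.
split; last by rewrite E3//; exact/Re_inv_gt0/E.
have [q0 _] := pos v v0 vn.
by rewrite E2// !mulf_neq0//; exact/Re_gt0_neq0/E.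
Qed.

Lemma rpos_cfrac L pq : (forall ab, ab \in L -> cfcoef ab) -> rpos pq -> rpos (cfrac L pq).
Proof.
move=> hL hpq; elim: L hL => [//|ab L IH] hL.
have [] // := @rpos_step ab (cfrac L pq).
  by apply: hL; rewrite mem_head.
by apply: IH => x xL; apply: hL; rewrite inE xL orbT.
Qed.

Section Point.
Variable zeta : C.
Hypothesis zT : onT zeta.
Local Notation bfilter := (bfilter zeta).
Local Notation cay := (cay zeta).
Local Notation jet := (jet zeta).

Let div_lim (psi : C -> C) (A : R) c : 0 < A -> (forall z, inD z -> psi z != 0) ->
  ccvg bfilter (fun z => (psi z)^-1 - rC A / cay z) c ->
  ccvg bfilter (fun z => psi z / cay z) (rC A)^-1.
Proof.
move=> A0 p0 h.
have h1 : ccvg bfilter (fun z => rC A + cay z * ((psi z)^-1 - rC A / cay z)) (rC A + 0 * c).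
  by apply: ccvgD; [exact: ccvg_cst|apply: ccvgM => //; exact: cay_cvg].
rewrite mul0r addr0 in h1.
have An : rC A != 0 by rewrite rC_eq0 gt_eqF.
have h2 : ccvg bfilter (fun z => (rC A + cay z * ((psi z)^-1 - rC A / cay z))^-1) (rC A)^-1 by exact: ccvgV.
apply: eq_ccvg h2; apply: near_bfilter => z zD.
have := cay_neq0 zT zD => c0; have p := p0 z zD.
have -> : rC A + cay z * ((psi z)^-1 - rC A / cay z) = cay z / psi z by field; rewrite p c0.
by rewrite invf_div.
Qed.

(** Closeness of inverses gains two orders: [Psi - psi] is [(1 / psi - 1 / Psi) Psi psi], and both
    factors are of the order of [cay]. *)
Let inv_close (Psi psi : C -> C) k (A : R) : 0 < A ->
  (forall z, inD z -> Psi z != 0) -> (forall z, inD z -> psi z != 0) ->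
  ccvg bfilter (fun z => Psi z / cay z) (rC A)^-1 ->
  ccvg bfilter (fun z => psi z / cay z) (rC A)^-1 ->
  ccvg bfilter (fun z => ((psi z)^-1 - (Psi z)^-1) / cay z ^+ k) 0 ->
  ccvg bfilter (fun z => (Psi z - psi z) / cay z ^+ k.+2) 0.
Proof.
move=> A0 P0 p0 c1 c2 c3.
have h3 : ccvg bfilter (fun z => ((psi z)^-1 - (Psi z)^-1) / cay z ^+ k * (Psi z / cay z) * (psi z / cay z))
   (0 * (rC A)^-1 * (rC A)^-1) by do 2!apply: ccvgM => //.
rewrite !mul0r in h3; apply: eq_ccvg h3; apply: near_bfilter => z zD.
have := P0 z zD; have := p0 z zD; have := cay_neq0 zT zD => c0 h1 h2.
by rewrite !exprS; field; rewrite h1 h2 c0 expf_neq0.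
Qed.

(** The tail [pq] is quantified last and must agree with [A / v + b] only up to [o(1)]: this leaves
    the freedom used later for genericity, while each step of [L] gains two orders. *)
Theorem cfrac_approx m Psi S (kap : R) : holo_on_D Psi -> (forall z, inD z -> 0 < Re (Psi z)) ->
  jet (2 * m).+2 Psi S -> S.[0] = 0 -> 0 < kap -> contact S (2 * m).+2 kap ->
  exists (L : seq (R * C)) (A : R) (b : C),
  [/\ size L = m, (forall ab, ab \in L -> cfcoef ab), 0 < A, 0 < Re b &
   forall pq, rpos pq ->
     ccvg bfilter (fun z => (pq.1.[cay z] / pq.2.[cay z])^-1 - rC A / cay z - b) 0 ->
     ccvg bfilter (fun z => (Psi z - (cfrac L pq).1.[cay z] / (cfrac L pq).2.[cay z]) / cay z ^+ (2 * m).+2) 0].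
Proof.
elim: m Psi S kap => [|m IH] Psi S kap hPsi Psi0 jS S0 kap0 cS.
  have [A [b [S1 [kap' [A0 S10 k0 cq [j1 c1]]]]]] := jet_reduce zT hPsi Psi0 jS S0 kap0 cS.
  (* At the last step the denominator [y^0] is 1, so the contact constant itself is the real part of
     [b]; this gives [Re b > 0]. *)
  have bk : Re b = kap'.
    have c2 : (fun y : R => (Re b + Re S1.[iR y]) / y ^+ (2 * 0)) @ (0 : R)^' --> (Re b + Re S1.[0]) / 1.
      under eq_fun do rewrite muln0 expr0.
      apply: cvgM; last exact: cvg_cst.
      by apply: cvgD; [exact: cvg_cst|exact: (ccvg_Re (poly_iR_cvg S1))].
    have := cvg_unique _ c2 c1; rewrite S10 addr0 divr1; exact.
  exists [::], A, b; split => //; first by rewrite bk.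
  move=> pq hpq cpq /=.
  have cc := cay_neq0 zT.
  have rc z : inD z -> 0 <= Re (cay z) by move=> zD; exact/ltW/Re_cay_gt0.
  have p0 z : inD z -> pq.1.[cay z] / pq.2.[cay z] != 0.
    by move=> zD; apply: Re_gt0_neq0; have [] := hpq _ (rc z zD) (cc z zD).
  have P0 z : inD z -> Psi z != 0 by move=> zD; exact/Re_gt0_neq0/Psi0.
  have c2 : ccvg bfilter (fun z => (pq.1.[cay z] / pq.2.[cay z])^-1 - rC A / cay z) b.
    have h : ccvg bfilter (fun z => (pq.1.[cay z] / pq.2.[cay z])^-1 - rC A / cay z - b + b) (0 + b).
      by apply: ccvgD => //; exact: ccvg_cst.
    by rewrite add0r in h; apply: eq_ccvg h; apply: near_bfilter => z _; rewrite subrK.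
  apply: (inv_close A0) => //; first exact: div_lim c2.
  have l1 := jet_lim zT j1; rewrite S10 in l1.
  have h : ccvg bfilter (fun z => ((pq.1.[cay z] / pq.2.[cay z])^-1 - rC A / cay z - b) -
     ((Psi z)^-1 - rC A / cay z - b)) (0 - 0) by exact: ccvgB.
  rewrite subr0 in h; apply: eq_ccvg h; apply: near_bfilter => z zD.
  by rewrite muln0 expr0 divr1; ring.
have E2 : (2 * m.+1)%N = (2 * m).+2 by rewrite mulnS.
rewrite E2 in jS cS *.
have [A [b [S1 [kap' [A0 S10 k0 cq [j1 c1]]]]]] := jet_reduce zT hPsi Psi0 jS S0 kap0 cS.
(* Here a finite limit after division by a positive power of [y] forces the constant term to be
   imaginary. *)
have b0 : Re b = 0.
  have c2 : (fun y : R => (Re b + Re S1.[iR y]) / y ^+ (2 * m).+2 * y ^+ (2 * m).+2) @ (0 : R)^' -->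
      kap' * 0 ^+ (2 * m).+2.
    by apply: cvgM => //; apply: cvg_expn; exact: dnbhs_id.
  have c3 : (fun y : R => (Re b + Re S1.[iR y]) / y ^+ (2 * m).+2 * y ^+ (2 * m).+2) @ (0 : R)^' -->
      Re b + Re S1.[0].
    have c4 : (fun y : R => Re b + Re S1.[iR y]) @ (0 : R)^' --> Re b + Re S1.[0].
      by apply: cvgD; [exact: cvg_cst|exact: (ccvg_Re (poly_iR_cvg S1))].
    apply: cvg_trans c4; apply: near_eq_cvg; apply: filterS (@near0_neq0 R) => y y0.
    by rewrite divfK// expf_neq0.
  have : Re b + Re S1.[0] = kap' * 0 ^+ (2 * m).+2 by exact: (cvg_unique _ c3 c2).
  by rewrite S10 addr0 expr0n mulr0.
have cS1 : contact S1 (2 * m).+2 kap'.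
  by move: c1; rewrite /contact; under eq_fun do rewrite b0 add0r.
have [hP1 P10] := reduce_gt0 zT hPsi Psi0 A0 b0 S10 k0 cS1 j1.
have [L [A' [b' [sL hL A'0 b'0 H]]]] := IH _ _ _ hP1 P10 j1 S10 k0 cS1.
have ok : cfcoef (A, b) by [].
exists ((A, b) :: L), A', b'; split => //.
- by rewrite /= sL.
- by move=> ab; rewrite inE => /orP[/eqP ->//|]; exact: hL.
move=> pq hpq cpq.
have h1 := H pq hpq cpq.
have posL := rpos_cfrac hL hpq.
have [posS ES] := rpos_step ok posL.
rewrite [cfrac (_ :: _) _]/(cfstep (A, b) (cfrac L pq)).
have cc := cay_neq0 zT.
have rc z : inD z -> 0 <= Re (cay z) by move=> zD; exact/ltW/Re_cay_gt0.
have p0 z : inD z -> (cfstep (A, b) (cfrac L pq)).1.[cay z] / (cfstep (A, b) (cfrac L pq)).2.[cay z] != 0.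
  by move=> zD; apply: Re_gt0_neq0; have [] := posS _ (rc z zD) (cc z zD).
have P0 z : inD z -> Psi z != 0 by move=> zD; exact/Re_gt0_neq0/Psi0.
apply: (inv_close A0) => //.
  have l1 := jet_lim zT j1; rewrite S10 in l1.
  have h : ccvg bfilter (fun z => b + (((Psi z)^-1 - rC A / cay z - b) -
     ((Psi z)^-1 - rC A / cay z - b - (cfrac L pq).1.[cay z] / (cfrac L pq).2.[cay z]) / cay z ^+ (2 * m).+2 * cay z ^+ (2 * m).+2))
     (b + (0 - 0 * 0 ^+ (2 * m).+2)).
    apply: ccvgD; first exact: ccvg_cst.
    by apply: ccvgB => //; apply: ccvgM => //; apply: ccvgX; exact: cay_cvg.
  rewrite mul0r subr0 addr0 in h; apply: (div_lim (c := b) A0) => //; apply: eq_ccvg h.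
  apply: near_bfilter => z zD; rewrite ES ?rc ?cc//= divfK; last by rewrite expf_neq0// cc.
  by ring.
have h : ccvg bfilter (fun z => - (((Psi z)^-1 - rC A / cay z - b - (cfrac L pq).1.[cay z] / (cfrac L pq).2.[cay z]) / cay z ^+ (2 * m).+2)) (- 0).
  exact: ccvgN.
rewrite oppr0 in h; apply: eq_ccvg h; apply: near_bfilter => z zD.
by rewrite ES ?rc ?cc//= -mulNr; congr (_ / _); ring.
Qed.
End Point.
End ContinuedFraction.

(** * Generic choice of the tail of the continued fraction *)

Section Perturbation.
Variable R : realType.
Local Notation C := R[i].
Local Notation Re := complex.Re.
Local Notation Im := complex.Im.
Implicit Types (z v w a : C) (s t : R) (pq : {poly C} * {poly C}) (ab : R * C) (L : seq (R * C)).

Lemma avoid_seq (l : seq R) : exists2 x, 0 < x & x \notin l.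
Proof.
suff [x x0 hx] : exists2 x : R, 0 < x & forall y, y \in l -> y < x.
  by exists x => //; apply/negP => /hx; rewrite ltxx.
elim: l => [|y l [x x0 hx]]; first by exists 1.
exists (x + `|y|); first by rewrite ltr_wpDr.
move=> u; rewrite inE => /orP[/eqP ->|/hx h].
  by apply: le_lt_trans (ler_norm y) _; rewrite ltrDr.
by apply: lt_le_trans h _; rewrite lerDl.
Qed.

Lemma cfrac_lin L (c d : {poly C}) (u w : {poly C} * {poly C}) :
  cfrac L (c * u.1 + d * w.1, c * u.2 + d * w.2) =
  (c * (cfrac L u).1 + d * (cfrac L w).1, c * (cfrac L u).2 + d * (cfrac L w).2).
Proof.
elim: L => [//|ab L IH]; rewrite /= IH /cfstep /=.
by congr (_, _); ring.
Qed.

(** A step acts on the pair numerator, denominator by a matrix of determinant [- 'X^2]. Its use: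
    denominators coming from independent tails can share only the root 0. *)
Lemma cfrac_det L (u w : {poly C} * {poly C}) : (cfrac L u).1 * (cfrac L w).2 - (cfrac L u).2 * (cfrac L w).1 =
  (- 'X^2) ^+ size L * (u.1 * w.2 - u.2 * w.1).
Proof.
elim: L => [|ab L IH]; first by rewrite expr0 mul1r.
by rewrite /= exprS -[RHS]mulrA -IH; ring.
Qed.

Lemma cfrac_at0 L pq : (forall ab, ab \in L -> cfcoef ab) -> pq.2.[0] != 0 -> (cfrac L pq).2.[0] != 0.
Proof.
move=> hL p0; elim: L hL => [//|ab L IH] hL.
rewrite (cfstepE ab (cfrac L pq) 0).2 mulr0 mul0r !addr0 mulf_neq0//.
  by have [A0 _] := hL ab (mem_head _ _); rewrite rC_eq0 gt_eqF.
by apply: IH => x xL; apply: hL; rewrite inE xL orbT.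
Qed.

Definition no_common_root pq := forall v, pq.1.[v] = 0 -> pq.2.[v] = 0 -> False.

Lemma cfrac_ncr L pq : (forall ab, ab \in L -> cfcoef ab) -> pq.2.[0] != 0 ->
  no_common_root pq -> no_common_root (cfrac L pq).
Proof.
move=> hL p0 hpq; elim: L hL => [//|ab L IH] hL v.
have hL' x : x \in L -> cfcoef x by move=> xL; apply: hL; rewrite inE xL orbT.
have [-> _ /eqP|v0] := eqVneq v 0; first by apply/negP; exact: (@cfrac_at0 (ab :: L)).
have [E1 E2] := cfstepE ab (cfrac L pq) v; rewrite [cfrac (_ :: _) _]/(cfstep ab (cfrac L pq)) E1 E2.
move=> /eqP; rewrite mulf_eq0 (negbTE v0) /= => /eqP q0; rewrite q0 mulr0 add0r => /eqP.
by rewrite mulf_eq0 (negbTE v0) /= => /eqP; move=> /(IH hL' v); exact.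
Qed.

(** Positivity at [v = oo], the image of [- zeta] under [cay]; it also forces numerator and
    denominator to have exact degree [d]. *)
Definition top_pos d pq := [/\ (size pq.1 <= d.+1)%N, (size pq.2 <= d.+1)%N, pq.2`_d != 0 &
  0 < Re (pq.1`_d / pq.2`_d)].

Lemma cfrac_top L d pq : (forall ab, ab \in L -> cfcoef ab) -> top_pos d pq ->
  top_pos (size L + d) (cfrac L pq).
Proof.
move=> hL hpq; elim: L hL => [//|ab L IH] hL.
have hL' x : x \in L -> cfcoef x by move=> xL; apply: hL; rewrite inE xL orbT.
have [sP sQ q0 r0] := IH hL'; rewrite /= addSn.
have [_ b0] := hL ab (mem_head _ _).
set P := (cfrac L pq).1 in sP r0 *; set Q := (cfrac L pq).2 in sQ q0 r0 *.
set e := (size L + d)%N in sP sQ q0 r0 *.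
have sXQ : (size ('X * Q)%R <= e.+2)%N.
  by rewrite mulrC; apply: leq_trans (size_polyMleq _ _) _; rewrite size_polyX addn2.
have sXP : (size ('X * P)%R <= e.+2)%N.
  by rewrite mulrC; apply: leq_trans (size_polyMleq _ _) _; rewrite size_polyX addn2.
have cXQ : ('X * Q)`_e.+1 = Q`_e by rewrite coefXM.
have cQ1 : Q`_e.+1 = 0 by apply: nth_default.
have cQ : (((rC ab.1)%:P + ab.2 *: 'X) * Q + 'X * P)`_e.+1 = Q`_e * (ab.2 + P`_e / Q`_e).
  rewrite mulrDl -scalerAl !coefD coefCM coefZ !coefXM /= cQ1 mulr0 add0r.
  by field.
have rr : 0 < Re (ab.2 + P`_e / Q`_e) by rewrite creD b0 add0r.
split; rewrite /cfstep /= -/P -/Q //.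
- rewrite mulrDl -scalerAl; apply: leq_trans (size_polyD _ _) _; rewrite geq_max sXP andbT.
  apply: leq_trans (size_polyD _ _) _; rewrite geq_max; apply/andP; split.
    by rewrite mul_polyC; apply: leq_trans (size_scale_leq _ _) _; exact: leqW.
  by apply: leq_trans (size_scale_leq _ _) _.
- by rewrite cQ mulf_neq0// Re_gt0_neq0.
- by rewrite cQ cXQ invfM mulrA divff// mul1r Re_inv_gt0.
Qed.

(** The fraction [1 / (A / v + b + e v / (1 + p v))]. For positive [p] and [e] the last term has
    positive real part on the right half-plane, and it vanishes at [v = 0]. *)
Definition cfbase (p e A : R) (b : C) : {poly C} * {poly C} :=
  ('X * (1 + rC p *: 'X), ((rC A)%:P + b *: 'X) * (1 + rC p *: 'X) + rC e *: 'X^2).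

Lemma cfbaseE p e A b v : (cfbase p e A b).1.[v] = v * (1 + rC p * v) /\
  (cfbase p e A b).2.[v] = (rC A + b * v) * (1 + rC p * v) + rC e * v ^+ 2.
Proof. by rewrite /cfbase /= !hornerE. Qed.

Section Base.
Variables (p e A : R) (b : C).
Hypotheses (p0 : 0 < p) (e0 : 0 < e) (A0 : 0 < A) (b0 : 0 < Re b).

Lemma cfbase_den v : 0 <= Re v -> 1 + rC p * v != 0.
Proof.
move=> v0; apply: Re_gt0_neq0; rewrite creD Re_rCM /=.
by rewrite ltr_pwDl// mulr_ge0// ltW.
Qed.

Lemma cfbase_inv v : 0 <= Re v -> v != 0 -> rpos (cfbase p e A b) /\
  ((cfbase p e A b).1.[v] / (cfbase p e A b).2.[v])^-1 - rC A / v - b = rC e * (v / (1 + rC p * v)).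
Proof.
move=> v0 vn; split.
  move=> {v0 vn v} v v0 vn; have d0 := cfbase_den v0.
  have [E1 E2] := cfbaseE p e A b v.
  have E3 : (cfbase p e A b).2.[v] = v * (1 + rC p * v) * (rC A / v + b + rC e * (v / (1 + rC p * v))).
    by rewrite E2; field; rewrite d0 vn.
  have r1 : 0 < Re (rC A / v + b + rC e * (v / (1 + rC p * v))).
    rewrite !creD !Re_rCM creV.
    have h1 : 0 <= Re v / cabs v ^+ 2 by rewrite divr_ge0// exprn_ge0// cabs_ge0.
    have h2 : 0 < Re (v / (1 + rC p * v)).
      have -> : v / (1 + rC p * v) = (v^-1 + rC p)^-1.
        have -> : v^-1 + rC p = (1 + rC p * v) / v by field.
        by rewrite invf_div.
      by apply: Re_inv_gt0; rewrite creD creV /= ltr_wpDl.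
    apply: addr_gt0; last exact: mulr_gt0.
    by apply: ltr_wpDl => //; exact: mulr_ge0 (ltW A0) h1.
  have x0 := Re_gt0_neq0 r1.
  split; first by rewrite E3 !mulf_neq0.
  rewrite E1 E3; move: (Re_inv_gt0 r1) x0; set x := rC A / v + b + _ => r2 x0.
  by rewrite (_ : _ / _ = x^-1)//; field; rewrite x0 d0 vn.
have d0 := cfbase_den v0.
have [E1 E2] := cfbaseE p e A b v.
by rewrite invf_div E1 E2; field; rewrite d0 vn.
Qed.

Lemma cfbase_rpos : rpos (cfbase p e A b).
Proof. by case: (@cfbase_inv 1) => //=; rewrite oner_neq0. Qed.

Lemma cfbase_at0 : (cfbase p e A b).2.[0] != 0.
Proof. by rewrite (cfbaseE _ _ _ _ _).2 !mulr0 !addr0 expr0n mulr0 addr0 mulr1 rC_eq0 gt_eqF. Qed.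

Lemma cfbase_ncr : no_common_root (cfbase p e A b).
Proof.
move=> v; have [-> ->] := cfbaseE p e A b v => /eqP.
have [->|v0] := eqVneq v 0.
  rewrite !mulr0 !addr0 expr0n mulr0 addr0 mulr1 => _ /eqP.
  by rewrite mulf_eq0 rC_eq0 gt_eqF//= oner_eq0.
rewrite mulf_eq0 (negbTE v0) /= => /eqP ->; rewrite mulr0 add0r => /eqP.
by rewrite mulf_eq0 rC_eq0 gt_eqF//= expf_eq0 (negbTE v0).
Qed.

Lemma cfbase_top : top_pos 2 (cfbase p e A b).
Proof.
have E1 : ('X * (1 + rC p *: 'X)) = 'X + rC p *: 'X^2 :> {poly C}.
  by rewrite mulrDr mulr1 -scalerAr -expr2.
have E2 : ((rC A)%:P + b *: 'X) * (1 + rC p *: 'X) + rC e *: 'X^2 =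
   (rC A)%:P + (rC A * rC p + b) *: 'X + (b * rC p + rC e) *: 'X^2 :> {poly C}.
  by rewrite -!mul_polyC !polyCD !polyCM; ring.
have c2 : ((rC A)%:P + (rC A * rC p + b) *: 'X + (b * rC p + rC e) *: 'X^2)`_2 = b * rC p + rC e.
  by rewrite !coefD !coefZ coefC coefX coefXn /= mulr0 !add0r mulr1.
have r0 : 0 < Re (b * rC p + rC e) by rewrite creD mulrC Re_rCM /= addr_gt0// mulr_gt0.
split; rewrite /cfbase /= ?E1 ?E2.
- apply: leq_trans (size_polyD _ _) _; rewrite geq_max size_polyX /=.
  by apply: leq_trans (size_scale_leq _ _) _; rewrite size_polyXn.
- apply: leq_trans (size_polyD _ _) _; rewrite geq_max; apply/andP; split; last first.
    by apply: leq_trans (size_scale_leq _ _) _; rewrite size_polyXn.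
  apply: leq_trans (size_polyD _ _) _; rewrite geq_max; apply/andP; split.
    by rewrite size_polyC; case: (_ != 0).
  by apply: leq_trans (size_scale_leq _ _) _; rewrite size_polyX.
- by rewrite c2 Re_gt0_neq0.
- rewrite c2 coefD coefZ coefX coefXn /= add0r mulr1 Re_rCM mulr_gt0//.
  exact: Re_inv_gt0.
Qed.

End Base.

Lemma separable_roots (P : {poly C}) d : size P = d.+1 -> (forall x, P.[x] = 0 -> P^`().[x] != 0) ->
  exists s : seq C, [/\ uniq s, size s = d & forall x, x \in s -> P.[x] = 0].
Proof.
move=> sP h; have P0 : P != 0 by rewrite -size_poly_eq0 sP.
have [s E] := closed_field_poly_normal P.
have sep : separable_poly P.
  by rewrite unlock; apply/Pdiv.ClosedField.coprimepP => x /eqP /h.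
have lc : lead_coef P != 0 by rewrite lead_coef_eq0.
exists s; split.
- rewrite -separable_prod_XsubC; apply: dvdp_separable sep.
  by apply/dvdpP; exists (lead_coef P)%:P; rewrite mul_polyC.
- by apply/eqP; rewrite -eqSS -sP {1}E size_scale// size_prod_XsubC.
- by move=> x xs; apply/eqP; rewrite E hornerZ mulf_eq0 -/(root _ x) root_prod_XsubC xs orbT.
Qed.

(** A multiple root of [f + c g] is a zero of the Wronskian, and there [c] is determined as
    [- f / g]. The Wronskian is not zero, since otherwise [g], coprime to [f], would divide its own
    nonzero derivative; so finitely many [c] are exceptional. *)
Lemma pencil (f g : {poly C}) : no_common_root (f, g) -> g^`() != 0 ->
  exists l : seq C, forall c x, c \notin l -> (f + c *: g).[x] = 0 -> (f + c *: g)^`().[x] != 0.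
Proof.
move=> ncr g'0; pose W := f^`() * g - f * g^`().
have W0 : W != 0.
  apply/negP => /eqP /eqP; rewrite subr_eq0 => /eqP E.
  have cop : coprimep g f.
    by apply/Pdiv.ClosedField.coprimepP => x /eqP gx; apply/negP => /eqP fx; exact: (ncr x fx gx).
  have : g %| f * g^`() by rewrite -E dvdp_mull.
  rewrite (Gauss_dvdpr _ cop) => /(dvdp_leq g'0).
  rewrite leqNgt lt_size_deriv//; apply: contra_neq g'0 => ->.
  by rewrite derivC.
have [s E] := closed_field_poly_normal W.
exists [seq - (f.[x] / g.[x]) | x <- s] => c x hc.
rewrite derivD derivZ !hornerD !hornerZ => h; apply/negP => /eqP h'.
have gx : g.[x] != 0.
  by apply/negP => /eqP gx; apply: (ncr x) => //=; move: h; rewrite gx mulr0 addr0.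
have fx : f.[x] = - c * g.[x] by apply/eqP; rewrite mulNr -subr_eq0 opprK h.
have f'x : f^`().[x] = - c * g^`().[x] by apply/eqP; rewrite mulNr -subr_eq0 opprK h'.
have Wx : W.[x] = 0 by rewrite /W !hornerE fx f'x; ring.
have xs : x \in s.
  have := Wx; rewrite E hornerZ => /eqP; rewrite mulf_eq0 lead_coef_eq0 (negbTE W0) /=.
  by rewrite -/(root _ x) root_prod_XsubC.
move/negP : hc; apply; apply/mapP; exists x => //.
by rewrite fx -mulrA divff// mulr1 opprK.
Qed.

(** The zeros of the numerator will be the finite preimages of [eta], hence must be simple; [-1]
    must not be among them because it is the value of [cay] at infinity. *)
Lemma cfrac_generic L (A : R) b : (forall ab, ab \in L -> cfcoef ab) -> 0 < A -> 0 < Re b ->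
  exists p e : R, [/\ 0 < p, 0 < e, (cfrac L (cfbase p e A b)).1.[-1] != 0 &
    exists s : seq C, [/\ uniq s, size s = (size L).+2 &
      forall x, x \in s -> (cfrac L (cfbase p e A b)).1.[x] = 0]].
Proof.
move=> hL A0 b0.
have sz p e : 0 < p -> 0 < e -> size (cfrac L (cfbase p e A b)).1 = (size L).+3.
  move=> p0 e0; have [sP _ q0 r0] := cfrac_top hL (cfbase_top A p0 e0 b0).
  rewrite addn2 in sP q0 r0; apply/eqP; rewrite eqn_leq sP ltnNge; apply/negP => h.
  by move: r0; rewrite nth_default// mul0r ltxx.
case: L hL sz => [|ab L] hL sz.
  (* With no step before it the numerator is ['X (1 + p 'X)], independent of [e]; [p = 2] gives the
     roots 0 and [- 1 / 2], both different from [-1]. *)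
  exists 2, 1; have [h2 h1] : (0 < 2 :> R) /\ (0 < 1 :> R) by [].
  split=> //.
    rewrite (cfbaseE _ _ _ _ _).1 mulN1r oppr_eq0; apply/eqP => -[/eqP].
    by rewrite /= ?mulr0 ?mul0r; lra.
  apply: (separable_roots (sz _ _ h2 h1)) => x /=.
  have -> : ('X * (1 + rC 2 *: 'X))^`() = 1 + (rC 2 + rC 2) *: 'X :> {poly C}.
    rewrite derivM derivX derivD derivZ derivX -polyC1 derivC add0r polyC1 mul1r.
    by rewrite -addrA -scalerAr mulr1 -scalerDl.
  rewrite !hornerE => /eqP; rewrite mulf_eq0 => /orP[/eqP ->|/eqP h].
    by rewrite mulr0 addr0 oner_neq0.
  by rewrite mulrDl addrA h add0r; apply: contra_eqN h => /eqP ->; rewrite addr0 oner_neq0.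
have hL' x : x \in L -> cfcoef x by move=> xL; apply: hL; rewrite inE xL orbT.
(* Linearity in the tail: [cfbase] is [1 + p 'X] times the unperturbed tail [u] plus [e 'X^2] times
   [(0, 1)]. The numerator thus becomes ['X (f + e g)], a pencil in [e]. *)
pose u : {poly C} * {poly C} := ('X, (rC A)%:P + b *: 'X).
pose F1 := (cfrac L u).2; pose T := (cfrac L (0, 1)).2.
have F10 : F1.[0] != 0 by apply: cfrac_at0 => //=; rewrite !hornerE rC_eq0 gt_eqF.
have T0 : T.[0] != 0 by apply: cfrac_at0 => //=; rewrite hornerC oner_neq0.
have ncr x : F1.[x] = 0 -> T.[x] = 0 -> x = 0.
  move=> h1 h2; have := congr1 (horner^~ x) (cfrac_det L u (0, 1)).
  rewrite !hornerE -/F1 -/T h1 h2 mulr0 mul0r subr0 /= ?mulr0 ?mulr1 ?subr0 => /esym/eqP.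
  by rewrite mulf_eq0 expf_eq0 oppr_eq0 expf_eq0 /= => /orP[/andP[_ /eqP]|/eqP].
have [rT ET] := closed_field_poly_normal T.
have Tn0 : T != 0 by apply: contra_neq T0 => ->; rewrite horner0.
(* Keeps the root [- 1 / p] of the first factor of [f] off the roots of [T], so that [f] and [g]
   have no common root. *)
have [p p0 hp] := avoid_seq [seq Re (- r^-1) | r <- rT].
have Tp : T.[- (rC p)^-1] != 0.
  apply/negP => h; move/negP : hp; apply; apply/mapP; exists (- (rC p)^-1).
    move: h; rewrite ET hornerZ mulf_eq0 lead_coef_eq0 (negbTE Tn0) /=.
    by rewrite -/(root _ _) root_prod_XsubC.
  by rewrite invrN opprK invrK.
pose f := (1 + rC p *: 'X) * F1; pose g := 'X^2 * T.
have fE x : f.[x] = (1 + rC p * x) * F1.[x] by rewrite /f hornerM !hornerE.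
have gE x : g.[x] = x ^+ 2 * T.[x] by rewrite /g hornerM hornerXn.
have fg : no_common_root (f, g).
  move=> x /=; rewrite fE gE => /eqP + /eqP; rewrite mulf_eq0 => H1.
  rewrite mulf_eq0 expf_eq0 /= => H2; move: H2 H1.
  move=> /orP[/eqP ->|/eqP h1] /orP[/eqP h2|/eqP h2].
  - by move/eqP : h2; rewrite mulr0 addr0 oner_eq0.
  - by move: F10; rewrite h2 eqxx.
  - move/negP : Tp; apply; move/eqP : h2; rewrite addrC addr_eq0 => /eqP h2.
    have pn : rC p != 0 by rewrite rC_eq0 gt_eqF.
    by rewrite (_ : - (rC p)^-1 = x) ?h1// -[x](mulKf pn) h2 mulrN1.
  - by move/eqP : F10; apply; have x0 := ncr x h2 h1; rewrite x0 in h2.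
have g'0 : g^`() != 0.
  apply/negP => /eqP h; have : g^`()`_1 = 0 by rewrite h coef0.
  rewrite coef_deriv /g coefXnM /= subnn -horner_coef0 => /eqP.
  by rewrite mulrn_eq0 /= (negbTE T0).
have [l hl] := pencil fg g'0.
(* Besides the exceptional parameters of the pencil, the value making [-1] a root is avoided. *)
have [e e0 he] := avoid_seq (Re (- (f.[-1] / g.[-1])) :: [seq Re c | c <- l]).
have PE : (cfrac (ab :: L) (cfbase p e A b)).1 = 'X * (f + rC e *: g).
  have -> : cfbase p e A b = ((1 + rC p *: 'X) * u.1 + (rC e *: 'X^2) * 0, (1 + rC p *: 'X) * u.2 + (rC e *: 'X^2) * 1).
    by rewrite /cfbase /u /= mulr0 addr0 mulr1; congr (_, _); ring.
  have := @cfrac_lin L (1 + rC p *: 'X) (rC e *: 'X^2) u (0, 1) => /= ->.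
  by rewrite /f /g [rC e *: (_ * T)]scalerAl.
have el : rC e \notin l.
  apply/negP => h; move: he; rewrite inE negb_or => /andP[_ /negP]; apply.
  by apply/mapP; exists (rC e).
exists p, e; split=> //.
  rewrite PE hornerM hornerX mulN1r oppr_eq0 hornerD hornerZ; apply/negP => /eqP h.
  have g1 : g.[-1] != 0.
    by apply/negP => /eqP g1; apply: (fg (-1)) => //=; move: h; rewrite g1 mulr0 addr0.
  move/negP : he; apply; rewrite inE; apply/orP; left; apply/eqP.
  have -> : f.[-1] = - rC e * g.[-1] by apply/eqP; rewrite mulNr -subr_eq0 opprK h.
  by rewrite -mulrA divff// mulr1 opprK.
apply: (separable_roots (sz _ _ p0 e0)) => x; rewrite PE.
have -> : ('X * (f + rC e *: g)).[x] = x * (f + rC e *: g).[x] by rewrite hornerM hornerX.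
have -> : ('X * (f + rC e *: g))^`().[x] = (f + rC e *: g).[x] + x * (f + rC e *: g)^`().[x].
  by rewrite derivM derivX mul1r [LHS]hornerD [('X * _).[x]]hornerM hornerX.
have [->|x0] := eqVneq x 0.
  move=> _; rewrite [0 * _]mul0r addr0 hornerD hornerZ fE gE expr0n /= mul0r.
  by rewrite !mulr0 !addr0 mul1r.
move=> /eqP; rewrite mulf_eq0 (negbTE x0) /= => /eqP h; rewrite h add0r mulf_neq0//.
exact: hl.
Qed.
End Perturbation.

(** * Basic functions *)

Section Transfer.
Variable R : realType.
Local Notation C := R[i].
Local Notation Re := complex.Re.
Local Notation Im := complex.Im.
Implicit Types (z v w a : C) (s t : R) (pq : {poly C} * {poly C}).

Lemma Re_cdiv z w : Re (z / w) = (Re z * Re w + Im z * Im w) / cabs w ^+ 2.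
Proof. by rewrite creM creV cimV; ring. Qed.

Lemma halfplane_disc z : 1 + z != 0 -> 1 - cabs ((1 - z) / (1 + z)) ^+ 2 = 4 * Re z / cabs (1 + z) ^+ 2.
Proof.
move=> z0; have n0 : cabs (1 + z) ^+ 2 != 0 by rewrite expf_neq0// cabs_eq0.
rewrite cabsf_div expr_div_n; apply: (mulIf n0); rewrite mulrBl !divfK// mul1r.
by rewrite !sqr_cabs creB creD cimB cimD /=; ring.
Qed.

Lemma halfplane_lt1 z : 0 < Re z -> cabs ((1 - z) / (1 + z)) < 1.
Proof.
move=> z0; have n0 : 1 + z != 0 by apply: Re_gt0_neq0; rewrite creD /= addr_gt0.
rewrite -(@expr_lt1 _ 2) ?cabs_ge0// -subr_gt0 halfplane_disc//.
by apply: divr_gt0; [exact: mulr_gt0|apply: exprn_gt0; rewrite cabs_gt0].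
Qed.

Section Point.
Variables zeta eta : C.
Hypothesis zT : onT zeta.
Hypothesis eT : onT eta.
Local Notation cay := (cay zeta).

Lemma Re_cay z : Re (cay z) = (1 - cabs z ^+ 2) / cabs (zeta + z) ^+ 2.
Proof.
rewrite /cay Re_cdiv; congr (_ / _).
have -> : (1 : R) = cabs zeta ^+ 2 by rewrite zT expr1n.
by rewrite !sqr_cabs creB creD cimB cimD; ring.
Qed.

(** Homogenization of [P] of degree [d] in the pair [zeta - z], [zeta + z]: the composite of [P]
    with [cay], cleared of its denominator. *)
Definition hom (d : nat) (P : {poly C}) : {poly C} :=
  \sum_(k < d.+1) P`_k *: ((zeta%:P - 'X) ^+ k * (zeta%:P + 'X) ^+ (d - k)).

Let hA z : (zeta%:P - 'X).[z] = zeta - z. Proof. by rewrite !hornerE. Qed.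
Let hB z : (zeta%:P + 'X).[z] = zeta + z. Proof. by rewrite !hornerE. Qed.

Lemma hom_cay d (P : {poly C}) z : (size P <= d.+1)%N -> zeta + z != 0 ->
  (hom d P).[z] = (zeta + z) ^+ d * P.[cay z].
Proof.
move=> sP z0; rewrite /hom horner_sum (horner_coef_wide _ sP) mulr_sumr.
apply: eq_bigr => k _; rewrite hornerZ hornerM !horner_exp hA hB.
rewrite /cay expr_div_n; have kd : (k <= d)%N by rewrite -ltnS.
have -> : (zeta + z) ^+ d = (zeta + z) ^+ (d - k) * (zeta + z) ^+ k by rewrite -exprD subnK.
by field; rewrite expf_neq0.
Qed.

Lemma hom_opp d P : (hom d P).[- zeta] = P`_d * (2 * zeta) ^+ d.
Proof.
rewrite /hom horner_sum (bigD1 ord_max)//= big1 ?addr0; last first.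
  move=> k; rewrite -val_eqE /= => kd; rewrite hornerZ hornerM !horner_exp hA hB subrr.
  rewrite [0 ^+ (d - k)]expr0n subn_eq0 leqNgt ltn_neqAle kd /= -ltnS ltn_ord /=.
  by rewrite !mulr0.
rewrite hornerZ hornerM !horner_exp hA hB subnn expr0 mulr1 opprK; congr (_ * _ ^+ _).
by ring.
Qed.

Lemma size_hom d P : (size (hom d P) <= d.+1)%N.
Proof.
apply: leq_trans (size_sum _ _ _) _; apply/bigmax_leqP => k _.
apply: leq_trans (size_scale_leq _ _) _.
apply: leq_trans (size_polyMleq _ _) _.
have s1 : (size (zeta%:P - 'X)%R <= 2)%N.
  by rewrite -size_polyN opprB size_XsubC.
have s2 : (size (zeta%:P + 'X)%R <= 2)%N.
  by rewrite addrC -[zeta]opprK polyCN size_XsubC.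
have kd : (k <= d)%N by rewrite -ltnS.
have e1 : (size ((zeta%:P - 'X) ^+ k)%R <= k.+1)%N.
  apply: leq_trans (size_poly_exp_leq _ _) _; rewrite ltnS -[leqRHS]mul1n leq_mul2r.
  by apply/orP; right; lia.
have e2 : (size ((zeta%:P + 'X) ^+ (d - k))%R <= (d - k).+1)%N.
  apply: leq_trans (size_poly_exp_leq _ _) _; rewrite ltnS -[leqRHS]mul1n leq_mul2r.
  by apply/orP; right; lia.
move: e1 e2; move: (size _) (size _) => a c e1 e2; lia.
Qed.

Variables (d : nat) (pq : {poly C} * {poly C}).
Hypothesis pos : rpos pq.
Hypothesis top : top_pos d pq.
Hypothesis ncr : no_common_root pq.
Hypothesis P0 : pq.1.[0] = 0.
Hypothesis Q0 : pq.2.[0] != 0.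
Hypothesis P1 : pq.1.[-1] != 0.
Variable rts : seq C.
Hypothesis urts : uniq rts.
Hypothesis srts : size rts = d.
Hypothesis hrts : forall x, x \in rts -> pq.1.[x] = 0.

Let hP := hom d pq.1.
Let hQ := hom d pq.2.
(** With [psi] the value of [P / Q] at [cay z], the quotient [p / q] is [eta (1 - psi) / (1 + psi)],
    the return from the half-plane to the disc. *)
Let p := eta *: (hQ - hP).
Let q := hQ + hP.
Let f z := p.[z] / q.[z].
Let z0 : zeta != 0 := zeta_neq0 zT.
Let sP : (size pq.1 <= d.+1)%N. Proof. by case: top. Qed.
Let sQ : (size pq.2 <= d.+1)%N. Proof. by case: top. Qed.

(* At the boundary point [- zeta], where [cay] has its pole, the ratio of leading coefficients plays the role of [P / Q] *)
Let ratio z : exists2 psi : C, (zeta + z != 0 -> psi = pq.1.[cay z] / pq.2.[cay z]) &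
  (cabs z <= 1 -> [/\ hQ.[z] != 0, hP.[z] = psi * hQ.[z] & 0 <= Re psi] /\ (z != zeta -> 0 < Re psi)).
Proof.
have [h|h] := eqVneq (zeta + z) 0.
  have zE : z = - zeta by apply/eqP; rewrite -addr_eq0 addrC h.
  exists (pq.1`_d / pq.2`_d) => //; rewrite zE /hP /hQ !hom_opp => _.
  have [_ _ q0 r0] := top.
  do !split => //; last exact: ltW.
    by rewrite mulf_neq0// expf_neq0// mulf_neq0// pnatr_eq0.
  by rewrite mulrA divfK.
exists (pq.1.[cay z] / pq.2.[cay z]) => // z1; rewrite /hP /hQ !hom_cay//.
have hd : (zeta + z) ^+ d != 0 by rewrite expf_neq0.
have r0 : 0 <= Re (cay z).
  by rewrite Re_cay divr_ge0 ?exprn_ge0 ?cabs_ge0// subr_ge0 exprn_ile1 ?cabs_ge0.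
have [zz|zz] := eqVneq z zeta.
  have c0 : cay z = 0 by rewrite /cay zz subrr mul0r.
  by rewrite c0 P0 !mul0r mulr0; split => //; split => //; rewrite mulf_neq0.
have c0 : cay z != 0.
  by rewrite /cay mulf_neq0 ?invr_eq0// subr_eq0 eq_sym.
have [qn rn] := pos r0 c0.
do !split => //; last exact: ltW.
  by rewrite mulf_neq0.
by field.
Qed.

Let qn z : cabs z <= 1 -> q.[z] != 0.
Proof.
move=> z1; have [psi _ /(_ z1)[[h1 h2 h3] _]] := ratio z.
rewrite /q hornerD h2 -{1}[hQ.[z]]mul1r -mulrDl mulf_neq0//.
by apply: Re_gt0_neq0; rewrite creD /= ltr_pwDl.
Qed.

Let fE z : cabs z <= 1 -> exists psi : C, [/\ f z = eta * ((1 - psi) / (1 + psi)), 0 <= Re psi,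
  (z != zeta -> 0 < Re psi) & (zeta + z != 0 -> psi = pq.1.[cay z] / pq.2.[cay z])].
Proof.
move=> z1; have [psi E /(_ z1)[[h1 h2 h3] h4]] := ratio z.
exists psi; split => //; rewrite /f /p /q hornerZ [(hQ - _).[z]]hornerD hornerN hornerD h2.
have n0 : 1 + psi != 0 by apply: Re_gt0_neq0; rewrite creD /= ltr_pwDl.
have -> : hQ.[z] - psi * hQ.[z] = (1 - psi) * hQ.[z] by ring.
have -> : hQ.[z] + psi * hQ.[z] = (1 + psi) * hQ.[z] by ring.
by field; rewrite h1 n0.
Qed.

Let fzeta : f zeta = eta.
Proof.
have n2 : zeta + zeta != 0 by rewrite -mulr2n mulrn_eq0 /= z0.
have [|psi [-> _ _ ->]] := fE (z := zeta); rewrite ?zT//.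
by rewrite /cay subrr !mul0r P0 mul0r subr0 addr0 divr1 mulr1.
Qed.

Let f_inD z : cabs z <= 1 -> z != zeta -> inD (f z).
Proof.
move=> z1 zz; have [psi [-> _ /(_ zz) h _]] := fE z1.
by rewrite /inD cabsM eT mul1r halfplane_lt1.
Qed.

(** The inverse of [cay], with its pole at [r = -1]; roots of [P] are carried to preimages of
    [eta]. *)
Let zrt r : C := zeta * (1 - r) / (1 + r).
Let rtn r : r \in rts -> 1 + r != 0.
Proof.
move=> rr; apply/negP; rewrite addrC addr_eq0 => /eqP h; move: (hrts rr); rewrite h => h'.
by move: P1; rewrite h' eqxx.
Qed.

Let zrtE r : r \in rts -> zeta + zrt r != 0 /\ cay (zrt r) = r.
Proof.
move=> /rtn rn.
have E1 : zeta + zrt r = 2 * zeta / (1 + r) by rewrite /zrt; field.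
have E2 : zeta - zrt r = 2 * zeta * r / (1 + r) by rewrite /zrt; field.
rewrite /cay E1 E2; split; first by rewrite !mulf_neq0 ?invr_eq0// pnatr_eq0.
by field; rewrite rn z0.
Qed.

Let uz : uniq (map zrt rts).
Proof.
rewrite map_inj_in_uniq// => x y xr yr h.
by rewrite -(zrtE xr).2 -(zrtE yr).2 h.
Qed.

Let hPz r : r \in rts -> hP.[zrt r] = 0.
Proof. by move=> rr; have [h1 h2] := zrtE rr; rewrite /hP hom_cay// h2 hrts// mulr0. Qed.

Let hPn0 : hP != 0.
Proof.
apply/negP => /eqP h; have := hom_opp d pq.1; rewrite -/hP h horner0 => /esym/eqP.
have [_ _ q0 r0] := top.
rewrite mulf_eq0 expf_eq0 mulf_eq0 pnatr_eq0 (negbTE z0) /= andbF orbF => /eqP h'.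
by move: r0; rewrite h' mul0r ltxx.
Qed.

Let rootz z : hP.[z] = 0 -> z \in map zrt rts.
Proof.
move=> h; apply/negPn/negP => nz.
have := @max_poly_roots _ hP (z :: map zrt rts) hPn0.
rewrite /= nz uz size_map srts; rewrite /root h eqxx /=.
have -> : all (root hP) (map zrt rts).
  by apply/allP => x /mapP[r rr ->]; apply/eqP; exact: hPz.
by move=> /(_ isT isT); rewrite ltnNge size_hom.
Qed.

Let size_hP : size hP = d.+1.
Proof.
apply/eqP; rewrite eqn_leq size_hom /=.
have := @max_poly_roots _ hP (map zrt rts) hPn0; rewrite uz size_map srts; apply=> //.
by apply/allP => x /mapP[r rr ->]; apply/eqP; exact: hPz.
Qed.

Let pqE : p - eta *: q = (- (2 * eta)) *: hP.
Proof. by rewrite /p /q -!mul_polyC !polyCN !polyCM; ring. Qed.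

Let en0 : eta != 0. Proof. by rewrite -cabs_gt0 eT. Qed.

Let szq : (size q <= d.+1)%N.
Proof. by apply: leq_trans (size_polyD _ _) _; rewrite geq_max !size_hom. Qed.

Let szp : (size p <= d.+1)%N.
Proof.
apply: leq_trans (size_scale_leq _ _) _; apply: leq_trans (size_polyD _ _) _.
by rewrite size_polyN geq_max !size_hom.
Qed.

Let szpq : size (p - eta *: q) = d.+1.
Proof. by rewrite pqE size_scale ?size_hP// oppr_eq0 mulf_neq0// pnatr_eq0. Qed.

Let common z : p.[z] = 0 -> q.[z] = 0 -> False.
Proof.
rewrite /p /q hornerZ !hornerE => /eqP; rewrite mulf_eq0 (negbTE en0) /= subr_eq0 => /eqP E.
rewrite E -mulr2n => /eqP; rewrite mulrn_eq0 /= => /eqP h.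
have [h'|h'] := eqVneq (zeta + z) 0.
  have zE : z = - zeta by apply/eqP; rewrite -addr_eq0 addrC h'.
  have := hom_opp d pq.1; rewrite -/hP -zE h => /esym/eqP.
  have [_ _ q0 r0] := top.
  rewrite mulf_eq0 expf_eq0 mulf_eq0 pnatr_eq0 (negbTE z0) /= andbF orbF => /eqP h2.
  by move: r0; rewrite h2 mul0r ltxx.
have hd : (zeta + z) ^+ d != 0 by rewrite expf_neq0.
have h1 : pq.1.[cay z] = 0.
  by apply: (mulfI hd); rewrite mulr0 -hom_cay// -/hP h.
have h2 : pq.2.[cay z] = 0.
  by apply: (mulfI hd); rewrite mulr0 -hom_cay// -/hQ E h.
exact: ncr h1 h2.
Qed.

Let maxsz : (d < maxn (size p) (size q))%N.
Proof.
by have := size_polyD p (- (eta *: q)); rewrite szpq size_polyN [size (eta *: q)]size_scale.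
Qed.

Let rdeg : rat_deg p q = d.
Proof.
rewrite /rat_deg; move: maxsz szp szq; move: (size p) (size q) => a c; lia.
Qed.

(** Since [p - eta q] is a nonzero multiple of [hP], the finite preimages of [eta] are the [d]
    distinct zeros of [hP]. Infinity is not one of them because [p - eta q] has full degree [d]. *)
Let reg : regular_value p q eta.
Proof.
exists (map Some (map zrt rts)); split.
- by rewrite map_inj_uniq ?uz// => x y [].
- by rewrite !size_map rdeg.
case=> [z|].
  rewrite mem_map; last by move=> x y [].
  rewrite /rat_ext; case: ifPn => [qz|qz].
    apply/esym/negbTE/negP => /mapP[r rr zr].
    have hz : hP.[z] = 0 by rewrite zr hPz.
    apply: (@common z); last exact/eqP.
    by move/eqP : qz; rewrite /q /p hornerZ !hornerE hz addr0 subr0 => ->; rewrite mulr0.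
  have E : p.[z] - eta * q.[z] = - (2 * eta) * hP.[z].
    by have := congr1 (horner^~ z) pqE; rewrite !hornerE.
  apply/eqP/idP => [[h]|/mapP[r rr zr]].
    have h2 : p.[z] = eta * q.[z] by rewrite -[in RHS]h divfK.
    apply: rootz; move: E; rewrite h2 subrr => /esym/eqP.
    by rewrite mulf_eq0 oppr_eq0 mulf_eq0 pnatr_eq0 (negbTE en0) /= => /eqP.
  move: E; rewrite zr hPz// mulr0 => /eqP; rewrite subr_eq0 => /eqP E.
  by rewrite E mulfK// -zr.
have -> : (None \in map Some (map zrt rts)) = false.
  by apply/negbTE/negP => /mapP[].
rewrite /rat_ext; case: ltnP => // h; case: ifPn => [/eqP sE|_].
  apply/negbTE/negP => /eqP[E].
  have : (size (p - eta *: q)%R <= d)%N.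
    apply/leq_sizeP => j jd; rewrite coefB [(eta *: q)`_j]coefZ.
    have [jd'|jd'] := ltnP d j.
      by rewrite (nth_default 0 (leq_trans szp jd')) (nth_default 0 (leq_trans szq jd')) mulr0 subr0.
    have -> : j = d by lia.
    have sq : size q = d.+1.
      by move: maxsz szp szq sE; move: (size p) (size q) => a c; lia.
    have lq : lead_coef q != 0 by rewrite lead_coef_eq0 -size_poly_eq0 sq.
    have : lead_coef p = eta * lead_coef q by rewrite -E divfK.
    by rewrite !lead_coefE sE sq /= => ->; rewrite subrr.
  by rewrite szpq ltnn.
by apply/negbTE/negP => /eqP[] /esym/eqP; rewrite (negbTE en0).
Qed.

Lemma basic_of_ratio : exists f : C -> C, [/\ basic_fun f zeta d, f zeta = eta &
  forall z, inD z -> exists psi, [/\ 0 < Re psi, psi = pq.1.[cay z] / pq.2.[cay z] &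
    f z = eta * ((1 - psi) / (1 + psi))]].
Proof.
exists f; split => //; last first.
  move=> z zD; have [psi [E _ h1 h2]] := fE (ltW zD).
  have n0 := zetaD_neq0 zT zD.
  exists psi; split => //; last exact: h2.
  by apply: h1; apply/eqP => h; move: zD; rewrite h /inD zT ltxx.
exists p, q; split.
- by apply/Pdiv.ClosedField.coprimepP => x /eqP px; apply/negP => /eqP qx; exact: common px qx.
- by apply/negP => /eqP h; have := qn (z := 0); rewrite cabs0 h horner0 eqxx => /(_ ler01).
- exact: rdeg.
- by move=> z z1; split => //; exact: qn.
split.
- move=> z zD; apply: f_inD; first exact: ltW.
  by apply/eqP => h; move: zD; rewrite h /inD zT ltxx.
- by rewrite fzeta.
- by move=> z z1 /eqP zz; apply: f_inD => //; rewrite z1.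
- by rewrite fzeta; exact: reg.
Qed.

End Point.
End Transfer.

(** * The jet of a map of even contact *)

Section ContactJet.
Variable R : realType.
Local Notation C := R[i].
Local Notation Re := complex.Re.
Local Notation Im := complex.Im.
Local Notation lam := (@lebesgue_measure R).
Implicit Types (z v w a : C) (s t : R).

Lemma radial_unique (f : C -> C) t l l' : radial_lim f t l -> radial_lim f t l' -> l = l'.
Proof. by move=> /radial_seq h /radial_seq h'; exact: (ccvg_unique h h'). Qed.

Lemma dense_ae (N : set R) (tau del : R) : measurable N -> lam N = 0%E -> 0 <= tau < 2 * pi -> 0 < del ->
  exists t, [/\ tau < t < tau + del, t <= 2 * pi & ~ N t].
Proof.
move=> mN lN /andP[t0 t2] d0; apply: contrapT => H.
pose b := Num.min (tau + del) (2 * pi).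
have tb : tau < b by rewrite lt_min t2 ltrDl d0.
have sub : `]tau, b[%classic `<=` N.
  move=> t /=; rewrite in_itv /= lt_min => /and3P[h1 h2 h3].
  by apply: contrapT => nN; apply: H; exists t; rewrite h1 h2 (ltW h3).
have : (lam `]tau, b[ <= lam N)%E by apply: le_measure; rewrite ?inE.
by rewrite lN lebesgue_measure_itv /= lte_fin tb -EFinD lee_fin leNgt subr_gt0 tb.
Qed.

Lemma nt_bfilter (f : C -> C) zeta l l' : onT zeta -> ccvg (bfilter zeta) f l -> nt_lim f zeta l' -> l = l'.
Proof.
move=> zT cf nf; have two : 1 < (2 : R) by rewrite ltr1n.
have := (nt_limP _ _ _).1 nf 2 two => cn.
have c1 : ccvg ((1 : R)^'-) (fun r => f (rC r * zeta)) l.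
  apply/ccvg_lt => e e0; apply: (radial_bfilter zT (P := fun z => cabs (f z - l) < e)).
  by move/ccvg_lt : cf; exact.
have c2 : ccvg ((1 : R)^'-) (fun r => f (rC r * zeta)) l'.
  apply/ccvg_lt => e e0; move/ccvg_lt : cn => /(_ e e0) [d d0 hd].
  near=> r.
  have /andP[r0 r1] : 0 <= r < 1 by near: r; exact: near1_01.
  have rd : 1 - d < r by near: r; apply: nbhs_left_gt; rewrite ltrBlDr ltrDl.
  have E : cabs (rC r * zeta - zeta) = 1 - r.
    by rewrite -{2}[zeta]mul1r -mulrBl cabsM zT mulr1 -rC1 -rCB cabs_rC distrC ger0_norm// subr_ge0 ltW.
  apply: hd; first by rewrite E; lra.
  split; first by rewrite /inD cabsM zT cabs_rC ger0_norm// mulr1.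
  by rewrite E cabsM zT cabs_rC ger0_norm// mulr1 ltr_pMl// subr_gt0.
exact: (ccvg_unique c1 c2).
Unshelve. all: by end_near. Qed.

Lemma poly_contact k (S : {poly C}) (K d : R) : 0 < d ->
  (forall y, 0 < `|y| < d -> `|Re S.[iR y]| <= K * `|y| ^+ k) -> exists kap, contact S k kap.
Proof.
move=> d0; elim: k S => [|k IH] S h.
  exists (Re S.[0]); rewrite /contact; under eq_fun do rewrite expr0 divr1.
  exact: (ccvg_Re (poly_iR_cvg S)).
have S0 : Re S.[0] = 0.
  have c1 : (fun y => `|Re S.[iR y]|) @ (0 : R)^' --> `|Re S.[0]|.
    by apply: cvg_norm; exact: (ccvg_Re (poly_iR_cvg S)).
  have c2 : (fun y : R => K * `|y| ^+ k.+1) @ (0 : R)^' --> K * `|0 : R| ^+ k.+1.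
    apply: cvgM; first exact: cvg_cst.
    by apply: cvg_expn; apply: cvg_norm; exact: dnbhs_id.
  have : `|Re S.[0]| <= K * `|0 : R| ^+ k.+1.
    apply: (ler_cvg_to c1 c2); exists d => //= y yd y0; apply: h; rewrite normr_gt0 y0 /=.
    by move: yd; rewrite /= ?sub0r ?normrN.
  by rewrite normr0 expr0n mulr0 normr_le0 => /eqP.
have [S1 hS1] : exists S1, S - (S.[0])%:P = 'X * S1 by apply: poly_root0; rewrite !hornerE subrr.
have E y : Re S.[iR y] = y * Re (iR 1 *: S1).[iR y].
  have := congr1 (horner^~ (iR y)) hS1; rewrite hornerD hornerN hornerC hornerM hornerX => E.
  have -> : S.[iR y] = S.[0] + iR y * S1.[iR y] by rewrite -E addrC subrK.
  rewrite creD S0 add0r hornerZ.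
  have -> : iR y = rC y * iR 1 by apply: complex_ext; rewrite /= ?mulr0 ?mul0r ?mulr1 ?subrr ?addr0.
  by rewrite -[rC y * iR 1 * _]mulrA Re_rCM.
have [y /andP[y0 yd]|kap hk] := IH (iR 1 *: S1).
  have := h y; rewrite y0 yd E normrM exprS mulrCA => /(_ isT).
  by rewrite ler_pM2l.
exists kap; apply: cvg_trans hk; apply: near_eq_cvg; apply: filterS (@near0_neq0 R) => y y0.
by rewrite E exprS; field; rewrite y0 expf_neq0.
Qed.

Section Point.
Variables (phi : C -> C) (zeta eta : C).
Hypothesis sphi : self_map phi.
Hypothesis zT : onT zeta.
Hypothesis eT : onT eta.
Hypothesis ntl : nt_lim phi zeta eta.
Local Notation cz := (cay zeta).
Local Notation bf := (bfilter zeta).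
Let hphi : holo_on_D phi. Proof. by case: sphi. Qed.
Let Dphi z : inD z -> inD (phi z). Proof. by case: sphi => _; apply. Qed.
Let Psi z := cay eta (phi z).

Lemma psi_gt0 z : inD z -> 0 < Re (Psi z).
Proof. by move=> zD; apply: Re_cay_gt0 => //; exact: Dphi. Qed.

Lemma holo_psi : holo_on_D Psi.
Proof. by apply: (holo_comp hphi Dphi); exact: holo_cay. Qed.

Lemma phi_psi z : inD z -> phi z = eta * ((1 - Psi z) / (1 + Psi z)).
Proof.
move=> zD; have d0 := zetaD_neq0 eT (Dphi zD); have e0 := zeta_neq0 eT.
have -> : 1 - Psi z = 2 * phi z / (eta + phi z) by rewrite /Psi /cay; field.
have -> : 1 + Psi z = 2 * eta / (eta + phi z) by rewrite /Psi /cay; field.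
by field; rewrite d0 e0.
Qed.

Lemma cay_ge z : cabs (z - zeta) = cabs (cz z) * cabs (zeta + z) \/ zeta + z = 0.
Proof.
have [h|h] := eqVneq (zeta + z) 0; [by right|left].
by rewrite cabsB /cay cabsf_div divfK// cabs_eq0.
Qed.

Lemma jetX k f S n : jet zeta k f S -> jet zeta k (fun z => f z ^+ n) (S ^+ n).
Proof.
move=> h; elim: n => [|n IH].
  rewrite expr0; apply: (jet_ext (f := fun z => (1 : {poly C}).[cz z])); last exact: jet_poly.
  by move=> z _; rewrite hornerC expr0.
rewrite exprS; apply: (jet_ext (f := fun z => f z * f z ^+ n)); first by move=> z _; rewrite exprS.
exact: jetM.
Qed.

Lemma jet_cst k c : jet zeta k (fun=> c) c%:P.
Proof.
apply: (jet_ext (f := fun z => (c%:P).[cz z])); last exact: jet_poly.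
by move=> z _; rewrite hornerC.
Qed.

Lemma jet_local k : exists S, jet zeta k (fun z => z - zeta) S.
Proof.
(* In the coordinate [v = cay z] one has [z - zeta = - 2 zeta v / (1 + v)]. *)
have h1 : jet zeta k (fun z => (1 + 'X : {poly C}).[cz z]) (1 + 'X) by exact: jet_poly.
have [|U hU] := jetV zT _ h1; first by rewrite !hornerE oner_neq0.
have h2 := jetM zT (jet_poly zeta k (- (2 * zeta) *: 'X)) hU.
exists ((- (2 * zeta) *: 'X) * U); apply: jet_ext h2 => z zD.
have d0 := zetaD_neq0 zT zD; have z0 := zeta_neq0 zT.
have -> : (1 + 'X : {poly C}).[cz z] = 1 + cz z by rewrite !hornerE.
rewrite hornerZ hornerX (_ : 1 + cz z = 2 * zeta / (zeta + z)); last by rewrite /cay; field.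
by rewrite /cay; field; rewrite d0 z0.
Qed.

Lemma jet_sum k n (a : nat -> C) : exists S, jet zeta k (fun z => \sum_(i < n) a i * (z - zeta) ^+ i) S.
Proof.
have [T hT] := jet_local k.
elim: n => [|n [S hS]].
  exists 0%:P; apply: jet_ext (jet_cst k 0) => z _; by rewrite big_ord0.
exists (S + (a n)%:P * T ^+ n); apply: jet_ext (jetD hS (jetM zT (jet_cst k (a n)) (jetX n hT))).
by move=> z _; rewrite big_ord_recr.
Qed.

Lemma jet_expansion k (a : nat -> C) : has_expansion phi zeta k a -> exists S, jet zeta k phi S.
Proof.
move=> hexp; have [S hS] := jet_sum k k.+1 a.
have h0 : jet zeta k (fun z => phi z - \sum_(i < k.+1) a i * (z - zeta) ^+ i) 0%:P.
  apply/ccvg_lt => e e0.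
  (* On the disc [cabs (z - zeta) <= 2 * cabs (cay z)], hence the power of 2; the extra half makes
     the final inequality strict. *)
  have e1 : 0 < e / 2 / 2 ^+ k by ppos.
  have [d d0 hd] := hexp _ e1.
  exists d => // z zd zD; rewrite hornerC !subr0 cabsf_div cabsX.
  have c0 : 0 < cabs (cz z) by rewrite cabs_gt0 cay_neq0.
  rewrite ltr_pdivrMr ?exprn_gt0//.
  apply: le_lt_trans (hd _ zD zd) _.
  have [E|h] := cay_ge z; last by have := zetaD_neq0 zT zD; rewrite h eqxx.
  have z2 : cabs (zeta + z) <= 2.
    by apply: le_trans (ler_cabsD _ _) _; rewrite zT; move: zD; rewrite /inD; lra.
  rewrite E exprMn mulrCA mulrC ltr_pM2r ?exprn_gt0//.
  apply: (@le_lt_trans _ _ (e / 2 / 2 ^+ k * 2 ^+ k)); last by rewrite divfK ?expf_neq0// ?pnatr_eq0//; lra.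
  by rewrite ler_pM2l// lerXn2r// nnegrE ?cabs_ge0.
exists (0%:P + S); apply: jet_ext (jetD h0 hS) => z _; by rewrite subrK.
Qed.

Lemma expansion_a0 k (a : nat -> C) : has_expansion phi zeta k a -> ccvg bf phi eta.
Proof.
move=> /jet_expansion[S hS]; have c := jet_lim zT hS.
by rewrite -(nt_bfilter zT c ntl).
Qed.

Lemma jet_psi k (a : nat -> C) : has_expansion phi zeta k a -> exists2 S, jet zeta k Psi S & S.[0] = 0.
Proof.
move=> hexp; have [T hT] := jet_expansion hexp.
have T0 : T.[0] = eta by exact: (nt_bfilter zT (jet_lim zT hT) ntl).
have e0 := zeta_neq0 eT.
have h1 := jetD (jet_cst k eta) hT.
have [|U hU] := jetV zT _ h1.
  by rewrite hornerD hornerC T0 -mulr2n mulrn_eq0 /= e0.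
have h2 := jetM zT (jetD (jet_cst k eta) (jetN hT)) hU.
exists ((eta%:P - T) * U); first exact: jet_ext h2.
by rewrite hornerM hornerD hornerN hornerC T0 subrr mul0r.
Qed.

Variables (w : R -> C) (N : set R).
Hypothesis mN : measurable N.
Hypothesis lN : lam N = 0%E.
Hypothesis wD : forall t, inD (w t).
Hypothesis hN : forall t, 0 <= t <= 2 * pi -> ~ N t -> radial_lim phi t (w t).
Definition good (d : R) t := [/\ 0 <= t <= 2 * pi, ~ N t & cabs (expi t - zeta) < d].
Let W t := cay eta (w t).
Let Y t := cz (expi t).
Let rD n t : inD (zpol (rk R n) t). Proof. by rewrite /inD cabs_zpol normrk. Qed.

Lemma good_le (d d' : R) t : d <= d' -> good d t -> good d' t.
Proof. by move=> dd [h1 h2 h3]; split => //; exact: lt_le_trans dd. Qed.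

Lemma zpol_rk_cvg t : ccvg \oo (fun n => zpol (rk R n) t) (expi t).
Proof.
rewrite -[expi t]mul1r -rC1; apply: ccvgM; last exact: ccvg_cst.
by apply: ccvg_rC; exact: rk_cvg.
Qed.

Lemma near_zpol (d : R) t : cabs (expi t - zeta) < d -> \forall n \near \oo, cabs (zpol (rk R n) t - zeta) < d.
Proof.
move=> h; have e0 : 0 < d - cabs (expi t - zeta) by rewrite subr_gt0.
have c := zpol_rk_cvg t; move/ccvg_lt : c => /(_ _ e0); apply: filterS => n hn.
by apply: le_lt_trans (ler_cabs_distD _ _ (expi t)) _; lra.
Qed.

Lemma good_ex (d : R) : 0 < d -> exists t, good d t.
Proof.
move=> d0; have [tau ht zE] := onT_expi zT.
have c : ccvg (nbhs tau) (@expi R) (expi tau) by apply: ccvg_expi; exact: cvg_id.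
have : \forall x \near tau, cabs (expi x - expi tau) < d by move/ccvg_lt : c; exact.
move=> /nbhs_ballP[r /= r0 hr].
have [t [/andP[h1 h2] h3 h4]] := dense_ae mN lN ht r0.
exists t; split=> //.
  by rewrite h3 andbT; apply: le_trans (ltW h1); case/andP: ht.
by rewrite zE; apply: hr; rewrite /ball /= distrC ger0_norm; lra.
Qed.

Lemma w_near k (a : nat -> C) (e : R) : has_expansion phi zeta k a -> 0 < e ->
  exists2 d, 0 < d & forall t, good d t -> cabs (eta - w t) <= e.
Proof.
move=> hexp e0; have c := expansion_a0 hexp; move/ccvg_lt : c => /(_ e e0) [d d0 hd].
exists d => // t [ht nN td]; rewrite cabsB.
have c1 : (fun n => cabs (phi (zpol (rk R n) t) - eta)) @ \oo --> cabs (w t - eta).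
  apply: ccvg_cabs; apply: ccvgB; last exact: ccvg_cst.
  by apply: radial_seq; exact: hN.
apply: (ler_cvg_to c1 (cvg_cst e)); apply: filterS (near_zpol td) => n hn.
by apply/ltW/hd.
Qed.

(** With exponent 0 the quotient would be [1 - cabs (w t) ^+ 2], which is small near [zeta] since
    [w t] approaches [eta] on the circle. *)
Lemma contact_pos k (a : nat -> C) n (del c c' : R) : has_expansion phi zeta k a -> 0 < del -> 0 < c ->
  (forall t, good del t -> c <= (1 - cabs (w t) ^+ 2) / cabs (eta - w t) ^+ n <= c') -> n != 0%N.
Proof.
move=> hexp d0 c0 hc; apply/eqP => n0.
have e0 : 0 < c / 4 by ppos.
have [d d10 hd] := w_near hexp e0.
have [t gt] : exists t, good (Num.min d del) t by apply: good_ex; rewrite lt_min d10.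
have g1 := good_le (d' := d) _ gt; have g2 := good_le (d' := del) _ gt.
rewrite ge_min lexx in g1; rewrite ge_min lexx orbT in g2.
have := hd t (g1 isT); have /andP[h _] := hc t (g2 isT).
move: h; rewrite n0 expr0 divr1 => h1 h2.
have h3 := ler_cabs_dist eta (w t); rewrite eT in h3.
by have := wD t; rewrite /inD; have := cabs_ge0 (w t); nra.
Qed.

(** Both quotients share their numerator and [cabs (eta - w t)] is small near [zeta], so a lower
    bound with one exponent is incompatible with an upper bound with a larger one. Used in both
    directions, it makes the order of contact unique. *)
Lemma contact_leq k (a : nat -> C) n1 n2 (del c1 c1' c2 c2' : R) : has_expansion phi zeta k a -> 0 < del -> 0 < c1 ->
  (forall t, good del t -> c1 <= (1 - cabs (w t) ^+ 2) / cabs (eta - w t) ^+ n1 <= c1') ->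
  (forall t, good del t -> c2 <= (1 - cabs (w t) ^+ 2) / cabs (eta - w t) ^+ n2 <= c2') -> (n2 <= n1)%N.
Proof.
move=> hexp d0 c0 hc1 hc2; rewrite leqNgt; apply/negP => n12.
pose e := Num.min 1 (c1 / (2 * (`|c2'| + 1))).
have k0 : 0 < `|c2'| + 1 by rewrite ltr_wpDl.
have e0 : 0 < e by rewrite lt_min ltr01 /=; ppos.
have [d d10 hd] := w_near hexp e0.
have [t gt] : exists t, good (Num.min d del) t by apply: good_ex; rewrite lt_min d10.
have g1 := good_le (d' := d) _ gt; have g2 := good_le (d' := del) _ gt.
rewrite ge_min lexx in g1; rewrite ge_min lexx orbT in g2.
have he := hd t (g1 isT); have /andP[h1 _] := hc1 t (g2 isT); have /andP[_ h2] := hc2 t (g2 isT).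
have u0 : 0 < cabs (eta - w t) by rewrite cabs_gt0; exact: zetaB_neq0.
move: he h1 h2 u0; set u := cabs (eta - w t) => he h1 h2 u0.
have [u1 u2] : u <= 1 /\ u <= c1 / (2 * (`|c2'| + 1)).
  by move: he; rewrite le_min => /andP.
rewrite ler_pdivlMr ?exprn_gt0// in h1; rewrite ler_pdivrMr ?exprn_gt0// in h2.
have h3 := le_trans h1 h2.
have un : u ^+ n2 <= u ^+ n1 * u.
  by rewrite -exprSr; apply: ler_wiXn2l => //; exact: ltW.
have h4 : c1 * u ^+ n1 <= (`|c2'| + 1) * (u ^+ n1 * u).
  apply: le_trans h3 _; apply: (@le_trans _ _ ((`|c2'| + 1) * u ^+ n2)).
    by apply: ler_wpM2r; [exact/ltW/exprn_gt0|have := ler_norm c2'; lra].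
  by apply: ler_wpM2l => //; rewrite addr_ge0.
have h5 : c1 <= (`|c2'| + 1) * u.
  by rewrite -(ler_pM2r (exprn_gt0 n1 u0)) mulrAC -[leRHS]mulrA.
by move: u2; rewrite ler_pdivlMr ?mulr_gt0//; nra.
Qed.

Lemma circle_den_ge t : cabs (expi t - zeta) < 1 -> 1 <= cabs (zeta + expi t) <= 2.
Proof.
move=> h; apply/andP; split; last first.
  by apply: le_trans (ler_cabsD _ _) _; rewrite zT cabs_expi.
have := ler_cabs_dist (zeta + zeta) (zeta - expi t).
rewrite [cabs (zeta - _)]cabsB (_ : zeta + zeta - (zeta - expi t) = zeta + expi t); last by ring.
have -> : cabs (zeta + zeta) = 2.
  rewrite (_ : zeta + zeta = rC (1 + 1) * zeta); last by rewrite rCD rC1; ring.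
  by rewrite cabsM zT mulr1 cabs_rC ger0_norm.
by lra.
Qed.

Lemma circle_cay t : cabs (expi t - zeta) < 1 ->
  [/\ cabs (Y t) <= cabs (expi t - zeta), cabs (expi t - zeta) <= 2 * cabs (Y t) & Y t = iR (Im (Y t))].
Proof.
move=> h; have /andP[d1 d2] := circle_den_ge h.
have d0 : 0 < cabs (zeta + expi t) by exact: lt_le_trans d1.
split.
- by rewrite /Y /cay cabsf_div cabsB ler_pdivrMr// ler_peMr// cabs_ge0.
- by rewrite /Y /cay cabsf_div [cabs (zeta - _)]cabsB mulrA ler_pdivlMr// mulrC ler_wpM2r// cabs_ge0.
- by apply: complex_ext => //=; rewrite /Y Re_cay// cabs_expi expr1n subrr mul0r.
Qed.

(** The jet estimate holds at all points of the disc near [zeta], hence passes to radial limits. *)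
Lemma jet_boundary k S (e : R) : jet zeta k Psi S -> 0 < e ->
  exists2 d, 0 < d <= 1 & forall t, good d t -> cabs (W t - S.[Y t]) <= e * cabs (Y t) ^+ k.
Proof.
move=> jS e0; move/ccvg_lt : jS => /(_ e e0) [d d0 hd].
exists (Num.min d 1); first by rewrite lt_min d0 ltr01 ge_min lexx orbT.
move=> t [ht nN]; rewrite lt_min => /andP[td t1].
have /andP[q1 _] := circle_den_ge t1.
have q0 : zeta + expi t != 0 by rewrite -cabs_gt0; exact: lt_le_trans q1.
have cY : ccvg \oo (fun n => cz (zpol (rk R n) t)) (Y t).
  have c := zpol_rk_cvg t; apply: ccvgM; first by apply: ccvgB => //; exact: ccvg_cst.
  by apply: ccvgV => //; apply: ccvgD => //; exact: ccvg_cst.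
have cW : ccvg \oo (fun n => Psi (zpol (rk R n) t)) (W t).
  have c := radial_seq (hN ht nN).
  by apply: (ccvg_comp c); apply: holo_cont => //; exact: holo_cay.
have c1 : (fun n => cabs (Psi (zpol (rk R n) t) - S.[cz (zpol (rk R n) t)])) @ \oo --> cabs (W t - S.[Y t]).
  apply: ccvg_cabs; apply: ccvgB => //.
  by apply: (ccvg_comp cY); exact: ccont_poly.
have c2 : (fun n => e * cabs (cz (zpol (rk R n) t)) ^+ k) @ \oo --> e * cabs (Y t) ^+ k.
  by apply: cvgM; [exact: cvg_cst|apply: cvg_expn; exact: ccvg_cabs].
apply: (ler_cvg_to c1 c2); apply: filterS (near_zpol td) => n hn.
have := hd _ hn (rD n t); rewrite subr0 cabsf_div cabsX ltr_pdivrMr ?exprn_gt0 ?cabs_gt0 ?cay_neq0//.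
exact: ltW.
Qed.

Section Contact.
Variables (n : nat) (a : nat -> C) (del c c' : R).
Hypothesis hexp : has_expansion phi zeta n.+1 a.
Hypothesis del0 : 0 < del.
Hypothesis c0 : 0 < c.
Hypothesis c'0 : 0 < c'.
Hypothesis hc : forall t, good del t -> c <= (1 - cabs (w t) ^+ 2) / cabs (eta - w t) ^+ n.+1 <= c'.

(** The leading coefficient of the jet is nonzero by the Hopf-type bound, so [W] and [Y] are
    comparable up to constants. *)
Lemma boundary_size S : jet zeta n.+1 Psi S -> S.[0] = 0 ->
  exists d K : R, [/\ 0 < d <= 1, 0 < K & forall t, good d t ->
    [/\ K * cabs (Y t) <= cabs (W t), cabs (W t) <= 4 * K * cabs (Y t) & cabs (eta - w t) <= 1]].
Proof.
move=> jS S0; have [S' SE] := poly_root0 S0; rewrite SE in jS *.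
have s10 : 0 < cabs S'.[0].
  rewrite cabs_gt0; apply: Re_gt0_neq0.
  apply: lt_le_trans (jet_lead_Re zT holo_psi psi_gt0 jS); apply: psi_gt0; exact: inD0.
set s1 := cabs S'.[0] in s10.
have e0 : 0 < s1 / 4 by ppos.
have [d1 /andP[d10 d11] hd1] := jet_boundary jS e0.
have cS : ccvg (cnbhs 0) (fun v => S'.[v]) S'.[0] by exact: ccont_poly.
move/ccvg_lt : cS => /(_ _ e0) [d2 d20 hd2].
have [d3 d30 hd3] := w_near hexp ltr01.
pose d := Num.min d1 (Num.min d2 d3).
exists d, (s1 / 2); split; [|by ppos|].
  by rewrite !lt_min d10 d20 d30 /= ge_min d11.
move=> t gt.
have g1 : good d1 t by apply: good_le gt; rewrite ge_min lexx.
have g2 : good d2 t by apply: good_le gt; rewrite !ge_min lexx !orbT.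
have g3 : good d3 t by apply: good_le gt; rewrite !ge_min lexx !orbT.
have h1 := hd1 t g1; have [_ _ t2] := g2; have [_ _ t1] := g1.
have t11 : cabs (expi t - zeta) < 1 by exact: lt_le_trans d11.
have [y1 y2 _] := circle_cay t11.
have h2 : cabs (S'.[Y t] - S'.[0]) < s1 / 4 by apply: hd2; rewrite subr0; exact: le_lt_trans t2.
have yk : cabs (Y t) ^+ n.+1 <= cabs (Y t).
  rewrite exprS ler_piMr ?cabs_ge0// exprn_ile1 ?cabs_ge0//.
  by apply: le_trans y1 _; exact: ltW.
have SY : cabs (('X * S').[Y t]) = cabs (Y t) * cabs S'.[Y t] by rewrite hornerM hornerX cabsM.
have a1 := ler_cabs_dist S'.[0] (S'.[0] - S'.[Y t]); rewrite subKr [cabs (S'.[0] - _)]cabsB -/s1 in a1.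
have a2 := ler_cabs_dist S'.[Y t] S'.[0]; rewrite -/s1 in a2.
have y0 := cabs_ge0 (Y t).
have b1 : s1 / 4 * cabs (Y t) ^+ n.+1 <= s1 / 4 * cabs (Y t) by rewrite ler_pM2l.
have b2 : 3 / 4 * s1 * cabs (Y t) <= cabs (('X * S').[Y t]) by rewrite SY mulrC ler_wpM2l//; lra.
have b3 : cabs (('X * S').[Y t]) <= 5 / 4 * s1 * cabs (Y t) by rewrite SY mulrC ler_wpM2r//; lra.
have a3 := ler_cabs_dist ('X * S').[Y t] (('X * S').[Y t] - W t); rewrite subKr [cabs (_ - W t)]cabsB in a3.
have a4 := ler_cabs_dist (W t) ('X * S').[Y t].
split; last exact: hd3.
- by nra.
- by nra.
Qed.

(** Converts contact, stated with powers of [eta - w t], into powers of the coordinate [Y] along the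
    circle; the bound on [1 - cabs (w t)] serves later to compare boundary values. *)
Lemma boundary_size_y S : jet zeta n.+1 Psi S -> S.[0] = 0 -> exists d K1 K2 : R,
  [/\ 0 < d <= 1, 0 < K1, 0 < K2 & forall t, good d t ->
    K1 * cabs (Y t) ^+ n.+1 <= Re (W t) <= K2 * cabs (Y t) ^+ n.+1 /\
    K1 * cabs (Y t) ^+ n.+1 <= 1 - cabs (w t)].
Proof.
move=> jS S0; have [d1 [K [d1b K0 hd1]]] := boundary_size jS S0.
have /andP[d10 d11] := d1b.
exists (Num.min d1 del), (c / 4 * K ^+ n.+1), (c' * (8 * K) ^+ n.+1); split; [|by ppos|by ppos|].
  by rewrite lt_min d10 del0 ge_min d11.
move=> t gt.
have g1 : good d1 t by apply: good_le gt; rewrite ge_min lexx.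
have g2 : good del t by apply: good_le gt; rewrite ge_min lexx orbT.
have [h1 h2 h3] := hd1 t g1; have /andP[h4 h5] := hc g2.
have u0 : 0 < cabs (eta - w t) by rewrite cabs_gt0; exact: zetaB_neq0.
rewrite ler_pdivlMr ?exprn_gt0// in h4; rewrite ler_pdivrMr ?exprn_gt0// in h5.
have q1 : 1 <= cabs (eta + w t).
  have := ler_cabs_dist (eta + eta) (eta - w t).
  rewrite (_ : eta + eta - (eta - w t) = eta + w t); last by ring.
  have -> : cabs (eta + eta) = 2.
    rewrite (_ : eta + eta = rC (1 + 1) * eta); last by rewrite rCD rC1; ring.
    by rewrite cabsM eT mulr1 cabs_rC ger0_norm.
  by lra.
have q2 : cabs (eta + w t) <= 2.
  by apply: le_trans (ler_cabsD _ _) _; rewrite eT; have := wD t; rewrite /inD; lra.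
have q0 : 0 < cabs (eta + w t) by exact: lt_le_trans q1.
have uE : cabs (eta - w t) = cabs (W t) * cabs (eta + w t) by rewrite /W /cay cabsf_div divfK// gt_eqF.
have y0 := cabs_ge0 (Y t); have w0 := cabs_ge0 (W t).
have x0 : 0 <= 1 - cabs (w t) ^+ 2 by rewrite subr_ge0 exprn_ile1 ?cabs_ge0// ltW// wD.
have e1 : (K * cabs (Y t)) ^+ n.+1 <= cabs (eta - w t) ^+ n.+1.
  rewrite lerXn2r ?nnegrE ?cabs_ge0 ?mulr_ge0 ?(ltW K0)//.
  by apply: le_trans h1 _; rewrite uE ler_peMr.
have e2 : cabs (eta - w t) ^+ n.+1 <= (8 * K * cabs (Y t)) ^+ n.+1.
  rewrite lerXn2r ?nnegrE ?cabs_ge0 ?mulr_ge0 ?(ltW K0)//.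
  rewrite uE; apply: (@le_trans _ _ (cabs (W t) * 2)); first by rewrite ler_wpM2l.
  by move: h2; nra.
rewrite !exprMn in e1 e2.
have f1 : c * (K ^+ n.+1 * cabs (Y t) ^+ n.+1) <= 1 - cabs (w t) ^+ 2.
  by apply: le_trans h4; rewrite ler_pM2l.
have f2 : 1 - cabs (w t) ^+ 2 <= c' * ((8 * K) ^+ n.+1 * cabs (Y t) ^+ n.+1).
  by apply: le_trans h5 _; rewrite ler_pM2l// exprMn.
have RW : Re (W t) = (1 - cabs (w t) ^+ 2) / cabs (eta + w t) ^+ 2 by rewrite /W Re_cay.
have q4 : cabs (eta + w t) ^+ 2 <= 4 by move: q2 q1; nra.
have q5 : 1 <= cabs (eta + w t) ^+ 2 by move: q1; nra.
split; last first.
  have := wD t; rewrite /inD; have := cabs_ge0 (w t).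
  move: f1; rewrite mulrA; set z1 := c * K ^+ n.+1 * _ => f1 g3 g4.
  have -> : c / 4 * K ^+ n.+1 * cabs (Y t) ^+ n.+1 = z1 / 4 by rewrite /z1; field.
  by nra.
rewrite RW; apply/andP; split.
  rewrite ler_pdivlMr ?exprn_gt0//; apply: le_trans f1.
  have -> : c * (K ^+ n.+1 * cabs (Y t) ^+ n.+1) = c / 4 * K ^+ n.+1 * cabs (Y t) ^+ n.+1 * 4 by field.
  by apply: ler_wpM2l => //; nneg.
rewrite ler_pdivrMr ?exprn_gt0//; apply: le_trans f2 _.
rewrite mulrA ler_peMr//; nneg.
Qed.

Lemma dense_le (F G : R -> R) (d t0 : R) : {for t0, continuous F} -> {for t0, continuous G} ->
  0 <= t0 < 2 * pi -> cabs (expi t0 - zeta) < d -> (forall t, good d t -> F t <= G t) -> F t0 <= G t0.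
Proof.
move=> cF cG ht td h; rewrite leNgt; apply/negP => GF.
have e0 : 0 < (F t0 - G t0) / 2 by rewrite divr_gt0// subr_gt0.
move/cvgrPdist_lt : cF => /(_ _ e0) cF; move/cvgrPdist_lt : cG => /(_ _ e0) cG.
have ce : ccvg (nbhs t0) (@expi R) (expi t0) by apply: ccvg_expi; exact: cvg_id.
have e1 : 0 < d - cabs (expi t0 - zeta) by rewrite subr_gt0.
have cd : \forall x \near t0, cabs (expi x - expi t0) < d - cabs (expi t0 - zeta).
  by move/ccvg_lt : ce; exact.
have [r /= r0 hr] : exists2 r : R, 0 < r & forall x, `|t0 - x| < r ->
    [/\ `|F t0 - F x| < (F t0 - G t0) / 2, `|G t0 - G x| < (F t0 - G t0) / 2 &
      cabs (expi x - expi t0) < d - cabs (expi t0 - zeta)].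
  have : \forall x \near t0, [/\ `|F t0 - F x| < (F t0 - G t0) / 2, `|G t0 - G x| < (F t0 - G t0) / 2 &
      cabs (expi x - expi t0) < d - cabs (expi t0 - zeta)].
    near=> x; split; by near: x.
  by move=> /nbhs_ballP[r /= r0 hr]; exists r.
have [t [/andP[h1 h2] h3 h4]] := dense_ae mN lN ht r0.
have tr : `|t0 - t| < r by rewrite distrC ger0_norm; lra.
have [k1 k2 k3] := hr t tr.
have gt : good d t.
  split=> //; first by rewrite h3 andbT; apply: le_trans (ltW h1); case/andP: ht.
  by apply: le_lt_trans (ler_cabs_distD _ _ (expi t0)) _; lra.
have := h t gt; have := ler_norm (F t0 - F t); have := ler_norm (- (G t0 - G t)).
rewrite normrN; lra.
Unshelve. all: by end_near. Qed.

(** Almost-everywhere bounds become bounds for the polynomial at every small [y] by density, and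
    [poly_contact] gives the limit. Evenness makes [y^n] equal to [cabs (iR y) ^+ n] on both sides
    of 0. *)
Lemma contact_of_boundary S : jet zeta n.+1 Psi S -> S.[0] = 0 -> ~~ odd n.+1 ->
  exists2 kap, 0 < kap & contact S n.+1 kap.
Proof.
move=> jS S0 on; have [d1 [K1 [K2 [d1b K10 K20 hd1]]]] := boundary_size_y jS S0.
have /andP[d10 d11] := d1b.
have e0 : 0 < K1 / 2 by ppos.
have [d2 /andP[d20 d21] hd2] := jet_boundary jS e0.
pose d := Num.min d1 d2.
have dd0 : 0 < d by rewrite lt_min d10.
have dd1 : d <= 1 by rewrite ge_min d11.
have gd t : good d t -> K1 / 2 * cabs (Y t) ^+ n.+1 <= Re S.[Y t] <= (K2 + K1) * cabs (Y t) ^+ n.+1.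
  move=> gt.
  have g1 : good d1 t by apply: good_le gt; rewrite ge_min lexx.
  have g2 : good d2 t by apply: good_le gt; rewrite ge_min lexx orbT.
  have [/andP[h1 h2] _] := hd1 t g1; have h3 := hd2 t g2.
  have := le_trans (cabs_Re _) h3; rewrite creB ler_norml => /andP[h4 h5].
  have : 0 <= cabs (Y t) ^+ n.+1 by rewrite exprn_ge0// cabs_ge0.
  by move: h1 h2 h4 h5; set x := cabs (Y t) ^+ n.+1; nra.
have all y : 0 < `|y| < d / 2 -> K1 / 2 * y ^+ n.+1 <= Re S.[iR y] <= (K2 + K1) * y ^+ n.+1.
  move=> /andP[y0 yd].
  have [t0 ht0 bE] := onT_expi (bpt_onT zT y).
  have td : cabs (expi t0 - zeta) < d.
    by rewrite -bE; apply: le_lt_trans (bpt_close zT y) _; lra.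
  have YE : Y t0 = iR y by rewrite /Y -bE cay_bpt.
  have q0 : zeta + expi t0 != 0 by rewrite -bE; exact: bptD_neq0.
  have cY : ccvg (nbhs t0) Y (Y t0).
    have ce : ccvg (nbhs t0) (@expi R) (expi t0) by apply: ccvg_expi; exact: cvg_id.
    apply: ccvgM; first by apply: ccvgB => //; exact: ccvg_cst.
    by apply: ccvgV => //; apply: ccvgD => //; exact: ccvg_cst.
  have cS : {for t0, continuous (fun t => Re S.[Y t])}.
    by apply: ccvg_Re; apply: (ccvg_comp cY); exact: ccont_poly.
  have cK (K : R) : {for t0, continuous (fun t => K * cabs (Y t) ^+ n.+1)}.
    by apply: cvgM; [exact: cvg_cst|apply: cvg_expn; exact: ccvg_cabs].
  have yE : cabs (Y t0) ^+ n.+1 = y ^+ n.+1.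
    by rewrite YE cabs_iR -normrX ger0_norm// exprn_even_ge0.
  rewrite -yE -YE; apply/andP; split.
    by apply: (dense_le (d := d) (cK _) cS) => // t /gd/andP[].
  by apply: (dense_le (d := d) cS (cK _)) => // t /gd/andP[].
have d20' : 0 < d / 2 by ppos.
have [y hy|kap hk] := @poly_contact n.+1 S (K2 + K1) (d / 2) d20'.
  have /andP[h1 h2] := all y hy.
  have y0 : 0 <= y ^+ n.+1 by rewrite exprn_even_ge0.
  by rewrite -normrX [`|y ^+ _|]ger0_norm// ger0_norm// (le_trans _ h1)// mulr_ge0// ltW.
exists kap => //; apply: (@lt_le_trans _ _ (K1 / 2)) => //.
apply: (ler_cvg_to (cvg_cst _) hk); exists (d / 2) => //= y yd y0.
have hy : 0 < `|y| < d / 2 by rewrite normr_gt0 y0 /=; move: yd; rewrite /= ?sub0r ?normrN.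
have /andP[h1 h2] := all y hy.
by rewrite ler_pdivlMr// exprn_even_gt0//= y0 orbT.
Qed.

End Contact.
End Point.
End ContactJet.

(** * The basic function attached to a contact point *)

Section BasicExists.
Variable R : realType.
Local Notation C := R[i].
Local Notation Re := complex.Re.
Local Notation Im := complex.Im.
Local Notation lam := (@lebesgue_measure R).
Implicit Types (z v a : C) (s t : R).

Lemma den_ge1 zeta z : onT zeta -> cabs (z - zeta) < 1 -> 1 <= cabs (zeta + z).
Proof.
move=> zT h; have := ler_cabs_dist (zeta + zeta) (zeta - z).
rewrite [cabs (zeta - _)]cabsB (_ : zeta + zeta - (zeta - z) = zeta + z); last by ring.
have -> : cabs (zeta + zeta) = 2.
  rewrite (_ : zeta + zeta = rC (1 + 1) * zeta); last by rewrite rCD rC1; ring.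
  by rewrite cabsM zT mulr1 cabs_rC ger0_norm.
by lra.
Qed.

Lemma cay_le zeta z : onT zeta -> cabs (z - zeta) < 1 -> cabs (cay zeta z) <= cabs (z - zeta).
Proof.
move=> zT h; have d1 := den_ge1 zT h.
by rewrite /cay cabsf_div cabsB ler_pdivrMr ?(lt_le_trans _ d1)// ler_peMr ?cabs_ge0.
Qed.

Lemma disc_map_diff eta (P Q : C) : onT eta -> 0 < Re P -> 0 < Re Q ->
  cabs (eta * ((1 - P) / (1 + P)) - eta * ((1 - Q) / (1 + Q))) <= 2 * cabs (P - Q).
Proof.
move=> eT P0 Q0.
have ge1 (X : C) : 0 < Re X -> 1 <= cabs (1 + X).
  by move=> X0; apply: le_trans (ler_Re_cabs _); rewrite creD /= lerDl ltW.
have n0 (X : C) : 0 < Re X -> 1 + X != 0.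
  by move=> X0; rewrite -cabs_gt0; apply: lt_le_trans (ge1 _ X0).
have p0 := n0 _ P0; have q0 := n0 _ Q0.
have -> : eta * ((1 - P) / (1 + P)) - eta * ((1 - Q) / (1 + Q)) =
   eta * (rC (1 + 1) * (Q - P)) / ((1 + P) * (1 + Q)) by rewrite rCD rC1; field; rewrite p0 q0.
rewrite cabsf_div !cabsM eT mul1r cabs_rC ger0_norm// [cabs (Q - P)]cabsB.
rewrite ler_pdivrMr; last by rewrite mulr_gt0 ?cabs_gt0.
rewrite ler_peMr ?mulr_ge0 ?cabs_ge0//.
by have := ge1 _ P0; have := ge1 _ Q0; nra.
Qed.

Lemma basic_cont f zeta d z : basic_fun f zeta d -> cabs z <= 1 ->
  ccvg (within (fun v => cabs v <= 1) (cnbhs z)) f (f z).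
Proof.
move=> [p [q [_ _ _ hf _]]] z1; have [q0 ->] := hf _ z1.
apply: (@eq_ccvg _ _ _ _ (fun v => p.[v] / q.[v])).
  by exists 1 => // v _ /hf[_ ->].
have h : ccvg (cnbhs z) (fun v => p.[v] / q.[v]) (p.[z] / q.[z]).
  by apply: ccvgM; [exact: ccont_poly|apply: ccvgV => //; exact: ccont_poly].
by apply: cvg_trans h; apply: cvg_app; exact: cvg_within.
Qed.

Lemma basic_lt1 f zeta d t : basic_fun f zeta d -> expi t <> zeta -> inD (f (expi t)).
Proof. by move=> [p [q [_ _ _ _ [_ _ h _]]]]; apply: h; rewrite /onT cabs_expi. Qed.

Lemma basic_radial f zeta d t : basic_fun f zeta d -> radial_lim f t (f (expi t)).
Proof.
move=> bf e e0; have t1 : cabs (expi t : C) <= 1 by rewrite cabs_expi.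
have := basic_cont bf t1; move/ccvg_lt => /(_ e e0) [r r0 hr].
exists r => // x /andP[x0 x1] xr; apply: hr.
  rewrite -{2}[expi t]mul1r -mulrBl cabsM cabs_expi mulr1 -rC1 -rCB cabs_rC distrC ger0_norm; lra.
by rewrite cabsM cabs_expi mulr1 cabs_rC ger0_norm; lra.
Qed.

Lemma basic_holo (f : C -> C) zeta d : basic_fun f zeta d -> holo_on_D f.
Proof.
move=> [p [q [_ _ _ hf _]]].
have h z : inD z -> q.[z] != 0 /\ f z = p.[z] / q.[z] by move=> zD; apply: hf; exact: ltW.
apply: (@holo_ext _ (fun z => p.[z] / q.[z])); first by move=> z /h[_ ->].
by apply: holoM; [exact: holo_poly|apply: holoV; [exact: holo_poly|move=> z /h[]]].
Qed.

Variable phi : C -> C.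
Hypothesis sphi : self_map phi.
Variables (w : R -> C) (N : set R).
Hypothesis mN : measurable N.
Hypothesis lN : lam N = 0%E.
Hypothesis wD : forall t, inD (w t).
Hypothesis hN : forall t, 0 <= t <= 2 * pi -> ~ N t -> radial_lim phi t (w t).
Variable zeta : C.
Hypothesis zT : onT zeta.
Local Notation bf := (bfilter zeta).

Lemma null_setU (A B : set R) : measurable A -> measurable B -> lam A = 0%E -> lam B = 0%E ->
  measurable (A `|` B) /\ lam (A `|` B) = 0%E.
Proof.
move=> mA mB A0 B0; split; first exact: measurableU.
exact: null_set_setU.
Qed.

Lemma contact_data k : contact_order phi zeta k -> exists eta N' (del c c' : R),
  [/\ nt_lim phi zeta eta, onT eta, [/\ measurable N', lam N' = 0%E & N `<=` N'],
    [/\ 0 < del, 0 < c & 0 < c'] & forall t, good zeta N' del t ->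
      c <= (1 - cabs (w t) ^+ 2) / cabs (eta - w t) ^+ k <= c'].
Proof.
move=> [eta [nl eT [del [c [c' [d0 c0 c'0 [M [mM lM hM]]]]]]]].
have [mU lU] := null_setU mN mM lN lM.
exists eta, (N `|` M), del, c, c'; split; [by []|by []|by split => //; exact: subsetUl|by []|].
move=> t [ht nt td].
have [l [rl hl]] := hM t ht (fun h => nt (or_intror h)) td.
by rewrite (radial_unique (hN ht (fun h => nt (or_introl h))) rl).
Qed.

(** Boundary values within half of [1 - cabs (w t)] have comparable distances to [eta] and to the
    circle, so only the constants of contact change. *)
Lemma contact_of_close f d m eta (N' : set R) (del c c' : R) : basic_fun f zeta d -> onT eta -> nt_lim f zeta eta ->
  measurable N' -> lam N' = 0%E -> 0 < del -> 0 < c -> 0 < c' ->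
  (forall t, good zeta N' del t -> c <= (1 - cabs (w t) ^+ 2) / cabs (eta - w t) ^+ m <= c') ->
  (forall t, good zeta N' del t -> cabs (w t - f (expi t)) <= 1 / 2 * (1 - cabs (w t))) ->
  contact_order f zeta m.
Proof.
move=> bff eT nl mM lM d0 c0 c'0 hc hcl.
exists eta; split => //; exists del, (c / 4 / (3 / 2) ^+ m), (3 * c' * 2 ^+ m).
split; [exact: d0|by ppos|by ppos|].
exists N'; split => // t ht nt td; exists (f (expi t)); split; first exact: basic_radial bff.
have gt : good zeta N' del t by [].
have /andP[h1 h2] := hc t gt; have h3 := hcl t gt.
set l := w t in h1 h2 h3 *; set l1 := f (expi t) in h3 *.
have lD : cabs l < 1 by exact: wD.
have u0 : 0 < cabs (eta - l) by rewrite cabs_gt0; exact: zetaB_neq0.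
have a1 := ler_cabs_dist eta l; rewrite eT in a1.
have a2 := ler_cabs_distD eta l1 l; have a3 := ler_cabs_distD eta l l1.
rewrite [cabs (l1 - l)]cabsB in a3.
have a4 := ler_cabs_dist l l1; have a5 := ler_cabs_dist l1 l; rewrite [cabs (l1 - l)]cabsB in a5.
have l0 := cabs_ge0 l; have l10 := cabs_ge0 l1.
have b1 : 1 / 2 * cabs (eta - l) <= cabs (eta - l1) by lra.
have b2 : cabs (eta - l1) <= 3 / 2 * cabs (eta - l) by lra.
have v0 : 0 < cabs (eta - l1) by lra.
have c1 : (1 - cabs l ^+ 2) / 4 <= 1 - cabs l1 ^+ 2 by nra.
have c2 : 1 - cabs l1 ^+ 2 <= 3 * (1 - cabs l ^+ 2) by nra.
have e1 : (1 / 2) ^+ m * cabs (eta - l) ^+ m <= cabs (eta - l1) ^+ m.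
  by rewrite -exprMn lerXn2r// nnegrE; lra.
have e2 : cabs (eta - l1) ^+ m <= (3 / 2) ^+ m * cabs (eta - l) ^+ m.
  by rewrite -exprMn lerXn2r// nnegrE; lra.
have um : 0 < cabs (eta - l) ^+ m by rewrite exprn_gt0.
have vm : 0 < cabs (eta - l1) ^+ m by rewrite exprn_gt0.
rewrite ler_pdivlMr// in h1; rewrite ler_pdivrMr// in h2.
apply/andP; split.
  rewrite ler_pdivlMr//; apply: le_trans c1.
  apply: (@le_trans _ _ (c / 4 * cabs (eta - l) ^+ m)); last by lra.
  have k0 : 0 < (3 / 2 : R) ^+ m by ppos.
  rewrite -[leLHS]mulrA ler_pM2l; last by ppos.
  by rewrite mulrC ler_pdivrMr// mulrC.
rewrite ler_pdivrMr//; apply: le_trans c2 _.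
apply: (@le_trans _ _ (3 * c' * cabs (eta - l) ^+ m)); first by lra.
rewrite -[leRHS]mulrA ler_pM2l; last by ppos.
have k0 : 0 < (2 : R) ^+ m by ppos.
by move: e1; rewrite expr_div_n expr1n mulrAC mul1r ler_pdivrMr// mulrC.
Qed.

(** Beyond the data asked of a basic function, this records closeness relative to [1 - cabs (w t)]
    on the circle, which is all that the compactness argument retains of the jets. *)
Lemma basic_exists m n (a : nat -> C) : contact_order phi zeta (2 * m)%N ->
  contact_order phi zeta n -> has_expansion phi zeta n a ->
  exists f, [/\ basic_fun f zeta m.+1, contact_order f zeta (2 * m)%N, same_D (2 * m)%N f phi zeta &
    exists N', [/\ measurable N', lam N' = 0%E & forall e : R, 0 < e -> exists2 d : R, 0 < d &
      forall t, good zeta N' d t -> cabs (w t - f (expi t)) <= e * (1 - cabs (w t))]].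
Proof.
move=> co1 co2 hexp.
have [eta [N1 [d1 [c1 [c1' [ntl eT [mN1 lN1 NN1] [d10 c10 c1'0] hc1]]]]]] := contact_data co1.
have [eta' [N2 [d2 [c2 [c2' [ntl' _ [mN2 lN2 NN2] [d20 c20 c2'0] hc2]]]]]] := contact_data co2.
have ce := expansion_a0 zT ntl hexp.
have E : eta = eta' by exact: (nt_bfilter zT ce ntl').
subst eta'; have [mM lM] := null_setU mN1 mN2 lN1 lN2.
pose M := N1 `|` N2; pose del := Num.min d1 d2.
have del0 : 0 < del by rewrite lt_min d10.
have hM t : 0 <= t <= 2 * pi -> ~ M t -> radial_lim phi t (w t).
  by move=> ht nt; apply: hN => // /NN1 h; apply: nt; left.
have hcM1 t : good zeta M del t -> c1 <= (1 - cabs (w t) ^+ 2) / cabs (eta - w t) ^+ (2 * m) <= c1'.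
  move=> [ht nt]; rewrite lt_min => /andP[td1 td2]; apply: hc1; split => // h; apply: nt; by left.
have hcM2 t : good zeta M del t -> c2 <= (1 - cabs (w t) ^+ 2) / cabs (eta - w t) ^+ n <= c2'.
  move=> [ht nt]; rewrite lt_min => /andP[td1 td2]; apply: hc2; split => // h; apply: nt; by right.
(* The expansion comes with its own exponent [n], the prescribed contact with [2 m]; uniqueness of
   the order identifies them. *)
have nE : n = (2 * m)%N.
  apply/eqP; rewrite eqn_leq; apply/andP; split.
    exact: (contact_leq zT eT ntl mM lM wD hM hexp del0 c10 hcM1 hcM2).
  exact: (contact_leq zT eT ntl mM lM wD hM hexp del0 c20 hcM2 hcM1).
have n0 := contact_pos zT eT ntl mM lM wD hM hexp del0 c10 hcM1.
subst n; case: m n0 => [|m] // _ in co1 co2 hexp hc1 hc2 hcM1 hcM2 *.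
have nn : (2 * m.+1)%N = (2 * m).+2 by rewrite mulnS.
rewrite nn in co1 co2 hexp hc1 hc2 hcM1 hcM2 *.
have on : ~~ odd (2 * m).+2 by rewrite -nn mul2n odd_double.
have [S jS S0] := jet_psi zT eT ntl hexp.
have [kap kap0 hkap] := contact_of_boundary sphi zT eT ntl mM lM wD hM hexp del0 c10 c1'0 hcM1 jS S0 on.
have [L [A [b [sL hL A0 b0 happ]]]] := cfrac_approx zT (holo_psi sphi eT) (psi_gt0 sphi eT) jS S0 kap0 hkap.
have [p [e [p0 e0 P1 [rts [urts srts hrts]]]]] := cfrac_generic hL A0 b0.
set pq := cfbase p e A b in P1 hrts.
have rp : rpos pq := cfbase_rpos p0 e0 A0 b0.
have base : ccvg bf (fun z => (pq.1.[cay zeta z] / pq.2.[cay zeta z])^-1 - rC A / cay zeta z - b) 0.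
  have cc := cay_cvg zT.
  apply: (@eq_ccvg _ _ _ _ (fun z => rC e * (cay zeta z / (1 + rC p * cay zeta z)))).
    apply: near_bfilter => z zD.
    have v0 : 0 <= Re (cay zeta z) by apply: ltW; exact: Re_cay_gt0.
    have [_ hb] := cfbase_inv p0 e0 A0 b0 v0 (cay_neq0 zT zD).
    by rewrite -hb.
  have -> : (0 : C) = rC e * (0 / (1 + rC p * 0)) by rewrite mul0r mulr0.
  apply: ccvgM; first exact: ccvg_cst.
  apply: ccvgM => //; apply: ccvgV; first by rewrite mulr0 addr0 oner_neq0.
  by apply: ccvgD; [exact: ccvg_cst|apply: ccvgM => //; exact: ccvg_cst].
have app := happ _ rp base.
have Q0 : (cfrac L pq).2.[0] != 0 by apply: cfrac_at0 => //; exact: cfbase_at0.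
have P0 : (cfrac L pq).1.[0] = 0.
  case: (L) => [|ab L'].
    exact: etrans (cfbaseE p e A b 0).1 (mul0r _).
  exact: etrans (cfstepE ab (cfrac L' pq) 0).1 (mul0r _).
have tp : top_pos m.+2 (cfrac L pq).
  by rewrite -sL -addn2; apply: cfrac_top => //; exact: cfbase_top.
have ncr : no_common_root (cfrac L pq).
  by apply: cfrac_ncr => //; [exact: cfbase_at0|exact: cfbase_ncr].
rewrite sL in srts.
have [f [bff fz hf]] := basic_of_ratio zT eT (rpos_cfrac hL rp) tp ncr P0 Q0 P1 urts srts hrts.
have close (ep : R) : 0 < ep -> exists2 d : R, 0 < d & forall z, inD z -> cabs (z - zeta) < d ->
    cabs (phi z - f z) <= ep * cabs (z - zeta) ^+ (2 * m).+2.
  move=> ep0; have ep2 : 0 < ep / 2 by ppos.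
  move/ccvg_lt : app => /(_ _ ep2) [d d0 hd].
  exists (Num.min d 1); first by rewrite lt_min d0 ltr01.
  move=> z zD; rewrite lt_min => /andP[zd z1].
  have [psi [psi0 psiE ->]] := hf _ zD.
  rewrite (phi_psi sphi eT zD).
  apply: le_trans (disc_map_diff eT (psi_gt0 sphi eT zD) psi0) _.
  have := hd _ zd zD; rewrite subr0 -psiE cabsf_div cabsX.
  have c0 : 0 < cabs (cay zeta z) by rewrite cabs_gt0 cay_neq0.
  rewrite ltr_pdivrMr ?exprn_gt0// => h.
  have h1 : cabs (cay zeta z) ^+ (2 * m).+2 <= cabs (z - zeta) ^+ (2 * m).+2.
    by rewrite lerXn2r ?nnegrE ?cabs_ge0// cay_le.
  by move: h h1; set x1 := _ ^+ _; set x2 := _ ^+ _; set x3 := cabs (_ - psi); nra.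
have hexpf : has_expansion f zeta (2 * m).+2 a.
  move=> ep ep0; have ep2 : 0 < ep / 2 by ppos.
  have [r1 r10 hr1] := close _ ep2; have [r2 r20 hr2] := hexp _ ep2.
  exists (Num.min r1 r2); first by rewrite lt_min r10.
  move=> z zD; rewrite lt_min => /andP[z1 z2].
  apply: le_trans (ler_cabs_distD _ _ (phi z)) _; rewrite [cabs (f z - _)]cabsB.
  by have := hr1 _ zD z1; have := hr2 _ zD z2; set x1 := cabs (z - zeta) ^+ _; lra.
(* Equal jets give [o] of the power [(2 m).+2] of the distance to [zeta], and contact bounds
   [1 - cabs (w t)] below by a multiple of the same power. The factor [2 ^+ (2 * m).+2] compares the
   distance with [cay]. *)
have bclose : forall ep : R, 0 < ep -> exists2 d : R, 0 < d & forall t, good zeta M d t ->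
    cabs (w t - f (expi t)) <= ep * (1 - cabs (w t)).
  have [r1 [K1 [K2 [/andP[r10 r11] K10 K20 hK]]]] :=
    boundary_size_y sphi zT eT ntl wD hM hexp del0 c10 c1'0 hcM1 jS S0.
  move=> ep ep0; have ep1 : 0 < ep * K1 / 2 ^+ (2 * m).+2 by ppos.
  have [r2 r20 hr2] := close _ ep1.
  exists (Num.min r1 r2); first by rewrite lt_min r10.
  move=> t gt; have [ht nt] := gt; rewrite lt_min => /andP[t1 t2].
  have g1 : good zeta M r1 t by apply: good_le gt; rewrite ge_min lexx.
  have [_ hk] := hK t g1.
  have t11 : cabs (expi t - zeta) < 1 by exact: lt_le_trans r11.
  have [_ y2 _] := circle_cay zT t11.
  have cz := zpol_rk_cvg t.
  have cp := radial_seq (hM t ht nt).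
  have cf := radial_seq (@basic_radial _ _ _ t bff).
  have h1 : cabs (w t - f (expi t)) <= ep * K1 / 2 ^+ (2 * m).+2 * cabs (expi t - zeta) ^+ (2 * m).+2.
    have q1 : (fun k => cabs (phi (zpol (rk R k) t) - f (zpol (rk R k) t))) @ \oo --> cabs (w t - f (expi t)).
      by apply: ccvg_cabs; exact: ccvgB.
    have q2 : (fun k => ep * K1 / 2 ^+ (2 * m).+2 * cabs (zpol (rk R k) t - zeta) ^+ (2 * m).+2) @ \oo -->
        ep * K1 / 2 ^+ (2 * m).+2 * cabs (expi t - zeta) ^+ (2 * m).+2.
      apply: cvgM; first exact: cvg_cst.
      by apply: cvg_expn; apply: ccvg_cabs; apply: ccvgB => //; exact: ccvg_cst.
    apply: (ler_cvg_to q1 q2); apply: filterS (near_zpol t2) => k hk2.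
    by apply: hr2 => //; rewrite /inD cabs_zpol normrk.
  apply: le_trans h1 _.
  apply: (@le_trans _ _ (ep * (K1 * cabs (cay zeta (expi t)) ^+ (2 * m).+2))); last by rewrite ler_pM2l.
  apply: (@le_trans _ _ (ep * K1 / 2 ^+ (2 * m).+2 * (2 * cabs (cay zeta (expi t))) ^+ (2 * m).+2)).
    by rewrite ler_pM2l// lerXn2r ?nnegrE ?cabs_ge0// mulr_ge0// cabs_ge0.
  by rewrite exprMn [leLHS]mulrA divfK ?expf_neq0 ?pnatr_eq0// mulrA.
have ntf : nt_lim f zeta eta.
  move=> K K1 ep ep0; have ep2 : 0 < ep / 2 by ppos.
  move/ccvg_lt : ce => /(_ _ ep2) [r1 r10 hr1]; have [r2 r20 hr2] := close _ ltr01.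
  exists (Num.min r1 (Num.min r2 (Num.min 1 (ep / 2)))); first by rewrite !lt_min r10 r20 ltr01.
  move=> z [zD _]; rewrite !lt_min => /and4P[z1 z2 z3 z4].
  apply: le_lt_trans (ler_cabs_distD _ _ (phi z)) _; rewrite [cabs (f z - _)]cabsB.
  have h1 := hr1 _ z1 zD; have h2 := hr2 _ zD z2; rewrite mul1r in h2.
  have h3 : cabs (z - zeta) ^+ (2 * m).+2 <= cabs (z - zeta).
    by rewrite exprS ler_piMr ?cabs_ge0// exprn_ile1 ?cabs_ge0// ltW.
  by lra.
exists f; split => //.
- have [|r r0 hr] := bclose (1 / 2); first by ppos.
  apply: (contact_of_close bff eT ntf mM lM (del := Num.min del r) _ c10 c1'0).
  + by rewrite lt_min del0.
  + by move=> t gt; apply: hcM1; apply: good_le gt; rewrite ge_min lexx.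
  + by move=> t gt; apply: hr; apply: good_le gt; rewrite ge_min lexx orbT.
- by exists a.
- by exists M.
Qed.

End BasicExists.

(** * Norms and means *)

Section Means.
Variable R : realType.
Local Notation C := R[i].
Local Notation Re := complex.Re.
Local Notation Im := complex.Im.
Local Notation GR := (measurableTypeR R).
Local Notation lam := (@lebesgue_measure R).
Local Notation mfunR f := (measurable_fun (setT : set GR) (f : GR -> R)).
Implicit Types (z : C) (s t : R).
Let pi2 : 0 < 2 * pi :> R := @pi2_gt0 R.

Definition mean2 (f : C -> C) (r : R) := RI 0 (2 * pi) (fun t => cabs (f (zpol r t)) ^+ 2).

Lemma circ_contsqr (f : C -> C) (r : R) : holo_on_D f -> `|r| < 1 ->
  continuous (fun t => cabs (f (zpol r t)) ^+ 2).
Proof. by move=> hf r1 t; apply: cvg_expn; apply: ccvg_cabs; exact: circ_ccvg. Qed.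

Lemma mean2_rint (f : C -> C) (r : R) : holo_on_D f -> `|r| < 1 ->
  rint 0 (2 * pi) (fun t => cabs (f (zpol r t)) ^+ 2).
Proof. by move=> hf r1; apply: contT_rint; exact: circ_contsqr. Qed.

Lemma mean2_ge0 (f : C -> C) (r : R) : 0 <= mean2 f r.
Proof. by apply: RI_ge0 => t _; rewrite exprn_ge0// cabs_ge0. Qed.

Lemma I02cE : @I02c R = `[0, 2 * pi]%classic.
Proof. by apply/seteqP; split => t; rewrite /I02c /= in_itv. Qed.

Lemma h2sq_le (f : C -> C) (M : R) : holo_on_D f ->
  (h2sq f <= M%:E)%E <-> (forall r : R, 0 < r < 1 -> mean2 f r <= M).
Proof.
move=> hf.
have E (r : R) : 0 < r < 1 -> (\int[lam]_(t in @I02c R) (cabs (f (rC r * expi t)) ^+ 2)%:E)%E = (mean2 f r)%:E.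
  move=> /andP[r0 r1]; rewrite I02cE /mean2 RI_EFin//; apply: mean2_rint => //.
  by rewrite gtr0_norm.
split=> [h r r01|h].
  rewrite -lee_fin -E//; apply: le_trans h; apply: ereal_sup_ubound.
  by exists r => //=; rewrite in_itv.
apply: ge_ereal_sup => x [r /=]; rewrite in_itv /= => r01 <-.
by rewrite E// lee_fin h.
Qed.

Lemma h2sq_ge0 (f : C -> C) : (0 <= h2sq f)%E.
Proof.
apply: (@le_trans _ _ (\int[lam]_(t in @I02c R) (cabs (f (rC (1 / 2) * expi t)) ^+ 2)%:E)%E).
  by apply: integral_ge0 => t _; rewrite lee_fin exprn_ge0// cabs_ge0.
apply: ereal_sup_ubound; exists (1 / 2) => //=; rewrite in_itv /=; apply/andP; split; lra.
Qed.

Lemma measurable_poisson_circ (r : R) : `|r| < 1 ->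
  measurable_fun (setT : set (GR * GR)) (fun p : GR * GR => poisson (zpol r p.1 : C) p.2).
Proof.
move=> r1; apply: measurable_poissonC.
- have cR : continuous (fun t : R => Re (zpol r t)).
    by move=> t; apply: ccvg_Re; apply: zpol_cvg; [exact: cvg_cst|exact: cvg_id].
  exact: measurableT_comp (continuous_measurable_fun cR) measurable_fst.
- have cR : continuous (fun t : R => Im (zpol r t)).
    by move=> t; apply: ccvg_Im; apply: zpol_cvg; [exact: cvg_cst|exact: cvg_id].
  exact: measurableT_comp (continuous_measurable_fun cR) measurable_fst.
- exact: measurable_snd.
- by move=> p; rewrite /inD cabs_zpol.
Qed.

(** The squared modulus on the inner circle is dominated by its Poisson mean over the outer one;
    averaging in the angle, the kernel integrates to [2 pi] by symmetry. *)
Lemma mean2_mono (f : C -> C) (r r' : R) : holo_on_D f -> 0 <= r < r' -> r' < 1 -> mean2 f r <= mean2 f r'.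
Proof.
move=> hf /andP[r0 rr] r1; have r'0 : 0 < r' by exact: le_lt_trans rr.
pose q := r / r'.
have q0 : 0 <= q by rewrite divr_ge0// ltW.
have q1 : q < 1 by rewrite /q ltr_pdivrMr// mul1r.
have nq : `|q| < 1 by rewrite ger0_norm.
have nr : `|r'| < 1 by rewrite gtr0_norm.
have nr0 : `|r| < 1 by rewrite ger0_norm//; lra.
pose F s := cabs (f (zpol r' s)) ^+ 2.
have cF : continuous F by exact: circ_contsqr.
have [K [K0 hK]] := cont_bounded (2 * pi) cF.
have r'01 : 0 <= r' < 1 by rewrite (ltW r'0).
have zE t : zpol r t = rC r' * zpol q t.
  by rewrite /zpol mulrA -rCM /q [r' * _]mulrC divfK// gt_eqF.
have qD t : inD (zpol q t) by rewrite /inD cabs_zpol.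
pose G t s := F s * poisson (zpol q t : C) s.
have mG : measurable_fun (setT : set (GR * GR)) (fun p : GR * GR => G p.1 p.2).
  apply: measurable_funM; last exact: measurable_poisson_circ.
  exact: measurableT_comp (continuous_measurable_fun cF) measurable_snd.
have F0 s : 0 <= F s by rewrite exprn_ge0// cabs_ge0.
have G0 t s : 0 <= G t s by rewrite mulr_ge0// poisson_ge0.
have P1 t s : poisson (zpol q t : C) s <= (1 + q) / (1 - q).
  by have := poisson_le s (qD t); rewrite cabs_zpol ger0_norm.
have GB t s : 0 <= t <= 2 * pi -> 0 <= s <= 2 * pi -> G t s <= K * ((1 + q) / (1 - q)).
  move=> _ hs; apply: ler_pM => //; first exact: poisson_ge0.
  by apply: le_trans (hK s hs); exact: ler_norm.
have mS t : mfunR (G t) by exact: (measurableT_comp mG (pair1_measurable t)).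
have mT s : mfunR (G^~ s) by exact: (measurableT_comp mG (pair2_measurable s)).
have iG t : 0 <= t <= 2 * pi -> rint 0 (2 * pi) (G t).
  by move=> ht; apply: (bounded_rint (M := K * ((1 + q) / (1 - q)))) => // s hs; rewrite ger0_norm// GB.
have mI : mfunR (fun t => RI 0 (2 * pi) (G t)).
  have cI : continuous (fun t => RI 0 (2 * pi) (G t)).
    move=> t; apply: (@poisson_int_ccvg _ _ (nbhs t) _ (fun t => zpol q t) F) => //.
      exact: nearW.
    by apply: zpol_cvg; [exact: cvg_cst|exact: cvg_id].
  exact: continuous_measurable_fun.
have -> : mean2 f r' = (2 * pi)^-1 * RI 0 (2 * pi) (fun t => RI 0 (2 * pi) (G t)).
  rewrite (RI_swap mG G0 GB).
  have -> : RI 0 (2 * pi) (fun s => RI 0 (2 * pi) (G^~ s)) = RI 0 (2 * pi) (fun s => 2 * pi * F s).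
    apply: eq_RI => s hs; rewrite /G RIZ; first by rewrite mean_poissonl ?q0// mulrC.
    apply: (bounded_rint (M := (1 + q) / (1 - q))).
      by have := measurableT_comp (measurable_poisson_circ nq) (pair2_measurable s).
    by move=> t _; rewrite ger0_norm ?poisson_ge0.
  by rewrite RIZ; [rewrite mulrA mulVf ?mul1r// gt_eqF|exact: contT_rint].
have iI : rint 0 (2 * pi) (fun t => RI 0 (2 * pi) (G t)).
  apply: (bounded_rint (M := K * ((1 + q) / (1 - q)) * (2 * pi - 0))) => // t ht.
  apply: RI_bound; [exact: ltW|exact: iG|move=> s hs; by rewrite ger0_norm// GB].
rewrite -RIZ//; apply: le_RI; [exact: mean2_rint|exact: rintZ|].
by move=> t _; rewrite zE; exact: sqr_bound.
Qed.

Lemma h2_point (f : C -> C) (M : R) rho z : holo_on_D f -> mean2 f rho <= M ->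
  0 <= rho < 1 -> inD z ->
  cabs (f (rC rho * z)) ^+ 2 <= (2 * pi)^-1 * ((1 + cabs z) / (1 - cabs z) * M).
Proof.
move=> hf hM r01 zD; apply: le_trans (sqr_bound hf r01 zD) _.
have r1 : `|rho| < 1 by case/andP: r01 => h1 h2; rewrite ger0_norm.
rewrite ler_pM2l ?invr_gt0//; apply: (@le_trans _ _ ((1 + cabs z) / (1 - cabs z) * mean2 f rho)); last first.
  apply: ler_wpM2l => //; apply: divr_ge0; last by rewrite subr_ge0 ltW.
  by rewrite addr_ge0// cabs_ge0.
rewrite -RIZ; last exact: mean2_rint.
apply: le_RI.
- by apply: poisson_rint => //; exact: circ_contsqr.
- by apply: rintZ; exact: mean2_rint.
- move=> t _; rewrite mulrC ler_wpM2r ?exprn_ge0 ?cabs_ge0//.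
  exact: poisson_le.
Qed.

Lemma h2_point1 (f : C -> C) (M : R) z : holo_on_D f -> (forall r : R, 0 < r < 1 -> mean2 f r <= M) ->
  inD z -> cabs (f z) ^+ 2 <= (2 * pi)^-1 * ((1 + cabs z) / (1 - cabs z) * M).
Proof.
move=> hf hM zD; have c := rad_ccvg hf zD.
have c1 : (fun r => cabs (f (rC r * z)) ^+ 2) @ (1 : R)^'- --> cabs (f z) ^+ 2.
  by apply: cvg_expn; exact: ccvg_cabs.
apply: (ler_cvg_to c1 (cvg_cst _)); near=> r.
have r0 : 0 < r by near: r; exact: nbhs_left_gt.
have r1 : r < 1 by near: r; exact: nbhs_left_lt.
by apply: h2_point => //; [apply: hM; rewrite r0|rewrite (ltW r0)].
Unshelve. all: by end_near. Qed.

(** A one-sided Schur test: only the integrals of the kernel [V] in its first variable need to be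
    bounded by [K]. *)
Lemma tonelli_bound (F : R -> R) (V : R -> R -> R) (g : R -> R) (K c : R) :
  rint 0 (2 * pi) F -> mfunR F -> (forall s, 0 <= F s) ->
  measurable_fun (setT : set (GR * GR)) (fun p : GR * GR => V p.1 p.2) ->
  (forall t s, 0 <= V t s) ->
  (forall t, rint 0 (2 * pi) (fun s => F s * V t s)) ->
  (forall s, 0 <= s <= 2 * pi -> rint 0 (2 * pi) (V^~ s) /\ RI 0 (2 * pi) (V^~ s) <= K) ->
  0 <= c -> rint 0 (2 * pi) g ->
  (forall t, 0 <= t <= 2 * pi -> 0 <= g t <= RI 0 (2 * pi) (fun s => F s * V t s) + c) ->
  RI 0 (2 * pi) g <= K * RI 0 (2 * pi) F + 2 * pi * c.
Proof.
move=> iF mF F0 mV V0 iV hV c0 ig hg.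
rewrite -lee_fin RI_EFin// EFinD.
have mFV : measurable_fun (setT : set (GR * GR)) (fun p : GR * GR => (F p.2 * V p.1 p.2)%:E).
  apply/measurable_EFinP; apply: measurable_funM => //.
  exact: measurableT_comp mF measurable_snd.
have FV0 (p : GR * GR) : (0 <= (F p.2 * V p.1 p.2)%:E)%E by rewrite lee_fin mulr_ge0.
have TE := @tonelli_on _ `[0, 2 * pi]%classic `[0, 2 * pi]%classic _
  (measurable_itv _) (measurable_itv _) mFV FV0.
have mI (H : GR * GR -> \bar R) : measurable_fun setT H -> (forall p, 0 <= H p)%E ->
    measurable_fun (setT : set GR) (fun t : GR => (\int[lam]_(s in `[0%R, (2 * pi)%R]) H (t, s))%E).
  move=> mH H0; pose G := H \_ (setT `*` `[0, 2 * pi]%classic).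
  have mG : measurable_fun setT G.
    apply/(measurable_restrictT _ (measurableX measurableT (measurable_itv _))).
    exact: measurable_funS mH.
  have G0 p : (0 <= G p)%E by apply: erestrict_ge0 => q _; exact: H0.
  have := @measurable_fun_fubini_tonelli_F _ _ _ _ R lam G mG G0.
  apply: eq_measurable_fun => t _.
  rewrite /fubini_F [RHS]integral_mkcond; apply: eq_integral => s _.
  by rewrite /G !patchE in_setX /= in_setT.
apply: (@le_trans _ _ (\int[lam]_(t in `[0%R, (2 * pi)%R]) ((\int[lam]_(s in `[0%R, (2 * pi)%R]) (F s * V t s)%:E) + c%:E))%E).
  apply: ge0_le_integral => //=.
  - by move=> t; rewrite in_itv /= lee_fin => /hg/andP[].
  - by case/integrableP : ig.
  - by apply: emeasurable_funD => //; apply: measurable_funTS; exact: (mI _ mFV FV0).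
  - move=> t; rewrite in_itv /= => ht; rewrite -RI_EFin// -EFinD lee_fin.
    by have /andP[] := hg t ht.
rewrite ge0_integralD//=; last 2 first.
- by move=> t _; apply: integral_ge0 => s _; rewrite lee_fin mulr_ge0.
- by apply: measurable_funTS; exact: (mI _ mFV FV0).
apply: leeD; last first.
  rewrite integral_cst//= lebesgue_measure_itv /= lte_fin pi2 oppr0 adde0 -EFinM.
  by rewrite lee_fin mulrC.
rewrite [leLHS]TE EFinM.
rewrite RI_EFin// -ge0_integralZl//=; last 3 first.
- by apply/measurable_EFinP; exact: measurable_funTS.
- by move=> s _; rewrite lee_fin.
- have z0 : 0 <= (0 : R) <= 2 * pi by rewrite lexx ltW.
  rewrite lee_fin; have [_ h] := hV _ z0; apply: le_trans h.
  by apply: RI_ge0.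
apply: ge0_le_integral => //=.
- by move=> s _; apply: integral_ge0 => t _; rewrite lee_fin mulr_ge0.
- apply: measurable_funTS; apply: (mI (fun p => (F p.1 * V p.2 p.1)%:E)).
    exact: measurableT_comp mFV (measurable_fun_pair measurable_snd measurable_fst).
  by move=> p; rewrite lee_fin mulr_ge0.
- by apply/measurable_EFinP; apply: measurable_funM => //; exact: measurable_funTS.
- move=> s; rewrite in_itv /= => hs; have [i h] := hV s hs.
  rewrite -RI_EFin; last exact: rintZ.
  by rewrite RIZ// -EFinM lee_fin mulrC ler_wpM2r.
Qed.

(** For a bounded function the means increase to the integral of the boundary values. On the null
    set [G] is set to 0, so that pointwise bounds on [G] hold there trivially. *)
Lemma mean2_boundary (g : C -> C) (K : R) (l : R -> C) (N : set R) : holo_on_D g ->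
  (forall z, inD z -> cabs (g z) <= K) -> measurable N -> lam N = 0%E ->
  (forall t, 0 <= t <= 2 * pi -> ~ N t -> radial_lim g t (l t)) ->
  exists G : R -> R, [/\ rint 0 (2 * pi) G,
    forall t, 0 <= t <= 2 * pi -> ~ N t -> G t = cabs (l t) ^+ 2,
    forall t, N t -> G t = 0 & forall r : R, 0 <= r < 1 -> mean2 g r <= RI 0 (2 * pi) G].
Proof.
move=> hg gK mN lN hN.
pose D : set R := `[0, 2 * pi] `\` N.
have mD : measurable D by exact: measurableD.
pose G := (fun t => cabs (l t) ^+ 2) \_ D.
have cvgG t : D t -> (fun n => cabs (g (zpol (rk R n) t)) ^+ 2) @ \oo --> cabs (l t) ^+ 2.
  move=> [] /=; rewrite in_itv /= => ht nt; apply: cvg_expn; apply: ccvg_cabs.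
  by apply: radial_seq; exact: hN.
have mG : mfunR G.
  apply: (iffLR (measurable_restrictT (D := D) (fun t => cabs (l t) ^+ 2) mD)).
  apply: (measurable_fun_cvg (h := fun n t => cabs (g (zpol (rk R n) t)) ^+ 2)).
    move=> n; apply: measurable_funTS; apply: continuous_measurable_fun.
    exact: circ_contsqr (normrk _ _).
  by move=> t Dt; exact: cvgG.
have GE t : 0 <= t <= 2 * pi -> ~ N t -> G t = cabs (l t) ^+ 2.
  by move=> ht nt; rewrite /G patchE mem_set//; split => //=; rewrite in_itv.
exists G.
have [iG cG] := @RI_dct_ae R (fun n t => cabs (g (zpol (rk R n) t)) ^+ 2) G 0 (2 * pi) (K ^+ 2) N
  (fun n => continuous_measurable_fun (circ_contsqr hg (normrk R n))) mG
  (fun n t _ => ltac:(rewrite ger0_norm ?exprn_ge0 ?cabs_ge0//; apply: lerXn2r;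
     rewrite ?nnegrE ?cabs_ge0//; [apply: le_trans (cabs_ge0 _) (gK _ (inD0 R))|
     apply: gK; rewrite /inD cabs_zpol; exact: normrk])) mN lN
  (fun t ht nt => ltac:(rewrite (GE t ht nt); apply: cvgG; split => //=; by rewrite in_itv)).
split => // [t nt|r /andP[r0 r1]].
  by rewrite /G patchE memNset// => -[].
apply: (ler_cvg_to (cvg_cst _) cG).
have e0 : 0 < 1 - r by rewrite subr_gt0.
have c := @rk_cvg R; move/cvgrPdist_lt : c => /(_ _ e0); apply: filterS => n.
rewrite ger0_norm ?subr_ge0 ?(ltW (rk_lt1 _ _))// => hn.
by apply: mean2_mono => //; [rewrite r0; lra|exact: rk_lt1].
Qed.

End Means.

(** * The essential norm estimate *)

Section Key.
Variable R : realType.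
Local Notation C := R[i].
Local Notation Re := complex.Re.
Local Notation Im := complex.Im.
Local Notation GR := (measurableTypeR R).
Local Notation lam := (@lebesgue_measure R).
Local Notation mfunR f := (measurable_fun (setT : set GR) (f : GR -> R)).
Implicit Types (z : C) (s t : R).
Let pi2 : 0 < 2 * pi :> R := @pi2_gt0 R.

Lemma fin_radius (I : finType) (P : I -> R -> Prop) :
  (forall i d d', P i d -> 0 < d' <= d -> P i d') ->
  (forall i, exists2 d, 0 < d & P i d) -> exists2 d, 0 < d & forall i, P i d.
Proof.
move=> Pmono ex.
have ex' i : exists d, 0 < d /\ P i d by have [d] := ex i; exists d.
have [d hd] := choice ex'.
have m0 : 0 < \big[Num.min/1]_i d i by apply: lt_bigmin => // i _; case: (hd i).
exists (\big[Num.min/1]_i d i) => // i.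
by have [_ h] := hd i; apply: Pmono h _; rewrite m0 bigmin_le.
Qed.

Lemma min_lip (x y x' y' k : R) : `|x - x'| <= k -> `|y - y'| <= k -> `|Num.min x y - Num.min x' y'| <= k.
Proof.
rewrite !ler_norml => /andP[h1 h2] /andP[h3 h4].
by apply/andP; split; rewrite !minEle; case: (leP x y) => a1; case: (leP x' y') => a2; lra.
Qed.

(** The distance to the finite set, truncated at [d] so that the empty list also has a value. *)
Lemma dist_exists (l : seq C) (d : R) : 0 < d -> exists D : C -> R,
  [/\ forall z z', `|D z - D z'| <= cabs (z - z'),
      forall zeta z, zeta \in l -> D z <= cabs (z - zeta) &
      forall z, (forall zeta, zeta \in l -> d <= cabs (z - zeta)) -> d <= D z].
Proof.
move=> d0; elim: l => [|a l [D [h1 h2 h3]]].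
  by exists (fun=> d); split => // z z'; rewrite subrr normr0 cabs_ge0.
exists (fun z => Num.min (cabs (z - a)) (D z)); split.
- move=> z z'; apply: min_lip => //; rewrite ler_norml; apply/andP; split.
    have := ler_cabs_dist (z' - a) (z - a).
    by rewrite (_ : z' - a - (z - a) = z' - z); [rewrite [cabs (z' - z)]cabsB; lra|ring].
  have := ler_cabs_dist (z - a) (z' - a).
  by rewrite (_ : z - a - (z' - a) = z - z'); [lra|ring].
- move=> zeta z; rewrite inE => /orP[/eqP->|/h2 h]; first by rewrite ge_min lexx.
  by rewrite ge_min h orbT.
- move=> z h; rewrite le_min h ?mem_head//= h3// => zeta zl; apply: h.
  by rewrite inE zl orbT.
Qed.

Lemma cutoff_exists (l : seq C) (d : R) : 0 < d -> exists X : C -> R,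
  [/\ forall z, 0 <= X z <= 1,
      forall z z', `|X z - X z'| <= 2 / d * cabs (z - z'),
      forall zeta z, zeta \in l -> cabs (z - zeta) <= d / 2 -> X z = 0 &
      forall z, (forall zeta, zeta \in l -> d <= cabs (z - zeta)) -> X z = 1].
Proof.
move=> d0; have [D [h1 h2 h3]] := dist_exists l d0.
have k0 : 0 < 2 / d by ppos.
have kd : 2 / d * d = 2 by rewrite divfK// gt_eqF.
(* The function [min 1 (max 0 (2 D / d - 1))], with the maximum written through [Num.min] so that
   one Lipschitz lemma covers both operations. *)
exists (fun z => Num.min 1 (- Num.min 0 (- (2 / d * D z - 1)))); split.
- move=> z; rewrite le_min ler01 ge_min lexx /= oppr_ge0 ge_min lexx.
  by [].
- move=> z z'; have kk : 0 <= 2 / d * cabs (z - z') by rewrite mulr_ge0 ?cabs_ge0// ltW.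
  apply: min_lip; first by rewrite subrr normr0.
  rewrite -opprD normrN; apply: min_lip; first by rewrite subrr normr0.
  rewrite -opprD normrN (_ : _ - 1 - (_ - 1) = 2 / d * (D z - D z')); last by ring.
  by rewrite normrM gtr0_norm// ler_pM2l.
- move=> zeta z zl zd; have hD := le_trans (h2 _ z zl) zd.
  have : 2 / d * D z <= 1.
    apply: (@le_trans _ _ (2 / d * (d / 2))); first by rewrite ler_pM2l.
    by rewrite mulrA kd divff.
  by move=> h; rewrite (min_idPl (_ : 0 <= _)) ?oppr0 ?(min_idPr (_ : 0 <= 1))//; lra.
- move=> z /h3 h; have : 2 <= 2 / d * D z by rewrite -[X in X <= _]kd ler_pM2l.
  move=> hh; rewrite (min_idPr (_ : - _ <= 0)) ?opprK; last by lra.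
  by apply/min_idPl; lra.
Qed.

Lemma basic_gap f zeta k (d : R) : basic_fun f zeta k -> 0 < d -> exists2 h : R, 0 < h &
  forall t, 0 <= t <= 2 * pi -> d <= cabs (expi t - zeta) -> cabs (f (expi t)) <= 1 - h.
Proof.
(* The last term penalizes only parameters within [d] of [zeta], so [q] is positive on the whole
   circle and its minimum is the gap elsewhere. *)
move=> bff d0; pose q t := 1 - cabs (f (expi t)) + (d - Num.min (cabs (expi t - zeta)) d).
have ce t : ccvg (nbhs t) (@expi R) (expi t) by apply: ccvg_expi; exact: cvg_id.
have cq : continuous q.
  move=> t; apply: cvgD.
    apply: cvgB; first exact: cvg_cst.
    apply: ccvg_cabs; apply/ccvg_lt => e e0.
    have t1 : cabs (expi t : C) <= 1 by rewrite cabs_expi.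
    have := basic_cont bff t1; move/ccvg_lt => /(_ e e0) [r r0 hr].
    have := ce t; move/ccvg_lt => /(_ r r0); apply: filterS => x hx.
    by apply: hr => //; rewrite cabs_expi.
  apply: cvgB; first exact: cvg_cst.
  have c1 : ccvg (nbhs t) (fun x => expi x - zeta) (expi t - zeta) by apply: ccvgB; [exact: ce|exact: ccvg_cst].
  exact: cvg_minl (ccvg_cabs c1).
have [c _ hc] := EVT_min (ltW pi2) (continuous_subspaceT cq).
have q0 : 0 < q c.
  rewrite /q; have [E|nE] := eqVneq (expi c) zeta.
    have [p [r [_ _ _ _ [_ fT _ _]]]] := bff.
    by rewrite E fT [zeta - _]subrr cabs0 (min_idPl (ltW d0)) subrr subr0 add0r.
  have : inD (f (expi c)) by apply: (basic_lt1 bff); exact/eqP.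
  rewrite /inD => h; apply: ltr_pwDl; first by rewrite subr_gt0.
  by rewrite subr_ge0 ge_min lexx orbT.
exists (q c) => // t ht td.
have := hc t; rewrite in_itv /= => /(_ ht).
by rewrite {2}/q (min_idPr td) subrr addr0; lra.
Qed.

Lemma rint_le (f g : R -> R) (a b : R) : mfunR g -> (forall t, 0 <= g t <= f t) -> rint a b f -> rint a b g.
Proof.
move=> mg h; apply: le_integrable => //.
  by apply/measurable_EFinP; exact: measurable_funTS.
move=> t _; have /andP[g0 gf] := h t.
by rewrite /= lee_fin ger0_norm// ger0_norm// (le_trans g0).
Qed.

Lemma radial_ccvg (f : C -> C) t l :
  radial_lim f t l <-> ccvg ((1 : R)^'-) (fun r => f (rC r * expi t)) l.
Proof.
split=> h.
  apply/ccvg_lt => e /h[d d0 hd]; near=> r; apply: hd.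
    by apply/andP; split; near: r; [exact: nbhs_left_gt|exact: nbhs_left_lt].
  by near: r; apply: nbhs_left_gt; rewrite ltrBlDr ltrDl.
move=> e e0; move/ccvg_lt : h => /(_ e e0) [d /= d0 hd].
exists d => // r /andP[r0 r1] rd; apply: hd => //=.
by rewrite ger0_norm ?subr_ge0 ?(ltW r1)//; lra.
Unshelve. all: by end_near. Qed.

Lemma ccvg_sum (T : Type) (F : set_system T) {FF : Filter F} (I : Type) (s : seq I) (f : I -> T -> C) (l : I -> C) :
  (forall i, ccvg F (f i) (l i)) -> ccvg F (fun x => \sum_(i <- s) f i x) (\sum_(i <- s) l i).
Proof.
move=> h; elim: s => [|a s IH].
  by rewrite big_nil; under eq_fun do rewrite big_nil; exact: ccvg_cst.
by rewrite big_cons; under eq_fun do rewrite big_cons; apply: ccvgD.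
Qed.

Lemma h2_bound (f : C -> C) (M a : R) : holo_on_D f -> (forall r : R, 0 < r < 1 -> mean2 f r <= M) ->
  a < 1 -> forall z, cabs z <= a -> cabs (f z) <= 1 + (2 * pi)^-1 * ((1 + a) / (1 - a) * M).
Proof.
move=> hf hM a1 z za; have zD : inD z by exact: le_lt_trans a1.
have M0 : 0 <= M by apply: le_trans (mean2_ge0 f (1 / 2)) (hM _ _); apply/andP; split; lra.
have h := h2_point1 hf hM zD; have z0 := cabs_ge0 z.
have h1 : (1 + cabs z) / (1 - cabs z) <= (1 + a) / (1 - a).
  apply: ler_pM; [lra|rewrite invr_ge0; lra|lra|].
  by rewrite lef_pV2 ?posrE; lra.
have h2 : (2 * pi)^-1 * ((1 + cabs z) / (1 - cabs z) * M) <= (2 * pi)^-1 * ((1 + a) / (1 - a) * M).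
  by rewrite ler_pM2l ?invr_gt0// ler_wpM2r.
have := le_trans h h2; have := cabs_ge0 (f z).
by set x := _^-1 * _; nra.
Qed.

Lemma circle_gap (f : C -> C) (r : R) : self_map f -> `|r| < 1 -> exists2 h : R, 0 < h &
  forall t, 0 <= t <= 2 * pi -> cabs (f (zpol r t)) <= 1 - h.
Proof.
move=> [hf Df] r1.
have c : continuous (fun t => cabs (f (zpol r t))) by move=> t; apply: ccvg_cabs; exact: circ_ccvg.
have [x _ hx] := EVT_max (ltW pi2) (continuous_subspaceT c).
exists (1 - cabs (f (zpol r x))).
  by rewrite subr_gt0; apply: Df; rewrite /inD cabs_zpol.
by move=> t ht; have := hx t; rewrite in_itv /= => /(_ ht); lra.
Qed.

Section Estimate.
Variables (n : nat) (psi : 'I_n -> C -> C) (phi : C -> C).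
Hypothesis sphi : self_map phi.
Hypothesis spsi : forall j, self_map (psi j).
Definition dop (f : C -> C) z : C := f (phi z) - \sum_(j < n) f (psi j z).

Lemma holo_dop f : holo_on_D f -> holo_on_D (dop f).
Proof.
move=> hf; have [hp Dp] := sphi; apply: holoB; first exact: (holo_comp hp Dp hf).
by apply: holo_sum => j; have [hj Dj] := spsi j; exact: (holo_comp hj Dj hf).
Qed.

Lemma dop_bound f z (K : R) : cabs (f (phi z)) <= K -> (forall j, cabs (f (psi j z)) <= K) ->
  cabs (dop f z) <= K + n%:R * K.
Proof.
move=> h1 h2; apply: le_trans (ler_cabsB _ _) _; apply: lerD => //.
apply: le_trans (cabs_sum _ _) _; apply: le_trans (ler_sum _ (fun j _ => h2 j)) _.
by rewrite sumr_const card_ord mulr_natl.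
Qed.

(** Dilations are bounded and continuous up to the circle, which gives the composites boundary
    values even where [psi j] touches the circle. *)
Definition dil (f : C -> C) (rho : R) z := f (rC rho * z).

Lemma holo_dil f rho : holo_on_D f -> 0 <= rho <= 1 -> holo_on_D (dil f rho).
Proof.
move=> hf r01; apply: (@holo_comp _ (fun z => rC rho * z)) => //.
  by apply: holoM; [exact: holo_cst|exact: holo_id].
by move=> z zD; exact: inD_rCM.
Qed.

Lemma dop_dil f (M r : R) : holo_on_D f -> (forall r : R, 0 < r < 1 -> mean2 f r <= M) -> 0 <= r < 1 ->
  (fun k => mean2 (dop (dil f (rk R k))) r) @ \oo --> mean2 (dop f) r.
Proof.
move=> hf hM /andP[r0 r1]; have nr : `|r| < 1 by rewrite ger0_norm.
have [h1 h10 hh1] := circle_gap sphi nr.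
have [h2 h20 hh2] : exists2 h : R, 0 < h & forall j : 'I_n, forall t, 0 <= t <= 2 * pi -> cabs (psi j (zpol r t)) <= 1 - h.
  apply: (@fin_radius 'I_n (fun j h => forall t, 0 <= t <= 2 * pi -> cabs (psi j (zpol r t)) <= 1 - h)).
    by move=> i d d' h /andP[_ dd] t ht; apply: le_trans (h t ht) _; lra.
  by move=> j; exact: circle_gap.
pose a := 1 - Num.min h1 h2.
have a1 : a < 1 by rewrite /a ltrBlDr ltrDl lt_min h10.
pose K := 1 + (2 * pi)^-1 * ((1 + a) / (1 - a) * M).
have dK k v : cabs v <= a -> cabs (dil f (rk R k) v) <= K.
  move=> va; apply: (h2_bound hf hM a1); rewrite cabsM cabs_rC ger0_norm ?rk_ge0//.
  by apply: le_trans va; rewrite ler_piMl ?cabs_ge0// ltW// rk_lt1.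
have zD t : inD (zpol r t) by rewrite /inD cabs_zpol.
have hk k : holo_on_D (dop (dil f (rk R k))).
  by apply/holo_dop/holo_dil => //; rewrite rk_ge0 ltW// rk_lt1.
have [k|k t ht|t ht|_ //] := @RI_dct R (fun k t => cabs (dop (dil f (rk R k)) (zpol r t)) ^+ 2)
   (fun t => cabs (dop f (zpol r t)) ^+ 2) 0 (2 * pi) ((K + n%:R * K) ^+ 2).
- by apply: continuous_measurable_fun; exact: circ_contsqr.
- rewrite ger0_norm ?exprn_ge0 ?cabs_ge0//.
  have h : cabs (dop (dil f (rk R k)) (zpol r t)) <= K + n%:R * K.
    apply: dop_bound => [|j]; apply: dK; rewrite /a.
      by apply: le_trans (hh1 t ht) _; rewrite lerD2l lerN2 ge_min lexx.
    by apply: le_trans (hh2 j t ht) _; rewrite lerD2l lerN2 ge_min lexx orbT.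
  by rewrite lerXn2r// nnegrE ?cabs_ge0// (le_trans _ h)// cabs_ge0.
- apply: cvg_expn; apply: ccvg_cabs.
  have c v : inD v -> ccvg \oo (fun k => dil f (rk R k) v) (f v).
    move=> vD; have c1 := rad_ccvg hf vD; rewrite /ccvg /dil.
    exact: (cvg_comp _ _ (@rk_left R) c1).
  apply: ccvgB; first by apply: c; have [_ Dp] := sphi; exact: Dp.
  by apply: ccvg_sum => j; apply: c; have [_ Dp] := spsi j; exact: Dp.
Qed.

Hypothesis finE : finite_set (Eset phi).
Variables (zeta : 'I_n -> C) (deg : 'I_n -> nat).
Hypothesis zinj : injective zeta.
Hypothesis FE : Fset phi = [set zeta j | j in [set: 'I_n]].
Hypothesis bas : forall j, basic_fun (psi j) (zeta j) (deg j).
Variables (w : R -> C) (N : set R).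
Hypothesis mRe : mfunR (fun t => Re (w t)).
Hypothesis mIm : mfunR (fun t => Im (w t)).
Hypothesis wD : forall t, inD (w t).
Hypothesis mN : measurable N.
Hypothesis lN : lam N = 0%E.
Hypothesis hN : forall t, 0 <= t <= 2 * pi -> ~ N t -> radial_lim phi t (w t).
Hypothesis close : forall j (e : R), 0 < e -> exists2 d : R, 0 < d &
  forall t, good (zeta j) N d t -> cabs (w t - psi j (expi t)) <= e * (1 - cabs (w t)).

Lemma zeta_separated : exists2 d : R, 0 < d & forall i j, i != j -> 2 * d <= cabs (zeta i - zeta j).
Proof.
have [p d d' h /andP[_ dd] pn|p|d d0 h] := @fin_radius ('I_n * 'I_n)%type
    (fun p d => p.1 != p.2 -> 2 * d <= cabs (zeta p.1 - zeta p.2)).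
- by apply: le_trans (h pn); lra.
- have [E|nE] := eqVneq p.1 p.2; first by exists 1.
  exists (cabs (zeta p.1 - zeta p.2) / 2); last by move=> _; lra.
  by rewrite divr_gt0// cabs_gt0 subr_eq0; apply: contra_neq nE => /zinj.
- by exists d => // i j; exact: (h (i, j)).
Qed.

Lemma sqr_sum_le (x y : C) (a b : R) : cabs x ^+ 2 <= a -> cabs y <= b -> cabs (x - y) ^+ 2 <= 2 * a + 2 * b ^+ 2.
Proof.
move=> h1 h2; have := ler_cabsB x y; have := cabs_ge0 x; have := cabs_ge0 y; have := cabs_ge0 (x - y).
have := sqr_ge0 (cabs x - cabs y).
move: h1 h2; set p := cabs x; set q := cabs y; set u := cabs (x - y) => h1 h2 h3 u0 q0 p0 h4.
have : u ^+ 2 <= (p + q) ^+ 2 by rewrite lerXn2r// nnegrE addr_ge0.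
have : q ^+ 2 <= b ^+ 2 by rewrite lerXn2r// nnegrE (le_trans q0).
by move: h3; rewrite !sqrrD sqrrN mulrN mulNrn; lra.
Qed.

Lemma psi_le1 j t : cabs (psi j (expi t)) <= 1.
Proof.
have [E|/eqP nE] := eqVneq (expi t) (zeta j).
  by have [p [q [_ _ _ _ [_ fT _ _]]]] := bas j; rewrite E fT.
exact: ltW (basic_lt1 (bas j) nE).
Qed.

Lemma radial_dil f rho (p : C -> C) t l : holo_on_D f -> 0 <= rho < 1 -> cabs l <= 1 ->
  radial_lim p t l -> radial_lim (fun z => dil f rho (p z)) t (dil f rho l).
Proof.
move=> hf /andP[r0 r1] l1 /radial_ccvg h; apply/radial_ccvg.
have lD : inD (rC rho * l).
  rewrite /inD cabsM cabs_rC ger0_norm//; apply: le_lt_trans r1.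
  by rewrite ler_piMr.
have c : ccvg ((1 : R)^'-) (fun r => rC rho * p (rC r * expi t)) (rC rho * l).
  by apply: ccvgM => //; exact: ccvg_cst.
exact: (ccvg_comp c (holo_cont hf lD)).
Qed.

Let U f (rho : R) t := (2 * pi)^-1 * RI 0 (2 * pi) (fun s => cabs (f (zpol rho s)) ^+ 2 * poisson (w t) s).

(* Near [zeta i] the map [psi i] shadows [phi] and the other [psi j] stay in a smaller disc;
   away from all [zeta i] only the points where [phi] is close to the circle matter. *)
Lemma boundary_pointwise (e d h1 h2 : R) (X : C -> R) f (rho B : R) t :
  0 < e <= 1 / 2 ->
  (forall j t, good (zeta j) N d t -> cabs (w t - psi j (expi t)) <= e * (1 - cabs (w t))) ->
  (forall i j, i != j -> 2 * d <= cabs (zeta i - zeta j)) ->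
  (forall z, 0 <= X z <= 1) ->
  (forall z, (forall j, d <= cabs (z - zeta j)) -> X z = 1) ->
  (forall j t, 0 <= t <= 2 * pi -> d <= cabs (expi t - zeta j) -> cabs (psi j (expi t)) <= 1 - h2) ->
  holo_on_D f -> 0 <= rho < 1 -> 0 <= B ->
  (forall z, cabs z <= 1 - h1 -> cabs (f z) <= B) -> (forall z, cabs z <= 1 - h2 -> cabs (f z) <= B) ->
  0 <= t <= 2 * pi -> ~ N t ->
  cabs (dil f rho (w t) - \sum_(j < n) dil f rho (psi j (expi t))) ^+ 2 <=
  (32 * e ^+ 2 + 2 * (X (expi t) * (if 1 - h1 < cabs (w t) then 1 else 0))) * U f rho t +
  (2 + 2 * n%:R ^+ 2) * B ^+ 2.
Proof.
move=> /andP[e0 e1] hcl hsep X01 X1 hgap hf rho01 B0 fB1 fB2 ht nt.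
have /andP[r0 r1] := rho01.
have dle v (h : R) : cabs v <= 1 - h -> cabs (rC rho * v) <= 1 - h.
  by move=> vh; apply: le_trans vh; rewrite cabsM cabs_rC ger0_norm// ler_piMl ?cabs_ge0// ltW.
have U0 : 0 <= U f rho t.
  rewrite mulr_ge0 ?invr_ge0 ?(ltW pi2)//; apply: RI_ge0 => s _.
  by rewrite mulr_ge0 ?exprn_ge0 ?cabs_ge0// poisson_ge0.
have B20 : 0 <= B ^+ 2 by rewrite exprn_ge0.
have far j : d <= cabs (expi t - zeta j) -> cabs (dil f rho (psi j (expi t))) <= B.
  by move=> h; apply: fB2; apply: dle; exact: hgap.
have nB (P : pred 'I_n) : \sum_(j < n | P j) B <= n%:R * B.
  rewrite sumr_const -[leLHS]mulr_natl; apply: ler_wpM2r => //; rewrite ler_nat.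
  by apply: leq_trans (max_card _) _; rewrite card_ord.
have csum (P : pred 'I_n) (F : 'I_n -> C) : (forall j, P j -> cabs (F j) <= B) -> cabs (\sum_(j < n | P j) F j) <= n%:R * B.
  move=> hF; apply: le_trans (nB P).
  rewrite -!(big_filter _ P); apply: le_trans (cabs_sum _ _) _.
  rewrite !big_filter; exact: ler_sum.
have nn : (n%:R * B) ^+ 2 = n%:R ^+ 2 * B ^+ 2 by rewrite exprMn.
have i01 : 0 <= (if 1 - h1 < cabs (w t) then 1 else 0 : R) by case: ifP.
have /andP[X0 X1'] := X01 (expi t).
have [[i ti]|far_all] := pselect (exists i, cabs (expi t - zeta i) < d).
  rewrite (bigD1 i)//= opprD addrA.
  have s1 := sqr_diff hf rho01 (wD t) (_ : 0 <= e <= 1 / 2) (hcl i t (And3 ht nt ti)).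
  rewrite (ltW e0) e1 in s1; have {}s1 := s1 isT.
  have s2 : cabs (\sum_(j < n | j != i) dil f rho (psi j (expi t))) <= n%:R * B.
    apply: csum => j ji; apply: far.
    have := hsep j i ji; have := ler_cabs_distD (zeta j) (zeta i) (expi t).
    by rewrite [cabs (zeta j - expi t)]cabsB; lra.
  apply: le_trans (sqr_sum_le s1 s2) _; rewrite nn -/(U f rho t).
  have : 0 <= X (expi t) * (if 1 - h1 < cabs (w t) then 1 else 0) * U f rho t.
    by apply: mulr_ge0 => //; exact: mulr_ge0.
  move=> xu; rewrite -subr_ge0.
  set x := X _ * _ in xu *; set u := U _ _ _ in xu *.
  rewrite (_ : _ - _ = 2 * (x * u) + 2 * B ^+ 2); last by ring.
  by apply: addr_ge0; exact: mulr_ge0.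
have hfar j : d <= cabs (expi t - zeta j) by rewrite leNgt; apply/negP => h; apply: far_all; exists j.
rewrite (X1 _ hfar) mul1r.
have s2 : cabs (\sum_(j < n) dil f rho (psi j (expi t))) <= n%:R * B by apply: csum => j _; exact: far.
have s1 : cabs (dil f rho (w t)) ^+ 2 <= B ^+ 2 + (if 1 - h1 < cabs (w t) then 1 else 0) * U f rho t.
  case: ifPn => hw.
    by rewrite mul1r; apply: le_trans (sqr_bound hf rho01 (wD t)) _; rewrite -/(U f rho t) lerDr.
  rewrite mul0r addr0 lerXn2r ?nnegrE ?cabs_ge0//; apply: fB1; apply: dle.
  by rewrite leNgt.
apply: le_trans (sqr_sum_le s1 s2) _; rewrite nn.
have : 0 <= e ^+ 2 * U f rho t by rewrite mulr_ge0// exprn_ge0// ltW.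
move=> eu; rewrite -subr_ge0.
set x := if _ then _ else _; set u := U _ _ _ in eu *.
by rewrite (_ : _ - _ = 32 * (e ^+ 2 * u)); [exact: mulr_ge0|ring].
Qed.

(** Integrating [boundary_pointwise] and exchanging integrals leaves, for each [s], the kernel at
    [w t] with weight [32 e^2] plus twice its cut-off tail. The first integral is at most
    [2 pi kap], the second at most [e] by [boundary_tail], both independently of [s]; the smaller
    discs produce the term in [B]. *)
Lemma essential_estimate (eps : R) : 0 < eps -> exists h K : R, [/\ 0 < h < 1, 0 <= K &
  forall f (M B : R), holo_on_D f -> (forall r : R, 0 < r < 1 -> mean2 f r <= M) -> 0 <= B ->
    (forall z, cabs z <= 1 - h -> cabs (f z) <= B) ->
    forall r : R, 0 < r < 1 -> mean2 (dop f) r <= eps * M + K * B ^+ 2].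
Proof.
have alg (x y c : R) : 0 <= x -> 0 < c <= 1 / 2 -> 2 <= y -> 32 * c ^+ 2 * (y * x) + 2 * c <= c * (32 * x + 1) * y.
  move=> x0 /andP[c0 c1] y2; rewrite -subr_ge0.
  rewrite (_ : _ - _ = 32 * (c * (x * (y * (1 - c)))) + c * (y - 2)); last by ring.
  have y0 : 0 <= y by exact: le_trans y2.
  have c10 : 0 <= 1 - c by rewrite subr_ge0; lra.
  have y20 : 0 <= y - 2 by rewrite subr_ge0.
  by apply: addr_ge0; nneg.
have p2 : 2 <= 2 * pi :> R by rewrite ler_peMr// (le_trans _ (pi_ge2 R))// ler1n.
move=> eps0; have [hp Dp] := sphi.
have k0D : inD (phi 0) by apply: Dp; exact: inD0.
pose kap := (1 + cabs (phi 0)) / (1 - cabs (phi 0)).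
have kap0 : 0 <= kap.
  by apply: divr_ge0; [rewrite addr_ge0// cabs_ge0|rewrite subr_ge0; exact: ltW].
(* The bound [1 / 2] is what [sqr_diff] requires; the other one absorbs [32 e^2 (2 pi kap) + 2 e]
   into [2 pi eps]. *)
pose e := Num.min (1 / 2) (eps / (32 * kap + 1)).
have kk : 0 < 32 * kap + 1 by lra.
have e0 : 0 < e by rewrite lt_min; apply/andP; split; [lra|exact: divr_gt0].
have e1 : e <= 1 / 2 by rewrite ge_min lexx.
have e2 : e * (32 * kap + 1) <= eps by rewrite -ler_pdivlMr// ge_min lexx orbT.
have [d1 d10 hd1] : exists2 d : R, 0 < d & forall j t, good (zeta j) N d t ->
    cabs (w t - psi j (expi t)) <= e * (1 - cabs (w t)).
  apply: (@fin_radius 'I_n (fun j d => forall t, good (zeta j) N d t -> cabs (w t - psi j (expi t)) <= e * (1 - cabs (w t)))).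
    by move=> i d d' h /andP[_ dd] t gt; apply: h; exact: good_le gt.
  by move=> j; exact: close.
have [d2 d20 hd2] := zeta_separated.
pose d := Num.min d1 d2.
have d0 : 0 < d by rewrite lt_min d10.
have hcl j t : good (zeta j) N d t -> cabs (w t - psi j (expi t)) <= e * (1 - cabs (w t)).
  by move=> gt; apply: hd1; apply: good_le gt; rewrite ge_min lexx.
have hsep i j : i != j -> 2 * d <= cabs (zeta i - zeta j).
  move=> /hd2; apply: le_trans; rewrite ler_pM2l// ge_min lexx orbT//.
have [X [X01 XL X0 X1]] := cutoff_exists (codom zeta) d0.
have X1' z : (forall j, d <= cabs (z - zeta j)) -> X z = 1.
  by move=> h; apply: X1 => v /codomP[j ->].
have Xvan v z : Fset phi v -> cabs (z - v) <= d / 2 -> X z = 0.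
  by rewrite FE => -[j _ <-] h; apply: X0 h; exact: codom_f.
have finF : finite_set (Fset phi) by rewrite FE; exact: finite_image.
have L0 : 0 < 2 / d by ppos.
have dd0 : 0 < d / 2 by ppos.
have [h1 /andP[h10 h11] tail] := boundary_tail sphi finE finF mRe mIm wD mN lN hN X01 L0 XL dd0 Xvan e0.
have [h2 h20 hgap] : exists2 h : R, 0 < h & forall j t, 0 <= t <= 2 * pi -> d <= cabs (expi t - zeta j) ->
    cabs (psi j (expi t)) <= 1 - h.
  apply: (@fin_radius 'I_n (fun j h => forall t, 0 <= t <= 2 * pi -> d <= cabs (expi t - zeta j) ->
    cabs (psi j (expi t)) <= 1 - h)).
    by move=> i c c' h /andP[_ cc] t ht td; apply: le_trans (h t ht td) _; lra.
  by move=> j; exact: basic_gap.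
pose h := Num.min h1 h2.
exists h, (2 * pi * (2 + 2 * n%:R ^+ 2)); split.
- by rewrite lt_min h10 h20 gt_min h11.
- by rewrite mulr_ge0 ?(ltW pi2)// addr_ge0// mulr_ge0// exprn_ge0.
move=> f M B hf hM B0 fB r /andP[r0 r1].
have fB1 z : cabs z <= 1 - h1 -> cabs (f z) <= B.
  by move=> zh; apply: fB; apply: le_trans zh _; rewrite lerD2l lerN2 ge_min lexx.
have fB2 z : cabs z <= 1 - h2 -> cabs (f z) <= B.
  by move=> zh; apply: fB; apply: le_trans zh _; rewrite lerD2l lerN2 ge_min lexx orbT.
have M0 : 0 <= M by apply: le_trans (mean2_ge0 f (1 / 2)) (hM _ _); apply/andP; split; lra.
have r01 : 0 <= r < 1 by rewrite (ltW r0).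
(* It suffices to treat the dilations of [f]. The sup bound [K] set below depends on the dilation,
   but serves only to pass to boundary values and leaves no trace in the estimate. *)
apply: (ler_cvg_to (dop_dil hf hM r01) (cvg_cst _)); apply: filterE => k.
set rho := rk R k; have rho01 : 0 <= rho < 1 by exact: rk01.
have /andP[rho0 rho1] := rho01.
have nrho : `|rho| < 1 by rewrite ger0_norm.
have rhoM : mean2 f rho <= M.
  apply: hM; rewrite rho1 andbT /rho /rk subr_gt0 invf_lt1 ?ltr0n// ltr1n//.
pose K := 1 + (2 * pi)^-1 * ((1 + rho) / (1 - rho) * M).
have dK z : cabs z <= 1 -> cabs (dil f rho z) <= K.
  move=> z1; apply: (h2_bound hf hM rho1); rewrite cabsM cabs_rC ger0_norm//.
  by rewrite ler_piMr.
have hdil : holo_on_D (dil f rho) by apply: holo_dil => //; rewrite rho0 ltW.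
have gK z : inD z -> cabs (dop (dil f rho) z) <= K + n%:R * K.
  move=> zD; apply: dop_bound => [|j]; apply: dK; apply: ltW; first exact: Dp.
  by have [_ Dj] := spsi j; exact: Dj.
have rl t : 0 <= t <= 2 * pi -> ~ N t -> radial_lim (dop (dil f rho)) t
    (dil f rho (w t) - \sum_(j < n) dil f rho (psi j (expi t))).
  move=> ht nt; apply/radial_ccvg; apply: ccvgB.
    by apply/(radial_ccvg (fun z => dil f rho (phi z))); apply: radial_dil => //; [exact/ltW/wD|exact: hN].
  apply: ccvg_sum => j; apply/(radial_ccvg (fun z => dil f rho (psi j z))).
  by apply: radial_dil => //; [exact: psi_le1|exact: (@basic_radial _ _ _ _ t (bas j))].
have [G [iG GE G0 GM]] := mean2_boundary (holo_dop hdil) gK mN lN rl.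
apply: le_trans (GM r r01) _.
pose v t := (2 * pi)^-1 * (32 * e ^+ 2 + 2 * (X (expi t) * (if 1 - h1 < cabs (w t) then 1 else 0))).
have v0 t : 0 <= v t.
  have /andP[x0 _] := X01 (expi t).
  rewrite mulr_ge0 ?invr_ge0 ?(ltW pi2)//; apply: addr_ge0; first by rewrite mulr_ge0// exprn_ge0// ltW.
  by rewrite mulr_ge0// mulr_ge0//; case: ifP.
have cF : continuous (fun s => cabs (f (zpol rho s)) ^+ 2) by exact: circ_contsqr.
have cX : continuous (fun t => X (expi t)).
  move=> t; apply/cvgrPdist_lt => c c0; have c1 : 0 < c / (2 / d) by ppos.
  have ce : ccvg (nbhs t) (@expi R) (expi t) by apply: ccvg_expi; exact: cvg_id.
  move/ccvg_lt : ce => /(_ _ c1); apply: filterS => x hx.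
  by apply: le_lt_trans (XL _ _) _; rewrite cabsB mulrC -ltr_pdivlMr.
have mw : mfunR (fun t => cabs (w t)).
  have -> : (fun t => cabs (w t)) = fun t => Num.sqrt (Re (w t) ^+ 2 + Im (w t) ^+ 2) by [].
  apply: (measurableT_comp (continuous_measurable_fun (@sqrt_continuous R))).
  by apply: measurable_funD; apply: measurable_funX.
have mif : mfunR (fun t => if 1 - h1 < cabs (w t) then 1 else 0).
  apply: measurable_fun_ifT; [|exact: measurable_cst|exact: measurable_cst].
  by apply: measurable_fun_ltr => //; exact: measurable_cst.
have mXi : mfunR (fun t => X (expi t) * (if 1 - h1 < cabs (w t) then 1 else 0)).
  by apply: measurable_funM => //; exact: continuous_measurable_fun.
have mv : mfunR v.
  apply: measurable_funM; first exact: measurable_cst.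
  apply: measurable_funD; first exact: measurable_cst.
  by apply: measurable_funM => //; exact: measurable_cst.
have mP s : mfunR (fun t => poisson (w t) s) by apply: measurable_poissonC => //; exact: measurable_cst.
have iP s : rint 0 (2 * pi) (fun t => poisson (w t) s) by have [] := boundary_poisson sphi mRe mIm wD mN lN hN s.
have iVs t : rint 0 (2 * pi) (fun s => cabs (f (zpol rho s)) ^+ 2 * poisson (w t) s) by exact: poisson_rint.
have tb := @tonelli_bound R (fun s => cabs (f (zpol rho s)) ^+ 2) (fun t s => v t * poisson (w t) s) G eps
  ((2 + 2 * n%:R ^+ 2) * B ^+ 2) (mean2_rint hf nrho) (continuous_measurable_fun cF).
apply: le_trans (tb _ _ _ _ _ _ iG _) _.
- by move=> s; rewrite exprn_ge0// cabs_ge0.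
- apply: measurable_funM; first exact: measurableT_comp mv measurable_fst.
  apply: measurable_poissonC; [| |exact: measurable_snd|by move=> p; exact: wD].
    exact: measurableT_comp mRe measurable_fst.
  exact: measurableT_comp mIm measurable_fst.
- by move=> t s; rewrite mulr_ge0// poisson_ge0.
- by move=> t; apply: eq_rint (rintZ (v t) (iVs t)) => s _; rewrite mulrCA.
- move=> s hs.
  have XP t : 0 <= X (expi t) * (if 1 - h1 < cabs (w t) then 1 else 0) <= 1.
    by have /andP[x0 x1] := X01 (expi t); case: ifP => _; rewrite ?mulr1 ?mulr0 ?x0 ?x1 ?lexx ?ler01.
  have i1 : rint 0 (2 * pi) (fun t => X (expi t) * (if 1 - h1 < cabs (w t) then 1 else 0) * poisson (w t) s).
    apply: (rint_le _ _ (iP s)); first exact: measurable_funM.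
    move=> t; have /andP[x0 x1] := XP t; have p0 := poisson_ge0 s (wD t).
    by rewrite mulr_ge0//= ler_piMl.
  have i2 : rint 0 (2 * pi) (fun t => 32 * e ^+ 2 * poisson (w t) s +
      2 * (X (expi t) * (if 1 - h1 < cabs (w t) then 1 else 0) * poisson (w t) s)).
    by apply: rintD; exact: rintZ.
  have VE t : v t * poisson (w t) s = (2 * pi)^-1 * (32 * e ^+ 2 * poisson (w t) s +
      2 * (X (expi t) * (if 1 - h1 < cabs (w t) then 1 else 0) * poisson (w t) s)).
    rewrite /v; move: (X _ * _) (poisson _ _) ((2 * pi)^-1) => x y z; ring.
  split; first by apply: eq_rint (rintZ _ i2) => t _; rewrite VE.
  rewrite (eq_RI (fun t _ => VE t)) RIZ// RID; [|exact: rintZ|exact: rintZ].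
  rewrite !RIZ//; have [_ b1 _] := boundary_poisson sphi mRe mIm wD mN lN hN s.
  have b2 : RI 0 (2 * pi) (fun t => X (expi t) * (if 1 - h1 < cabs (w t) then 1 else 0) * poisson (w t) s) <= e.
    apply: le_trans (tail s hs); rewrite le_eqVlt; apply/orP; left; apply/eqP; apply: eq_RI => t _.
    by case: ifP => _; rewrite ?mulr1 ?mulr0 ?mul0r.
  have b3 : poisson (phi 0) s <= kap by exact: poisson_le.
  have b4 : RI 0 (2 * pi) (fun t => poisson (w t) s) <= 2 * pi * kap.
    by apply: le_trans b1 _; rewrite ler_pM2l.
  rewrite mulrC ler_pdivrMr//.
  apply: (@le_trans _ _ (32 * e ^+ 2 * (2 * pi * kap) + 2 * e)).
    by apply: lerD; rewrite ler_pM2l// mulr_gt0// exprn_gt0.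
  apply: (@le_trans _ _ (e * (32 * kap + 1) * (2 * pi))); last by rewrite ler_pM2r.
  by apply: alg => //; rewrite e0.
- by rewrite mulr_ge0 ?exprn_ge0// addr_ge0// mulr_ge0// exprn_ge0.
- have VI t : RI 0 (2 * pi) (fun s => cabs (f (zpol rho s)) ^+ 2 * (v t * poisson (w t) s)) =
      (32 * e ^+ 2 + 2 * (X (expi t) * (if 1 - h1 < cabs (w t) then 1 else 0))) * U f rho t.
    have -> : RI 0 (2 * pi) (fun s => cabs (f (zpol rho s)) ^+ 2 * (v t * poisson (w t) s)) =
       RI 0 (2 * pi) (fun s => v t * (cabs (f (zpol rho s)) ^+ 2 * poisson (w t) s)).
      by apply: eq_RI => s _; rewrite mulrCA.
    by rewrite RIZ// /v /U -[LHS]mulrA [LHS]mulrCA.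
  have c0 : 0 <= (2 + 2 * n%:R ^+ 2) * B ^+ 2 by rewrite mulr_ge0 ?exprn_ge0// addr_ge0// mulr_ge0// exprn_ge0.
  have I0 t : 0 <= RI 0 (2 * pi) (fun s => cabs (f (zpol rho s)) ^+ 2 * (v t * poisson (w t) s)).
    by apply: RI_ge0 => s _; rewrite mulr_ge0 ?exprn_ge0 ?cabs_ge0// mulr_ge0// poisson_ge0.
  move=> t ht; have [nt|nt] := pselect (N t); first by rewrite (G0 t nt) lexx addr_ge0.
  rewrite (GE t ht nt) exprn_ge0 ?cabs_ge0//= VI.
  apply: (boundary_pointwise (e := e) (d := d) (h1 := h1) (h2 := h2)) => //.
  by rewrite e0.
- by rewrite -[2 * pi * (_ + _) * _]mulrA lerD2r ler_pM2l.
Qed.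

End Estimate.
End Key.

(** * Compactness *)

Section Compact.
Variable R : realType.
Local Notation C := R[i].
Local Notation lam := (@lebesgue_measure R).
Implicit Types (z : C) (t : R).
Let pi2 : 0 < 2 * pi :> R := @pi2_gt0 R.

Lemma mean2_lim (u : nat -> C -> C) (v : C -> C) (M r : R) : (forall k, holo_on_D (u k)) -> 0 <= r < 1 ->
  (forall e : R, 0 < e -> exists K, forall k, (K <= k)%N -> forall z, cabs z <= r -> cabs (u k z - v z) <= e) ->
  (forall k z, cabs z <= r -> cabs (u k z) <= M) ->
  (fun k => mean2 (u k) r) @ \oo --> mean2 v r.
Proof.
move=> hu /andP[r0 r1] huv huM; have nr : `|r| < 1 by rewrite ger0_norm.
have zr t : cabs (zpol r t) <= r by rewrite cabs_zpol ger0_norm.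
have [k|k t ht|t ht|_ //] := @RI_dct R (fun k t => cabs (u k (zpol r t)) ^+ 2)
   (fun t => cabs (v (zpol r t)) ^+ 2) 0 (2 * pi) (M ^+ 2).
- by apply: continuous_measurable_fun; exact: circ_contsqr.
- have h := huM k _ (zr t); rewrite ger0_norm ?exprn_ge0 ?cabs_ge0//.
  by rewrite lerXn2r// nnegrE ?cabs_ge0// (le_trans _ h)// cabs_ge0.
- apply: cvg_expn; apply: ccvg_cabs; apply/ccvg_lt => e e0.
  have [|K hK] := huv (e / 2); first by ppos.
  by exists K => // k Kk; apply: le_lt_trans (hK k Kk _ (zr t)) _; lra.
Qed.

Lemma mean2B (f g : C -> C) (A B r : R) : holo_on_D f -> holo_on_D g -> 0 < r < 1 ->
  mean2 f r <= A -> mean2 g r <= B -> mean2 (fun z => f z - g z) r <= 2 * A + 2 * B.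
Proof.
move=> hf hg /andP[r0 r1] hA hB; have nr : `|r| < 1 by rewrite gtr0_norm.
have i1 := mean2_rint hf nr; have i2 := mean2_rint hg nr.
apply: (@le_trans _ _ (2 * mean2 f r + 2 * mean2 g r)); last by lra.
rewrite -!RIZ// -RID; [|exact: rintZ|exact: rintZ].
apply: le_RI; [by apply: (mean2_rint (f := fun z => f z - g z)) => //; exact: holoB|by apply: rintD; exact: rintZ|].
by move=> t _; apply: sqr_sum_le.
Qed.

(** The estimate is applied to the differences from a locally uniform limit [v]: their [H^2] means
    stay bounded and are multiplied by an arbitrary [eps], while their supremum on the smaller disc
    tends to 0. *)
Lemma compact_of_estimate n (psi : 'I_n -> C -> C) (phi : C -> C) :
  self_map phi -> (forall j, self_map (psi j)) ->
  (forall eps : R, 0 < eps -> exists h K : R, [/\ 0 < h < 1, 0 <= K &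
    forall f (M B : R), holo_on_D f -> (forall r : R, 0 < r < 1 -> mean2 f r <= M) -> 0 <= B ->
      (forall z, cabs z <= 1 - h -> cabs (f z) <= B) ->
      forall r : R, 0 < r < 1 -> mean2 (dop psi phi f) r <= eps * M + K * B ^+ 2]) ->
  compact_on_H2 (dop psi phi).
Proof.
move=> sphi spsi est u hu [M0 hM0].
have hol k : holo_on_D (u k) by case: (hu k).
have hM k (r : R) : 0 < r < 1 -> mean2 (u k) r <= M0 by have := hM0 k; move/(h2sq_le _ (hol k)); exact.
have M00 : 0 <= M0 by apply: le_trans (mean2_ge0 (u 0%N) (1 / 2)) (hM _ _ _); apply/andP; split; lra.
pose B (a : R) : R := 1 + (2 * pi)^-1 * ((1 + a) / (1 - a) * M0).
have hB (a : R) : a < 1 -> forall k z, cabs z <= a -> cabs (u k z) <= B a.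
  by move=> a1 k; exact: (h2_bound (hol k) (hM k) a1).
have [v hv [sigma smono huv]] := montel hol hB.
have vM (r : R) : 0 < r < 1 -> mean2 v r <= M0.
  move=> /andP[r0 r1]; have r01 : 0 <= r < 1 by rewrite (ltW r0).
  have c := @mean2_lim (fun k => u (sigma k)) v (B r) r (fun k => hol _) r01 (huv r r1) (fun k => hB r r1 _).
  by apply: (ler_cvg_to c (cvg_cst _)); apply: filterE => k; apply: hM; rewrite r0.
exists sigma; split => //; exists (dop psi phi v).
  split; first exact: holo_dop.
  (* The estimate with [eps = 1] already shows that the image of [v] lies in [H^2]. *)
  have [h [K [/andP[h0 h1] K0 hest]]] := est 1 ltr01.
  have h2 : 1 - h < 1 by lra.
  have Bh0 : 0 <= B (1 - h).
    rewrite addr_ge0// mulr_ge0 ?invr_ge0 ?(ltW pi2)// mulr_ge0//.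
    by apply: divr_ge0; lra.
  have := hest v M0 (B (1 - h)) hv vM Bh0 (h2_bound hv vM h2).
  move/(h2sq_le _ (holo_dop sphi spsi hv)) => le.
  by apply: le_lt_trans le _; exact: ltry.
have small (e : R) : 0 < e -> \forall k \near \oo,
    (h2sq (fun z => (dop psi phi (u (sigma k)) z - dop psi phi v z)%R) <= e%:E)%E.
  move=> e0; have M1 : 0 < M0 + 1 by lra.
  (* The means of [u (sigma k) - v] are at most [4 M0], so this parameter makes the first term at
     most [e / 2]; [b] does the same for the second, using [b^2 <= b]. *)
  have ep0 : 0 < e / (8 * (M0 + 1)) by ppos.
  have [h [K [/andP[h0 h1] K0 hest]]] := est _ ep0.
  have K1 : 0 < 2 * (K + 1) by lra.
  pose b := Num.min 1 (e / (2 * (K + 1))).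
  have b0 : 0 < b by rewrite lt_min ltr01 divr_gt0.
  have b1 : b <= 1 by rewrite ge_min lexx.
  have b2 : b * (2 * (K + 1)) <= e by rewrite -ler_pdivlMr// ge_min lexx orbT.
  have h2 : 1 - h < 1 by lra.
  have [k0 hk0] := huv _ h2 _ b0; exists k0 => // k k0k.
  have hd : holo_on_D (fun z => u (sigma k) z - v z) by exact: holoB.
  have E : (fun z => dop psi phi (u (sigma k)) z - dop psi phi v z) = dop psi phi (fun z => u (sigma k) z - v z).
    by apply/funext => z; rewrite /dop sumrB; ring.
  rewrite /= E; apply/(h2sq_le _ (holo_dop sphi spsi hd)) => r r01.
  have dM (x : R) : 0 < x < 1 -> mean2 (fun z => u (sigma k) z - v z) x <= 2 * M0 + 2 * M0.
    by move=> x01; apply: mean2B => //; [exact: hM|exact: vM].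
  apply: le_trans (hest _ _ b hd dM (ltW b0) (hk0 k k0k) r r01) _.
  have t1 : e / (8 * (M0 + 1)) * (2 * M0 + 2 * M0) <= e / 2.
    have -> : e / 2 = e / (8 * (M0 + 1)) * (4 * (M0 + 1)) by field; rewrite gt_eqF.
    by rewrite ler_pM2l//; lra.
  have t2 : K * b ^+ 2 <= e / 2.
    have : K * b ^+ 2 <= K * b by rewrite ler_wpM2l// expr2 ler_piMl// ltW.
    by move: b2; nra.
  by lra.
apply/(@fine_cvgP R); split.
  apply: filterS (small 1 ltr01) => k hk; rewrite ge0_fin_numE ?h2sq_ge0//.
  by apply: le_lt_trans hk _; exact: ltry.
apply/cvgrPdist_le => e e0; apply: filterS (small e e0) => k hk.
rewrite /= sub0r normrN ger0_norm; last by rewrite fine_ge0// h2sq_ge0.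
rewrite -lee_fin fineK// ge0_fin_numE ?h2sq_ge0//.
by apply: le_lt_trans hk _; exact: ltry.
Qed.

End Compact.

(** * Assembly of the basic functions and compactness of the difference *)

Theorem mainTheorem16 (R : realType) (phi : R[i] -> R[i]) (r : nat)
    (zeta : 'I_r -> R[i]) (m : 'I_r -> nat) :
  classS phi ->
  injective zeta ->
  Fset phi = [set zeta j | j in [set: 'I_r]] ->
  (forall j, contact_order phi (zeta j) (2 * m j)%N) ->
  exists phis : 'I_r -> (R[i] -> R[i]),
    (forall j, [/\ basic_fun (phis j) (zeta j) (m j).+1,
                   contact_order (phis j) (zeta j) (2 * m j)%N &
                   same_D (2 * m j)%N (phis j) phi (zeta j)]) /\
    compact_on_H2 (fun f => fun z =>
      Cop phi f z - \sum_(j < r) Cop (phis j) f z).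
Proof.
move=> [sphi aephi finE hF] zinj FE hcont.
have [w [mRe mIm wD [N [mN lN hN]]]] := boundary_fun sphi aephi.
have zF j : Fset phi (zeta j) by rewrite FE; exists j.
have ex j : exists f, [/\ basic_fun f (zeta j) (m j).+1, contact_order f (zeta j) (2 * m j)%N,
    same_D (2 * m j)%N f phi (zeta j) &
    exists N', [/\ measurable N', lebesgue_measure N' = 0%E & forall e : R, 0 < e -> exists2 d : R, 0 < d &
      forall t, good (zeta j) N' d t -> cabs (w t - f (expi t)) <= e * (1 - cabs (w t))]].
  have [n [_ con [a hexp]]] := hF _ (zF j).
  have [zT _] := zF j.
  exact: (basic_exists sphi mN lN wD hN zT (hcont j) con hexp).
have [phis hphis] := choice ex.
exists phis; split; first by move=> j; have [h1 h2 h3 _] := hphis j.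
have bas j : basic_fun (phis j) (zeta j) (m j).+1 by have [] := hphis j.
have exN j : exists N', [/\ measurable N', lebesgue_measure N' = 0%E & forall e : R, 0 < e -> exists2 d : R, 0 < d &
      forall t, good (zeta j) N' d t -> cabs (w t - phis j (expi t)) <= e * (1 - cabs (w t))].
  by have [] := hphis j.
have [Nj hNj] := choice exN.
have spsi j : self_map (phis j).
  split; first exact: basic_holo (bas j).
  by have [p [q [_ _ _ _ [h _ _ _]]]] := bas j.
have [mU lU] : measurable (\big[setU/set0]_(j < r) Nj j) /\ lebesgue_measure (\big[setU/set0]_(j < r) Nj j) = 0%E.
  apply: (big_ind (fun A => measurable A /\ lebesgue_measure A = 0%E)) => [|A B [mA lA] [mB lB]|j _].
  - by rewrite measure0.
  - by split; [exact: measurableU|exact: null_set_setU].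
  - by have [] := hNj j.
(* A common null set for the radial limits of [phi] and for all the closeness statements, since the
   estimate works with a single one. *)
pose M := N `|` \big[setU/set0]_(j < r) Nj j.
have mM : measurable M by exact: measurableU.
have lM : lebesgue_measure M = 0%E by exact: null_set_setU.
apply: (@compact_of_estimate R r phis phi sphi spsi) => eps eps0.
apply: (essential_estimate sphi spsi finE zinj FE bas mRe mIm wD mM lM _ _ eps0) => [t ht nt|j e e0].
  by apply: hN => // h; apply: nt; left.
have [_ _ /(_ e e0) [d d0 hd]] := hNj j; exists d => // t [ht nt td].
apply: hd; split => // h; apply: nt; right.
by rewrite (bigD1 j)//=; left.
Qed.
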